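(* Let $G$ be a finite almost quasisimple group with unique non-abelian composition factor $S=\mathrm{PSp}_{2n}(q)$, $n\ge2$, $q=p^f$ odd, $(n,q)\neq(2,3)$, let $V$ be a faithful irreducible $\mathbb{C}G$-module and $g\in G$ with simple spectrum on $V$. Assume we are in the case where $E(G)$ is a quotient of $\mathrm{Sp}_{2n}(q)$, every irreducible constituent of $V|_{E(G)}$ is one of the four Weil modules, of dimension $d:=(q^n\pm1)/2$, and $\dim V\in\{d,2d\}$. Then $\bar g\in\mathrm{PCSp}_{2n}(q)$. Assume furthermore that $\bar g$ is a $p'$-element. Then one of the following holds. (i) $V|_{E(G)}$ is an irreducible Weil module, $\bar g\in\mathrm{PSp}_{2n}(q)$, and either ($\alpha$) $\bar{\mathsf{o}}(g)=(q^n\pm1)/2$ and $\bar g$ generates a unique, up to $\mathrm{PSp}_{2n}(q)$-conjugacy, cyclic maximal torus $T_\pm<\mathrm{PSL}_2(q^n)$ of order $(q^n\pm1)/2$ in $\mathrm{PSp}_{2n}(q)$; or ($\beta$) $n=a+b$ with $a,b\in\mathbb{Z}_{\ge1}$, $2e\mid a$ for $e:=\gcd(a,b)$, $\bar{\mathsf{o}}(g)=(q^a+1)(q^b+1)/2$, and $\bar g$ generates a unique, up to $\mathrm{PSp}_{2n}(q)$-conjugacy, cyclic maximal torus $T_{a,b}<(\mathrm{Sp}_{2a}(q)\times\mathrm{Sp}_{2b}(q))/\mathbf{Z}(\mathrm{Sp}_{2n}(q))$ of order $(q^a+1)(q^b+1)/2$ in $\mathrm{PSp}_{2n}(q)$.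 (ii) $V|_{E(G)}$ is reducible, $\dim V=q^n\pm1$, $\bar g\notin\mathrm{PSp}_{2n}(q)$, and $\bar g^2$ fulfills the conclusions of (i).
   Context: Almost quasisimple: $S\lhd G/\mathbf{Z}(G)\le\mathrm{Aut}(S)$, $S$ non-abelian simple; $E(G)$ is the unique quasisimple normal subgroup with $E(G)/\mathbf{Z}(E(G))\cong S$. Simple spectrum: all eigenvalues of multiplicity one. $\bar g:=g\mathbf{Z}(G)\in G/\mathbf{Z}(G)\le\mathrm{Aut}(S)$ and $\bar{\mathsf{o}}(g)$ is its order. $\mathrm{PCSp}_{2n}(q)$ is the conformal symplectic group modulo its center, i.e. the group of inner-diagonal automorphisms of $S$. The four Weil modules of $\mathrm{Sp}_{2n}(q)$, $q$ odd, are the irreducible constituents, of degrees $(q^n\pm1)/2$, of the two Weil representations of degree $q^n$. *)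

(* Defs.v *)
From HB Require Import structures.
From mathcomp Require Export all_boot all_order all_algebra.
From mathcomp Require Export all_fingroup all_solvable all_field.
From mathcomp Require Export mxrepresentation complex reals.

Set Implicit Arguments.
Unset Strict Implicit.
Unset Printing Implicit Defensive.

Import GroupScope GRing.Theory.
Local Open Scope ring_scope.

(* Matrices in {'GL_(2 * n)[F]} have size (2 * n).-1.+1, which is 2 * n as soon
   as n > 0. They act on row vectors from the right. *)
Notation dimV n := ((2 * n).-1.+1) (only parsing).

Section SymplecticForm.

Variables (R : comUnitRingType) (n : nat).

Definition symp_mx : 'M[R]_(dimV n) :=
  \matrix_(i, j) (((i + n)%N == j)%:R - ((j + n)%N == i)%:R).

Definition symp_form (u v : 'rV[R]_(dimV n)) : R :=
  (u *m symp_mx *m v^T) 0 0.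

Definition is_symplectic (A : 'M[R]_(dimV n)) : bool :=
  A *m symp_mx *m A^T == symp_mx.

Lemma is_symplectic1 : is_symplectic 1%:M.
Proof. by rewrite /is_symplectic trmx1 mulmx1 mul1mx. Qed.

Lemma is_symplecticM A B :
  is_symplectic A -> is_symplectic B -> is_symplectic (A *m B).
Proof.
move=> /eqP hA /eqP hB; apply/eqP.
by rewrite trmx_mul !mulmxA -(mulmxA A) -(mulmxA A) hB.
Qed.

Lemma is_symplectic_form A u v :
  is_symplectic A -> symp_form (u *m A) (v *m A) = symp_form u v.
Proof.
move=> /eqP hA; rewrite /symp_form trmx_mul !mulmxA.
by rewrite -(mulmxA u) -(mulmxA u) hA.
Qed.

End SymplecticForm.

Section ClassicalGroups.

Variables (n : nat) (F : finFieldType).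

Definition Sp_set := [set g : {'GL_(2 * n)[F]} | is_symplectic (GLval g)].

Lemma Sp_group_set : group_set Sp_set.
Proof.
apply/group_setP; split=> [|x y]; rewrite !inE ?GL_1E ?is_symplectic1 //.
by rewrite GL_MxE; apply: is_symplecticM.
Qed.

Definition Sp : {group {'GL_(2 * n)[F]}} := Group Sp_group_set.

Definition PSp : {group coset_of 'Z(Sp)} := (Sp / 'Z(Sp))%G.

Definition CSp := [set g : {'GL_(2 * n)[F]} |
  [exists c : F, (c != 0) &&
    (GLval g *m symp_mx F n *m (GLval g)^T == c *: symp_mx F n)]].

(* PSp and PCSp viewed inside Aut(PSp), through their conjugation action on
   PSp. The scalars are the kernel of the action of CSp. *)
Definition PSp_aut : {set {perm coset_of 'Z(Sp)}} := conj_aut PSp @* PSp.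

Definition PCSp_aut : {set {perm coset_of 'Z(Sp)}} :=
  [set a in Aut PSp | [exists h in CSp, [forall x in Sp,
     a (coset 'Z(Sp) x) == coset 'Z(Sp) (x ^ h)%g]]].

End ClassicalGroups.

(* The cocycle B / 2 is the usual one in odd characteristic. *)
Section Heisenberg.

Variables (n : nat) (F : finFieldType).

Record heisenberg := Heis { heis_vec : 'rV[F]_(dimV n); heis_ctr : F }.

Definition heis_pair (h : heisenberg) := (heis_vec h, heis_ctr h).
Definition pair_heis (c : 'rV[F]_(dimV n) * F) := Heis c.1 c.2.

Lemma heis_pairK : cancel heis_pair pair_heis.
Proof. by case. Qed.

HB.instance Definition _ := Finite.copy heisenberg (can_type heis_pairK).

Local Notation B := (@symp_form F n).

Definition heis_mul (x y : heisenberg) : heisenberg :=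
  Heis (heis_vec x + heis_vec y)
       (heis_ctr x + heis_ctr y + B (heis_vec x) (heis_vec y) / 2%:R).
Definition heis_one : heisenberg := Heis 0 0.
Definition heis_inv (x : heisenberg) : heisenberg :=
  Heis (- heis_vec x) (- heis_ctr x + B (heis_vec x) (heis_vec x) / 2%:R).

Lemma heis_mulA : associative heis_mul.
Proof.
move=> [u r] [v s] [w t]; congr Heis => /=; first exact: addrA.
rewrite /symp_form !mulmxDl linearD /= mulmxDr.
rewrite ![(_ + _ : 'M__) _ _]mxE !mulrDl -!addrA; congr (_ + (_ + _)).
by rewrite [RHS]addrCA; congr (_ + _); rewrite addrC -addrA.
Qed.

Lemma heis_mul1 : left_id heis_one heis_mul.
Proof.
move=> [u r]; congr Heis => /=; first exact: add0r.
by rewrite /symp_form !mul0mx mxE mul0r addr0 add0r.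
Qed.

Lemma heis_mulV : left_inverse heis_one heis_inv heis_mul.
Proof.
move=> [u r]; congr Heis => /=; first exact: addNr.
rewrite /symp_form !mulNmx [(- _ : 'M__) _ _]mxE mulNr.
by rewrite addrAC addrK addNr.
Qed.

HB.instance Definition _ :=
  Finite_isGroup.Build heisenberg heis_mulA heis_mul1 heis_mulV.

Definition heis_act (h : heisenberg) (x : {'GL_(2 * n)[F]}) : heisenberg :=
  Heis (heis_vec h *m GLval x) (heis_ctr h).

End Heisenberg.

Section WeilModules.

Variables (C : fieldType) (n : nat) (F : finFieldType).

(* A Weil representation extends to the semidirect product with Sp an
   irreducible representation of the Heisenberg group whose central character
   is nontrivial. *)
Definition weil_representation
    (w : mx_representation C (Sp n F) (#|F| ^ n)) : Prop :=
  exists rho : mx_representation C [set: heisenberg n F] (#|F| ^ n),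
    [/\ mx_irreducible rho,
        exists t : F, rho (Heis 0 t) != 1%:M
      & forall x h, x \in Sp n F ->
          rho h *m w x = w x *m rho (heis_act h x)].

Definition weil_module d (r : mx_representation C (Sp n F) d) : Prop :=
  exists w : mx_representation C (Sp n F) (#|F| ^ n),
    weil_representation w /\
    exists (U : 'M_(#|F| ^ n)) (simU : mxsimple w U),
      mx_rsim r (submod_repr (mxsimple_module simU)).

(* The inflation of r to Sp through pi is a Weil module. *)
Definition weil_module_via (gT : finGroupType) (E : {group gT})
    (pi : {morphism Sp n F >-> gT}) d (r : mx_representation C E d) : Prop :=
  exists w : mx_representation C (Sp n F) d,
    weil_module w /\ {in Sp n F, forall x, w x = r (pi x)}.

End WeilModules.

Definition simple_spectrum (C : fieldType) m (A : 'M[C]_m) : Prop :=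
  forall a : C, eigenvalue A a -> mup a (char_poly A) = 1%N.

Section AlmostQuasisimple.

Variables (gT sT : finGroupType) (G : {group gT}) (S : {group sT}).

(* iota realizes G / Z(G) as a subgroup of Aut(S); S itself is identified with
   its group of inner automorphisms. *)
Definition almost_quasisimple
    (iota : {morphism (G / 'Z(G))%g >-> {perm sT}}) : Prop :=
  [/\ simple S, ~~ abelian S, 'injm iota,
      (conj_aut S @* S <| iota @* (G / 'Z(G)))%g
    & (iota @* (G / 'Z(G)) \subset Aut S)%g].

Definition quasisimple (E : {group gT}) : bool :=
  (E^`(1) == E)%g && simple (E / 'Z(E))%g.

Definition is_layer (E : {group gT}) : Prop :=
  [/\ E <| G, quasisimple E & (E / 'Z(E) \isog S)%g].

End AlmostQuasisimple.

(* K stands for an algebraic closure of F through j. *)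
Section MaximalTori.

Variables (n : nat) (F : finFieldType) (K : closedFieldType).
Variable j : {rmorphism F -> K}.

(* A torus of GL is the image of some G_m^k under a rational representation;
   the latter is diagonalizable, with Laurent monomials as weights. *)
Definition torus (T : 'M[K]_(dimV n) -> Prop) : Prop :=
  exists k (P : 'M[K]_(dimV n)) (chi : 'I_(dimV n) -> 'I_k -> int),
    P \in unitmx /\
    forall A, T A <-> exists t : 'I_k -> K, (forall i, t i != 0) /\
      A = invmx P *m diag_mx (\row_l \prod_(i < k) t i ^ chi l i) *m P.

Definition symplectic_torus (T : 'M[K]_(dimV n) -> Prop) : Prop :=
  torus T /\ forall A, T A -> is_symplectic A.

Definition maximal_torus (T : 'M[K]_(dimV n) -> Prop) : Prop :=
  symplectic_torus T /\
  forall T', symplectic_torus T' -> (forall A, T A -> T' A) ->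
    forall A, T' A -> T A.

Definition frobenius_stable (T : 'M[K]_(dimV n) -> Prop) : Prop :=
  forall A, T (map_mx (fun x => x ^+ #|F|) A) <-> T A.

(* The points fixed by the Frobenius map are those with entries in j(F). *)
Definition maximal_torus_Sp (H : {group {'GL_(2 * n)[F]}}) : Prop :=
  exists T, [/\ maximal_torus T, frobenius_stable T
    & forall x, x \in H <-> x \in Sp n F /\ T (map_mx j (GLval x))].

Definition maximal_torus_PSp (T : {group coset_of 'Z(Sp n F)}) : Prop :=
  exists2 H, maximal_torus_Sp H & T :=: (H / 'Z(Sp n F))%g.

End MaximalTori.

Section Subgroups.

Variables (n : nat) (F : finFieldType).

(* The symplectic space F^(2n) is identified by phi with L^2, where L is the
   extension of F of degree n, equipped with the trace of the standard
   symplectic L-form; SL_2(L) = Sp_2(L) acts by L-linear maps. *)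
Definition PSL2_subgroup (M : {group coset_of 'Z(Sp n F)}) : Prop :=
  exists (L : finFieldType) (i : {rmorphism F -> L})
         (phi : 'rV[F]_(dimV n) -> 'rV[L]_2) (H : {group {'GL_(2 * n)[F]}}),
    [/\ #|L| = (#|F| ^ n)%N,
        bijective phi /\ (forall a u v, phi (a *: u + v) = i a *: phi u + phi v),
        forall u v, i (symp_form u v) =
          \sum_(k < n) (@symp_form L 1 (phi u) (phi v)) ^+ (#|F| ^ k),
        forall x, x \in H <-> exists A : 'M[L]_2,
          \det A = 1 /\ forall u, phi (u *m GLval x) = phi u *m A
      & M :=: (H / 'Z(Sp n F))%g].

(* The stabilizer of an orthogonal decomposition of F^(2n) into nondegenerate
   subspaces of dimensions 2a and 2b (the row spaces of U and W) *)
Definition SpxSp_subgroup (a b : nat) (M : {group coset_of 'Z(Sp n F)}) : Prop :=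
  exists (U W : 'M[F]_(dimV n)) (H : {group {'GL_(2 * n)[F]}}),
    [/\ \rank U = (2 * a)%N /\ \rank W = (2 * b)%N,
        (U + W :=: 1%:M)%MS,
        U *m symp_mx F n *m W^T = 0,
        forall x, x \in H <->
          [/\ x \in Sp n F, stablemx U (GLval x) & stablemx W (GLval x)]
      & M :=: (H / 'Z(Sp n F))%g].

End Subgroups.

Definition pm (s : bool) (N : nat) : nat := if s then N.+1 else N.-1.

Section Conclusion.

Variables (n : nat) (F : finFieldType) (K : closedFieldType).
Variable j : {rmorphism F -> K}.

Local Notation q := #|F|.
Local Notation S := (PSp n F).

Definition torus_pm (s : bool) (T : {group coset_of 'Z(Sp n F)}) : Prop :=
  [/\ cyclic T, maximal_torus_PSp j T,
      exists2 M, PSL2_subgroup M & T \proper M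
    & #|T| = (pm s (q ^ n))./2].

Definition torus_ab (a b : nat) (T : {group coset_of 'Z(Sp n F)}) : Prop :=
  [/\ cyclic T, maximal_torus_PSp j T,
      exists2 M, SpxSp_subgroup a b M & T \proper M
    & #|T| = ((q ^ a + 1) * (q ^ b + 1))./2].

(* The element of PSp which induces the automorphism y generates a subgroup
   satisfying tor, and all such subgroups are conjugate in PSp. *)
Definition generates_unique (tor : {group coset_of 'Z(Sp n F)} -> Prop)
    (y : {perm coset_of 'Z(Sp n F)}) : Prop :=
  exists T : {group coset_of 'Z(Sp n F)},
    [/\ tor T, conj_aut S @* T = <[y]>%g
      & forall T' : {group coset_of 'Z(Sp n F)}, tor T' ->
          exists2 x, x \in S & T' :=: (T :^ x)%g].

Definition case_alpha (y : {perm coset_of 'Z(Sp n F)}) : Prop :=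
  exists s : bool,
    #[y] = (pm s (q ^ n))./2 /\ generates_unique (torus_pm s) y.

Definition case_beta (y : {perm coset_of 'Z(Sp n F)}) : Prop :=
  exists a b : nat,
    [/\ (0 < a)%N /\ (0 < b)%N, n = (a + b)%N, (2 * gcdn a b %| a)%N,
        #[y] = ((q ^ a + 1) * (q ^ b + 1))./2
      & generates_unique (torus_ab a b) y].

Definition torus_conclusion (y : {perm coset_of 'Z(Sp n F)}) : Prop :=
  y \in PSp_aut n F /\ (case_alpha y \/ case_beta y).

End Conclusion.

(* Main.v *)
(* An automorphism of PSp permutes the centres of the Sylow p-subgroups, which are
   the images of the root subgroups; hence it permutes the points of the symplectic
   space, preserves orthogonality, and by the fundamental theorem of projective
   geometry is induced by u |-> s(u) M with M a similitude of multiplier c. This is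
   applied twice: to the action of E, so that up to twisting the Weil modules pi
   induces the identity of PSp, and to gbar.

   Simple spectrum forces the order of gbar to be at least dim V. If s has order
   e > 1, the e-th power of u |-> s(u) M is a linear map commuting with it, and the
   order of such a map modulo signs is at most 2^(n-1) |F^s|^n, which is too small.
   So s = 1. If c is not a square, no Weil constituent U is stable under g, because
   the trace of a root element on U changes when its parameter is multiplied by a
   nonsquare; then dim V = 2 d, and g^2 has simple spectrum on U since U and U g
   meet trivially. If c is a square, g is a scalar times the image of some y in Sp.

   This leaves y in Sp, with simple spectrum on a Weil constituent and of order at
   least (q^n - 1) / 2 modulo signs. The eigenvalues of y form blocks
   {z^(q^i), z^(- q^i) | i < a} with z^(q^a) = z or 1/z, and y^k is a sign for k the
   lcm of the q^a - 1 or q^a + 1, which forces one or two blocks with distinct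
   eigenvalues, of total size n. A block of type q^a - 1 spans two y-stable
   isotropic subspaces in duality; averaging the Heisenberg group over them gives
   two operators commuting with y which cannot commute on the constituent unless
   a = n. Finally the centralizer of y in Sp is the torus <y, -1>, and two tori of
   the same shape are conjugate since their generators can be chosen with the same
   eigenvalues. *)

From HB Require Import structures.
Require Import Defs.
From mathcomp Require Import mxabelem ring zify.

Set Implicit Arguments.
Unset Strict Implicit.
Unset Printing Implicit Defensive.

Import GroupScope GRing.Theory.
Local Open Scope ring_scope.

(** * The symplectic form and transvections *)

(** Three counts carry the proof. Order bound: an element y of F^s[x] with y y* = 1 is encoded by
    its Cayley transform, a skew element of F^s[x], and these lie in the F^s-span of n elements. The
    transform needs 1 + y invertible, so y is first multiplied by a reflection 2 e - 1; the
    idempotents e are self-adjoint, hence of even rank, and number at most 2^n. Arithmetic: a block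
    of size a >= 2 contributes at most (5/9) q^a to the lcm because q^a >= 9, and all blocks of size
    1 together at most (q^2 - 1) / 2. Uniqueness: the centralizer of y embeds by eigenvalues into a
    product of groups of roots of unity whose cardinal is exactly twice the order of y modulo signs,
    so the embedding is onto; the generator of any torus of the same shape can thus be matched
    inside the given one. On the representation side, no model is chosen: the Weil constituents are
    the images of the two spectral projections of one operator [P0], the sum of the Heisenberg
    translations divided by q^n, and all traces follow from the commutation relations. *)

Lemma mulmx_row_scalar (R : comNzRingType) N (v : 'rV[R]_N) (A : 'M[R]_(1, 1)) :
  A *m v = A 0 0 *: v.
Proof. by rewrite {1}[A]mx11_scalar mul_scalar_mx. Qed.

(** The eigenvalue on each basis vector is compared with that on the first one through their sum. *)
Lemma scalar_of_lines (F : fieldType) N (A : 'M[F]_N.+1) :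
  (forall u : 'rV[F]_N.+1, (u *m A <= u)%MS) -> exists c, A = c%:M.
Proof.
move=> hA.
have ev (u : 'rV_N.+1) : exists c : F, u *m A = c *: u by apply/sub_rVP/hA.
have [c0 hc0] := ev (delta_mx 0 0).
exists c0; apply/row_matrixP=> i.
have [ci hci] := ev (delta_mx 0 i).
rewrite -row1 in hci *; rewrite !rowE mulmx1 mul_mx_scalar in hci *.
have [->//|ni0] := eqVneq i 0.
have [c hc] := ev (delta_mx 0 0 + delta_mx 0 i).
move: hc; rewrite mulmxDl hc0 hci => /rowP hc.
have := hc 0; have := hc i.
rewrite !mxE !eqxx /= (negPf ni0) eq_sym (negPf ni0) /= !mulr0 !add0r !addr0 !mulr1.
by move=> -> ->.
Qed.

Lemma eq_mulrows (R : pzSemiRingType) m N (A A' : 'M[R]_(m, N)) :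
  (forall u : 'rV_m, u *m A = u *m A') -> A = A'.
Proof. by move=> h; apply/row_matrixP=> i; rewrite !rowE h. Qed.

Section Form.
Variables (F : fieldType) (n : nat).
Hypothesis n_gt0 : (0 < n)%N.
Local Notation N := (dimV n).
Local Notation J := (symp_mx F n).
Local Notation B := (@symp_form F n).

Lemma dimV_eq : N = (2 * n)%N.
Proof. by rewrite prednK // muln_gt0. Qed.

Lemma symp_mx_tr : J^T = - J.
Proof. by apply/matrixP=> i j; rewrite !mxE opprB. Qed.

Lemma symp_mx_sq : J *m J = - 1%:M.
Proof.
have lt2 m : (m < N)%N = (m < n + n)%N by rewrite dimV_eq mul2n addnn.
have dj (i : 'I_N) : (i < n + n)%N by rewrite -lt2.
apply/matrixP=> i k; rewrite !mxE.
(* Row [i] of the form has a single nonzero entry, in column [j0], so each entry of the product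
   reduces to one term. *)
pose j0 : nat := if (i < n)%N then (i + n)%N else (i - n)%N.
have j0P : (j0 < N)%N.
  rewrite /j0 lt2; case: (ltnP i n) => h; first by rewrite ltn_add2r.
  by rewrite (leq_ltn_trans (leq_subr _ _)).
rewrite (bigD1 (Ordinal j0P)) //= [X in _ + X]big1 => [|j nj]; last first.
  rewrite !mxE.
  suff [-> ->] : ((i + n == j) = false)%N /\ ((j + n == i) = false)%N.
    by rewrite subrr mul0r.
  move/negPf: nj; rewrite -val_eqE /= /j0 => nj; split; apply/eqP=> e.
    move: nj; rewrite ifT; last by have := dj j; rewrite -e ltn_add2r.
    by rewrite -e eqxx.
  move: nj; rewrite -e ltnNge leq_addl /= addnK eqxx //.
rewrite addr0 !mxE /= /j0; case: (ltnP i n) => hi.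
  rewrite eqxx eqn_add2r; set b := (i + n + n == i)%N.
  have -> : b = false.
    by apply/negbTE; rewrite /b -addnA -{2}[nat_of_ord i]addn0 eqn_add2l addnn double_eq0 -lt0n.
  set b' := (i + n + n == k)%N; have -> : b' = false.
    apply/negbTE/eqP => e; have := dj k; rewrite -e.
    by rewrite ltn_add2r ltnNge leq_addl.
  by rewrite subr0 mul1r sub0r eq_sym val_eqE.
rewrite subnK // eqxx; set b := (i + n == i - n)%N.
have -> : b = false.
  apply/negbTE/eqP => e; have: (i - n < i + n)%N by rewrite (leq_ltn_trans (leq_subr _ _)) // -{1}[nat_of_ord i]addn0 ltn_add2l.
  by rewrite -e ltnn.
set b' := (k + n == i - n)%N; have -> : b' = false.
  apply/negbTE/eqP => e; have := dj i; rewrite -{1}(subnK hi) -e.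
  by rewrite ltn_add2r ltnNge leq_addl.
by rewrite sub0r subr0 mulN1r val_eqE.
Qed.

Lemma symp_mx_unit : J \in unitmx.
Proof.
have /mulmx1_unit[] // : J *m (- J) = 1%:M by rewrite mulmxN symp_mx_sq opprK.
Qed.

Lemma mulJ_inj m (A A' : 'M[F]_(m, N)) : A *m J = A' *m J -> A = A'.
Proof. by move/(congr1 (mulmx^~ (invmx J))); rewrite !mulmxK // symp_mx_unit. Qed.

Lemma formE u v : u *m J *m v^T = (B u v)%:M.
Proof. by rewrite [LHS]mx11_scalar. Qed.

Lemma formDl u u' v : B (u + u') v = B u v + B u' v.
Proof. by rewrite /symp_form !mulmxDl mxE. Qed.
Lemma formDr u v v' : B u (v + v') = B u v + B u v'.
Proof. by rewrite /symp_form linearD /= mulmxDr mxE. Qed.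
Lemma formZl a u v : B (a *: u) v = a * B u v.
Proof. by rewrite /symp_form -!scalemxAl mxE. Qed.
Lemma formZr a u v : B u (a *: v) = a * B u v.
Proof. by rewrite /symp_form linearZ /= -scalemxAr mxE. Qed.
Lemma formNl u v : B (- u) v = - B u v.
Proof. by rewrite -scaleN1r formZl mulN1r. Qed.
Lemma formNr u v : B u (- v) = - B u v.
Proof. by rewrite -scaleN1r formZr mulN1r. Qed.
Lemma form0l v : B 0 v = 0.
Proof. by rewrite /symp_form !mul0mx mxE. Qed.
Lemma form0r u : B u 0 = 0.
Proof. by rewrite /symp_form trmx0 mulmx0 mxE. Qed.

Lemma formC u v : B v u = - B u v.
Proof.
have: (u *m J *m v^T)^T = (B u v)%:M by rewrite formE tr_scalar_mx.
rewrite !trmx_mul symp_mx_tr trmxK mulNmx mulmxN mulmxA formE.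
by move/matrixP/(_ 0 0); rewrite !mxE eqxx !mulr1n => /eqP; rewrite eqr_oppLR => /eqP.
Qed.

Lemma form_nondegl u : (forall v, B u v = 0) -> u = 0.
Proof.
move=> hu; apply: mulJ_inj; rewrite mul0mx; apply/rowP=> i.
have := hu (delta_mx 0 i); rewrite /symp_form trmx_delta -colE => h.
by rewrite mxE in h; rewrite h mxE.
Qed.

Lemma form_nondegr v : (forall u, B u v = 0) -> v = 0.
Proof. by move=> h; apply: form_nondegl => u; rewrite formC h oppr0. Qed.

Lemma form_exists v : v != 0 -> exists u, B u v = 1.
Proof.
move=> v0; have [u hu] : exists u, B u v != 0.
  have [i hi] : exists i, B (delta_mx 0 i) v != 0.
    case: (pickP (fun i => B (delta_mx 0 i) v != 0)) => [i hi|h]; first by exists i.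
    case/eqP: v0; apply: form_nondegr => u.
    rewrite (row_sum_delta u); elim/big_rec: _ => [|i x _ hx]; first by rewrite form0l.
    by rewrite formDl formZl (eqP (negbFE (h i))) mulr0 hx addr0.
  by exists (delta_mx 0 i).
by exists ((B u v)^-1 *: u); rewrite formZl mulVf.
Qed.

Lemma symplecticP (A : 'M[F]_N) :
  reflect (forall u v, B (u *m A) (v *m A) = B u v) (is_symplectic A).
Proof.
apply: (iffP idP) => [h u v|h]; first exact: is_symplectic_form.
apply/eqP/matrixP=> i j; have := h (delta_mx 0 i) (delta_mx 0 j).
rewrite /symp_form trmx_mul trmx_delta !mulmxA => e.
have mE (X : 'M[F]_N) : (delta_mx 0 i *m X *m delta_mx j 0 : 'M_1) 0 0 = X i j.
  by rewrite -rowE -colE !mxE.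
by rewrite -!mE !mulmxA.
Qed.

Lemma symplectic_unit (A : 'M[F]_N) : is_symplectic A -> A \in unitmx.
Proof.
move=> /eqP e; have : A *m (J *m A^T *m invmx J) = 1%:M.
  by rewrite !mulmxA e mulmxV ?symp_mx_unit.
by case/mulmx1_unit.
Qed.

Lemma symplecticN1 : is_symplectic (- 1%:M : 'M[F]_N).
Proof. by rewrite /is_symplectic linearN /= trmx1 mulNmx mulmxN mul1mx mulmx1 opprK. Qed.

Lemma symplecticV (A : 'M[F]_N) : is_symplectic A -> is_symplectic (invmx A).
Proof.
move=> sA; have uA := symplectic_unit sA; apply/symplecticP=> u v.
by rewrite -(is_symplectic_form _ _ sA) !mulmxKV.
Qed.

(** The symplectic transvection u |-> u + a B(u, v) v, written for the right action on rows. *)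
Definition tv (v : 'rV[F]_N) (a : F) : 'M[F]_N := 1%:M + a *: (J *m v^T *m v).

Lemma mul_tv u v a : u *m tv v a = u + (a * B u v) *: v.
Proof.
rewrite /tv mulmxDr mulmx1 -scalemxAr !mulmxA formE mul_scalar_mx scalerA.
by [].
Qed.

Hypothesis char2 : (2%:R : F) != 0.

Lemma formxx u : B u u = 0.
Proof.
have /eqP := formC u u; rewrite -addr_eq0 -mulr2n -mulr_natl mulf_eq0 (negPf char2).
by move/eqP.
Qed.

Lemma tv_symplectic v a : is_symplectic (tv v a).
Proof.
apply/symplecticP=> x y; rewrite !mul_tv !(formDl, formDr, formZl, formZr) formxx.
by rewrite (formC v y); ring.
Qed.

Lemma tvM v a b : tv v a *m tv v b = tv v (a + b).
Proof.
apply: eq_mulrows => u; rewrite mulmxA !mul_tv formDl formZl formxx mulr0 addr0.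
by rewrite -addrA -scalerDl -mulrDl.
Qed.

Lemma tv0 v : tv v 0 = 1%:M.
Proof. by rewrite /tv scale0r addr0. Qed.

Lemma tvZ k v a : tv (k *: v) a = tv v (k ^+ 2 * a).
Proof.
apply: eq_mulrows => u; rewrite !mul_tv formZr scalerA; congr (_ + _ *: _); ring.
Qed.

Lemma tv_conj v a (A : 'M[F]_N) : is_symplectic A -> tv v a *m A = A *m tv (v *m A) a.
Proof.
move=> sA; apply: eq_mulrows => u.
by rewrite !mulmxA !mul_tv is_symplectic_form // mulmxDl -scalemxAl.
Qed.

(** The transvection along v - u works, since B u (v - u) = B u v is the coefficient to invert. *)
Lemma symp_trans1 u v : B u v != 0 -> exists2 A : 'M[F]_N, is_symplectic A & u *m A = v.
Proof.
move=> h; exists (tv (v - u) (B u v)^-1); first exact: tv_symplectic.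
by rewrite mul_tv formDr formNr formxx subr0 mulVf // scale1r addrC subrK.
Qed.

(** A space is not the union of two hyperplanes: if the obvious vectors each fail one condition,
    their sum meets both. *)
Lemma form_exists2 (u v : 'rV[F]_N) : u != 0 -> v != 0 -> exists2 w, B u w != 0 & B w v != 0.
Proof.
move=> u0 v0; have [a ha] := form_exists u0; have [b hb] := form_exists v0.
have ha' : B u a = -1 by rewrite formC ha.
have [eb|nb] := eqVneq (B u b) 0; last by exists b; rewrite // hb oner_neq0.
have [ea|na] := eqVneq (B a v) 0.
  exists (a + b); first by rewrite formDr eb addr0 ha' oppr_eq0 oner_neq0.
  by rewrite formDl ea add0r hb oner_neq0.
by exists a => //; rewrite ha' oppr_eq0 oner_neq0.
Qed.

Lemma symp_trans (u v : 'rV[F]_N) : u != 0 -> v != 0 -> exists2 A : 'M[F]_N, is_symplectic A & u *m A = v.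
Proof.
move=> u0 v0; have [w h1 h2] := form_exists2 u0 v0.
have [A sA <-] := symp_trans1 h2; have [A' sA' <-] := symp_trans1 h1.
by exists (A' *m A); [apply: is_symplecticM | rewrite mulmxA].
Qed.

End Form.

Section SpGroup.
Variables (F : finFieldType) (n : nat).
Hypothesis n_gt0 : (0 < n)%N.
Hypothesis char2 : (2%:R : F) != 0.
Local Notation N := (dimV n).
Local Notation J := (symp_mx F n).
Local Notation B := (@symp_form F n).
Local Notation gT := {'GL_(2 * n)[F]}.

(** A singular matrix is sent to 1; the lock keeps simplification from unfolding the insertion into
    the subtype. *)
Definition toGL (A : 'M[F]_N) : gT := locked (insubd (1%g : gT) A).

Lemma toGLK A : A \in unitmx -> GLval (toGL A) = A.
Proof. by move=> uA; rewrite /toGL -lock -[GLval _]/(val _) insubdK. Qed.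

Lemma GLval_inj : injective (@GLval (2 * n) F).
Proof. exact: val_inj. Qed.

Lemma SpE (x : gT) : (x \in Sp n F) = is_symplectic (GLval x).
Proof. by rewrite inE. Qed.

Lemma toGL_Sp A : is_symplectic A -> toGL A \in Sp n F.
Proof. by move=> sA; rewrite SpE toGLK // symplectic_unit. Qed.

Lemma toGLM A A' : A \in unitmx -> A' \in unitmx -> toGL (A *m A') = (toGL A * toGL A')%g.
Proof. by move=> uA uA'; apply: GLval_inj; rewrite GL_MxE !toGLK // unitmx_mul uA. Qed.

Lemma GLval_unitmx (x : gT) : GLval x \in unitmx.
Proof. exact: GL_unitmx. Qed.

Lemma GLval1 : GLval (1%g : gT) = 1%:M.
Proof. exact: GL_1E. Qed.

Lemma GLvalM (x y : gT) : GLval (x * y)%g = GLval x *m GLval y.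
Proof. exact: GL_MxE. Qed.

Lemma GLvalV (x : gT) : GLval (x^-1)%g = invmx (GLval x).
Proof. exact: GL_VxE. Qed.

Lemma GLvalJ (x y : gT) : GLval (x ^ y)%g = invmx (GLval y) *m GLval x *m GLval y.
Proof. by rewrite conjgE !GLvalM GLvalV mulmxA. Qed.

Lemma GLvalX (x : gT) k : GLval (x ^+ k)%g = GLval x ^+ k.
Proof. by elim: k => [|k IH]; rewrite ?expg0 ?GLval1 // expgS GLvalM IH exprS. Qed.

Definition tg v a : gT := toGL (tv v a).

Lemma GLval_tg v a : GLval (tg v a) = tv v a.
Proof. by rewrite toGLK // symplectic_unit ?tv_symplectic. Qed.

Lemma tg_Sp v a : tg v a \in Sp n F.
Proof. by rewrite SpE GLval_tg tv_symplectic. Qed.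

Lemma tgM v a b : (tg v a * tg v b)%g = tg v (a + b).
Proof. by apply: GLval_inj; rewrite GLvalM !GLval_tg tvM. Qed.

Lemma tg0 v : tg v 0 = 1%g.
Proof. by apply: GLval_inj; rewrite GLval_tg tv0 GLval1. Qed.

Lemma tg_conj v a x : x \in Sp n F -> (tg v a ^ x)%g = tg (v *m GLval x) a.
Proof.
rewrite SpE => sx; apply: GLval_inj; rewrite GLvalJ !GLval_tg -mulmxA tv_conj //.
by rewrite mulKmx // GLval_unitmx.
Qed.

Lemma Sp_trans (u v : 'rV[F]_N) : u != 0 -> v != 0 -> exists2 x, x \in Sp n F & u *m GLval x = v.
Proof.
move=> u0 v0; have [A sA <-] := symp_trans n_gt0 char2 u0 v0.
by exists (toGL A); rewrite ?toGL_Sp // toGLK // symplectic_unit.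
Qed.

Definition m1 : gT := toGL (- 1%:M).

Lemma GLval_m1 : GLval m1 = - 1%:M.
Proof. by rewrite toGLK // symplectic_unit ?symplecticN1. Qed.

Lemma m1_Sp : m1 \in Sp n F.
Proof. by rewrite SpE GLval_m1 symplecticN1. Qed.

Lemma symp_scalar (c : F) : is_symplectic (c%:M : 'M[F]_N) -> c = 1 \/ c = -1.
Proof.
move=> /eqP; rewrite tr_scalar_mx mul_mx_scalar mul_scalar_mx scalerA => e.
have: (c * c - 1) *: J = 0 by rewrite scalerBl e scale1r subrr.
move/eqP; rewrite scaler_eq0 => /orP[|/eqP j0]; last first.
  by have := symp_mx_unit F n_gt0; rewrite j0 unitr0.
rewrite -expr2 subr_eq0 sqrf_eq1 => /orP[] /eqP ->; by [left|right].
Qed.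

Lemma symp_lines x : x \in Sp n F -> (forall u : 'rV_N, (u *m GLval x <= u)%MS) ->
  x = 1%g \/ x = m1.
Proof.
rewrite SpE => sx /scalar_of_lines[c hc]; rewrite hc in sx.
by case: (symp_scalar sx) => e; [left|right]; apply: GLval_inj;
  rewrite hc e ?GLval1 ?GLval_m1 // raddfN.
Qed.

Lemma tv_line (u v : 'rV[F]_N) (a : F) : u != 0 -> v != 0 -> a != 0 -> tv u a = tv v a -> exists k : F, v = k *: u.
Proof.
move=> u0 v0 a0 e; have [w hw] := form_exists n_gt0 v0.
have := congr1 (mulmx w) e; rewrite !mul_tv hw => /addrI; rewrite mulr1 => h.
exists (B w u); apply: (scalerI a0); by rewrite -h scalerA.
Qed.

(** A central element commutes with every transvection, so it stabilizes every line and is a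
    symplectic scalar. *)
Lemma center_SpP x : reflect (x = 1%g \/ x = m1) (x \in 'Z(Sp n F)).
Proof.
apply: (iffP idP) => [/centerP[xS cx]|].
  apply: symp_lines => // u; have [->|u0] := eqVneq u 0; first by rewrite mul0mx.
  have ux0 : u *m GLval x != 0.
    apply: contra u0 => /eqP e; apply/eqP.
    by rewrite -[u](mulmxK (GLval_unitmx x)) e mul0mx.
  have := cx _ (tg_Sp u 1); move/commgP/conjg_fixP=> e.
  have : (tg u 1 ^ x)%g = tg u 1 by apply/conjg_fixP/commgP/commute_sym/cx/tg_Sp.
  rewrite tg_conj // => /(congr1 GLval); rewrite !GLval_tg => h.
  have [k ->] := tv_line u0 ux0 (oner_neq0 F) (esym h); exact: scalemx_sub.
move=> h; apply/centerP; have xS : x \in Sp n F by case: h => ->; rewrite ?group1 ?m1_Sp.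
split=> // y yS; case: h => ->; first by rewrite /commute mulg1 mul1g.
by apply: GLval_inj; rewrite !GLvalM GLval_m1 mulNmx mulmxN mul1mx mulmx1.
Qed.

Lemma m1_neq1 : m1 != 1%g.
Proof.
apply/eqP => /(congr1 GLval); rewrite GLval_m1 GLval1 => /matrixP/(_ 0 0).
rewrite !mxE eqxx => /eqP; rewrite eq_sym -subr_eq0 opprK -mulr2n -mulr_natr mul1r.
exact/negP.
Qed.

Lemma center_SpE : 'Z(Sp n F) = [set 1%g; m1].
Proof. by apply/setP=> x; rewrite in_set2; apply/center_SpP/orP => -[] /eqP; auto. Qed.

Lemma card_center_Sp : #|'Z(Sp n F)| = 2%N.
Proof. by rewrite center_SpE cards2 eq_sym m1_neq1. Qed.

End SpGroup.

(** * Root subgroups and Sylow subgroups *)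

Section Roots.
Variables (F : finFieldType) (n : nat).
Hypothesis n_gt0 : (0 < n)%N.
Hypothesis char2 : (2%:R : F) != 0.
Local Notation N := (dimV n).
Local Notation J := (symp_mx F n).
Local Notation B := (@symp_form F n).
Local Notation gT := {'GL_(2 * n)[F]}.
Local Notation Sp := (Sp n F).
Local Notation Z := 'Z(Sp).

Lemma gl_repr_subproof : mx_repr Sp (fun x : gT => GLval x).
Proof. by split=> [|x y _ _]; rewrite ?GLval1 ?GLvalM. Qed.
Definition gl_repr := MxRepresentation gl_repr_subproof.

Definition root_set (v : 'rV[F]_N) : {set gT} := [set tg v a | a in F].

Lemma root_group_set v : group_set (root_set v).
Proof.
apply/group_setP; split=> [|x y]; first by apply/imsetP; exists 0; rewrite ?tg0.
by case/imsetP=> a _ -> /imsetP[b _ ->]; apply/imsetP; exists (a + b); rewrite ?tgM.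
Qed.
Canonical root_subgroup v := Group (root_group_set v).

Lemma root_subgroupP v x : reflect (exists a, x = tg v a) (x \in root_subgroup v).
Proof. by apply: (iffP imsetP) => [[a _]|[a]] ->; exists a. Qed.

Lemma root_sub v : root_subgroup v \subset Sp.
Proof. by apply/subsetP=> x /root_subgroupP[a ->]; apply: tg_Sp. Qed.

Lemma rootJ v x : x \in Sp -> (root_subgroup v :^ x)%g = root_subgroup (v *m GLval x).
Proof.
move=> xS; apply/setP=> y; rewrite mem_conjg; apply/root_subgroupP/root_subgroupP => -[a e]; exists a.
  by rewrite -(conjgKV x y) e tg_conj.
by rewrite e -tg_conj // conjgK.
Qed.

(** The unipotent radical of the stabilizer of the line of [v]: it fixes [v] and acts trivially on
    the orthogonal of [v] modulo [v]. Its center will be the root subgroup of [v]. *)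
Definition unip_set (v : 'rV[F]_N) : {set gT} :=
  [set x in Sp | (v *m GLval x == v) &&
     [forall u, (B u v == 0) ==> (u *m GLval x - u <= v)%MS]].

Lemma unipP v x : reflect
  [/\ x \in Sp, v *m GLval x = v & forall u, B u v = 0 -> (u *m GLval x - u <= v)%MS]
  (x \in unip_set v).
Proof.
rewrite [x \in unip_set v]inE; apply: (iffP and3P) => [[xS /eqP e /forallP h]|[xS e h]].
  by split=> // u /eqP hu; apply: (implyP (h u)).
by split=> //; [apply/eqP | apply/forallP=> u; apply/implyP=> /eqP /h].
Qed.

Lemma unip_group_set v : group_set (unip_set v).
Proof.
apply/group_setP; split=> [|x y /unipP[xS xv hx] /unipP[yS yv hy]]; apply/unipP.
  by split; rewrite ?group1 // GLval1 ?mulmx1 // => u _; rewrite mulmx1 subrr sub0mx.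
split; first by rewrite groupM.
  by rewrite GLvalM mulmxA xv.
move=> u uv; rewrite GLvalM mulmxA.
have -> : u *m GLval x *m GLval y - u
  = (u *m GLval x - u) *m GLval y + (u *m GLval y - u).
  by rewrite mulmxBl addrA subrK.
by rewrite addmx_sub ?hy // -[X in (_ <= X)%MS]yv submxMr ?hx.
Qed.
Canonical unip v := Group (unip_group_set v).

Lemma root_sub_unip v : root_subgroup v \subset unip v.
Proof.
apply/subsetP=> x /root_subgroupP[a ->]; apply/unipP; split; first exact: tg_Sp.
  by rewrite GLval_tg // mul_tv formxx // mulr0 scale0r addr0.
by move=> u uv; rewrite GLval_tg // mul_tv uv mulr0 scale0r addr0 subrr sub0mx.
Qed.

Variable p : nat.
Hypothesis pF : p \in [pchar F].

Lemma p_gt2 : (2 < p)%N.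
Proof.
have pp := pcharf_prime pF; rewrite ltn_neqAle prime_gt1 // andbT.
by apply: contra char2 => /eqP e; have := pcharf0 pF; rewrite -e => ->.
Qed.

(** Each factor x - 1 goes one step down the filtration by the whole space, the orthogonal of v, the
    line of v, and 0. *)
Lemma unip_nilp v x : x \in unip v -> (GLval x - 1) ^+ 3 = 0.
Proof.
case/unipP=> xS xv hx; apply: eq_mulrows => u; rewrite mulmx0.
have uE (w : 'rV[F]_N) : w *m (GLval x - 1) = w *m GLval x - w by rewrite mulmxBr mulmx1.
rewrite !exprSr expr0 mul1r; rewrite -[(_ * _) * _]/(_ *m _ *m _) !mulmxA !(uE u).
set u1 := _ - u; have h1 : B u1 v = 0.
  rewrite /u1 formDl formNl -{1}xv is_symplectic_form ?subrr //.
  by rewrite -SpE.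
rewrite (uE u1); have /sub_rVP[a ->] := hx _ h1.
by rewrite -scalemxAl uE xv subrr scaler0.
Qed.

Lemma unip_expp v x : x \in unip v -> (x ^+ p = 1)%g.
Proof.
move=> xU; apply: GLval_inj; rewrite GLvalX GLval1.
have pM : p \in [pchar 'M[F]_N] by rewrite pchar_lalg.
have -> : GLval x = 1 + (GLval x - 1) by rewrite addrC subrK.
have cm : GRing.comm 1 (GLval x - 1) by rewrite /GRing.comm mul1r mulr1.
have := pFrobenius_autD_comm pM cm; rewrite !pFrobenius_autE => ->.
rewrite expr1n; have -> : p = (3 + (p - 3))%N by rewrite subnKC // p_gt2.
by rewrite exprD (unip_nilp xU) mul0r addr0.
Qed.

Lemma unip_pgroup v : p.-group (unip v).
Proof.
apply/pgroupP=> r rpr /(Cauchy rpr)[x xU ox].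
have := unip_expp xU => /eqP; rewrite -order_dvdn ox.
by rewrite dvdn_prime2 // (pcharf_prime pF).
Qed.

(** For [u] orthogonal to [v] this is w |-> w + B(w, v) u + B(w, u) v, an element of [unip v] which
    moves vectors outside the orthogonal of [v] in the direction of [u]. As a product of
    transvections it is symplectic at no cost. *)
Definition pair_unip (v u : 'rV[F]_N) : gT :=
  (tg (u + v) 1 * tg u (-1) * tg v (-1))%g.

Lemma mul_pair_unip v u w : B u v = 0 ->
  w *m GLval (pair_unip v u) = w + B w v *: u + B w u *: v.
Proof.
move=> uv; have vu : B v u = 0 by rewrite formC uv oppr0.
rewrite /pair_unip !GLvalM !GLval_tg // !mulmxA !mul_tv // mul1r.
rewrite !(formDl, formDr, formZl, formZr, formxx char2, uv, vu).
set a := B w u; set b := B w v.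
apply/rowP=> i; rewrite !mxE; ring.
Qed.

Lemma pair_unip_in v u : B u v = 0 -> pair_unip v u \in unip v.
Proof.
move=> uv; apply/unipP; split; first by rewrite !groupM ?tg_Sp.
  rewrite mul_pair_unip // formxx // scale0r addr0 formC uv oppr0 scale0r addr0 //.
move=> w wv; rewrite mul_pair_unip // wv scale0r addr0 addrC addKr.
exact: scalemx_sub.
Qed.

Lemma unip_norm v x : x \in Sp -> v *m GLval x = v -> x \in 'N(unip v).
Proof.
move=> xS xv; rewrite inE; apply/subsetP=> y; rewrite mem_conjg => /unipP[yS yv hy].
have -> : y = ((y ^ x^-1) ^ x)%g by rewrite conjgKV.
move: (y ^ x^-1)%g yS yv hy => z zS zv hz.
have xV : v *m invmx (GLval x) = v by rewrite -{1}xv mulmxK ?GLval_unitmx.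
apply/unipP; split; first by rewrite groupJ.
  by rewrite GLvalJ !mulmxA xV zv xv.
move=> u uv; rewrite GLvalJ !mulmxA.
set u' := u *m invmx (GLval x).
have {1}-> : u = u' *m GLval x by rewrite mulmxKV ?GLval_unitmx.
rewrite -mulmxBl -[X in (_ <= X)%MS]xv submxMr //.
apply: hz; rewrite -uv -(is_symplectic_form (A := GLval x)) -?SpE //.
by rewrite xv mulmxKV ?GLval_unitmx.
Qed.

Lemma centerP_root (v : 'rV[F]_N) (z : gT) : v != 0 -> z \in unip v ->
  (forall u, B u v = 0 -> commute z (pair_unip v u)) -> z \in root_subgroup v.
Proof.
move=> v0 zU cz; have [zS zv hz] := unipP _ _ zU.
have sz : is_symplectic (GLval z) by rewrite -SpE.
(* Commutation with [pair_unip v u], tested on a w with B w v = 1, gives 2 b v = 0, where b v is the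
   displacement of u. *)
have fixz u : B u v = 0 -> u *m GLval z = u.
  move=> uv; have /sub_rVP[b hb] := hz u uv.
  have ez : u *m GLval z = u + b *: v by rewrite -hb addrC subrK.
  have [w hw] := form_exists n_gt0 v0.
  have ht x : x *m GLval (pair_unip v u) = _ := mul_pair_unip x uv.
  move: (cz u uv) ht; move: (pair_unip v u) => t ct ht.
  have : w *m GLval (z * t)%g = w *m GLval (t * z)%g by rewrite ct.
  rewrite !GLvalM !mulmxA !ht !mulmxDl -!scalemxAl ez zv.
  have e1 : B (w *m GLval z) v = B w v by rewrite -{1}zv is_symplectic_form.
  have e2 : B (w *m GLval z) u = B w u - b * B w v.
    rewrite -(is_symplectic_form w u sz) ez formDr formZr e1; ring.
  rewrite e1 e2 hw !scale1r mulr1 => e.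
  have : (b + b) *: v = 0.
    apply/rowP=> i; have /eqP := congr1 (fun r : 'rV_N => r 0 i) e.
    rewrite /= !mxE -subr_eq0 => /eqP h; rewrite -[RHS]oppr0 -h; ring.
  move/eqP; rewrite scaler_eq0 (negPf v0) orbF -mulr2n -mulr_natl mulf_eq0 (negPf char2).
  by move=> /eqP ->; rewrite scale0r addr0.
have [u0 hu0] := form_exists n_gt0 v0.
have dec x : exists2 x', B x' v = 0 & x = B x v *: u0 + x'.
  exists (x - B x v *: u0); last by rewrite addrC subrK.
  by rewrite formDl formNl formZl hu0 mulr1 subrr.
(* The displacement w of u0 is orthogonal to the orthogonal of v, hence a multiple of v, which makes
   z a transvection. *)
have [w w0] : exists w, u0 *m GLval z = w + u0.
  by exists (u0 *m GLval z - u0); rewrite subrK.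
have hw u : B u v = 0 -> B w u = 0.
  move=> uv; have := is_symplectic_form u0 u sz; rewrite w0 (fixz u uv) formDl.
  by rewrite -[X in _ = X]add0r => /addIr.
have wE : w = B w u0 *: (- v).
  apply/eqP; rewrite -subr_eq0; apply/eqP; apply: (form_nondegl n_gt0) => x.
  have [x' x'v ->] := dec x.
  rewrite formDr !formZr !(formDl, formNl, formZl) (hw _ x'v) (formC x' v) x'v.
  by rewrite (formC u0 v) hu0; ring.
apply/root_subgroupP; exists (- B w u0); apply: GLval_inj; rewrite GLval_tg //.
apply: eq_mulrows => x; rewrite mul_tv; have [x' x'v e] := dec x.
rewrite {1}e mulmxDl -scalemxAl (fixz _ x'v) w0 {1}wE.
set b := B x v in e *; rewrite [X in _ = X + _]e.
by apply/rowP=> i; rewrite !mxE; ring.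
Qed.

Lemma fixed_vector (P : {group gT}) : p.-group P -> P \subset Sp ->
  exists2 v : 'rV[F]_N, v != 0 & forall x, x \in P -> v *m GLval x = v.
Proof.
move=> pP sP; have := rfix_pgroup_pchar pF gl_repr (ltn0Sn _) pP sP.
case/rowV0Pn=> v hv v0; exists v => // x xP.
by have /rfix_mxP := hv; apply.
Qed.

(** A Sylow subgroup P fixes a nonzero v, so it normalizes the p-group [unip v] and contains it by
    maximality. Its center then commutes with all [pair_unip v u], which confines it to the root
    subgroup of v. *)
Lemma sylow_center : exists (P : {group gT}) (v : 'rV[F]_N),
  [/\ p.-Sylow(Sp) P, v != 0 & 'Z(P) = root_subgroup v].
Proof.
have [P sylP] := Sylow_exists p Sp; have sP := pHall_sub sylP.
have pP := pHall_pgroup sylP.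
have [v v0 hv] := fixed_vector pP sP.
have uP : unip v \subset P.
  have nPU : P \subset 'N(unip v).
    by apply/subsetP=> x xP; apply: unip_norm; rewrite ?hv ?(subsetP sP).
  have pPU : p.-group (P <*> unip v) by rewrite norm_joinEl // pgroupM pP unip_pgroup.
  have usP : unip v \subset Sp by apply/subsetP=> x /unipP[].
  have sPU : P <*> unip v \subset Sp by rewrite join_subG sP usP.
  have := sub_pHall sylP pPU (joing_subl _ _) sPU => <-; exact: joing_subr.
exists P, v; split=> //; apply/eqP; rewrite eqEsubset; apply/andP; split.
  apply/subsetP=> z /centerP[zP cz]; apply: centerP_root => //.
    apply/unipP; split; [exact: (subsetP sP) | exact: hv | move=> u uv].
    have zS : is_symplectic (GLval z) by rewrite -SpE (subsetP sP).
    (* For this w the two products agree only if u z - u is a multiple of v. *)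
    have [w hw] := form_exists n_gt0 v0.
    have ht x : x *m GLval (pair_unip v u) = _ := mul_pair_unip x uv.
    move: (cz _ (subsetP uP _ (pair_unip_in uv))) ht; move: (pair_unip v u) => t ct ht.
    have : w *m GLval (z * t)%g = w *m GLval (t * z)%g by rewrite ct.
    rewrite !GLvalM !mulmxA !ht !mulmxDl -!scalemxAl (hv _ zP).
    have -> : B (w *m GLval z) v = B w v by rewrite -{1}(hv _ zP) is_symplectic_form.
    rewrite hw !scale1r -!addrA => /addrI => e'.
    have -> : u *m GLval z - u = (B (w *m GLval z) u - B w u) *: v.
      by rewrite scalerBl -[u *m _](addrK (B w u *: v)) -e'; apply/rowP=> i; rewrite !mxE; ring.
    exact: scalemx_sub.
  by move=> u uv; apply: cz; apply: (subsetP uP); apply: pair_unip_in.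
apply/subsetP=> x xr; apply/centerP; split.
  by apply: (subsetP uP); apply: (subsetP (root_sub_unip v)).
move=> y yP; have /root_subgroupP[a ->] := xr; apply/commute_sym/commgP/conjg_fixP.
apply/conjg_fixP/commgP/commute_sym/commgP/conjg_fixP.
by rewrite tg_conj ?(subsetP sP) // hv.
Qed.

End Roots.

(** * Semilinear maps from maps of points *)

Section Rows.
Variables (F : fieldType) (N : nat).
Implicit Types u v w x : 'rV[F]_N.

Lemma sub_rV_sym u v : u != 0 -> (u <= v)%MS -> (v <= u)%MS.
Proof.
move=> u0 /sub_rVP[a e]; have a0 : a != 0 by apply: contra u0 => /eqP z; rewrite e z scale0r.
by apply/sub_rVP; exists a^-1; rewrite e scalerA mulVf ?scale1r.
Qed.

Lemma span2P x u v :
  reflect (exists a b, x = a *: u + b *: v) (x <= u + v)%MS.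
Proof.
apply: (iffP sub_addsmxP) => [[[d e] ->]|[a [b ->]]].
  by exists (d 0 0), (e 0 0); rewrite !mulmx_row_scalar.
by exists (a%:M, b%:M); rewrite /= !mul_scalar_mx.
Qed.

Lemma scalar_sub k u (v : 'M[F]_(k, N)) a : a != 0 -> (a *: u <= v)%MS -> (u <= v)%MS.
Proof. by move=> a0 h; rewrite -[u](scale1r) -(mulVf a0) -scalerA scalemx_sub. Qed.
End Rows.

(** * The fundamental theorem of projective geometry *)

Section FTPG.
Variables (F : finFieldType) (m : nat).
Hypothesis m_gt1 : (1 < m)%N.
Local Notation V := 'rV[F]_m.+1.
Implicit Types u v w x : V.
Variable b : V -> V.
Hypothesis b_neq0 : forall v, v != 0 -> b v != 0.
Hypothesis b_col : forall u v w, u != 0 -> v != 0 -> w != 0 ->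
  (b w <= b u + b v)%MS = (w <= u + v)%MS.

Local Notation e0 := (delta_mx 0 0 : V).
Local Notation e0' := (b e0).
Local Notation inH v := ((v : V) 0 0 = 0).

Let e0_neq0 : e0 != 0.
Proof. by apply/eqP => /rowP/(_ 0); rewrite !mxE eqxx /=; apply/eqP/oner_neq0. Qed.

Let b_pt u w : u != 0 -> w != 0 -> (b w <= b u)%MS = (w <= u)%MS.
Proof. by move=> u0 w0; have := b_col u0 u0 w0; rewrite !(addsmx_idPl (submx_refl _)). Qed.

Let e0v_neq0 v : inH v -> e0 + v != 0.
Proof.
by move=> hv; apply/eqP => /rowP/(_ 0); rewrite !mxE hv eqxx addr0 /=; apply/eqP/oner_neq0.
Qed.

Let e0_notin v : inH v -> (e0 <= v)%MS = false.
Proof.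
move=> hv; apply/negP=> /sub_rVP[k] /rowP/(_ 0); rewrite !mxE hv eqxx mulr0 /=.
by apply/eqP/oner_neq0.
Qed.

Let notin_e0 v : inH v -> v != 0 -> (v <= e0)%MS = false.
Proof. by move=> hv v0; apply/negP=> /(sub_rV_sym v0); rewrite e0_notin. Qed.

(** Picks the multiple [l] of [b v] for which e0' + l represents the image of the point e0 + v. The
    point alone is known up to a factor; this normalization on the hyperplane [inH] makes the choice
    additive. *)
Let PL v (l : V) := [/\ l != 0, (l <= b v)%MS & ((e0' + l)%R <= b (e0 + v)%R)%MS].

Let PL_exists v : inH v -> v != 0 -> exists l, PL v l.
Proof.
move=> hv v0; have s0 := e0v_neq0 hv.
have : (b (e0 + v)%R <= e0' + b v)%MS.
  by rewrite b_col // addmx_sub_adds // submx_refl.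
case/span2P=> al [be e].
have al0 : al != 0.
  apply/eqP=> z; have : ((e0 + v)%R <= v)%MS.
    by rewrite -b_pt // e z scale0r add0r scalemx_sub.
  move=> h; have := e0_notin hv; rewrite -[e0](addrK v) addmx_sub //.
  by rewrite -scaleN1r scalemx_sub.
have be0 : be != 0.
  apply/eqP=> z; have : ((e0 + v)%R <= e0)%MS.
    by rewrite -b_pt // e z scale0r addr0 scalemx_sub.
  move=> h; have := notin_e0 hv v0; rewrite -[v](addKr e0) addmx_sub //.
  by rewrite -scaleN1r scalemx_sub.
exists ((be / al) *: b v); split.
- by rewrite scaler_eq0 mulf_eq0 invr_eq0 (negPf al0) (negPf be0) (negPf (b_neq0 v0)).
- exact: scalemx_sub.
apply: (scalar_sub al0); rewrite scalerDr scalerA mulrCA divff // mulr1 -e //.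
Qed.

Let PL_uniq v l l' : inH v -> v != 0 -> PL v l -> PL v l' -> l = l'.
Proof.
move=> hv v0 [l0 lb le] [l0' lb' le'].
have s0 := e0v_neq0 hv; have nb : (e0' <= b v)%MS = false by rewrite b_pt ?e0_notin.
have [k hk] := sub_rVP le; have [k' hk'] := sub_rVP le'.
have k0' : k' != 0.
  apply/eqP=> z; move: nb; rewrite -[e0'](addrK l') hk' z scale0r add0r -scaleN1r.
  by rewrite scalemx_sub.
have e : k' *: (e0' + l) = k *: (e0' + l').
  by rewrite hk hk' !scalerA mulrC.
have : ((k' - k) *: e0' <= b v)%MS.
  have -> : (k' - k) *: e0' = k *: l' - k' *: l.
    move: e; rewrite !scalerDr scalerBl => e.
    apply/eqP; rewrite -subr_eq0; move/eqP: e; rewrite -subr_eq0 => /eqP <-.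
    by apply/eqP/rowP=> i; rewrite !mxE; ring.
  by rewrite addmx_sub // -?scaleNr scalemx_sub.
have [/eqP|kk /(scalar_sub kk)] := eqVneq (k' - k) 0; last by rewrite nb.
rewrite subr_eq0 => /eqP ek _; move: e; rewrite -ek => /(scalerI k0').
exact: addrI.
Qed.

Lemma ftpg_aux : exists L : V -> V, L 0 = 0 /\
  forall v, inH v -> v != 0 -> PL v (L v).
Proof.
have h v : exists l, (v == 0 -> l = 0) /\ (inH v -> v != 0 -> PL v l).
  have [->|v0] := eqVneq v 0; first by exists 0; split=> // _ /eqP.
  have [hv|nv] := eqVneq (v 0 0) 0; last by exists 0; split => // h; rewrite h eqxx in nv.
  by have [l hl] := PL_exists hv v0; exists l.
have [L hL] := fin_all_exists h; exists L; split; first by apply: (hL 0).1.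
by move=> v; apply: (hL v).2.
Qed.

Section WithL.
Variable L : V -> V.
Hypothesis L0 : L 0 = 0.
Hypothesis LP : forall v, inH v -> v != 0 -> PL v (L v).

Let Lb v : inH v -> v != 0 -> (b v <= L v)%MS.
Proof. by move=> hv v0; have [l0 lb _] := LP hv v0; apply: sub_rV_sym. Qed.

Let Le v : inH v -> v != 0 -> (b (e0 + v)%R <= (e0' + L v)%R)%MS.
Proof.
move=> hv v0; have [l0 lb le] := LP hv v0; apply: sub_rV_sym => //.
apply/eqP=> /eqP; rewrite addr_eq0 => /eqP z.
have := e0_notin hv; rewrite -b_pt // z -scaleN1r scalemx_sub //.
Qed.

Let nle_neq0 u v : (u <= v)%MS = false -> u != 0.
Proof. by move=> h; apply/eqP=> z; rewrite z sub0mx in h. Qed.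

Let indep v w : inH v -> inH w -> v != 0 -> (w <= v)%MS = false ->
  forall x y z : F, x *: e0' + y *: L v + z *: L w = 0 -> [/\ x = 0, y = 0 & z = 0].
Proof.
move=> hv hw v0 nw x y z e; have w0 := nle_neq0 nw.
have [lv0 lvb _] := LP hv v0; have [lw0 lwb _] := LP hw w0.
have z0 : z = 0.
  apply/eqP/negPn/negP=> z0.
  have : (w <= e0 + v)%MS.
    rewrite -b_col //; apply: submx_trans (Lb hw w0) _.
    apply: (scalar_sub z0); have -> : z *: L w = - (x *: e0' + y *: L v).
      by apply/eqP; rewrite -addr_eq0 addrC e.
    by rewrite -scaleN1r scalemx_sub // addmx_sub_adds // scalemx_sub.
  case/span2P=> al [be hwe]; move: nw; rewrite hwe.
  have := congr1 (fun r : V => r 0 0) hwe; rewrite /= !mxE hv hw eqxx mulr0 addr0 mulr1 => <-.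
  by rewrite scale0r add0r scalemx_sub.
move: e; rewrite z0 scale0r addr0 => e.
have y0 : y = 0.
  apply/eqP/negPn/negP=> y0; have := notin_e0 hv v0; rewrite -b_pt //.
  rewrite (submx_trans (Lb hv v0)) //; apply: (scalar_sub y0).
  have -> : y *: L v = (- x) *: e0' by apply/eqP; rewrite scaleNr -addr_eq0 addrC e.
  exact: scalemx_sub.
move: e; rewrite y0 scale0r addr0 => /eqP; rewrite scaler_eq0 (negPf (b_neq0 e0_neq0)) orbF.
by move/eqP.
Qed.

Let inHD u v : inH u -> inH v -> inH (u + v).
Proof. by move=> hu hv; rewrite mxE hu hv addr0. Qed.
Let inHZ a v : inH v -> inH (a *: v).
Proof. by move=> hv; rewrite mxE hv mulr0. Qed.

(** The point e0 + v + w lies on the line through e0 + v and w and on the line through e0 + w and v,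
    so its image is proportional to e0' + L v + L w; uniqueness in [PL] concludes. *)
Let L_add_indep v w : inH v -> inH w -> v != 0 -> (w <= v)%MS = false ->
  L (v + w) = L v + L w.
Proof.
move=> hv hw v0 nw; have w0 := nle_neq0 nw.
have vw0 : v + w != 0.
  apply/eqP=> /eqP; rewrite addrC addr_eq0 => /eqP z.
  by move: nw; rewrite z -scaleN1r scalemx_sub.
have hvw := inHD hv hw; have s0 := e0v_neq0 hvw.
have [lv0 lvb lve] := LP hv v0; have [lw0 lwb lwe] := LP hw w0.
apply/esym/(PL_uniq hvw vw0 _ (LP hvw vw0)).
have ind := indep hv hw v0 nw.
have : (b (e0 + (v + w))%R <= (e0' + L v)%R + L w)%MS.
  apply: submx_trans (addsmxS (Le hv v0) (Lb hw w0)).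
  by rewrite b_col ?e0v_neq0 // addrA addmx_sub_adds // submx_refl.
case/span2P=> x [y hxy].
have : (b (e0 + (v + w))%R <= (e0' + L w)%R + L v)%MS.
  apply: submx_trans (addsmxS (Le hw w0) (Lb hv v0)).
  by rewrite b_col ?e0v_neq0 // [v + w]addrC addrA addmx_sub_adds // submx_refl.
case/span2P=> x' [y' hxy'].
have [ex ey ez] : [/\ x - x' = 0, x - y' = 0 & y - x' = 0].
  apply: ind; rewrite !scalerBl; move: hxy'; rewrite hxy !scalerDr => /eqP.
  rewrite -subr_eq0 => /eqP <-; apply/rowP=> i; rewrite !mxE; ring.
have e1 : b (e0 + (v + w)) = x *: (e0' + (L v + L w)).
  rewrite hxy -(subrK x' y) ez add0r -(subrK x' x) ex add0r.
  by rewrite -scalerDr addrA.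
have x0 : x != 0.
  by apply/eqP=> z; have := b_neq0 s0; rewrite e1 z scale0r eqxx.
have : (b (v + w)%R <= L v + L w)%MS.
  apply: submx_trans (addsmxS (Lb hv v0) (Lb hw w0)).
  by rewrite b_col // addmx_sub_adds // submx_refl.
case/span2P=> c [d hcd].
have : (b (e0 + (v + w))%R <= e0' + b (v + w)%R)%MS.
  by rewrite b_col // addmx_sub_adds // submx_refl.
case/span2P=> f [g hfg].
have [ef eg eh] : [/\ x - f = 0, x - g * c = 0 & x - g * d = 0].
  apply: ind; move: hfg; rewrite e1 hcd => /eqP; rewrite -subr_eq0 => /eqP <-.
  apply/rowP=> i; rewrite !mxE; ring.
split.
- apply/eqP=> z; have [] := ind 0 1 1.
    by rewrite scale0r add0r !scale1r.
  by move=> _ /eqP; rewrite oner_eq0.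
- apply: (scalar_sub x0).
  have -> : x *: (L v + L w) = g *: b (v + w); last exact: scalemx_sub.
  rewrite hcd !scalerDr !scalerA; move/eqP: eg; rewrite subr_eq0 => /eqP {1}->.
  by move/eqP: eh; rewrite subr_eq0 => /eqP ->.
by apply: (scalar_sub x0); rewrite -e1.
Qed.

Let e1 : V := delta_mx 0 (inord 1).
Let e2 : V := delta_mx 0 (inord 2).
Let n1 : (0 == inord 1 :> 'I_m.+1) = false.
Proof. by apply/eqP=> /(congr1 val) /=; rewrite inordK // ltnS ltnW. Qed.
Let n2 : (0 == inord 2 :> 'I_m.+1) = false.
Proof. by apply/eqP=> /(congr1 val) /=; rewrite inordK. Qed.
Let n12 : (inord 2 == inord 1 :> 'I_m.+1) = false.
Proof. by apply/eqP=> /(congr1 val) /=; rewrite !inordK // ltnS ltnW. Qed.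

Let he1 : inH e1.
Proof. by rewrite mxE n1 andbF. Qed.
Let he2 : inH e2.
Proof. by rewrite mxE n2 andbF. Qed.
Let e1_neq0 : e1 != 0.
Proof. by apply/eqP=> /rowP/(_ (inord 1)); rewrite !mxE !eqxx; apply/eqP/oner_neq0. Qed.
(** The hyperplane has dimension m >= 2, so no line contains it. *)
Let other v : exists2 u, inH u & (u <= v)%MS = false.
Proof.
have [h1|h1] := boolP (e1 <= v)%MS; last by exists e1; last exact: negbTE.
exists e2; first exact: he2.
apply/negP=> h2; have := submx_trans h2 (sub_rV_sym e1_neq0 h1).
case/sub_rVP=> k /rowP/(_ (inord 2)); rewrite !mxE !eqxx n12 mulr0.
by apply/eqP/oner_neq0.
Qed.

Let indepC u v : u != 0 -> (v <= u)%MS = false -> (u <= v)%MS = false.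
Proof. by move=> u0 h; apply/negP=> /(sub_rV_sym u0); rewrite h. Qed.

Let L_opp v : inH v -> L (- v) = - L v.
Proof.
move=> hv; have [->|v0] := eqVneq v 0; first by rewrite oppr0 L0 oppr0.
have [u hu nu] := other v; have u0 := nle_neq0 nu.
have hNv : inH (- v) by rewrite -scaleN1r; apply: inHZ.
have e1' : L u = L v + L (u - v).
  rewrite -L_add_indep //; first by rewrite addrC subrK.
    exact: inHD.
  apply/negP=> h; move: nu; rewrite -[u](subrK v) addmx_sub //.
have e2' : L (u - v) = L u + L (- v).
  rewrite L_add_indep //; apply/negP=> h; have := indepC v0 nu.
  by rewrite -[v]opprK -scaleN1r scalemx_sub.
apply/eqP; rewrite -addr_eq0 addrC; apply/eqP.
by apply: (addrI (L u)); rewrite addr0 addrCA addrC {2}e1' e2'; rewrite addrA addrC addrA.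
Qed.

(** For dependent v and w, a third vector u off their line reduces the claim to independent pairs,
    by associativity of v + w + u. *)
Let L_add v w : inH v -> inH w -> L (v + w) = L v + L w.
Proof.
move=> hv hw; have [->|v0] := eqVneq v 0; first by rewrite L0 !add0r.
have [->|w0] := eqVneq w 0; first by rewrite L0 !addr0.
have [/sub_rVP[c hc]|] := boolP (w <= v)%MS; last by move/negbTE; apply: L_add_indep.
have [z|vw0] := eqVneq (v + w) 0.
  have -> : w = - v by apply/eqP; rewrite -addr_eq0 addrC z.
  by rewrite subrr L0 L_opp // subrr.
have [u hu nu] := other v; have u0 := nle_neq0 nu.
have d1 : L (v + w + u) = L (v + w) + L u.
  apply: L_add_indep => //; first exact: inHD.
  apply/negP=> h; move: nu; rewrite (submx_trans h) // hc -{1}[v]scale1r -scalerDl.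
  exact: scalemx_sub.
have d2 : L (v + (w + u)) = L v + L (w + u).
  apply: L_add_indep => //; first exact: inHD.
  apply/negP=> h; move: nu; rewrite -[u](addKr w) addmx_sub //.
  by rewrite hc -scaleN1r !scalemx_sub.
have d3 : L (w + u) = L w + L u.
  apply: L_add_indep => //.
  by apply/negP=> h; move: nu; rewrite (submx_trans h) // hc scalemx_sub.
by apply: (addIr (L u)); rewrite -d1 -addrA d2 d3 addrA.
Qed.

Let L_line c v : inH v -> exists k, L (c *: v) = k *: L v.
Proof.
move=> hv; have [->|v0] := eqVneq v 0; first by exists 0; rewrite scaler0 L0 scaler0.
have [->|c0] := eqVneq c 0; first by exists 0; rewrite !scale0r L0.
have cv0 : c *: v != 0 by rewrite scaler_eq0 negb_or c0.
have [_ lb _] := LP (inHZ c hv) cv0.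
apply/sub_rVP; rewrite (submx_trans lb) // (submx_trans _ (Lb hv v0)) //.
by rewrite b_pt // scalemx_sub.
Qed.

(** L (c u) + L (c v) = L (c (u + v)) is a multiple of L u + L v, and L u, L v are independent, so
    both scale by the same factor. *)
Let L_scale_indep c k u v : inH u -> inH v -> u != 0 -> (v <= u)%MS = false ->
  L (c *: u) = k *: L u -> L (c *: v) = k *: L v.
Proof.
move=> hu hv u0 nv e; have v0 := nle_neq0 nv.
have [k1 h1] := L_line c hv; have [k2 h2] := L_line c (inHD hu hv).
have [] := indep hu hv u0 nv (x := 0) (y := k2 - k) (z := k2 - k1).
  rewrite scale0r add0r !scalerBl -e -h1.
  rewrite L_add // scalerDr L_add ?(inHZ c) // scalerDr in h2.
  move/eqP: h2; rewrite -subr_eq0 => /eqP h2; rewrite -[RHS]oppr0 -h2.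
  by apply/rowP=> i; rewrite !mxE; ring.
move=> _ /eqP; rewrite subr_eq0 => /eqP <- /eqP; rewrite subr_eq0 => /eqP ->.
exact: h1.
Qed.

Lemma ftpg_scale : exists s : F -> F, forall c v, inH v -> L (c *: v) = s c *: L v.
Proof.
have h c : exists k, L (c *: e1) = k *: L e1 by apply: L_line.
have [s hs] := fin_all_exists h; exists s => c v hv.
have [->|v0] := eqVneq v 0; first by rewrite scaler0 L0 scaler0.
have [hle|/negbTE nle] := boolP (v <= e1)%MS; last exact: L_scale_indep nle _.
have [u hu nu] := other e1; have u0 := nle_neq0 nu.
apply: (L_scale_indep (u := u)) => //; last exact: L_scale_indep nu _.
apply: indepC => //; apply/negP=> h'; move: nu; rewrite (submx_trans h') //.
Qed.

Lemma ftpg_L : exists (s : {rmorphism F -> F}) (M : 'M[F]_m.+1),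
  forall v, v != 0 -> (b v <= map_mx s v *m M)%MS.
Proof.
have [s hs] := ftpg_scale.
have [l10 _ _] := LP he1 e1_neq0.
have inj (x y : F) : x *: L e1 = y *: L e1 -> x = y.
  move/eqP; rewrite -subr_eq0 -scalerBl scaler_eq0 (negPf l10) orbF subr_eq0.
  by move/eqP.
have sB : zmod_morphism s.
  move=> x y; apply: inj; rewrite scalerBl -!hs // scalerBl L_add ?L_opp //;
  try by apply: inHZ.
  by rewrite -scaleN1r; do 2!apply: inHZ.
have sM : monoid_morphism s.
  split=> [|x y]; apply: inj; first by rewrite -hs // !scale1r.
  by rewrite -scalerA -!hs // ?scalerA //; apply: inHZ.
pose S : {rmorphism F -> F} := HB.pack s (GRing.isZmodMorphism.Build F F s sB)
  (GRing.isMonoidMorphism.Build F F s sM).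
pose M : 'M[F]_m.+1 := \matrix_i (if i == 0 then e0' else L (delta_mx 0 i)).
have LM v : inH v -> L v = map_mx S v *m M.
  move=> hv; rewrite {1}(row_sum_delta v) mulmx_sum_row.
  have hd i : inH (v 0 i *: delta_mx 0 i).
    by rewrite !mxE; case: (eqVneq 0 i) => [<-|]; rewrite ?hv ?mul0r ?andbF ?mulr0.
  have : L (\sum_i v 0 i *: delta_mx 0 i) = \sum_i L (v 0 i *: delta_mx 0 i) /\
         inH (\sum_i v 0 i *: delta_mx 0 i).
    elim/big_rec2: _ => [|i y x _ [ih1 ih2]]; first by rewrite mxE.
    by rewrite L_add // ih1; split=> //; apply: inHD.
  case=> -> _; apply: eq_bigr => i _; rewrite rowK mxE.
  case: (eqVneq i 0) => [->|i0]; first by rewrite hv rmorph0 !scale0r L0.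
  by rewrite hs // mxE eq_sym (negPf i0) andbF.
exists S, M => v v0.
have eM : e0' = map_mx S e0 *m M.
  by rewrite map_delta_mx -rowE rowK eqxx.
(* Outside the hyperplane, the point of v is represented by some e0 + v' with v' in the hyperplane,
   where the normalization of [L] gives the image. *)
have [hv|nv] := eqVneq (v 0 0) 0; first by rewrite -LM // Lb.
set a := v 0 0 in nv; pose v' := a^-1 *: v - e0.
have hv' : inH v' by rewrite !mxE eqxx mulVf // subrr.
have ev : v = a *: (e0 + v') by rewrite /v' addrC subrK scalerA mulfV ?scale1r.
have s0 := e0v_neq0 hv'.
have : (b v <= b (e0 + v')%R)%MS by rewrite b_pt // {1}ev scalemx_sub.
move/submx_trans; apply; rewrite ev map_mxZ -scalemxAl.
have -> : map_mx S (e0 + v') *m M = e0' + L v' by rewrite map_mxD mulmxDl -(LM v' hv') -eM.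
have h : (b (e0 + v')%R <= (e0' + L v')%R)%MS.
  have [z|v'0] := eqVneq v' 0; last exact: Le.
  by rewrite z L0 !addr0.
apply: submx_trans h _; apply: (scalar_sub (a := S a)) => //.
by rewrite fmorph_eq0.
Qed.

End WithL.

Lemma ftpg : exists (s : {rmorphism F -> F}) (M : 'M[F]_m.+1),
  M \in unitmx /\ forall v, v != 0 -> (b v <= map_mx s v *m M)%MS.
Proof.
have [L [L0 LP]] := ftpg_aux; have [s [M hM]] := ftpg_L L0 LP.
exists s, M; split=> //; rewrite -row_free_unit -kermx_eq0.
have [t st ts] : bijective s by apply: injF_bij; apply: fmorph_inj.
apply/rowV0P=> v /sub_kermxP vM; apply/eqP/negPn/negP=> v0.
have e : v = map_mx s (map_mx t v) by apply/rowP=> i; rewrite !mxE ts.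
have t0 : map_mx t v != 0 by apply: contra v0 => /eqP z; rewrite e z map_mx0.
have := hM _ t0; have -> : map_mx s (map_mx t v) *m M = 0 by rewrite -e.
move=> h; have z : b (map_mx t v) = 0 by have /sub_rVP[k ->] := h; rewrite scaler0.
by have := b_neq0 t0; rewrite z eqxx.
Qed.

End FTPG.

(** * Automorphisms of PSp *)

Lemma normal_coset_eq (rT : finGroupType) (G H : {group rT}) (x y : rT) :
  H <| G -> x \in G -> y \in G -> coset H x = coset H y ->
  exists2 z, z \in H & x = (y * z)%g.
Proof.
move=> nHG xG yG e; have nx := subsetP (normal_norm nHG) _ xG.
have ny := subsetP (normal_norm nHG) _ yG.
exists (y^-1 * x)%g; last by rewrite mulKVg.
by apply: coset_idr; rewrite ?groupM ?groupV // morphM ?groupV //= e -morphM ?groupV // mulVg morph1.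
Qed.

Section AutPSp.
Variables (F : finFieldType) (n : nat).
Hypothesis n_gt1 : (1 < n)%N.
Hypothesis char2 : (2%:R : F) != 0.
Variable p : nat.
Hypothesis pF : p \in [pchar F].
Local Notation N := (dimV n).
Local Notation J := (symp_mx F n).
Local Notation B := (@symp_form F n).
Local Notation gT := {'GL_(2 * n)[F]}.
Local Notation Sp := (Sp n F).
Local Notation Z := 'Z(Sp).
Local Notation PSp := (PSp n F).
Let n_gt0 : (0 < n)%N := ltnW n_gt1.
Implicit Types (u v w : 'rV[F]_N) (x y : gT).

Lemma Sp_normZ x : x \in Sp -> x \in 'N(Z).
Proof. by move=> xS; apply: (subsetP (normal_norm (center_normal Sp))). Qed.

Lemma mem_PSp x : x \in Sp -> coset Z x \in PSp.
Proof. by move=> xS; rewrite mem_quotient. Qed.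

Lemma PSpP z : z \in PSp -> exists2 x, x \in Sp & z = coset Z x.
Proof. by case/morphimP=> x _ xS ->; exists x. Qed.

Lemma cosetM x y : x \in Sp -> y \in Sp -> coset Z (x * y)%g = (coset Z x * coset Z y)%g.
Proof. by move=> xS yS; rewrite morphM ?Sp_normZ. Qed.

Lemma cosetJ x y : x \in Sp -> y \in Sp -> coset Z (x ^ y)%g = (coset Z x ^ coset Z y)%g.
Proof. by move=> xS yS; rewrite morphJ ?Sp_normZ. Qed.

Lemma coset_eqP x y : x \in Sp -> y \in Sp -> coset Z x = coset Z y ->
  x = y \/ x = (y * m1 F n)%g.
Proof.
move=> xS yS /(normal_coset_eq (center_normal Sp) xS yS)[z /(center_SpP n_gt0 char2)[] -> ->].
  by left; apply: mulg1.
by right.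
Qed.

Lemma coset_m1 : coset Z (m1 F n) = 1%g.
Proof. by apply: coset_id; apply/(center_SpP n_gt0 char2); right. Qed.

Lemma odd_p : odd p.
Proof.
have pp := pcharf_prime pF; case: (even_prime pp) => // e.
by have := pcharf0 pF; rewrite e => /eqP; rewrite (negPf char2).
Qed.

(** Two lifts of an element of PSp differ by a sign, and (- y)^p = - 1 when y^p = 1 and p is odd. *)
Lemma coset_pelt_inj x y : x \in Sp -> y \in Sp -> (x ^+ p = 1)%g -> (y ^+ p = 1)%g ->
  coset Z x = coset Z y -> x = y.
Proof.
move=> xS yS xp yp /(coset_eqP xS yS)[] // e; have := xp.
have cm : commute y (m1 F n).
  by apply: GLval_inj; rewrite !GLvalM GLval_m1 // mulNmx mulmxN mul1mx mulmx1.
rewrite e expgMn // yp mul1g => /(congr1 GLval); rewrite GLvalX GLval_m1 // GLval1.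
rewrite -[1%:M]/(1 : 'M_N) -signr_odd odd_p expr1 => /matrixP/(_ 0 0).
rewrite !mxE eqxx => /eqP; rewrite eq_sym -subr_eq0 opprK -mulr2n -mulr_natr mul1r.
by rewrite (negPf char2).
Qed.

Lemma tg_exp v a : (tg v a ^+ p = 1)%g.
Proof.
apply: (unip_expp char2 pF (v := v)); apply: (subsetP (root_sub_unip n_gt0 char2 v)).
by apply/root_subgroupP; exists a.
Qed.

(** For nonzero [v] this subgroup of PSp depends only on the line of [v] and determines it
    ([line_rb], [rb_line]), so it stands for a point of the projective space. *)
Definition rb v : {set coset_of Z} := (root_subgroup n_gt0 char2 v / Z)%g.

Lemma rbP v z : reflect (exists a, z = coset Z (tg v a)) (z \in rb v).
Proof.
apply: (iffP morphimP) => [[x _ /root_subgroupP[a ->] ->]|[a ->]]; first by exists a.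
exists (tg v a) => //; first by rewrite Sp_normZ // tg_Sp.
by apply/root_subgroupP; exists a.
Qed.

Lemma rbJ v y : y \in Sp -> (rb v :^ coset Z y)%g = rb (v *m GLval y).
Proof. by move=> yS; rewrite /rb -rootJ // quotientJ // Sp_normZ. Qed.

Lemma rb_line u v : u != 0 -> rb u = rb v -> (v <= u)%MS.
Proof.
move=> u0 e; have : coset Z (tg u 1) \in rb v by rewrite -e; apply/rbP; exists 1.
case/rbP=> a /(coset_pelt_inj (tg_Sp n_gt0 char2 _ _) (tg_Sp n_gt0 char2 _ _)
  (tg_exp _ _) (tg_exp _ _)) h.
have [->|v0] := eqVneq v 0; first exact: sub0mx.
have [w hw] := form_exists n_gt0 u0.
have := congr1 (fun x : gT => w *m GLval x) h; rewrite !GLval_tg // !mul_tv hw.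
move=> /addrI; rewrite mulr1 scale1r => e'.
by apply: sub_rV_sym => //; rewrite e' scalemx_sub.
Qed.

Lemma line_rb u v : u != 0 -> (u <= v)%MS -> rb u = rb v.
Proof.
move=> u0 /sub_rVP[k e]; have k0 : k != 0.
  by apply: contra u0 => /eqP z; rewrite e z scale0r.
apply/setP=> z; apply/rbP/rbP => -[a ->].
  by exists (k ^+ 2 * a); rewrite e /tg tvZ.
exists (k ^- 2 * a); rewrite e /tg tvZ // mulrA mulfV ?mul1r //.
by rewrite expf_neq0.
Qed.

(** Orthogonality of points becomes commutation of root subgroups, which automorphisms of PSp
    preserve. If the transvections commute, u and u + B(u, v) v lie on one line, whence B u v =
    0. *)
Lemma rb_commute u v : u != 0 -> v != 0 -> (rb u \subset 'C(rb v)) = (B u v == 0).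
Proof.
move=> u0 v0; apply/idP/eqP => [h|uv].
  have /centP/(_ (coset Z (tg v 1)))h1 : coset Z (tg u 1) \in 'C(rb v).
    by apply: (subsetP h); apply/rbP; exists 1.
  have {h1} : commute (coset Z (tg u 1)) (coset Z (tg v 1)).
    by apply: h1; apply/rbP; exists 1.
  move/commgP/conjg_fixP; rewrite -cosetJ ?tg_Sp // tg_conj ?tg_Sp //.
  move/(coset_pelt_inj (tg_Sp n_gt0 char2 _ _) (tg_Sp n_gt0 char2 _ _)
    (tg_exp _ _) (tg_exp _ _)) => /(congr1 GLval); rewrite !GLval_tg // => e.
  have ut0 : u *m tv v 1 != 0.
    apply: contra u0 => /eqP z; rewrite -[u](mulmxK (symplectic_unit n_gt0 (tv_symplectic char2 v 1))).
    by rewrite z mul0mx.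
  have [k hk] := tv_line n_gt0 u0 ut0 (oner_neq0 F) (esym e).
  move: hk; rewrite mul_tv mul1r => hk.
  have := congr1 (fun r => B r v) hk; rewrite /= formDl !formZl formxx // mulr0 addr0.
  have [//|b0] := eqVneq (B u v) 0; rewrite -{1}[B u v]mul1r => /(mulIf b0) k1.
  move: hk; rewrite -k1 scale1r -[X in _ = X]addr0 => /addrI /eqP.
  by rewrite scaler_eq0 (negPf v0) orbF => /eqP.
apply/subsetP=> _ /rbP[a ->]; apply/centP=> _ /rbP[c ->].
apply/commgP/conjg_fixP; rewrite -cosetJ ?tg_Sp // tg_conj ?tg_Sp //.
by rewrite GLval_tg // mul_tv uv mulr0 scale0r addr0.
Qed.

Lemma sylow_center_bar : exists (P : {group coset_of Z}) v,
  [/\ p.-Sylow(PSp) P, v != 0 & 'Z(P) = rb v].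
Proof.
have [P [v [sylP v0 cP]]] := sylow_center n_gt0 char2 pF.
have sP := pHall_sub sylP; have pP := pHall_pgroup sylP.
have nP : P \subset 'N(Z) := subset_trans sP (normal_norm (center_normal Sp)).
exists (P / Z)%G, v; split=> //; first exact: quotient_pHall.
(* P is a p-group with p odd and the center has order 2, so P maps isomorphically into PSp. *)
have tiPZ : Z :&: P = 1%g.
  apply: coprime_TIg; rewrite card_center_Sp //.
  rewrite coprime_sym (pnat_coprime pP) // p'natE ?(pcharf_prime pF) //.
  rewrite dvdn_prime2 ?(pcharf_prime pF) //.
  by apply: contraL odd_p => /eqP ->.
have [f [injf _ fE]] : exists f : {morphism P >-> coset_of Z},
   [/\ 'injm f, f @* P = (P / Z)%g & forall A : {set gT}, A \subset P -> f @* A = (A / Z)%g].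
  exists (restrm nP (coset Z)); split.
  - by rewrite ker_restrm ker_coset setIC tiPZ.
  - by rewrite restrm_quotientE.
  - by move=> A sA; rewrite restrm_quotientE.
by rewrite /= -fE // -injm_center // fE ?center_sub // cP.
Qed.

(** Sylow subgroups are conjugate, so the automorphism sends the center of one of them to a
    conjugate. Every root subgroup is conjugate to such a center, Sp being transitive on nonzero
    vectors. *)
Lemma aut_rb a : a \in Aut PSp -> forall v, v != 0 ->
  exists2 v', v' != 0 & a @: rb v = rb v'.
Proof.
move=> aA; have [P [v0 [sylP v00 cP]]] := sylow_center_bar.
have sP := pHall_sub sylP.
have sim (A : {set coset_of Z}) : A \subset PSp -> autm aA @* A = a @: A.
  by move=> sA; rewrite morphimEsub //; apply: eq_imset => x; rewrite autmE.
have imPSp : autm aA @* PSp = PSp by apply: im_autm.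
have sylP' : p.-Sylow(PSp) (autm aA @* P)%G.
  by rewrite -{1}imPSp morphim_pHall.
have [x xS e] := Sylow_trans sylP sylP'.
have srb v : rb v \subset PSp by rewrite quotientS // root_sub.
have e0 : a @: rb v0 = (rb v0 :^ x)%g.
  rewrite -sim // -cP injm_center // ?injm_autm //.
  by rewrite (e : _ @* _ = _) /center conjIg centJ.
have [y yS xE] := PSpP xS.
move=> v vn0; have [z zS ez] := Sp_trans n_gt0 char2 v00 vn0.
have azS : a (coset Z z) \in PSp.
  exact: (Aut_closed aA (mem_PSp zS)).
have [t tS aE] := PSpP azS.
exists (v0 *m GLval y *m GLval t).
  apply: contra v00 => /eqP h; apply/eqP.
  by rewrite -[v0](mulmxK (GLval_unitmx y)) -[_ *m GLval y](mulmxK (GLval_unitmx t)) h !mul0mx.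
rewrite -ez -(rbJ v0 zS) -sim; last by rewrite rbJ // srb.
rewrite morphimJ ?mem_PSp // sim // e0.
have -> : autm_morphism aA (coset Z z) = coset Z t by rewrite -aE.
by rewrite xE -!rbJ.
Qed.

(** The span of two vectors is its own double orthogonal. This turns preservation of orthogonality
    into preservation of collinearity. *)
Lemma span_perp (u v w : 'rV[F]_N) :
  (w <= u + v)%MS <-> (forall y : 'rV[F]_N, B u y = 0 -> B v y = 0 -> B w y = 0).
Proof.
split=> [/span2P[a [b ->]] y uy vy|h].
  by rewrite formDl !formZl uy vy !mulr0 addr0.
rewrite addsmxE submxE; apply/eqP/rowP=> i; rewrite [RHS]mxE.
set C := cokermx _; have jK : (J *m invmx J) = 1%:M by rewrite mulmxV ?symp_mx_unit.
pose y : 'rV[F]_N := (invmx J *m col i C)^T.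
have By (x : 'rV[F]_N) : B x y = (x *m C) 0 i.
  rewrite /symp_form /y trmxK -!mulmxA (mulmxA J) jK mul1mx.
  by rewrite !mxE; apply: eq_bigr => k _; rewrite mxE.
have cC (x : 'rV[F]_N) : (x <= col_mx u v)%MS -> B x y = 0.
  by rewrite By submxE => /eqP ->; rewrite mxE.
rewrite -By; apply: h; apply: cC; rewrite -addsmxE; [exact: addsmxSl|exact: addsmxSr].
Qed.

Section OneAut.
Variable a : {perm coset_of Z}.
Hypothesis aA : a \in Aut PSp.

Lemma aut_perp u v u' v' : u != 0 -> v != 0 -> u' != 0 -> v' != 0 ->
  a @: rb u = rb u' -> a @: rb v = rb v' -> B u v = 0 -> B u' v' = 0.
Proof.
move=> u0 v0 u0' v0' eu ev uv; apply/eqP; rewrite -rb_commute // -eu -ev.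
have srb w : rb w \subset PSp by rewrite quotientS // root_sub.
have sim (A : {set coset_of Z}) : A \subset PSp -> autm aA @* A = a @: A.
  by move=> sA; rewrite morphimEsub //; apply: eq_imset => x; rewrite autmE.
by rewrite -!sim // morphim_cents // rb_commute // uv.
Qed.
End OneAut.

Lemma aut_semilinear a : a \in Aut PSp ->
  exists (s : {rmorphism F -> F}) (M : 'M[F]_N),
    M \in unitmx /\ forall v, v != 0 -> a @: rb v = rb (map_mx s v *m M).
Proof.
move=> aA; have aVA : a^-1%g \in Aut PSp by rewrite groupV.
have h v : exists v', v != 0 -> v' != 0 /\ a @: rb v = rb v'.
  have [->|v0] := eqVneq v 0; first by exists 0.
  by have [v' h1 h2] := aut_rb aA v0; exists v'.
have [b hb] := fin_all_exists h.
have b0 v : v != 0 -> b v != 0 by move=> /hb[].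
have bE v : v != 0 -> a @: rb v = rb (b v) by move=> /hb[].
have bV v : v != 0 -> (a^-1)%g @: rb (b v) = rb v.
  move=> v0; rewrite -bE // -imset_comp -[RHS]imset_id; apply: eq_imset => x /=.
  by rewrite permK.
have bperp u v : u != 0 -> v != 0 -> B u v = 0 <-> B (b u) (b v) = 0.
  move=> u0 v0; split=> e.
    by apply: (aut_perp aA u0 v0) e; rewrite ?b0 ?bE.
  by apply: (aut_perp aVA (b0 _ u0) (b0 _ v0)) e; rewrite ?bV.
have bsurj w : w != 0 -> exists2 v, v != 0 & (w <= b v)%MS.
  move=> w0; have [v v0 e] := aut_rb aVA w0; exists v => //.
  apply: rb_line; first exact: b0.
  rewrite -bE // -e -imset_comp -[RHS]imset_id; apply: eq_imset => x /=.
  by rewrite permKV.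
have bcol u v w : u != 0 -> v != 0 -> w != 0 ->
    (b w <= b u + b v)%MS = (w <= u + v)%MS.
  move=> u0 v0 w0; apply/idP/idP => /span_perp h'; apply/span_perp=> y uy vy.
    have [->|y0] := eqVneq y 0; first exact: form0r.
    by apply: (bperp w y w0 y0).2; apply: h'; [apply: (bperp u y u0 y0).1|apply: (bperp v y v0 y0).1].
  have [->|y0] := eqVneq y 0; first exact: form0r.
  have [z z0 /sub_rVP[k e]] := bsurj y y0.
  have k0 : k != 0 by apply: contra y0 => /eqP zz; rewrite e zz scale0r.
  move: uy vy; rewrite e !formZr => /eqP; rewrite mulf_eq0 (negPf k0) => /eqP uz.
  move=> /eqP; rewrite mulf_eq0 (negPf k0) => /eqP vz.
  have -> : B (b w) (b z) = 0.
    by apply: (bperp w z w0 z0).1; apply: h'; [apply: (bperp u z u0 z0).2|apply: (bperp v z v0 z0).2].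
  by rewrite mulr0.
have m1N : (1 < (2 * n).-1)%N by lia.
have [s [M [uM hM]]] := ftpg m1N b0 bcol.
exists s, M; split=> // v v0; rewrite bE //; apply: line_rb; [exact: b0 | exact: hM].
Qed.

Lemma map_symp_mx (s : {rmorphism F -> F}) : map_mx s J = J.
Proof.
by apply/matrixP=> i j; rewrite !mxE rmorphB !rmorph_nat.
Qed.

Lemma form_map (s : {rmorphism F -> F}) u v :
  B (map_mx s u) (map_mx s v) = s (B u v).
Proof.
by rewrite /symp_form -{1}(map_symp_mx s) map_trmx -!map_mxM mxE.
Qed.

Lemma rmorph_fin_bij (s : {rmorphism F -> F}) : bijective s.
Proof. by apply: injF_bij; apply: fmorph_inj. Qed.

Lemma map_row_surj (s : {rmorphism F -> F}) (v : 'rV[F]_N) :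
  exists u, v = map_mx s u.
Proof.
have [t st ts] := rmorph_fin_bij s.
by exists (map_mx t v); apply/rowP=> i; rewrite !mxE ts.
Qed.

(** The matrix M from the projective theorem preserves orthogonality, so M J M^T J^-1 stabilizes
    every line and is a scalar. On elements, a lift y of the image of x and the conjugate X of x by
    u |-> s(u) M move all root subgroups alike, so they agree up to sign. *)
Theorem aut_PSp a : a \in Aut PSp ->
  exists (s : {rmorphism F -> F}) (M : 'M[F]_N) (c : F),
    [/\ M \in unitmx, c != 0, M *m J *m M^T = c *: J &
      forall x, x \in Sp ->
        toGL (invmx M *m map_mx s (GLval x) *m M) \in Sp /\
        a (coset Z x) = coset Z (toGL (invmx M *m map_mx s (GLval x) *m M))].
Proof.
move=> aA; have [s [M [uM hM]]] := aut_semilinear aA.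
have perp u v : u *m J *m v^T = 0 -> (u *m (M *m J *m M^T) *m v^T = 0).
  move=> uv.
  have [->|u0] := eqVneq u 0; first by rewrite !mul0mx.
  have [->|v0] := eqVneq v 0; first by rewrite trmx0 mulmx0.
  have [u1 e1] := map_row_surj s u; have [v1 e2] := map_row_surj s v.
  have u10 : u1 != 0 by apply: contra u0 => /eqP z; rewrite e1 z map_mx0.
  have v10 : v1 != 0 by apply: contra v0 => /eqP z; rewrite e2 z map_mx0.
  have iM w : w != 0 -> w *m M != 0.
    by apply: contra => /eqP z; rewrite -[w](mulmxK uM) z mul0mx.
  have := aut_perp aA u10 v10 _ _ (hM _ u10) (hM _ v10).
  rewrite -e1 -e2 => /(_ (iM _ u0) (iM _ v0)) h.
  have: u *m M *m J *m (v *m M)^T = 0.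
    rewrite formE h ?raddf0 //; move: uv; rewrite formE e1 e2 form_map.
    by move/matrixP/(_ 0 0); rewrite !mxE eqxx mulr1n => /eqP; rewrite fmorph_eq0 => /eqP.
  by rewrite trmx_mul !mulmxA.
have [c hc] : exists c : F, M *m J *m M^T *m invmx J = c%:M.
  apply: scalar_of_lines => u.
  (* the two forms have the same perp of u *)
  have [->|u0] := eqVneq u 0; first by rewrite mul0mx sub0mx.
  set w := u *m _; rewrite -(addsmx_idPl (submx_refl u)); apply/span_perp => y uy _.
  have := perp u y; rewrite formE uy raddf0 => /(_ erefl) h.
  have : w *m J *m y^T = 0.
    by rewrite /w !mulmxA mulmxKV ?symp_mx_unit // -!mulmxA !mulmxA in h *.
  rewrite formE => /matrixP/(_ 0 0); by rewrite !mxE eqxx mulr1n.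
have eM : M *m J *m M^T = c *: J.
  by rewrite -mul_scalar_mx -hc mulmxKV ?symp_mx_unit.
have c0 : c != 0.
  apply/eqP=> z; have : M *m J *m M^T \in unitmx.
    by rewrite !unitmx_mul uM symp_mx_unit // unitmx_tr.
  by rewrite eM z scale0r unitr0.
exists s, M, c; split=> // x xS.
set X := invmx M *m _ *m M.
have sX : is_symplectic X.
  have sx : map_mx s (GLval x) *m J *m (map_mx s (GLval x))^T = J.
    move: xS; rewrite SpE => /eqP /(congr1 (map_mx s)).
    by rewrite !map_mxM map_trmx !map_symp_mx.
  have eV : invmx M *m J *m (invmx M)^T = c^-1 *: J.
    apply: (scalerI c0); rewrite scalerA mulfV // scale1r scalemxAl scalemxAr -eM.
    by rewrite !mulmxA mulVmx // mul1mx -mulmxA trmx_inv -?trmx_mul mulmxV ?unitmx_tr // mulmx1.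
  apply/eqP; rewrite /X !trmx_mul !mulmxA.
  rewrite -(mulmxA _ M J) -(mulmxA _ (M *m J)) eM -scalemxAr -!scalemxAl.
  rewrite -(mulmxA _ _ J) -(mulmxA _ (_ *m J)) sx eV scalerA mulfV ?scale1r //.
have SX : toGL X \in Sp by apply: toGL_Sp.
split=> //.
have axS : a (coset Z x) \in PSp.
  exact: (Aut_closed aA (mem_PSp xS)).
have [y yS aE] := PSpP axS; rewrite aE.
have srb w : rb w \subset PSp by rewrite quotientS // root_sub.
have sim (A : {set coset_of Z}) : A \subset PSp -> autm aA @* A = a @: A.
  by move=> sA; rewrite morphimEsub //; apply: eq_imset => t; rewrite autmE.
have iX (w : 'rV[F]_N) (A : 'M[F]_N) : A \in unitmx -> w != 0 -> w *m A != 0.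
  by move=> uA; apply: contra => /eqP z; rewrite -[w](mulmxK uA) z mul0mx.
have line v : v != 0 ->
    (map_mx s v *m M *m GLval y <= map_mx s v *m map_mx s (GLval x) *m M)%MS.
  move=> v0; rewrite -map_mxM.
  have vx0 := iX _ _ (GLval_unitmx x) v0.
  apply: rb_line.
    by apply: iX => //; rewrite map_mx_eq0.
  rewrite -hM // -rbJ // -(rbJ _ yS) -hM // -sim; last by rewrite rbJ // srb.
  rewrite morphimJ ?mem_PSp // sim //.
  by have -> : autm_morphism aA (coset Z x) = coset Z y by rewrite -aE.
have sy : y \in Sp := yS.
have : (y * (toGL X)^-1)%g = 1%g \/ (y * (toGL X)^-1)%g = m1 F n.
  apply: symp_lines => //; first by rewrite groupM // groupV.
  move=> u; have [->|u0] := eqVneq u 0; first by rewrite mul0mx sub0mx.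
  have [v ev] := map_row_surj s (u *m invmx M).
  have v0 : v != 0.
    apply: contra u0 => /eqP z; move: ev; rewrite z map_mx0 => h.
    by apply/eqP; rewrite -[u](mulmxKV uM) h mul0mx.
  have := line v v0; rewrite -ev mulmxKV // GLvalM GLvalV toGLK ?symplectic_unit //.
  have uX : X \in unitmx by apply: symplectic_unit.
  move/(submxMr (invmx X)); rewrite -[X in (_ <= X)%MS]mulmxA mulmxA.
  have -> : u *m invmx M *m map_mx s (GLval x) *m M *m invmx X = u.
    have -> : u *m invmx M *m map_mx s (GLval x) *m M = u *m X by rewrite /X !mulmxA.
    exact: mulmxK.
  by rewrite mulmxA.
case=> e.
  by rewrite -[y](mulgKV (toGL X)) e mul1g.
by rewrite -[y](mulgKV (toGL X)) e cosetM ?m1_Sp // coset_m1 mul1g.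
Qed.

End AutPSp.

(** * Weil representations *)

Lemma repr_eigenspaces (K : closedFieldType) (gT : finGroupType) (G : {group gT}) m
    (rG : mx_representation K G m) x : x \in G -> (#[x]%g%:R : K) != 0 ->
  exists2 rs, uniq rs & (\sum_(r <- rs) eigenspace (rG x) r :=: 1%:M)%MS.
Proof.
case: m rG => [|m] rG xG rx0.
  by exists [::] => //; rewrite big_nil; apply/eqmxP; rewrite !thinmx0 submx_refl.
apply/diagonalizablePeigen/diagonalizableP.
have [rs e] := closed_field_poly_normal ('X^#[x]%g - 1 : {poly K}).
move: e; rewrite (monicP (monic_Xn_sub_1 _ (order_gt0 x))) scale1r => e; exists rs.
  by rewrite -separable_prod_XsubC -e separable_Xn_sub_1.
rewrite -e; apply: mxminpoly_min.
rewrite rmorphB rmorphXn rmorph1 /= horner_mx_X.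
have -> : rG x ^+ #[x]%g = rG (x ^+ #[x])%g by rewrite repr_mxX.
by rewrite expg_order repr_mx1 subrr.
Qed.

Section Weil.
Variables (C : closedFieldType) (F : finFieldType) (n : nat).
Hypothesis charC : [pchar C] =i pred0.
Hypothesis n_gt0 : (0 < n)%N.
Hypothesis char2 : (2%:R : F) != 0.
Local Notation N := (dimV n).
Local Notation B := (@symp_form F n).
Local Notation V := 'rV[F]_N.
Local Notation D := (#|F| ^ n)%N.
Local Notation H := (heisenberg n F).
Local Notation gT := {'GL_(2 * n)[F]}.
Local Notation Sp := (Sp n F).
Implicit Types (u v : V) (x y : gT).

Lemma natC_eq0 k : ((k%:R : C) == 0) = (k == 0)%N.
Proof. by have /pcharf0P -> := charC. Qed.

Lemma natC_inj (i j : nat) : (i%:R : C) = j%:R -> i = j.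
Proof.
wlog ij : i j / (i <= j)%N => [W|].
  by case: (leqP i j) => [/W|/ltnW/W h'] // hij; rewrite h'.
move=> e; have /eqP : ((j - i)%:R : C) = 0 by rewrite natrB // e subrr.
by rewrite natC_eq0 subn_eq0 => ji; apply/eqP; rewrite eqn_leq ij ji.
Qed.

Variable rho : mx_representation C [set: H] D.
Hypothesis rho_irr : mx_irreducible rho.
Hypothesis rho_nontriv : exists t : F, rho (Heis 0 t) != 1%:M.

Definition rv v : 'M[C]_D := rho (Heis v 0).
(** Central elements act by scalars, by Schur's lemma; the trace reads off the central character. *)
Definition psi (t : F) : C := \tr (rho (Heis 0 t)) / D%:R.

Lemma card_F_gt1 : (1 < #|F|)%N. Proof. exact: finNzRing_gt1. Qed.
Lemma D_gt0 : (0 < D)%N. Proof. by rewrite expn_gt0 (ltnW card_F_gt1). Qed.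
Lemma D_neq0 : (D%:R : C) != 0. Proof. by rewrite natC_eq0 -lt0n D_gt0. Qed.

Lemma rhoM u s v t : rho (Heis u s) *m rho (Heis v t) = rho (Heis (u + v) (s + t + B u v / 2%:R)).
Proof. by rewrite -repr_mxM ?inE. Qed.

Lemma rho_scalar (A : 'M[C]_D) : (forall v t, A *m rho (Heis v t) = rho (Heis v t) *m A) ->
  A = (\tr A / D%:R)%:M.
Proof.
move=> cA; have absr := group_closure_closed_field rho_irr.
have : is_scalar_mx A.
  by apply: (mx_abs_irr_cent_scalar absr); apply/centgmxP=> -[v t] _; apply: cA.
case/is_scalar_mxP=> a ->; rewrite mxtrace_scalar -[a *+ _]mulr_natr mulfK //.
exact: D_neq0.
Qed.

Lemma psiE t : rho (Heis 0 t) = (psi t)%:M.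
Proof.
apply: rho_scalar => v s; rewrite !rhoM !addr0 !add0r.
by rewrite form0l // form0r // mul0r !addr0 addrC.
Qed.

Lemma scalar_inj (a b : C) : (a%:M : 'M_D) = b%:M -> a = b.
Proof.
move=> /(congr1 mxtrace); rewrite !mxtrace_scalar -(mulr_natr a) -(mulr_natr b).
by apply: mulIf; apply: D_neq0.
Qed.

Lemma psi0 : psi 0 = 1.
Proof. by apply: scalar_inj; rewrite -psiE -[RHS](repr_mx1 rho). Qed.

Lemma psiD s t : psi (s + t) = psi s * psi t.
Proof.
apply: scalar_inj; rewrite -psiE scalar_mxM -!psiE rhoM addr0.
by rewrite form0l // mul0r addr0.
Qed.

Lemma psiN t : psi (- t) * psi t = 1.
Proof. by rewrite -psiD addNr psi0. Qed.

Lemma psi_nontriv : exists t, psi t != 1.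
Proof.
by have [t ht] := rho_nontriv; exists t; apply: contra ht => /eqP e; rewrite psiE e.
Qed.

Lemma rhoE v t : rho (Heis v t) = psi t *: rv v.
Proof.
rewrite -mul_scalar_mx -psiE /rv rhoM add0r addr0 form0l //.
by rewrite mul0r addr0.
Qed.

Lemma rvM u v : rv u *m rv v = psi (B u v / 2%:R) *: rv (u + v).
Proof. by rewrite /rv rhoM add0r add0r -rhoE. Qed.

Lemma rv0 : rv 0 = 1%:M.
Proof. by rewrite -[RHS](repr_mx1 rho). Qed.

Lemma rv_comm u v : rv u *m rv v = psi (B u v) *: (rv v *m rv u).
Proof.
rewrite !rvM scalerA -psiD addrC [v + u]addrC; congr (psi _ *: _).
rewrite (formC u v) mulNr; apply/eqP; rewrite -subr_eq0 opprB addrA -mulrDl -mulr2n.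
by rewrite -(mulr_natr (B u v)) mulfK // subrr.
Qed.

Lemma rvMN v : rv v *m rv (- v) = 1%:M.
Proof. by rewrite rvM formNr formxx // oppr0 mul0r psi0 scale1r subrr rv0. Qed.

Lemma rvMNl v : rv (- v) *m rv v = 1%:M.
Proof. by rewrite -{2}[v]opprK rvMN. Qed.

Lemma psi_form_nontriv v : v != 0 -> exists u, psi (B u v) != 1.
Proof.
move=> v0; have [u hu] := form_exists n_gt0 v0; have [t ht] := psi_nontriv.
by exists (t *: u); rewrite formZl hu mulr1.
Qed.

(** Conjugation by [rv u] multiplies [rv v] by psi (B u v), which differs from 1 for a suitable u
    when v is nonzero. *)
Lemma rv_tr v : \tr (rv v) = if v == 0 then D%:R else 0.
Proof.
case: eqVneq => [->|v0]; first by rewrite rv0 mxtrace1.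
have [u hu] := psi_form_nontriv v0.
have e : rv u *m rv v *m rv (- u) = psi (B u v) *: rv v.
  by rewrite rv_comm -scalemxAl -mulmxA rvMN mulmx1.
have := congr1 mxtrace e; rewrite mxtrace_mulC mulmxA rvMNl mul1mx mxtraceZ => /eqP.
by rewrite -{1}[\tr _]mul1r -subr_eq0 -mulrBl mulf_eq0 subr_eq0 eq_sym (negPf hu) => /eqP.
Qed.

Lemma card_V : #|{: V}| = (D * D)%N.
Proof. by rewrite card_mx mul1n -expnD -(dimV_eq n_gt0) mul2n addnn -mul2n (dimV_eq n_gt0). Qed.

Lemma psi_orth v : \sum_(u : V) psi (B u v / 2%:R) = if v == 0 then (D * D)%:R else 0.
Proof.
case: eqVneq => [->|v0].
  under eq_bigr do rewrite form0r // mul0r psi0.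
  by rewrite sumr_const card_V.
have [u0 hu0] := psi_form_nontriv v0.
(* The factor 2 cancels the division by 2 in the exponent. *)
have h : psi (B (2%:R *: u0) v / 2%:R) != 1.
  by rewrite formZl mulrC mulrA mulVf // mul1r.
set S := \sum_u _.
have e : S = psi (B (2%:R *: u0) v / 2%:R) * S.
  rewrite {1}/S (reindex_inj (addrI (2%:R *: u0))) mulr_sumr; apply: eq_bigr => u _.
  by rewrite formDl mulrDl psiD.
apply/eqP; move/eqP: e.
by rewrite -{1}[S]mul1r -subr_eq0 -mulrBl mulf_eq0 subr_eq0 eq_sym (negPf h).
Qed.

(** The sum commutes with the Heisenberg group, so it is a scalar, which is found by taking
    traces. *)
Lemma rv_average (A : 'M[C]_D) :
  \sum_(v : V) rv v *m A *m rv (- v) = (D%:R * \tr A)%:M.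
Proof.
set S := \sum_v _.
have -> : D%:R * \tr A = \tr S / D%:R.
  rewrite raddf_sum /=.
  under eq_bigr do rewrite -mulmxA mxtrace_mulC -mulmxA rvMNl mulmx1.
  by rewrite sumr_const card_V -(mulr_natr (\tr A)) natrM mulrA mulfK ?D_neq0 // mulrC.
apply: rho_scalar => u t; rewrite !rhoE -scalemxAl -scalemxAr; congr (_ *: _).
rewrite mulmx_sumr mulmx_suml (reindex_inj (addrI u)) /=; apply: eq_bigr => v _.
have -> : rv (u + v) = psi (- (B u v / 2%:R)) *: (rv u *m rv v).
  by rewrite rvM scalerA psiN scale1r.
have -> : rv (- (u + v)) = psi (B u v / 2%:R) *: (rv (- v) *m rv (- u)).
  rewrite rvM formNl formNr opprK (formC u v) scalerA -psiD mulNr subrr psi0 scale1r.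
  by rewrite opprD addrC.
rewrite -!scalemxAl -!scalemxAr -!scalemxAl scalerA psiN scale1r !mulmxA -(mulmxA _ _ (rv u)).
by rewrite rvMNl mulmx1.
Qed.

(** The operators [rv v] form a basis of the matrix algebra, orthogonal for the trace; the formula
    is [rv_average] on matrix units, read entry by entry. *)
Lemma rv_expand (A : 'M[C]_D) :
  A = D%:R^-1 *: \sum_(v : V) \tr (A *m rv (- v)) *: rv v.
Proof.
apply: (scalerI D_neq0); rewrite scalerA mulfV ?D_neq0 // scale1r.
apply/matrixP=> k i; rewrite mxE summxE.
have key l j : \sum_(v : V) rv v k i * rv (- v) j l = D%:R * ((i == j)%:R * (k == l)%:R).
  have := rv_average (delta_mx i j) => /matrixP/(_ k l).
  rewrite summxE mxE => e.
  transitivity (\sum_v (rv v *m delta_mx i j *m rv (- v)) k l).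
    apply: eq_bigr => v _; rewrite -(mul_delta_mx (0 : 'I_1)) mulmxA -mulmxA.
    by rewrite -colE -rowE mxE big_ord1 !mxE.
  rewrite e; case: (eqVneq k l) => _; last by rewrite !mulr0.
  rewrite mulr1n mulr1; congr (_ * _); rewrite /mxtrace.
  rewrite (bigD1 i) //= big1 ?addr0 => [|s ns]; first by rewrite mxE eqxx.
  by rewrite mxE (negPf ns).
transitivity (\sum_l \sum_j A l j * \sum_(v : V) rv v k i * rv (- v) j l).
  rewrite (bigD1 k) //= [X in _ = _ + X]big1 ?addr0 => [|l nl]; last first.
    by rewrite big1 // => j _; rewrite key [k == l]eq_sym (negPf nl) !mulr0.
  rewrite (bigD1 i) //= [X in _ = _ + X]big1 ?addr0 => [|j nj]; last first.
    by rewrite key [i == j]eq_sym (negPf nj) mul0r !mulr0.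
  by rewrite key !eqxx !mulr1 mulrC.
under eq_bigr do under eq_bigr do rewrite mulr_sumr.
under eq_bigr do rewrite exchange_big /=.
rewrite exchange_big /=; apply: eq_bigr => v _.
rewrite mxE /mxtrace mulr_suml; apply: eq_bigr => l _.
rewrite mxE mulr_suml; apply: eq_bigr => j _.
by rewrite -mulrA [rv v k i * _]mulrC.
Qed.

(** The parity operator: it intertwines v and - v, and in the Schroedinger model it is f(x) |-> f(-
    x). The Fourier sum dispenses with a model. *)
Definition P0 : 'M[C]_D := locked (D%:R^-1 *: \sum_(v : V) rv v).
Lemma P0E : P0 = D%:R^-1 *: \sum_(v : V) rv v.
Proof. by rewrite /P0 -lock. Qed.

Lemma P0_rv v : P0 *m rv v = rv (- v) *m P0.
Proof.
rewrite P0E -scalemxAl -scalemxAr mulmx_suml mulmx_sumr; congr (_ *: _).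
rewrite (reindex_inj (addIr (- v))) [RHS](reindex_inj (addIr v)) /=.
apply: eq_bigr => u _; rewrite !rvM subrK [- v + _]addrC addrK; congr (psi (_ / _) *: _).
by rewrite formDl formNl formxx // oppr0 addr0 formNl formDr formxx // addr0 -formC.
Qed.

Lemma P0P0 : P0 *m P0 = 1%:M.
Proof.
rewrite {1}P0E -scalemxAl mulmx_suml.
under eq_bigr => u _ do rewrite P0E -scalemxAr mulmx_sumr.
rewrite -scaler_sumr scalerA.
have -> : \sum_(u : V) \sum_(v : V) rv u *m rv v = (D * D)%:R *: 1%:M.
  transitivity (\sum_(u : V) \sum_(w : V) psi (B u w / 2%:R) *: rv w).
    apply: eq_bigr => u _; rewrite (reindex_inj (addrI (- u))); apply: eq_bigr => w _.
    by rewrite rvM addrA subrr add0r formDr formNr formxx // oppr0 add0r.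
  rewrite exchange_big /=.
  under eq_bigr => w _ do rewrite -scaler_suml psi_orth.
  rewrite (bigD1 0) //= eqxx rv0 big1 ?addr0 // => w /negPf ->.
  by rewrite scale0r.
by rewrite scalerA natrM mulrA -(mulrA D%:R^-1) mulVf ?D_neq0 // mulr1 mulVf ?D_neq0 // scale1r.
Qed.

Lemma P0_tr : \tr P0 = 1.
Proof.
rewrite P0E mxtraceZ raddf_sum /= (bigD1 0) //= big1 => [|v v0]; last by rewrite rv_tr (negPf v0).
by rewrite rv_tr eqxx addr0 mulVf ?D_neq0.
Qed.

(** With w = v / 2 one has rv v = (rv w)^2, and moving one factor across [P0] inverts it. *)
Lemma rvP0_tr v : \tr (rv v *m P0) = 1.
Proof.
have [w hw] : exists w, w + w = v.
  by exists (2%:R^-1 *: v); rewrite -scalerDl -mulr2n -[_ *+ 2]mulr_natr mulVf // scale1r.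
have -> : rv v = rv w *m rv w by rewrite rvM formxx // mul0r psi0 scale1r hw.
by rewrite mxtrace_mulC mulmxA P0_rv mxtrace_mulC !mulmxA rvMN mul1mx P0_tr.
Qed.

(** For e = 1 or - 1, the projection onto the e-eigenspace of [P0]; by [w_simple] the simple
    submodules of a Weil representation are among these images. *)
Definition Pe (e : C) : 'M[C]_D := 2%:R^-1 *: (1%:M + e *: P0).

Lemma two_neq0 : (2%:R : C) != 0. Proof. by rewrite natC_eq0. Qed.

Lemma PeP0 e : e * e = 1 -> Pe e *m P0 = e *: Pe e.
Proof.
move=> ee; rewrite /Pe -scalemxAl scalerA mulrC -scalerA mulmxDl mul1mx -scalemxAl P0P0.
by congr (_ *: _); rewrite scalerDr scalerA ee scale1r addrC.
Qed.

Lemma PePe e : e * e = 1 -> Pe e *m Pe e = Pe e.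
Proof.
move=> ee; rewrite {2}/Pe -scalemxAr mulmxDr mulmx1 -scalemxAr PeP0 // scalerA ee scale1r.
by rewrite -mulr2n -scaler_nat scalerA mulVf ?two_neq0 // scale1r.
Qed.

Lemma Pe_comm e A : A *m P0 = P0 *m A -> A *m Pe e = Pe e *m A.
Proof.
by move=> h; rewrite /Pe -scalemxAl -scalemxAr mulmxDl mulmxDr mul1mx mulmx1 -scalemxAl -scalemxAr h.
Qed.

Lemma sub_Pe e (u : 'rV[C]_D) : e * e = 1 -> (u <= Pe e)%MS = (u *m P0 == e *: u).
Proof.
move=> ee; apply/idP/eqP => [/submxP[a ->]|h]; first by rewrite -mulmxA PeP0 // scalemxAr.
have -> : u = u *m Pe e; last exact: submxMl.
rewrite /Pe -scalemxAr mulmxDr mulmx1 -scalemxAr h scalerA ee scale1r -mulr2n.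
by rewrite -scaler_nat scalerA mulVf ?two_neq0 // scale1r.
Qed.

Section Rep.
Variable w : mx_representation C Sp D.
Hypothesis wrel : forall x h, x \in Sp -> rho h *m w x = w x *m rho (heis_act h x).

Lemma w_rv x v : x \in Sp -> rv v *m w x = w x *m rv (v *m GLval x).
Proof. by move=> xS; rewrite /rv wrel. Qed.

Lemma w_P0 x : x \in Sp -> w x *m P0 = P0 *m w x.
Proof.
move=> xS; rewrite P0E -scalemxAl -scalemxAr mulmx_suml mulmx_sumr; congr (_ *: _).
rewrite (reindex_inj (h := fun v => v *m GLval x)) /=.
  by apply: eq_bigr => v _; rewrite w_rv.
by apply: (can_inj (g := fun v => v *m invmx (GLval x))) => v; rewrite mulmxK // GLval_unitmx.
Qed.

Lemma w_unit x : x \in Sp -> w x \in unitmx.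
Proof. by move=> xS; apply: repr_mx_unit. Qed.

(** In the basis [rv v] the coefficients of A are invariant under Sp, which is transitive on nonzero
    vectors; only the coefficients of 1 and of [P0] remain free. *)
Lemma w_commutant A : (forall x, x \in Sp -> A *m w x = w x *m A) ->
  exists a b, A = a *: 1%:M + b *: P0.
Proof.
move=> cA; have inv v x : x \in Sp -> \tr (A *m rv (- (v *m GLval x))) = \tr (A *m rv (- v)).
  move=> xS; have e : rv (- v) *m w x = w x *m rv (- (v *m GLval x)) by rewrite w_rv // mulNmx.
  have -> : rv (- v) = w x *m rv (- (v *m GLval x)) *m invmx (w x).
    by rewrite -e mulmxK // w_unit.
  rewrite !mulmxA cA // -!mulmxA [RHS]mxtrace_mulC !mulmxA mulmxKV ?w_unit //.
have [v1 v10] : exists v1 : V, v1 != 0.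
  exists (delta_mx 0 0); apply/eqP => /rowP/(_ 0); rewrite !mxE eqxx; apply/eqP/oner_neq0.
set b := \tr (A *m rv (- v1)).
exists (D%:R^-1 * (\tr A - b)), b.
rewrite {1}[A]rv_expand (bigD1 0) //= oppr0 rv0 mulmx1.
rewrite (eq_bigr (fun v => b *: rv v)) => [|v v0]; last first.
  by have [x xS <-] := Sp_trans n_gt0 char2 v10 v0; rewrite inv.
rewrite -scaler_sumr P0E [in RHS](bigD1 0) //= rv0.
rewrite !scalerDr !scalerA mulrBr scalerBl [b * _]mulrC addrA subrK //.
Qed.

(** By Maschke, U is the image of a projection commuting with Sp, hence of the form a + b P0.
    Idempotence forces a = 1/2 and b = 1/2 or - 1/2, unless b = 0; then U is zero or everything, and
    the latter is refuted by the invariant subspace of 1 + P0. *)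
Lemma w_simple U : mxsimple w U -> exists e, e * e = 1 /\ (U :=: Pe e)%MS.
Proof.
move=> simU; have modU := mxsimple_module simU.
have charG : [pchar C]^'.-group Sp.
  by rewrite /pgroup pcharf'_nat natC_eq0 -lt0n cardG_gt0.
have [W [modW UW dUW]] := mx_Maschke_pchar w charG modU (submx1 U).
have UW0 : (U :&: W)%MS = 0 by apply/mxdirect_addsP.
have [A [fA gA sA]] : exists A : 'M[C]_D, [/\ forall r : 'rV_D, (r <= U)%MS -> r *m A = r,
    forall r : 'rV_D, (r <= W)%MS -> r *m A = 0 & forall r : 'rV_D, (r *m A <= U)%MS].
  exists (proj_mx U W); split=> r.
  - exact: proj_mx_id.
  - exact: proj_mx_0.
  - exact: proj_mx_sub.
have AA : A *m A = A by apply: eq_mulrows => r; rewrite mulmxA fA.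
have cA x : x \in Sp -> A *m w x = w x *m A.
  move=> xS; apply: eq_mulrows => r; rewrite !mulmxA.
  have /sub_addsmxP[[k l] ->] : (r <= U + W)%MS by rewrite UW submx1.
  rewrite /= !mulmxDl; have r1U := submxMl k U; have r2W := submxMl l W.
  have r1x := submx_trans (submxMr (w x) r1U) (mxmoduleP modU x xS).
  have r2x := submx_trans (submxMr (w x) r2W) (mxmoduleP modW x xS).
  by rewrite (fA _ r1U) (gA _ r2W) (fA _ r1x) (gA _ r2x) mul0mx.
have AU : (A :=: U)%MS.
  apply/eqmxP; apply/andP; split.
    by apply/row_subP=> i; rewrite rowE sA.
  by apply/rV_subP=> r rU; rewrite -(fA _ rU) submxMl.
have [a [b eA]] := w_commutant cA.
(* The traces of the operator and of its product with [rv v], v nonzero, separate 1 from [P0]. *)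
have indep c d : c *: 1%:M + d *: P0 = 0 -> c = 0 /\ d = 0.
  move=> e.
  have t1 : c * D%:R + d = 0.
    by have := congr1 mxtrace e; rewrite raddfD /= !mxtraceZ mxtrace1 P0_tr mulr1 raddf0.
  have [v v0] : exists v1 : V, v1 != 0.
    exists (delta_mx 0 0); apply/eqP => /rowP/(_ 0); rewrite !mxE eqxx; apply/eqP/oner_neq0.
  have d0 : d = 0.
    have := congr1 (fun M => \tr (rv v *m M)) e; rewrite /= mulmxDr -!scalemxAr mulmx1.
    by rewrite raddfD /= !mxtraceZ rv_tr (negPf v0) rvP0_tr mulr0 add0r mulr1 mulmx0 raddf0.
  split=> //; move/eqP: t1; rewrite d0 addr0 mulf_eq0 (negPf D_neq0) orbF.
  by move/eqP.
have [e1 e2] : a * a + b * b - a = 0 /\ a * b + b * a - b = 0.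
  apply: indep; move: AA; rewrite eA => /eqP; rewrite -subr_eq0 => /eqP <-.
  rewrite mulmxDl !mulmxDr -!scalemxAl -!scalemxAr !mul1mx mulmx1 P0P0 !scalerA.
  apply/matrixP=> i j; rewrite !mxE; ring.
have nzU : U != 0 by case: simU.
have b0 : b != 0.
  apply/eqP=> z; move: e1; rewrite z mulr0 addr0 -{3}[a]mulr1 -mulrBr => /eqP.
  rewrite mulf_eq0 subr_eq0 => /orP[] /eqP az.
    by move: nzU; rewrite -(eqmx_eq0 AU) eA az z !scale0r addr0 eqxx.
  have U1 : (U :=: 1%:M)%MS.
    by apply: eqmx_trans (eqmx_sym AU) _; rewrite eA az z scale0r addr0 scale1r.
  case: simU => _ _ /(_ (1%:M + P0)) h.
  have modP : mxmodule w (1%:M + P0).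
    by apply/mxmoduleP=> x xS; rewrite mulmxDl mul1mx -w_P0 // -[X in X + _]mulmx1 -mulmxDr submxMl.
  have P1n0 : 1%:M + P0 != 0.
    apply/eqP=> z1; have [] := indep 1 1; rewrite ?scale1r // => /eqP.
    by rewrite oner_eq0.
  have := h modP _ P1n0; rewrite U1 submx1 => /(_ erefl) s1.
  have : (1%:M : 'M_D) *m (1%:M - P0) = 0.
    have /submxP[K eK] : ((1%:M : 'M_D) <= (1%:M + P0)%R)%MS by rewrite -U1.
    rewrite {1}eK -mulmxA mulmxBr mulmx1 mulmxDl mul1mx P0P0.
    by rewrite [P0 + _]addrC subrr mulmx0.
  rewrite mul1mx => z1; have [] := indep 1 (-1); rewrite ?scale1r ?scaleN1r // => /eqP.
  by rewrite oner_eq0.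
have a2 : a = 2%:R^-1.
  have : b * (2%:R * a - 1) = 0 by rewrite -e2; ring.
  move/eqP; rewrite mulf_eq0 (negPf b0) subr_eq0 => /eqP h.
  by rewrite -[a](mulKf two_neq0) h mulr1.
exists (2%:R * b); split.
  have : 4%:R * (a * a + b * b - a) = 0 by rewrite e1 mulr0.
  have aa : 2%:R * a = 1 by rewrite a2 mulfV ?two_neq0.
  move/eqP; have -> : 4%:R * (a * a + b * b - a) = (2%:R * a) * (2%:R * a) + 2%:R * b * (2%:R * b) - 2%:R * (2%:R * a) by ring.
  rewrite aa mulr1 mulr1 addrAC => /eqP e; apply/eqP; rewrite -subr_eq0; apply/eqP.
  by rewrite -e; ring.
apply: eqmx_trans (eqmx_sym AU) _; rewrite eA a2 /Pe scalerDr scalerA mulrA mulVf ?two_neq0 //.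
by rewrite mul1r.
Qed.

Definition sspec (e : C) y := forall (a : C) (u v : 'rV[C]_D),
  u *m w y = a *: u -> v *m w y = a *: v -> (u <= Pe e)%MS -> (v <= Pe e)%MS ->
  u != 0 -> (v <= u)%MS.

(** Operators commuting with y and [P0] preserve each eigenline of y in the image of [Pe e], so they
    are simultaneously diagonal there. *)
Lemma sspec_comm e y A A' : e * e = 1 -> y \in Sp -> sspec e y ->
  A *m w y = w y *m A -> A *m P0 = P0 *m A ->
  A' *m w y = w y *m A' -> A' *m P0 = P0 *m A' ->
  Pe e *m (A *m A') = Pe e *m (A' *m A).
Proof.
move=> ee yS ss cA pA cA' pA'.
have oy : (#[y]%g%:R : C) != 0 by rewrite natC_eq0 -lt0n order_gt0.
have [rs _ dec] := repr_eigenspaces w yS oy.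
have line X (u : 'rV_D) a : X *m w y = w y *m X -> X *m P0 = P0 *m X ->
    u *m w y = a *: u -> (u <= Pe e)%MS -> exists b : C, u *m X = b *: u.
  move=> cX pX ua ue; have [->|u0] := eqVneq u 0; first by exists 0; rewrite mul0mx scaler0.
  apply/sub_rVP; apply: (ss a) => //.
    by rewrite -mulmxA cX mulmxA ua scalemxAl.
  move: ue; rewrite !sub_Pe // => /eqP ue.
  by rewrite -mulmxA pX mulmxA ue scalemxAl.
apply: eq_mulrows => u; rewrite !(mulmxA u).
have : (u <= \sum_(r <- rs) eigenspace (w y) r)%MS by rewrite dec submx1.
rewrite (big_nth 0) big_mkord => /sub_sumsmxP[U ->].
rewrite !mulmx_suml; apply: eq_bigr => i _.
set u1 := U i *m _; set a := rs`_i.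
have u1a : u1 *m w y = a *: u1 by apply/eigenspaceP; exact: submxMl.
set u2 := u1 *m Pe e.
have u2a : u2 *m w y = a *: u2.
  by rewrite /u2 -mulmxA -Pe_comm ?w_P0 // mulmxA u1a scalemxAl.
have u2e : (u2 <= Pe e)%MS by apply: submxMl.
have [b hb] := line A u2 a cA pA u2a u2e; have [c hc] := line A' u2 a cA' pA' u2a u2e.
by rewrite !mulmxA hb hc -!scalemxAl hb hc !scalerA mulrC.
Qed.

(** For isotropic [U] this is the projection onto the vectors fixed by all [rv u] with u in [U]. *)
Definition avg (U : 'M[F]_N) : 'M[C]_D :=
  locked (#|[set v : V | (v <= U)%MS]|%:R^-1 *: \sum_(v : V | (v <= U)%MS) rv v).

Lemma avgE U : avg U = #|[set v : V | (v <= U)%MS]|%:R^-1 *: \sum_(v : V | (v <= U)%MS) rv v.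
Proof. by rewrite /avg -lock. Qed.

Let card_sub (U : 'M[F]_N) : (#|[set v : V | (v <= U)%MS]|%:R : C) != 0.
Proof.
by rewrite natC_eq0 -lt0n; apply/card_gt0P; exists 0; rewrite inE sub0mx.
Qed.

Let sub_shift (U : 'M[F]_N) u v : (u <= U)%MS -> ((u + v)%R <= U)%MS = (v <= U)%MS.
Proof.
move=> uU; apply/idP/idP => h; last exact: addmx_sub.
by rewrite -[v](addKr u) addmx_sub // -scaleN1r scalemx_sub.
Qed.

Let sum_sub (U : 'M[F]_N) (X : zmodType) (x : X) :
  \sum_(v : V | (v <= U)%MS) x = x *+ #|[set v : V | (v <= U)%MS]|.
Proof. by rewrite sumr_const cardsE. Qed.

Definition isotropic (U : 'M[F]_N) := forall u v, (u <= U)%MS -> (v <= U)%MS -> B u v = 0.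

Lemma rv_avg U u : isotropic U -> (u <= U)%MS -> rv u *m avg U = avg U.
Proof.
move=> iU uU; rewrite avgE -scalemxAr mulmx_sumr; congr (_ *: _).
rewrite [RHS](reindex_inj (addrI u)) /=; apply: eq_big => v; first by rewrite sub_shift.
by move=> vU; rewrite rvM iU // mul0r psi0 scale1r.
Qed.

Lemma avg_rv U u : isotropic U -> (u <= U)%MS -> avg U *m rv u = avg U.
Proof.
move=> iU uU; rewrite avgE -scalemxAl mulmx_suml; congr (_ *: _).
rewrite [RHS](reindex_inj (addrI u)) /=; apply: eq_big => v; first by rewrite sub_shift.
by move=> vU; rewrite rvM iU // mul0r psi0 scale1r addrC.
Qed.

Lemma avg_idem U : isotropic U -> avg U *m avg U = avg U.
Proof.
move=> iU; rewrite {1}avgE -scalemxAl mulmx_suml (eq_bigr (fun=> avg U)) => [|v vU].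
  by rewrite sum_sub -scaler_nat scalerA mulVf ?scale1r ?card_sub.
by rewrite rv_avg.
Qed.

Lemma avg_P0 U : avg U *m P0 = P0 *m avg U.
Proof.
rewrite avgE -scalemxAl -scalemxAr mulmx_suml mulmx_sumr; congr (_ *: _).
rewrite (reindex_inj oppr_inj) /=; apply: eq_big => v; last by rewrite P0_rv.
by rewrite -scaleN1r (eqmx_scale _ (_ : -1 != 0)) // oppr_eq0 oner_neq0.
Qed.

Lemma avg_w U y : y \in Sp -> (U *m GLval y <= U)%MS -> avg U *m w y = w y *m avg U.
Proof.
move=> yS sU; rewrite avgE -scalemxAl -scalemxAr mulmx_suml mulmx_sumr; congr (_ *: _).
have uy := GLval_unitmx y.
have eU : (U *m GLval y :=: U)%MS.
  by apply/eqmxP; have [_ <-] := mxrank_leqif_eq sU; rewrite mxrankMfree // row_free_unit.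
rewrite [RHS](reindex_inj (h := fun v => v *m GLval y)) /=; last first.
  by apply: (can_inj (g := fun v => v *m invmx (GLval y))) => v; rewrite mulmxK.
apply: eq_big => v; last by rewrite w_rv.
by rewrite -(submxMfree v U (_ : row_free (GLval y))) ?row_free_unit // eU.
Qed.

(** Only v = 0 survives in [avg U'] between the two outer factors: for v nonzero some u in U has psi
    (B u v) != 1, and [avg U] absorbs [rv u] on both sides. *)
Lemma avg_sandwich U U' : isotropic U ->
  (forall v, (v <= U')%MS -> v != 0 -> exists2 u, (u <= U)%MS & B u v != 0) ->
  avg U *m avg U' *m avg U = #|[set v : V | (v <= U')%MS]|%:R^-1 *: avg U.
Proof.
move=> iU pr; rewrite (avgE U') -scalemxAr -scalemxAl; congr (_ *: _).
rewrite mulmx_sumr mulmx_suml (bigD1 0) ?sub0mx //= rv0 mulmx1 avg_idem //.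
rewrite big1 ?addr0 // => v /andP[vU' v0]; have [u uU uv] := pr v vU' v0.
have [t ht] := psi_nontriv.
pose u' := (t / B u v) *: u.
have u'v : B u' v = t by rewrite formZl mulfVK.
have u'U : (u' <= U)%MS by apply: scalemx_sub.
have e : avg U *m rv v *m avg U = psi t *: (avg U *m rv v *m avg U).
  rewrite -{1}(avg_rv iU u'U) -(mulmxA (avg U)) rv_comm u'v -scalemxAr -scalemxAl mulmxA.
  by rewrite -[avg U *m _ *m _ *m _]mulmxA rv_avg.
apply/eqP; move/eqP: e; rewrite -{1}[_ *m _ *m _]scale1r -subr_eq0 -scalerBl scaler_eq0.
by rewrite subr_eq0 eq_sym (negPf ht).
Qed.

(* Two idempotents attached to y-stable isotropic subspaces in duality do not
   commute, unless the first one vanishes on the constituent. *)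
Lemma stable_isotropic e y U U' : e * e = 1 -> y \in Sp -> sspec e y ->
  isotropic U -> isotropic U' -> U' != 0 ->
  (forall v, (v <= U')%MS -> v != 0 -> exists2 u, (u <= U)%MS & B u v != 0) ->
  (U *m GLval y <= U)%MS -> (U' *m GLval y <= U')%MS ->
  #|[set v : V | (v <= U)%MS]| = D.
Proof.
move=> ee yS ss iU iU' nU' pr sU sU'.
have cm := sspec_comm ee yS ss (avg_w yS sU) (avg_P0 U) (avg_w yS sU') (avg_P0 U').
set c : C := #|[set v : V | (v <= U')%MS]|%:R^-1.
have sand := avg_sandwich iU pr; rewrite -/c in sand.
have h1 : Pe e *m avg U *m avg U' = c *: (Pe e *m avg U).
  rewrite -mulmxA cm -{1}(avg_idem iU) !mulmxA -(mulmxA (Pe e)) -cm.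
  by rewrite -mulmxA sand -scalemxAr.
have h2 : Pe e *m avg U *m avg U' = c *: (Pe e *m avg U *m avg U').
  by rewrite -{1}(avg_idem iU') mulmxA {1}h1 -scalemxAl.
have c1 : c != 1.
  apply/eqP=> /(congr1 GRing.inv); rewrite /c invrK invr1 -[1]/(1%:R) => /natC_inj k1.
  have [v vU' v0] := rowV0Pn nU'.
  have : (1 < #|[set v : V | (v <= U')%MS]|)%N.
    by apply/card_gt1P; exists 0, v; rewrite !inE sub0mx vU' eq_sym v0.
  by rewrite k1.
have h3 : Pe e *m avg U *m avg U' = 0.
  apply/eqP; move/eqP: h2; rewrite -{1}[_ *m _ *m _]scale1r -subr_eq0 -scalerBl scaler_eq0.
  by rewrite subr_eq0 eq_sym (negPf c1).
have h4 : Pe e *m avg U = 0.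
  apply/eqP; move/eqP: h1; rewrite h3 eq_sym scaler_eq0 /c invr_eq0 (negPf (card_sub _)).
  by [].
(* This trace equals (D / |U| + e) / 2, so D / |U| = - e and |U| = D after squaring. *)
have : \tr (Pe e *m avg U) = 0 by rewrite h4 raddf0.
rewrite /Pe -scalemxAl mxtraceZ mulmxDl mul1mx -scalemxAl raddfD /= mxtraceZ.
rewrite {2}avgE -scalemxAr mxtraceZ mulmx_sumr raddf_sum /=.
rewrite (eq_bigr (fun=> 1)) => [|v _]; last by rewrite mxtrace_mulC rvP0_tr.
rewrite sum_sub mulVf ?card_sub // mulr1.
have -> : \tr (avg U) = D%:R / #|[set v : V | (v <= U)%MS]|%:R.
  rewrite avgE mxtraceZ raddf_sum /= (bigD1 0) ?sub0mx //= rv_tr eqxx big1 ?addr0 1?mulrC //.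
  by move=> v /andP[_ v0]; rewrite rv_tr (negPf v0).
move/eqP; rewrite mulf_eq0 invr_eq0 (negPf two_neq0) addr_eq0 => /eqP h.
have : (D * D)%:R = (#|[set v : V | (v <= U)%MS]| * #|[set v : V | (v <= U)%MS]|)%:R :> C.
  rewrite !natrM -[D%:R](mulfVK (card_sub U)) h mulrACA mulrNN ee mul1r //.
move/natC_inj/eqP; rewrite !mulnn eqn_exp2r // => /eqP -> //.
Qed.

End Rep.
End Weil.

(** * Traces of root elements *)

Section RootTrace.
Variables (C : closedFieldType) (F : finFieldType) (n : nat).
Hypothesis charC : [pchar C] =i pred0.
Hypothesis n_gt1 : (1 < n)%N.
Hypothesis char2 : (2%:R : F) != 0.
Let n_gt0 : (0 < n)%N := ltnW n_gt1.
Local Notation N := (dimV n).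
Local Notation B := (@symp_form F n).
Local Notation V := 'rV[F]_N.
Local Notation D := (#|F| ^ n)%N.
Local Notation q := #|F|.
Local Notation H := (heisenberg n F).
Local Notation gT := {'GL_(2 * n)[F]}.
Local Notation Sp := (Sp n F).
Variable rho : mx_representation C [set: H] D.
Hypothesis rho_irr : mx_irreducible rho.
Hypothesis rho_nontriv : exists t : F, rho (Heis 0 t) != 1%:M.
Variable w : mx_representation C Sp D.
Hypothesis wrel : forall x h, x \in Sp -> rho h *m w x = w x *m rho (heis_act h x).
Local Notation rv := (rv rho).
Local Notation psi := (psi rho).
Local Notation P0 := (P0 rho).
Local Notation Pe := (Pe rho).

Variable v : V.
Hypothesis v0 : v != 0.

Lemma q_neq0 : (q%:R : C) != 0.
Proof. by rewrite natC_eq0 // -lt0n ltnW // finNzRing_gt1. Qed.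

Lemma psiF_orth y : \sum_(b : F) psi (b * y) = if y == 0 then q%:R else 0.
Proof.
case: eqVneq => [->|y0].
  by under eq_bigr do rewrite mulr0 psi0 //; rewrite sumr_const.
have [t ht] := psi_nontriv charC rho_irr rho_nontriv.
have e : \sum_b psi (b * y) = psi t * \sum_b psi (b * y).
  rewrite {1}(reindex_inj (addrI (t / y))) mulr_sumr; apply: eq_bigr => b _.
  by rewrite mulrDl mulfVK // psiD.
apply/eqP; move/eqP: e.
by rewrite -{1}[\sum_b _]mul1r -subr_eq0 -mulrBl mulf_eq0 subr_eq0 eq_sym (negPf ht).
Qed.

(** The projection onto the eigenspace of the commuting operators [rv (b *: v)] for the character b
    |-> psi (b y). *)
Definition Pi y : 'M[C]_D :=
  locked (q%:R^-1 *: \sum_(b : F) psi (- (b * y)) *: rv (b *: v)).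
Lemma PiE y : Pi y = q%:R^-1 *: \sum_(b : F) psi (- (b * y)) *: rv (b *: v).
Proof. by rewrite /Pi -lock. Qed.

Lemma rvb b c : rv (b *: v) *m rv (c *: v) = rv ((b + c) *: v).
Proof. by rewrite rvM // formZl formZr formxx // !mulr0 mul0r psi0 // scale1r scalerDl. Qed.

Lemma Pi_rvb y b : Pi y *m rv (b *: v) = psi (b * y) *: Pi y.
Proof.
rewrite PiE -scalemxAl scalerA mulrC -scalerA mulmx_suml; congr (_ *: _).
rewrite [in RHS](reindex_inj (addrI b)) scaler_sumr /=; apply: eq_bigr => c _.
rewrite -scalemxAl rvb scalerA -psiD // [c + b]addrC.
congr (psi _ *: _); ring.
Qed.

Lemma Pi_rv y u : Pi y *m rv u = rv u *m Pi (y + B u v).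
Proof.
rewrite !PiE -scalemxAl -scalemxAr mulmx_suml mulmx_sumr; congr (_ *: _).
apply: eq_bigr => b _; rewrite -scalemxAl -scalemxAr rv_comm // scalerA -psiD //.
congr (psi _ *: _); rewrite formZl (formC u v); ring.
Qed.

Lemma PiPi y z : Pi y *m Pi z = if y == z then Pi y else 0.
Proof.
rewrite {1}(PiE z) -scalemxAr mulmx_sumr.
under eq_bigr do rewrite -scalemxAr Pi_rvb scalerA -psiD //.
rewrite -scaler_suml (eq_bigr (fun b => psi (b * (y - z)))) => [|b _]; last first.
  by congr psi; ring.
rewrite psiF_orth subr_eq0; case: eqVneq => _; last by rewrite scale0r scaler0.
by rewrite scalerA mulVf ?q_neq0 // scale1r.
Qed.

Lemma sum_Pi : \sum_y Pi y = 1%:M.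
Proof.
under eq_bigr do rewrite PiE.
rewrite -scaler_sumr exchange_big /=.
rewrite (eq_bigr (fun b => (if b == 0 then q%:R else 0) *: rv (b *: v))) => [|b _]; last first.
  rewrite -scaler_suml -[b == 0]oppr_eq0 -psiF_orth; congr (_ *: _).
  by apply: eq_bigr => y _; congr psi; ring.
rewrite (bigD1 0) //= eqxx scale0r rv0 big1 ?addr0 ?scalerA ?mulVf ?q_neq0 ?scale1r //.
by move=> b /negPf ->; rewrite scale0r.
Qed.

(** Candidate for the action of the transvection [tv v a]: the phase psi (a y^2 / 2) on the
    eigenspace of index y. By [Sop_rv] it conjugates the Heisenberg operators as the transvection
    should. *)
Definition Sop a : 'M[C]_D := locked (\sum_(y : F) psi (a * y * y / 2%:R) *: Pi y).
Lemma SopE a : Sop a = \sum_(y : F) psi (a * y * y / 2%:R) *: Pi y.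
Proof. by rewrite /Sop -lock. Qed.

Lemma Sop_rv u a : rv u *m Sop a = Sop a *m rv (u *m tv v a).
Proof.
set s := B u v; rewrite mul_tv -/s.
have -> : rv (u + (a * s) *: v) = psi (- (a * s * s / 2%:R)) *: (rv u *m rv ((a * s) *: v)).
  rewrite rvM // scalerA -psiD // formZr -/s; rewrite [X in psi X](_ : _ = 0) ?psi0 ?scale1r //.
  ring.
rewrite !SopE mulmx_sumr -scalemxAr mulmx_suml scaler_sumr (reindex_inj (addIr s)) /=.
apply: eq_bigr => y _; rewrite -scalemxAr -scalemxAl mulmxA Pi_rv -mulmxA Pi_rvb -/s.
rewrite -scalemxAr !scalerA -!psiD //; congr (psi _ *: _).
by field.
Qed.

Lemma Sop0 : Sop 0 = 1%:M.
Proof. by rewrite SopE -sum_Pi; apply: eq_bigr => y _; rewrite !mul0r psi0 // scale1r. Qed.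

Lemma SopM a b : Sop a *m Sop b = Sop (a + b).
Proof.
rewrite (SopE a) mulmx_suml (SopE (a + b)); apply: eq_bigr => y _.
rewrite -scalemxAl (SopE b) mulmx_sumr (bigD1 y) //= big1 ?addr0 => [|z /negPf zy]; last first.
  by rewrite -scalemxAr PiPi eq_sym zy scaler0.
rewrite -scalemxAr PiPi eqxx scalerA -psiD //; congr (psi _ *: _); ring.
Qed.

(** By Schur's lemma [w (tg v a)] and [Sop a] differ by a factor l(a), multiplicative in a. Some
    Fourier coefficient of l is nonzero, since they add up to q l(0), and this identifies l with a
    character psi (k a). *)
Lemma rep_root : exists k : F, forall a, w (tg v a) = psi (k * a) *: Sop a.
Proof.
pose l a := \tr (w (tg v a) *m Sop (- a)) / D%:R.
have lE a : w (tg v a) = l a *: Sop a.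
  have e : w (tg v a) *m Sop (- a) = (l a)%:M.
    apply: (rho_scalar charC rho_irr) => u t.
    rewrite rhoE // -scalemxAl -scalemxAr; congr (_ *: _).
    rewrite mulmxA (w_rv wrel) ?tg_Sp // GLval_tg // -!mulmxA; congr (_ *m _).
    by rewrite Sop_rv -mulmxA tvM // subrr tv0 mulmx1.
  by rewrite -mul_scalar_mx -e -mulmxA SopM addNr Sop0 mulmx1.
move: l lE => l lE.
have lM a b : l (a + b) = l a * l b.
  apply: (scalar_inj (F := F) (n := n) charC).
  have h : l (a + b) *: Sop (a + b) = (l a * l b) *: Sop (a + b).
    rewrite -lE -tgM // repr_mxM ?tg_Sp // !lE -scalemxAl -scalemxAr SopM.
    by rewrite scalerA.
  have := congr1 (mulmx^~ (Sop (- (a + b)))) h.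
  by rewrite -!scalemxAl SopM subrr Sop0 !scalemx1.
have l0 : l 0 = 1.
  apply: (scalar_inj (F := F) (n := n) charC).
  have <- : w (tg v 0) *m Sop (- 0) = (l 0)%:M by rewrite lE -scalemxAl SopM subrr Sop0 scalemx1.
  by rewrite tg0 // repr_mx1 mul1mx oppr0 Sop0.
have [c hc] : exists c, \sum_a l a * psi (- (c * a)) != 0.
  case: (pickP (fun c => \sum_a l a * psi (- (c * a)) != 0)) => [c hc|h]; first by exists c.
  have : \sum_c \sum_a l a * psi (- (c * a)) = 0.
    by rewrite big1 // => c _; apply/eqP; rewrite -[_ == 0]negbK h.
  rewrite exchange_big /= (eq_bigr (fun a => if a == 0 then q%:R else 0)) => [|a _]; last first.
    rewrite -mulr_sumr (eq_bigr (fun c => psi (c * - a))) => [|c _]; last by rewrite mulrN.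
    by rewrite psiF_orth oppr_eq0; case: eqP => [->|]; rewrite ?l0 ?mul1r ?mulr0.
  by rewrite -big_mkcond big_pred1_eq => /eqP; rewrite (negPf q_neq0).
exists c => a; rewrite lE; congr (_ *: _).
have e : \sum_b l b * psi (- (c * b)) = l a * psi (- (c * a)) * \sum_b l b * psi (- (c * b)).
  rewrite {1}(reindex_inj (addrI a)) mulr_sumr; apply: eq_bigr => b _.
  rewrite lM mulrDr opprD psiD //; ring.
have : l a * psi (- (c * a)) = 1.
  apply/eqP; move/eqP: e; rewrite -{1}[\sum_b _]mul1r -subr_eq0 -mulrBl mulf_eq0 (negPf hc) orbF.
  by rewrite subr_eq0 eq_sym.
move=> h; rewrite -[l a]mulr1 -[1](psiN charC rho_irr (c * a)) mulrA h mul1r //.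
Qed.

Variable e : C.
Hypothesis ee : e * e = 1.
Local Notation r := (q ^ n.-1)%N.

Let t y : C := \tr (Pe e *m Pi y).

Lemma tr_Pi y : t y = 2%:R^-1 * (r%:R + e * (y == 0)%:R).
Proof.
rewrite /t /Pe -scalemxAl mxtraceZ mulmxDl mul1mx -scalemxAl raddfD /= mxtraceZ.
congr (_ * (_ + _ * _)).
  rewrite PiE mxtraceZ raddf_sum /= (bigD1 0) //= big1 ?addr0 => [|b b0].
    rewrite mul0r oppr0 psi0 // scale1r scale0r rv_tr // eqxx.
    by rewrite -{1}(prednK n_gt0) expnS natrM mulKf ?q_neq0.
  by rewrite mxtraceZ rv_tr // scaler_eq0 (negPf b0) (negPf v0) mulr0.
rewrite PiE -scalemxAr mxtraceZ mulmx_sumr raddf_sum /=.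
rewrite (eq_bigr (fun b => psi (b * - y))) => [|b _].
  by rewrite psiF_orth oppr_eq0; case: eqP; rewrite ?mulVf ?q_neq0 ?mulr0.
by rewrite -scalemxAr mxtraceZ mxtrace_mulC rvP0_tr // mulr1 mulrN.
Qed.

(* A constant trace would make all nontrivial characters of the root group occur
   equally often; in fact there are three different multiplicities. *)
Lemma root_trace_nonconst (tau : C) (d : F) : (forall k, d != k * k) ->
  (forall a, a != 0 -> \tr (Pe e *m w (tg v a)) = tau) -> False.
Proof.
move=> hd hf; have [k hk] := rep_root.
pose f a := \tr (Pe e *m w (tg v a)).
have fE a : f a = \sum_y psi (a * (k + y * y / 2%:R)) * t y.
  rewrite /f hk -scalemxAr mxtraceZ SopE mulmx_sumr raddf_sum mulr_sumr.
  apply: eq_bigr => y _ /=; rewrite -scalemxAr mxtraceZ mulrA -psiD //.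
  by congr (psi _ * _); ring.
(* [N c] is the multiplicity of the character a |-> psi (c a) of the root group on the image of
   [Pe e]. *)
pose N c := \sum_(y | y * y == 2%:R * (c - k)) t y.
have NE c : \sum_a f a * psi (- (c * a)) = q%:R * N c.
  under eq_bigr do rewrite fE mulr_suml.
  rewrite exchange_big /= /N [in RHS]big_mkcond [in RHS]mulr_sumr; apply: eq_bigr => y _.
  rewrite (eq_bigr (fun a => psi (a * (k + y * y / 2%:R - c)) * t y)) => [|a _]; last first.
    by rewrite mulrAC -psiD //; congr (psi _ * _); ring.
  rewrite -mulr_suml psiF_orth.
  have -> : (k + y * y / 2%:R - c == 0) = (y * y == 2%:R * (c - k)).
    rewrite -(inj_eq (mulfI char2)) mulr0 -[RHS]subr_eq0; congr (_ == _).
    rewrite mulrBr mulrDr mulrCA mulfV // mulr1; ring.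
  by case: ifP => _; rewrite ?mul0r ?mulr0.
have Nc c : c != 0 -> q%:R * N c = f 0 - tau.
  move=> c0; rewrite -NE (bigD1 0) //= mulr0 oppr0 psi0 // mulr1; congr (_ + _).
  rewrite (eq_bigr (fun a => tau * psi (a * - c))) => [|a a0]; last first.
    by rewrite /f hf // mulrN [a * c]mulrC.
  have := psiF_orth (- c); rewrite oppr_eq0 (negPf c0) (bigD1 0) //= mul0r psi0 // => h.
  by rewrite -mulr_sumr -[X in tau * X](addKr 1) h addr0 mulrN1.
have Neq c c' : c != 0 -> c' != 0 -> N c = N c'.
  by move=> c0 c0'; apply: (mulfI q_neq0); rewrite !Nc.
(* The three values reflect the number of solutions y of y^2 = 2 (c - k): one, two and none, the
   last because d is not a square. *)
have N1 : N k = 2%:R^-1 * (r%:R + e).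
  rewrite /N (bigD1 0) ?subrr ?mulr0 ?eqxx //= tr_Pi eqxx mulr1 big1 ?addr0 //.
  by move=> y /andP[]; rewrite mulf_eq0 orbb => ->.
have half c : 2%:R * (k + c / 2%:R - k) = c :> F.
  by rewrite addrAC subrr add0r mulrCA mulfV // mulr1.
have N2 : N (k + 1 / 2%:R) = r%:R.
  have n11 : (1 : F) != -1.
    by rewrite -subr_eq0 opprK -mulr2n -[_ *+ 2]mulr_natr mul1r.
  rewrite /N half (bigD1 1) ?mulr1 //= (bigD1 (-1)) ?mulrNN ?mulr1 ?eqxx //=; last first.
    by rewrite eq_sym.
  rewrite big1 ?addr0 => [|y /andP[/andP[]]]; last first.
    by rewrite -expr2 sqrf_eq1 => /orP[] /eqP ->; rewrite eqxx.
  rewrite !tr_Pi oppr_eq0 oner_eq0 mulr0 addr0 -mulrDl -mulr2n -[_ *+ 2]mulr_natr mulVf ?mul1r //.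
  exact: two_neq0.
have N3 : N (k + d / 2%:R) = 0.
  by rewrite /N half big1 // => y /eqP h; have := hd y; rewrite h eqxx.
have r_neq0 : (r%:R : C) != 0 by rewrite natC_eq0 // -lt0n expn_gt0 (ltnW (finNzRing_gt1 F)).
have rr : (r%:R : C) * r%:R != 1.
  apply/eqP; rewrite -natrM -[1]/(1%:R) => /(natC_inj charC) => h.
  have : (1 < r * r)%N.
    have r1 : (1 < r)%N by rewrite -{1}(expn0 q) ltn_exp2l ?finNzRing_gt1 // -ltnS (prednK n_gt0).
    by rewrite (leq_trans r1) // leq_pmulr // ltnW.
  by rewrite h.
have d12 : N k != N (k + 1 / 2%:R).
  rewrite N1 N2; apply: contra rr => /eqP h.
  have : e = r%:R.
    apply: (addrI r%:R); rewrite -mulr2n -[_ *+ 2]mulr_natl -{2}h mulrA mulfV ?mul1r //.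
    exact: two_neq0.
  by move=> <-; rewrite ee.
have d13 : N k != N (k + d / 2%:R).
  rewrite N1 N3 mulf_eq0 invr_eq0 (negPf (two_neq0 charC)) addr_eq0.
  by apply: contra rr => /eqP ->; rewrite mulrNN ee.
have d23 : N (k + 1 / 2%:R) != N (k + d / 2%:R) by rewrite N2 N3.
(* The three parameters have distinct multiplicities, hence are distinct, so two of them are
   nonzero, against [Neq]. *)
have [k0|k0] := eqVneq k 0.
  have z1 : k + 1 / 2%:R != 0 by rewrite k0 add0r mul1r invr_eq0.
  have z2 : k + d / 2%:R != 0.
    rewrite k0 add0r mulf_eq0 invr_eq0 (negPf char2) orbF.
    by have := hd 0; rewrite mulr0.
  by move: d23; rewrite (Neq _ _ z1 z2) eqxx.
have [z1|z1] := eqVneq (k + 1 / 2%:R) 0; last by move: d12; rewrite (Neq _ _ k0 z1) eqxx.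
have [z2|z2] := eqVneq (k + d / 2%:R) 0; last by move: d13; rewrite (Neq _ _ k0 z2) eqxx.
by move: d23; rewrite z1 z2 eqxx.
Qed.

End RootTrace.

(** * The order of an element commuting with a semilinear map *)

(** Powers of [a] are eventually periodic by finiteness; an exponent beyond the preperiod and
    divisible by the period gives an idempotent. *)
Lemma idempotent_power (T : finNzRingType) (a : T) :
  exists2 m, (0 < m)%N & a ^+ m * a ^+ m = a ^+ m.
Proof.
have [i [j [lij e]]] : exists i j, (i < j)%N /\ a ^+ i = a ^+ j.
  pose f (k : 'I_#|T|.+1) := a ^+ k.
  have /injectivePn[i [j nij e]] : ~~ injectiveb f.
    by apply/negP=> /injectiveP/leq_card; rewrite card_ord ltnn.
  case: (ltngtP i j) => h; first by exists i, j.
    by exists j, i; split.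
  by case/eqP: nij; apply: val_inj.
pose d := (j - i)%N; have d0 : (0 < d)%N by rewrite subn_gt0.
have per k : (i <= k)%N -> a ^+ k = a ^+ (k + d).
  move=> ik; have [c ->] : exists c, k = (i + c)%N by exists (k - i)%N; rewrite subnKC.
  by rewrite addnAC (_ : i + d = j)%N ?subnKC 1?ltnW // !exprD e.
have per' t k : (i <= k)%N -> a ^+ k = a ^+ (k + t * d).
  move=> ik; elim: t => [|t IH]; first by rewrite mul0n addn0.
  by rewrite mulSn addnCA addnC -per ?IH // (leq_trans ik) // leq_addr.
exists (i.+1 * d)%N; first by rewrite muln_gt0.
by rewrite -exprD -per' // (leq_trans (leqnSn i)) // leq_pmulr.
Qed.

Lemma char_poly_intertwine (R : fieldType) (m : nat) (A A' P : 'M[R]_m) : P \in unitmx -> A *m P = P *m A' ->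
  char_poly A = char_poly A'.
Proof.
move=> uP e; rewrite /char_poly; pose Q := map_mx polyC P.
have h : char_poly_mx A *m Q = Q *m char_poly_mx A'.
  rewrite /char_poly_mx mulmxBl mulmxBr -!map_mxM e; congr (_ - _).
  by rewrite mul_scalar_mx mul_mx_scalar.
have dQ : \det Q != 0 by rewrite det_map_mx polyC_eq0 -unitfE -unitmxE.
by apply: (mulIf dQ); rewrite -det_mulmx h det_mulmx mulrC.
Qed.

Section OrderBound.
Variables (F : finFieldType) (n : nat).
Hypothesis n_gt0 : (0 < n)%N.
Hypothesis char2 : (2%:R : F) != 0.
Local Notation N := (dimV n).
Local Notation J := (symp_mx F n).
Local Notation Mx := 'M[F]_N.

(** The adjoint for the symplectic form; a symplectic matrix has its inverse as adjoint. *)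
Definition star (A : Mx) : Mx := J *m A^T *m invmx J.

Let uJ : J \in unitmx. Proof. exact: symp_mx_unit. Qed.

Lemma starM A A' : star (A *m A') = star A' *m star A.
Proof. by rewrite /star trmx_mul !mulmxA mulmxKV. Qed.
Lemma starD A A' : star (A + A') = star A + star A'.
Proof. by rewrite /star linearD /= mulmxDr mulmxDl. Qed.
Lemma starN A : star (- A) = - star A.
Proof. by rewrite /star linearN /= mulmxN mulNmx. Qed.
Lemma starZ c A : star (c *: A) = c *: star A.
Proof. by rewrite /star linearZ /= -scalemxAr -scalemxAl. Qed.
Lemma star1 : star 1%:M = 1%:M.
Proof. by rewrite /star trmx1 mulmx1 mulmxV. Qed.
Lemma starX A k : star (A ^+ k) = star A ^+ k.
Proof. by elim: k => [|k IH]; [by rewrite !expr0 star1 | by rewrite exprSr exprS -[_ * A]/(_ *m A) starM IH]. Qed.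
Lemma star_symp A : is_symplectic A -> star A = invmx A.
Proof.
move=> sA; have uA := symplectic_unit n_gt0 sA; move/eqP: sA => sA.
by rewrite /star -{1}[J](mulKmx uA) -!mulmxA (mulmxA J) (mulmxA A) (mulmxA A J) sA mulmxV // mulmx1.
Qed.

(** The form is nondegenerate on the image of a self-adjoint idempotent: its Gram matrix G is
    invertible and skew, and det G = (- 1)^rank det G. *)
Lemma idem_even (e : Mx) : e *m e = e -> star e = e -> ~~ odd (\rank e).
Proof.
move=> ee se; have eJ : e *m J = J *m e^T by rewrite -{1}se /star mulmxKV.
move: (row_base e) (eq_row_base e) (row_base_free e) => R eR fR; pose G := R *m J *m R^T.
have Re : R *m e = R.
  have /submxP[K ->] : (R <= e)%MS by rewrite eR.
  by rewrite -mulmxA ee.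
have GT : G^T = - G by rewrite /G !trmx_mul trmxK symp_mx_tr mulNmx mulmxN mulmxA.
have uG : G \in unitmx.
  rewrite -row_free_unit -kermx_eq0; apply/rowV0P=> x /sub_kermxP xG.
  have : x *m R = 0.
    apply: (mulJ_inj n_gt0); rewrite mul0mx -Re !mulmxA -(mulmxA _ e) eJ.
    have /submxP[K eK] : (e <= R)%MS by rewrite eR.
    have -> : e^T = R^T *m K^T by rewrite {1}eK trmx_mul.
    rewrite !mulmxA; move: xG; by rewrite /G !mulmxA => ->; rewrite mul0mx.
  by rewrite -[X in _ = X](mul0mx _ R) => /(row_free_inj fR).
apply/negP=> odd_r; have : \det G = (-1) ^+ \rank e * \det G.
  by rewrite -detZ scaleN1r -GT det_tr.
rewrite -signr_odd odd_r expr1 mulN1r => /eqP; rewrite -addr_eq0 -mulr2n -[_ *+ 2]mulr_natl.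
by rewrite mulf_eq0 (negPf char2) /=; move: uG; rewrite unitmxE unitfE => /negPf ->.
Qed.

(** * Boolean algebras of self-adjoint idempotents *)

Section BoolAlg.
Variable I : {set Mx}.
Hypothesis I_idem : forall e, e \in I -> e *m e = e /\ star e = e.
Hypothesis I_comm : forall e f, e \in I -> f \in I -> e *m f = f *m e.
Hypothesis I_mul : forall e f, e \in I -> f \in I -> e *m f \in I.
Hypothesis I_sub : forall e f, e \in I -> f \in I -> f *m e = f -> e - f \in I.

(** Under a splitting e = f + g the counts below f and g multiply and the ranks, which are even,
    add. An indecomposable nonzero e has rank at least 2 and only 0 and e below it. The bound [r]
    serves the induction. *)
Lemma card_idempotents r e : e \in I -> (\rank e <= r)%N ->
  (#|[set f in I | f *m e == f]| <= 2 ^ (\rank e)./2)%N.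
Proof.
elim: r e => [|r IH] e eI re; have [ee se] := I_idem eI.
  have e0 : e = 0 by apply/eqP; rewrite -mxrank_eq0 -leqn0.
  apply: (@leq_trans #|[set (0%R : Mx)]|); last by rewrite cards1 expn_gt0.
  by apply/subset_leq_card/subsetP=> f; rewrite !inE e0 mulmx0 => /andP[_]; rewrite eq_sym.
have [f /and4P[fI /eqP fe f0 ne]|h] := pickP [pred f in I | [&& f *m e == f, f != 0 & f != e]].
  pose g := e - f; have gI : g \in I by apply: I_sub.
  have [ff _] := I_idem fI; have [gg _] := I_idem gI.
  have ef : e *m f = f by rewrite I_comm.
  have gf : g *m f = 0 by rewrite mulmxBl ef ff subrr.
  have fg : f *m g = 0 by rewrite mulmxBr fe ff subrr.
  have ge : g *m e = g by rewrite mulmxBl ee fe.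
  have g0 : g != 0 by rewrite subr_eq0 eq_sym.
  have rk : \rank e = (\rank f + \rank g)%N.
    have -> : \rank e = \rank (f + g)%MS.
      apply/eqP; rewrite eqn_leq; apply/andP; split; apply: mxrankS.
        by rewrite -[e](subrK f) addrC addmx_sub_adds.
      by rewrite addsmx_sub -{1}fe -{1}ge !submxMl.
    apply/eqP; rewrite -mxrank_sum_cap -{1}[\rank (f + g)%MS]addn0 eqn_add2l eq_sym mxrank_eq0.
    rewrite -submx0; apply/rV_subP=> u; rewrite sub_capmx => /andP[/submxP[a ->] /submxP[b e1]].
    by rewrite -{1}ff mulmxA e1 -mulmxA gf mulmx0 sub0mx.
  have rf : (\rank f <= r)%N.
    have : (0 < \rank g)%N by rewrite lt0n mxrank_eq0.
    by move: re; rewrite rk; lia.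
  have rg : (\rank g <= r)%N.
    have : (0 < \rank f)%N by rewrite lt0n mxrank_eq0.
    by move: re; rewrite rk; lia.
  have hf := IH f fI rf; have hg := IH g gI rg.
  have ev := idem_even (I_idem fI).1 (I_idem fI).2.
  rewrite rk halfD (negPf ev) add0n expnD.
  apply: leq_trans (leq_mul hf hg).
  rewrite -cardsX -(card_in_imset (f := fun x => (x *m f, x *m g))); last first.
    move=> x y; rewrite !inE => /andP[_ /eqP xe] /andP[_ /eqP ye] [] h1 h2.
    have efg : e = g + f by rewrite subrK.
    have ez z : z *m e = z *m g + z *m f by rewrite -[LHS]/(z *m e) [in LHS]efg; exact: mulmxDr.
    by rewrite -xe -ye !ez h1 h2.
  apply/subset_leq_card/subsetP=> z /imsetP[x]; rewrite !inE => /andP[xI _] -> /=.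
  by rewrite !I_mul // -!mulmxA ff gg !eqxx.
have := idem_even ee se; have [->|e0 ev] := eqVneq e 0.
  rewrite mxrank0 expn0 => _.
  apply: (@leq_trans #|[set (0%R : Mx)]|); last by rewrite cards1.
  by apply/subset_leq_card/subsetP=> f; rewrite !inE mulmx0 => /andP[_]; rewrite eq_sym.
have r2 : (0 < (\rank e)./2)%N.
  have : (0 < \rank e)%N by rewrite lt0n mxrank_eq0.
  by case: (\rank e) ev => [|[|k]].
apply: (leq_trans (_ : _ <= #|[set (0%R : Mx); e]|)%N); last first.
  by rewrite cards2 (leq_trans _ (leq_pexp2l _ r2)) //; case: (_ != _).
apply/subset_leq_card/subsetP=> f; rewrite !inE => /andP[fI fe].
have := h f; rewrite /= fI fe /=; case: eqP => //= _; by case: eqP.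
Qed.
End BoolAlg.

Variable x : {'GL_(2 * n)[F]}.
Hypothesis xS : x \in Sp n F.
Variables (s : {rmorphism F -> F}) (M : Mx).
Hypothesis uM : M \in unitmx.
Hypothesis sxM : map_mx s (GLval x) *m M = M *m GLval x.

Local Notation nu := (GLval x).
Local Notation nu' := (invmx (GLval x)).
Let F0 := {a : F | s a == a}.

Let unu : nu \in unitmx. Proof. exact: GLval_unitmx. Qed.
Let nuV : nu * nu' = 1. Proof. exact: mulmxV. Qed.
Let nuVl : nu' * nu = 1. Proof. exact: mulVmx. Qed.

(** The algebra F^s[x]. Keeping the coefficients in the fixed field is the source of the factor
    |F^s|^n. *)
Definition inR (A : Mx) := exists p : {poly F}, map_poly s p = p /\ A = horner_mx nu p.

Lemma inR1 : inR 1.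
Proof. by exists 1; rewrite rmorph1 rmorph1. Qed.
Lemma inR_nu : inR nu.
Proof. by exists 'X; rewrite map_polyX horner_mx_X. Qed.
Lemma inRD A A' : inR A -> inR A' -> inR (A + A').
Proof. by move=> [a [h ->]] [b [h' ->]]; exists (a + b); rewrite !rmorphD /= h h'. Qed.
Lemma inRN A : inR A -> inR (- A).
Proof. by move=> [a [h ->]]; exists (- a); rewrite !rmorphN /= h. Qed.
Lemma inRM A A' : inR A -> inR A' -> inR (A * A').
Proof. by move=> [a [h ->]] [b [h' ->]]; exists (a * b); rewrite !rmorphM /= h h'. Qed.
Lemma inRX A k : inR A -> inR (A ^+ k).
Proof. by move=> h; elim: k => [|k IH]; [exact: inR1 | rewrite exprS; apply: inRM]. Qed.
Lemma inRV (A : Mx) : A \in unitmx -> inR A -> inR (invmx A).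
Proof.
move=> uA hA; pose g := toGL A.
have e : (g^-1 = g ^+ #[g].-1)%g.
  apply: (@mulgI _ g); by rewrite mulgV -expgS prednK ?order_gt0 // expg_order.
have := congr1 GLval e; rewrite GLvalV GLvalX toGLK // => ->.
exact: inRX.
Qed.
Lemma inR_comm A A' : inR A -> inR A' -> A * A' = A' * A.
Proof. by move=> [a [h ->]] [b [h' ->]]; rewrite -!rmorphM /= mulrC. Qed.

(** M intertwines x with its image under s. Hence reduction modulo the characteristic polynomial
    stays over the fixed field. *)
Lemma char_nu_fix : map_poly s (char_poly nu) = char_poly nu.
Proof.
rewrite map_char_poly; exact: char_poly_intertwine sxM.
Qed.

Let E (j : nat) : Mx := nu ^+ j - nu' ^+ j.

Definition inE_span (A : Mx) := exists d : {ffun 'I_n -> F},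
  (forall j, s (d j) = d j) /\ A = \sum_(j < n) d j *: E j.+1.

Lemma inE_spanD A A' : inE_span A -> inE_span A' -> inE_span (A + A').
Proof.
move=> [d [hd ->]] [d' [hd' ->]]; exists [ffun j => d j + d' j]; split=> [j|].
  by rewrite ffunE rmorphD /= hd hd'.
by rewrite -big_split; apply: eq_bigr => j _; rewrite ffunE scalerDl.
Qed.
Lemma inE_spanZ c A : s c = c -> inE_span A -> inE_span (c *: A).
Proof.
move=> hc [d [hd ->]]; exists [ffun j => c * d j]; split=> [j|].
  by rewrite ffunE rmorphM /= hc hd.
by rewrite scaler_sumr; apply: eq_bigr => j _; rewrite ffunE scalerA.
Qed.
Lemma inE_span0 : inE_span 0.
Proof.
exists [ffun=> 0]; split=> [j|]; first by rewrite ffunE rmorph0.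
by rewrite big1 // => j _; rewrite ffunE scale0r.
Qed.
Lemma inE_spanE k : (k <= n)%N -> inE_span (E k).
Proof.
case: k => [_|k kn]; first by rewrite /E !expr0 subrr; apply: inE_span0.
exists [ffun j : 'I_n => (j == k :> nat)%:R]; split=> [j|].
  by rewrite ffunE rmorph_nat.
rewrite (bigD1 (Ordinal kn)) //= ffunE eqxx scale1r big1 ?addr0 // => j.
by rewrite -val_eqE /= => /negPf h; rewrite ffunE h scale0r.
Qed.

Let starnu : star nu = nu'. Proof. by apply: star_symp; rewrite -SpE. Qed.
Let starnu' : star nu' = nu.
Proof.
rewrite star_symp ?invmxK //; apply: symplecticV => //; by rewrite -SpE.
Qed.

Lemma nu_cancel i j : nu ^+ (i + j) * nu' ^+ i = nu ^+ j.
Proof.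
elim: i => [|i IH]; first by rewrite mulr1.
by rewrite addSn exprSr exprS mulrA -(mulrA _ nu) nuV mulr1.
Qed.

Lemma nu_cancel' i j : nu ^+ i * nu' ^+ (i + j) = nu' ^+ j.
Proof.
elim: i => [|i IH]; first by rewrite mul1r.
by rewrite addSn exprSr exprS mulrA -(mulrA _ nu) nuV mulr1.
Qed.

(** A can be written with exponents of x between 1 - n and n: multiply by x^(n-1), reduce modulo the
    characteristic polynomial, of degree 2 n, and divide back. Taking the skew part turns each power
    into a multiple of some [E k] with k <= n. *)
Lemma skew_in_span A : inR A -> star A = - A -> inE_span A.
Proof.
move=> hA sA.
have [p [hp hE]] : inR (nu ^+ n.-1 * A) by apply: inRM => //; apply: inRX; apply: inR_nu.
pose r := p %% char_poly nu.
have hr : map_poly s r = r by rewrite map_modp char_nu_fix hp.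
have rE : horner_mx nu p = horner_mx nu r.
  by rewrite {1}(divp_eq p (char_poly nu)) rmorphD rmorphM /= Cayley_Hamilton mulr0 add0r.
have sr : (size r <= n + n)%N.
  rewrite -ltnS; have : (size r < size (char_poly nu))%N by rewrite ltn_modp -size_poly_eq0 size_char_poly.
  by rewrite size_char_poly (dimV_eq n_gt0) mul2n addnn.
have AE : A = \sum_(i < n + n) r`_i *: (nu ^+ i * nu' ^+ n.-1).
  have cA : A = nu ^+ n.-1 * A * nu' ^+ n.-1.
    have -> : nu ^+ n.-1 * A = A * nu ^+ n.-1 by apply: inR_comm => //; apply: inRX; apply: inR_nu.
    by rewrite -mulrA -[X in nu ^+ X](addn0 n.-1) nu_cancel mulr1.
  rewrite cA hE rE.
  have {1}-> : r = \poly_(i < n + n) r`_i.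
    by apply/polyP=> i; rewrite coef_poly; case: ltnP => // h; rewrite nth_default // (leq_trans sr).
  rewrite poly_def linear_sum mulr_suml; apply: eq_bigr => i _ /=.
  by rewrite linearZ rmorphXn /= horner_mx_X -scalerAl.
have half : A = 2%:R^-1 *: (A - star A).
  by rewrite sA opprK -mulr2n -scaler_nat scalerA mulVf // scale1r.
have s2 : s 2%:R^-1 = 2%:R^-1 by rewrite fmorphV rmorph_nat.
rewrite half; apply: inE_spanZ => //.
have -> : A - star A = \sum_(i < n + n) r`_i *: (nu ^+ i * nu' ^+ n.-1 - nu ^+ n.-1 * nu' ^+ i).
  have starsum (I : Type) (l : seq I) (G : I -> Mx) : star (\sum_(i <- l) G i) = \sum_(i <- l) star (G i).
    elim: l => [|a l IH]; first by rewrite !big_nil /star trmx0 mulmx0 mul0mx.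
    by rewrite !big_cons starD IH.
  rewrite {1 2}AE starsum -sumrB; apply: eq_bigr => i _.
  by rewrite scalerBr starZ; congr (_ - _ *: _); rewrite starM !starX starnu starnu'.
have hc i : s r`_i = r`_i by rewrite -{2}hr coef_map.
elim/big_ind: _ => [|a b|i _]; [exact: inE_span0 | exact: inE_spanD|].
case: (leqP n.-1 i) => h.
  apply: inE_spanZ => //; rewrite -(subnKC h) nu_cancel nu_cancel'.
  by apply: inE_spanE; have := ltn_ord i; lia.
have -> : r`_i *: (nu ^+ i * nu' ^+ n.-1 - nu ^+ n.-1 * nu' ^+ i) = (- r`_i) *: E (n.-1 - i).
  rewrite -{1 2}(subnKC (ltnW h)) nu_cancel' nu_cancel.
  by rewrite /E scaleNr -scalerN opprB.
by apply: inE_spanZ; [rewrite rmorphN /= hc | apply: inE_spanE; lia].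
Qed.

(** Self-adjoint idempotents commuting with the whole centralizer of x. Unlike [inR] this condition
    is boolean, and it makes any two of them commute. *)
Let Iset : {set Mx} := [set e : Mx | [&& e * e == e, star e == e &
  [forall X : Mx, (X * nu == nu * X) ==> (e * X == X * e)]]].

Lemma IsetP e : reflect [/\ e * e = e, star e = e &
  forall X, X * nu = nu * X -> e * X = X * e] (e \in Iset).
Proof.
rewrite [_ \in Iset]inE; apply: (iffP and3P) => [[/eqP h1 /eqP h2 /forallP h3]|[h1 h2 h3]].
  by split=> // X hX; apply/eqP; apply: (implyP (h3 X)); apply/eqP.
split; try exact/eqP; apply/forallP=> X; apply/implyP=> /eqP hX; apply/eqP; exact: h3.
Qed.

Lemma card_Iset : (#|Iset| <= 2 ^ n)%N.
Proof.
have comm e f : e \in Iset -> f \in Iset -> e * f = f * e.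
  move=> /IsetP[_ _ h] /IsetP[_ _ h']; apply: h; apply: h'; by [].
have I1 : (1 : Mx) \in Iset.
  by apply/IsetP; split; rewrite ?mulr1 ?star1 // => X _; rewrite mul1r mulr1.
have : (#|[set f in Iset | f *m (1%R : Mx) == f]| <= 2 ^ (\rank (1%R : Mx))./2)%N.
  apply: (@card_idempotents Iset _ _ _ _ (\rank (1 : Mx))) => //.
  - by move=> e /IsetP[].
  - move=> e f eI fI; have [e1 e2 e3] := IsetP _ eI; have [f1 f2 f3] := IsetP _ fI.
    apply/IsetP; split.
    + by rewrite -mulrA (mulrA f) (comm f e) // -mulrA f1 mulrA e1.
    + by rewrite starM e2 f2 -[RHS](comm f e).
    + by move=> X hX; rewrite -[(_ *m _) * X]mulrA f3 // mulrA e3 // -mulrA.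
  - move=> e f eI fI fe; have [e1 e2 e3] := IsetP _ eI; have [f1 f2 f3] := IsetP _ fI.
    apply/IsetP; split.
    + have ef : e * f = f by rewrite comm.
      have fe' : f * e = f by [].
      by rewrite mulrBl !mulrBr e1 f1 ef fe' subrr subr0.
    + by rewrite starD starN e2 f2.
    + by move=> X hX; rewrite mulrBl mulrBr e3 // f3.
rewrite -[(1 : Mx)]/(1%:M : Mx) mxrank1.
have -> : (N./2 = n)%N by have := dimV_eq n_gt0; lia.
apply: leq_trans.
by apply/subset_leq_card/subsetP=> e eI; rewrite inE eI mulmx1 eqxx.
Qed.

Let gz (d : {ffun 'I_n -> F0}) : Mx := \sum_(j < n) val (d j) *: E j.+1.

(** The code k = (e, d) of y: with t = y (2 e - 1), the Cayley transform (1 - t) / (1 + t) is the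
    skew element [gz d]. The equation avoids the quotient. *)
Let Pr (y : Mx) (k : Mx * {ffun 'I_n -> F0}) : Prop :=
  k.1 \in Iset /\ gz k.2 * (1 + y * (2%:R *: k.1 - 1)) = 1 - y * (2%:R *: k.1 - 1).

Let refl_sq e : e * e = e -> (2%:R *: e - 1) * (2%:R *: e - 1) = 1 :> Mx.
Proof.
move=> ee; rewrite mulrBl !mulrBr !mulr1 !mul1r -scalerAl -scalerAr ee scalerA.
apply/matrixP=> i j; rewrite !mxE; ring.
Qed.

Let two_unit (A : Mx) (A' : Mx) : A * A' = 2%:R *: 1 -> A \in unitmx.
Proof.
move=> h; have : A *m (2%:R^-1 *: A') = 1%:M.
  by rewrite -scalemxAr [A *m A']h scalerA mulVf // scale1r.
by case/mulmx1_unit.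
Qed.

(** 1 + gz d is invertible, so the Cayley transform can be undone to recover t, and 2 e - 1 is its
    own inverse. *)
Lemma Pr_inj y y' k : Pr y k -> Pr y' k -> y = y'.
Proof.
case: k => e d [/= eI h] [_ h']; have [ee _ _] := IsetP _ eI.
set t := y * _ in h; set t' := y' * _ in h'.
have key u : gz d * (1 + u) = 1 - u -> (gz d + 1) * (1 + u) = 2%:R *: 1 /\ (gz d + 1) * u = 1 - gz d.
  move=> hu; split; first by rewrite mulrDl hu mul1r addrACA addNr addr0 scaler_nat.
  rewrite mulrDr mulr1 in hu; rewrite mulrDl mul1r.
  by apply/eqP; rewrite eq_sym subr_eq addrC addrA hu subrK.
have [k1 k2] := key t h; have [_ k2'] := key t' h'.
have uz := two_unit k1.
have tt : t = t'.
  have : (gz d + 1) *m t = (gz d + 1) *m t' by rewrite [_ *m t]k2 [_ *m t']k2'.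
  by move/(congr1 (mulmx (invmx (gz d + 1)))); rewrite !mulKmx.
by rewrite -[y]mulr1 -(refl_sq ee) mulrA -/t tt /t' -mulrA refl_sq // mulr1.
Qed.

(** Take for e an idempotent power of 1 + y. Where e is 1, 1 + y is invertible and t = y; where e is
    0, y is - 1 plus a nilpotent and t = - y. In both places 1 + t is invertible. *)
Lemma Pr_exists y : inR y -> star y * y = 1 -> exists k, Pr y k.
Proof.
move=> hy sy; have [m m0 hm] := idempotent_power (1 + y); set e := _ ^+ m in hm.
have uy : y \in unitmx by have /mulmx1_unit[] : star y *m y = 1%:M by [].
have ys : y * star y = 1.
  have : y *m (star y *m y) *m invmx y = y *m 1%:M *m invmx y by congr (_ *m _ *m _).
  by rewrite mulmx1 mulmxV // mulmxA mulmxK.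
have sye : star y = invmx y by rewrite -[LHS]mulr1 -[1](mulmxV uy) mulrA [star y * y]sy mul1r.
have hs : inR (star y) by rewrite sye; apply: inRV.
have he : inR e by apply: inRX; apply: inRD => //; apply: inR1.
have cy : y * e = e * y by apply: inR_comm.
have se : star e = e.
  have s1 : star (1 + y) = star y * (1 + y) by rewrite starD [star 1]star1 mulrDr mulr1 sy addrC.
  have s2 : star e = star y ^+ m * e.
    rewrite starX s1 exprMn_comm //; apply: inR_comm => //; apply: inRD => //; exact: inR1.
  have s3 : y ^+ m * star e = e.
    rewrite s2 mulrA -exprMn_comm; last by rewrite /GRing.comm ys sy.
    by rewrite ys expr1n mul1r.
  have hse : inR (star e) by rewrite s2; apply: inRM => //; apply: inRX.
  have h1 : star e * e = star e by rewrite s2 -mulrA hm.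
  have h2 : e * star e = e.
    by rewrite -{1}s3 -mulrA -[star e * star e]starM [e *m e]hm s3.
  by rewrite -h1 inR_comm.
have eI : e \in Iset.
  apply/IsetP; split=> // X hX; have [p [_ ->]] := he.
  apply/esym; exact: (comm_mx_horner p (hX : comm_mx X nu)).
set c := 2%:R *: e - 1; set t := y * c.
have cc : c * c = 1 by apply: refl_sq.
have hc : inR c.
  have -> : c = e + e - 1 by rewrite /c scaler_nat mulr2n.
  by apply: inRD; [apply: inRD | apply: inRN; apply: inR1].
have ht : inR t by apply: inRM.
have sc : star c = c by rewrite /c starD starN starZ se [star 1]star1.
have st : star t * t = 1.
  rewrite /t starM sc -[_ *m _]/(c * star y) mulrA -(mulrA c) sy mulr1 cc //.
have ut : (1 + t) \in unitmx.
  rewrite -row_free_unit -kermx_eq0; apply/rowV0P=> u /sub_kermxP h.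
  have te : t * e = y * e by rewrite /t /c -mulrA mulrBl -scalerAl hm mul1r scaler_nat mulr2n addrK.
  have h1 : u *m e *m (1 + y) = 0.
    have : u *m (1 + t) *m e = 0 by rewrite h mul0mx.
    rewrite -mulmxA [(1 + t) *m e]mulrDl mul1r te cy => <-.
    by rewrite -mulmxA [e *m _]mulmxDr mulmx1.
  have ue : u *m e = 0.
    have : u *m e *m (1 + y) ^+ m = 0.
      by rewrite -(prednK m0) exprS -[_ * _]/(_ *m _) mulmxA h1 mul0mx.
    by rewrite -mulmxA -/e [e *m e]hm.
  have h2 : u *m y = u.
    have : u *m (1 + t) = 0 by [].
    have -> : t = 2%:R *: (e * y) - y by rewrite /t /c mulrBr mulr1 -scalerAr cy.
    rewrite mulmxDr mulmxBr mulmx1 -scalemxAr [u *m (e * y)]mulmxA ue mul0mx scaler0 sub0r.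
    by move/eqP; rewrite subr_eq0 => /eqP.
  have pw k : u *m (1 + y) ^+ k = 2%:R ^+ k *: u.
    elim: k => [|k IH]; first by rewrite mulmx1 scale1r.
    rewrite exprSr -[_ * _]/(_ *m _) mulmxA IH -scalemxAl mulmxDr mulmx1 h2 -mulr2n.
    by rewrite -scaler_nat scalerA -exprSr.
  move: (pw m); rewrite -/e ue => /esym/eqP; rewrite scaler_eq0 expf_eq0 (negPf char2) andbF.
  by move/eqP.
pose z := (1 - t) * invmx (1 + t).
have hz : inR z.
  apply: inRM; first by apply: inRD; [exact: inR1 | exact: inRN].
  by apply: inRV => //; apply: inRD => //; exact: inR1.
have zt : z * (1 + t) = 1 - t by rewrite /z -mulrA [invmx _ * _]mulVmx // mulr1.
have sz : star z = - z.
  have h1 : star z * star (1 + t) = star (1 - t).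
    rewrite -[_ * _]starM -[_ *m _]/((1 + t) * z) (inR_comm (_ : inR (1 + t))) ?zt //.
    by apply: inRD => //; exact: inR1.
  have h2 : star z * (1 + t) = t - 1.
    have := congr1 (fun A => A * t) h1; rewrite /= -mulrA !starD starN [star 1]star1 !mulrDl mul1r mulNr st.
    by rewrite addrC.
  have := congr1 (mulmx^~ (invmx (1 + t))) h2; rewrite -[_ * _]/(_ *m _) mulmxK // => ->.
  by rewrite -mulNmx opprB.
have [d [hd zE]] := skew_in_span hz sz.
have hd' j : s (d j) == d j by rewrite hd.
exists (e, [ffun j => exist _ (d j) (hd' j)]); split=> //=.
have -> : gz [ffun j => exist _ (d j) (hd' j)] = z; last exact: zt.
by rewrite zE /gz; apply: eq_bigr => j _; rewrite ffunE.
Qed.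

(** With K the order modulo signs, the 2 K elements x^i and - x^i, i < K, are distinct and so have
    distinct codes. *)
Lemma order_bound : (2 * #[coset 'Z(Sp n F) x]%g <= 2 ^ n * #|[set a : F | s a == a]| ^ n)%N.
Proof.
set K := #[_]%g.
pose y (ib : 'I_K * bool) : Mx := (-1) ^+ ib.2 *: nu ^+ ib.1.
have h ib : exists k, Pr (y ib) k.
  have sg b : ((-1) ^+ b * (-1) ^+ b = 1 :> F) by rewrite -expr2 sqrr_sign.
  apply: Pr_exists.
    rewrite /y; case: ib => i [] /=; rewrite ?expr1 ?expr0 ?scaleN1r ?scale1r;
      by [apply: inRN; apply: inRX; apply: inR_nu | apply: inRX; apply: inR_nu].
  rewrite /y starZ starX starnu -scalerAl -scalerAr scalerA sg scale1r.
  by rewrite -exprMn_comm ?nuVl ?expr1n // /GRing.comm nuV nuVl.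
have [f hf] := fin_all_exists h.
have injf : injective (fun ib => f ib).
  move=> ib ib' e.
  have ey : y ib = y ib' by apply: (@Pr_inj _ _ (f ib)); [exact: hf | rewrite e; exact: hf].
  move: ib ib' ey {e} => [i b] [i' b']; rewrite /y /= => ey.
  have nuXn0 k : nu ^+ k != 0.
    apply/eqP=> z; have := unitr1 Mx; rewrite -(expr1n _ k) -nuV exprMn_comm ?z ?mul0r ?unitr0 //.
    by rewrite /GRing.comm nuV nuVl.
  have xX k : (x ^+ k)%g \in Sp n F by rewrite groupX.
  have ec : coset 'Z(Sp n F) (x ^+ i)%g = coset 'Z(Sp n F) (x ^+ i')%g.
    have [ebb|nbb] := eqVneq b b'.
      move: ey; rewrite ebb => /(congr1 (fun A => (-1) ^+ b' *: A)).
      have sg : ((-1) ^+ b' * (-1) ^+ b' = 1 :> F) by rewrite -expr2 sqrr_sign.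
      rewrite !scalerA sg !scale1r -!GLvalX => e; congr (coset _ _); exact: GLval_inj.
    have e : (x ^+ i = m1 F n * x ^+ i')%g.
      apply: GLval_inj; rewrite GLvalM GLval_m1 // !GLvalX mulNmx mul1mx.
      move: ey nbb; case: (b) (b') => [] [] //=; rewrite expr1 expr0 scaleN1r scale1r.
        by move=> <-; rewrite opprK.
      by move=> ->.
    have mZ : m1 F n \in 'Z(Sp n F) by apply/(center_SpP n_gt0 char2); right.
    by rewrite e; apply: coset_kerl.
  have nx : x \in 'N('Z(Sp n F)) by apply: Sp_normZ.
  have ii : i = i' :> nat.
    move: ec; rewrite !morphX // => /eqP; rewrite eq_expg_mod_order.
    by rewrite !modn_small => [/eqP|//|//].
  have {ii} ii : i = i' by apply: val_inj.
  congr pair => //; move: ey; rewrite ii => /eqP; rewrite -subr_eq0 -scalerBl scaler_eq0.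
  rewrite (negPf (nuXn0 _)) orbF; case: (b) (b') => [] [] //=; rewrite expr1 expr0.
    by rewrite -opprD oppr_eq0 -[1 + 1]/(2%:R) (negPf char2).
  by rewrite opprK -[1 + 1]/(2%:R) (negPf char2).
have cardD : (#|{: 'I_K * bool}| <= #|setX Iset [set: {ffun 'I_n -> F0}]|)%N.
  rewrite -cardsT -(card_imset _ injf); apply/subset_leq_card/subsetP=> _ /imsetP[ib _ ->].
  by have [h1 _] := hf ib; rewrite (surjective_pairing (f ib)) in_setX h1 inE.
move: cardD; rewrite card_prod card_ord card_bool mulnC => /leq_trans; apply.
rewrite cardsX cardsT card_ffun card_ord; apply: leq_mul; first exact: card_Iset.
by rewrite card_sig leq_exp2r // -(@cardsE _ (fun a => s a == a)).
Qed.

End OrderBound.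

(** * Products of blocks and their least common multiple *)

Section Arith.
Local Open Scope nat_scope.
Variables (n q : nat).
Hypotheses (q_odd : odd q) (q_gt2 : 2 < q) (n_gt1 : 1 < n) (nq : (n, q) <> (2, 3)).

Definition pmn (b : nat * bool) := pm b.2 (q ^ b.1).

Let qX_odd a : odd (q ^ a). Proof. by rewrite oddX q_odd orbT. Qed.
Let qX_gt0 a : 0 < q ^ a. Proof. by rewrite expn_gt0; lia. Qed.
Let qX_mono a b : a <= b -> 3 ^ a <= q ^ b.
Proof.
move=> ab; apply: (@leq_trans (3 ^ b)); first by rewrite leq_exp2l.
by case: b ab => // b _; rewrite leq_exp2r.
Qed.

Lemma pmn_half b : pmn b = 2 * (pmn b)./2.
Proof. by have := qX_odd b.1; rewrite /pmn /pm; case: b.2; lia. Qed.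

(** The starting value 2 accounts for the eigenvalues of square 1, which belong to no block. *)
Definition blk_lcm (bl : seq (nat * bool)) := \big[lcmn/2]_(b <- bl) pmn b.

(** Here j counts the blocks of size 1, c the larger ones, and A is the total size of the latter. L
    is the share of the blocks of size 1, at most (q^2 - 1) / 2 = lcm (q - 1, q + 1), and P is the
    product of the halves of the other weights: all weights are even, so the lcm needs a single
    factor 2. The ratio 5/9 is (9 + 1) / 18, as q^a >= 9 for a >= 2. *)
Lemma lcm_bound bl : all (fun b => 0 < b.1) bl ->
  exists j c A L P, [/\ j + c = size bl, j + A = \sum_(b <- bl) b.1, 2 * c <= A,
    (c = 0 -> A = 0) /\ 9 ^ c * P <= 5 ^ c * q ^ A &
    [/\ 0 < P, 0 < L, ~~ odd L, blk_lcm bl %| L * P &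
    [\/ j = 0 /\ L = 2, j = 1 /\ (L = q.-1 \/ L = q.+1) | 1 < j /\ 2 * L + 1 = q ^ 2]]].
Proof.
have [h qE] : exists h, q = 2 * h + 1 by exists q./2; lia.
elim: bl => [_|b bl IH /= /andP[b0 /IH]].
  exists 0, 0, 0, 2, 1; split; rewrite ?big_nil //; split=> //; last by apply: Or31.
  by rewrite /blk_lcm big_nil.
move=> [j] [c] [A] [L] [P] [e1 e2 e3 [e4 e4'] [P0 L0 Lodd Ldvd Lc]].
rewrite !big_cons /blk_lcm big_cons -/(blk_lcm bl).
have [b1|b1] := eqVneq b.1 1.
  have mE : pmn b = q.-1 \/ pmn b = q.+1 by rewrite /pmn b1 expn1 /pm; case: b.2; [right|left].
  suff [L' [d1 d2 L'0 L'odd hc]] : exists L', [/\ pmn b %| L', L %| L', 0 < L', ~~ odd L' &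
     (j.+1 = 1 /\ (L' = q.-1 \/ L' = q.+1)) \/ (1 < j.+1 /\ 2 * L' + 1 = q ^ 2)].
    exists j.+1, c, A, L', P; split=> //; [by rewrite addSn e1 | by rewrite addSn e2 b1 add1n |].
    split=> //; last by case: hc => h'; [apply: Or32 | apply: Or33].
    rewrite dvdn_lcm; apply/andP; split; first exact: dvdn_mulr.
    by apply: dvdn_trans Ldvd _; apply: dvdn_mul.
  have big m : m = q.-1 \/ m = q.+1 -> m %| 2 * (h * h.+1).
    case=> ->; rewrite qE addn1 /= ?succnK mulnA; first exact: dvdn_mulr.
    have -> : (2 * h).+2 = 2 * h.+1 by lia.
    by rewrite mulnAC dvdn_mulr.
  have q2 : 2 * (2 * (h * h.+1)) + 1 = q ^ 2 by rewrite qE; lia.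
  case: Lc => [[j0 ->]|[j1 hL]|[j2 hL]].
  - exists (pmn b); split; [exact: dvdnn | by rewrite [X in _ %| X]pmn_half dvdn_mulr | | |].
    + by case: mE => ->; lia.
    + by case: mE => ->; lia.
    + by left; split; [lia | exact: mE].
  - exists (2 * (h * h.+1)); split; [exact: big | exact: big | lia | lia | right; split; lia].
  - exists L; split=> //; last by right; split; lia.
    by have -> : L = 2 * (h * h.+1); [lia | exact: big].
exists j, c.+1, (b.1 + A), L, (P * (pmn b)./2); split=> //; [lia|lia|lia| |].
  split; first lia.
  have u9 : 9 * (pmn b)./2 <= 5 * q ^ b.1.
    have := @qX_mono 2 b.1; have := pmn_half b; rewrite /pmn /pm.
    by case: b.2 => /=; lia.
  rewrite !expnS expnD.
  have := leq_mul e4' u9; lia.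
split=> //.
- rewrite muln_gt0 P0 /=; have := @qX_mono 2 b.1; have := pmn_half b; rewrite /pmn /pm.
  by case: b.2 => /=; lia.
- rewrite dvdn_lcm; apply/andP; split.
    have [l ->] : exists l, L = 2 * l by exists L./2; lia.
    by rewrite {1}pmn_half mulnA dvdn_mul // -mulnA dvdn_mulr.
  by rewrite mulnA; apply: dvdn_mulr.
Qed.

Lemma lcm_even_dvd x y : lcmn (2 * x) (2 * y) %| 2 * x * y.
Proof. by rewrite dvdn_lcm dvdn_mulr // mulnAC dvdn_mulr. Qed.

(** [r] is half the number of eigenvalues of square 1, and N is at most L P. Outside (n, q) = (2,
    3), either there are at most two blocks and r = 0, or L P is below (q^n - 1) / 2; a positive r
    alone costs a factor q^r >= 3. *)
Lemma two_blocks (bl : seq (nat * bool)) r N :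
  all (fun b => 0 < b.1) bl -> \sum_(b <- bl) b.1 + r = n ->
  0 < N -> N %| blk_lcm bl ->
  (forall b, bl = [:: b] -> r = 0 -> N %| (pmn b)./2) ->
  q ^ n <= 2 * N + 1 ->
  r = 0 /\ ((exists b, bl = [:: b] /\ 2 * N = pmn b) \/
            exists b b', bl = [:: b; b'] /\ 2 * N = pmn b * pmn b').
Proof.
move=> bl0 sn N0 NL N1 NX.
have [j [c [A [L [P [e1 e2 e3 [e4 e5] [P0 L0 Lodd Ldvd Lc]]]]]]] := lcm_bound bl0.
have NLP : N <= L * P by apply: dvdn_leq (dvdn_trans NL Ldvd); rewrite muln_gt0 L0.
have nE : n = j + A + r by rewrite e2.
have XE : q ^ n = q ^ j * q ^ A * q ^ r by rewrite nE !expnD.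
have X9 := @qX_mono 2 n n_gt1.
have r3 : 0 < r -> 3 <= q ^ r by move=> r0; have := @qX_mono 1 r r0.
have rX : q ^ j * q ^ A <= q ^ n by rewrite XE leq_pmulr.
have rX3 : 0 < r -> 3 * (q ^ j * q ^ A) <= q ^ n by move=> /r3 h; rewrite XE mulnC leq_mul2l h orbT.
have q1 := expn1 q.
have q2E : q ^ 2 = q * q by rewrite -mulnn.
(* L is the part of the lcm which comes from the blocks of size 2. *)
have L2 : L <= 2 * q ^ j.
  case: Lc => [[-> ->]|[-> h]|[h1 h2]] //; first by rewrite expn1; lia.
  have : q ^ 2 <= q ^ j by rewrite leq_exp2l; lia.
  lia.
have L34 : 0 < j -> 3 * L <= 4 * q ^ j.
  case: Lc => [[-> ->]|[-> h]|[h1 h2]] // _; first by rewrite expn1; lia.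
  have : q ^ 2 <= q ^ j by rewrite leq_exp2l; lia.
  lia.
have L12 : 1 < j -> 2 * L <= q ^ j.
  case: Lc => [[-> ->]|[-> h]|[h1 h2]] // _.
  have : q ^ 2 <= q ^ j by rewrite leq_exp2l; lia.
  lia.
have two : size bl = 2 -> r = 0 -> r = 0 /\ ((exists b, bl = [:: b] /\ 2 * N = pmn b) \/
            exists b b', bl = [:: b; b'] /\ 2 * N = pmn b * pmn b').
  case: bl bl0 sn NL {N1 Ldvd e1 e2} => [|b [|b' []]] // /and3P[b0 b0' _] sn NL _ r0.
  split=> //; right; exists b, b'; split=> //.
  move: sn NL; rewrite /blk_lcm !big_cons !big_nil r0 !addn0 => sn.
  have -> : lcmn (pmn b') 2 = pmn b' by apply/eqP; rewrite eqn_dvd dvdn_lcml dvdn_lcm dvdnn pmn_half dvdn_mulr.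
  rewrite pmn_half (pmn_half b') => /dvdn_trans/(_ (lcm_even_dvd _ _)) /dvdnP[[|[|t]] E].
  - have := qX_mono b0; have := qX_mono b0'; have := pmn_half b; have := pmn_half b'.
    rewrite mul0n in E; move/eqP: E; rewrite !muln_eq0 /= /pmn /pm.
    by case: b.2; case: b'.2; lia.
  - by rewrite mul1n in E; rewrite -E; lia.
  (* A cofactor of at least 2 forces q^n <= q^a + q^b + 3 for the two sizes a and b, which only (n,
     q) = (2, 3) satisfies. *)
  - exfalso.
    have hh : 2 * (2 * N) <= pmn b * pmn b'.
      rewrite (pmn_half b) (pmn_half b'); move: E; set u := _./2; set v := _./2; lia.
    have hp : pmn b * pmn b' <= (q ^ b.1).+1 * (q ^ b'.1).+1.
      by apply: leq_mul; rewrite /pmn /pm; case: (_.2); lia.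
    have XE' : q ^ n = q ^ b.1 * q ^ b'.1 by rewrite -sn expnD.
    have key : q ^ n <= q ^ b.1 + q ^ b'.1 + 3 by lia.
    move: key; rewrite XE'.
    have h1 := qX_mono b0; have h2 := qX_mono b0'.
    have [b1|b1] := leqP b.1 1; have [b1'|b1'] := leqP b'.1 1.
    + have -> : b.1 = 1 by lia. have -> : b'.1 = 1 by lia.
      rewrite expn1 => hq; apply: nq; congr pair; [lia | nia].
    + have := qX_mono b1'; nia.
    + have := qX_mono b1; nia.
    + have := qX_mono b1'; have := qX_mono b1; nia.
(* Cases on the number c of blocks of size at least 2. For c >= 3 the inequality 2 (5/9)^3 < 1/2
   suffices; for smaller c the finer bounds on L, according to j, are needed. *)
case: c e1 e3 e4 e5 => [|[|[|c]]] e1 e3 e4 e5.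
- have A0 := e4 erefl; rewrite A0 expn0 !mul1n in e5.
  have P1 : P = 1 by lia.
  rewrite P1 muln1 in NLP; rewrite A0 addn0 in nE.
  case: Lc => [[j0 Lj]|[j1 Lj]|[j2 Lj]]; first by move: NLP; rewrite Lj; lia.
    exfalso; have [n2|n3] : n = 2 \/ 2 < n by lia.
      apply: nq; congr pair => //; have [q4|] := ltnP 3 q; last by lia.
      have := leq_mul q4 (leqnn q); move: NX NLP; rewrite n2 q2E.
      by clear -Lj q4; case: Lj => ->; lia.
    have : q ^ 3 <= q ^ n by rewrite leq_exp2l; lia.
    have := leq_mul q_gt2 (leqnn (q * q)); have := leq_mul q_gt2 (leqnn q).
    rewrite (expnS q 2) q2E; clear -Lj NX NLP q_gt2; case: Lj NLP => ->; lia.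
  have n2 : n <= 2.
    by rewrite -(@leq_exp2l q); lia.
  by apply: two; lia.
- rewrite !expn1 in e5.
  have [j0|j0] := posnP j.
    have Lj : L = 2 by case: Lc => [[_ ->]|[jj _]|[jj _]] //; move: jj; rewrite j0.
    have [r0|r0] := posnP r; last first.
      exfalso; have := rX3 r0; rewrite j0 expn0 mul1n; have := qX_mono e3; move: NLP; rewrite Lj.
      have : 3 ^ 2 * 3 <= q ^ A * q ^ r by apply: leq_mul; [exact: qX_mono | exact: r3].
      move: NX; rewrite XE j0 expn0 mul1n; clear -e5; lia.
    split=> //; left; case: bl bl0 sn N1 {NL Ldvd e2 two} e1 => [|b [|]] //; rewrite ?j0 //.
    move=> _; rewrite big_cons big_nil r0 !addn0 => bn N1 _; exists b; split=> //.
    have /dvdnP[[|[|t]] E] := N1 b erefl erefl; have := pmn_half b; rewrite E;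
      rewrite /pmn bn /pm; by case: b.2; lia.
  have [r0|r0] := posnP r; last first.
    exfalso; have := rX3 r0; have := L34 j0; move: NX NLP e5.
    move: (q ^ n) (q ^ j) (q ^ A) X9 => X y z X9 h1 h2 h3 h4 h5.
    have := leq_mul h4 h3; clear -h1 h2 h3 h4 h5 X9; lia.
  have [j1|j1] := leqP j 1; first by apply: two; lia.
  exfalso; have := L12 j1; move: NX NLP e5 rX.
  move: (q ^ n) (q ^ j) (q ^ A) X9 => X y z X9 h1 h2 h3 h4 h5.
  have := leq_mul h5 h3; clear -h1 h2 h3 h4 h5 X9; lia.
- have X81 : 81 <= q ^ n by rewrite (@qX_mono 4) //; lia.
  have [j0|j0] := posnP j.
    have [r0|r0] := posnP r; first by apply: two; lia.
    exfalso; have Lj : L = 2 by case: Lc => [[_ ->]|[jj _]|[jj _]] //; move: jj; rewrite j0.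
    have := rX3 r0; rewrite j0 expn0 mul1n; move: NX NLP e5; rewrite Lj.
    move: (q ^ n) (q ^ A) X81 => X z; lia.
  exfalso; have X243 : 243 <= q ^ n by rewrite (@qX_mono 5) //; lia.
  have := L34 j0; move: NX NLP e5 rX.
  clear X9; move: (q ^ n) (q ^ j) (q ^ A) X243 => X y z X9 h1 h2 h3 h4 h5.
  have := leq_mul h5 h3; clear -h1 h2 h3 h4 h5 X9; lia.
- exfalso; have X729 : 729 <= q ^ n by rewrite (@qX_mono 6) //; lia.
  have P3 : 729 * P <= 125 * q ^ A.
    rewrite -(@leq_pmul2l (9 ^ c)) ?expn_gt0 //; apply: (@leq_trans (9 ^ c.+3 * P)).
      by rewrite !expnS; lia.
    apply: leq_trans e5 _; rewrite !expnS !mulnA [_ * 125]mulnC.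
    have h59 : 5 ^ c <= 9 ^ c by case: (c) => [|d] //; rewrite leq_exp2r.
    by apply: leq_mul => //; clear -h59; lia.
  move: NX NLP P3 rX L2.
  clear X9; move: (q ^ n) (q ^ j) (q ^ A) X729 => X y z X9 h1 h2 h3 h4 h5.
  have := leq_mul h5 h3; clear -h1 h2 h3 h4 h5 X9; lia.
Qed.
End Arith.

(** * Frobenius orbits of eigenvalues *)

Lemma symp_mx_map (R S : comUnitRingType) (f : {rmorphism R -> S}) n :
  map_mx f (symp_mx R n) = symp_mx S n.
Proof. by apply/matrixP=> i j; rewrite !mxE rmorphB !rmorph_nat. Qed.

Lemma symp_form_map (R S : comUnitRingType) (f : {rmorphism R -> S}) n u v :
  @symp_form S n (map_mx f u) (map_mx f v) = f (symp_form u v).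
Proof. by rewrite /symp_form -(symp_mx_map f) map_trmx -!map_mxM mxE. Qed.

Lemma order_coset_dvd (gT : finGroupType) (Z : {group gT}) (x : gT) k :
  x \in 'N(Z) -> (x ^+ k)%g \in Z -> (#[coset Z x]%g %| k)%N.
Proof. by move=> nx xk; rewrite order_dvdn -morphX //= coset_id. Qed.

Lemma perm_uniq_sub (T : eqType) (l s : seq T) : uniq l -> {subset l <= s} ->
  exists s', perm_eq s (l ++ s').
Proof.
elim: l s => [|a l IH] s /=; first by exists s.
move=> /andP[al ul] ls; have pa := perm_to_rem (ls a (mem_head _ _)).
have [s' hs'] : exists s', perm_eq (rem a s) (l ++ s').
  apply: IH => // b bl; have := ls b; rewrite inE bl orbT => /(_ isT).
  by rewrite (perm_mem pa) inE => /predU1P[ba|//]; rewrite -ba bl in al.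
by exists s'; rewrite (perm_trans pa) // perm_cons.
Qed.

Lemma perm_uniq_size (T : eqType) (l s : seq T) : uniq l -> uniq s -> {subset l <= s} ->
  size l = size s -> perm_eq l s.
Proof.
move=> ul us ls e; apply: uniq_perm => //.
by have [] := uniq_min_size ul ls (eq_leq (esym e)).
Qed.

Lemma perm_map_rest (T : eqType) (f : T -> T) (l s s' : seq T) : perm_eq s (l ++ s') ->
  perm_eq (map f s) s -> perm_eq (map f l) l -> perm_eq (map f s') s'.
Proof.
move=> h hs hl; rewrite -(perm_cat2l l); apply: (@perm_trans _ (map f l ++ map f s')).
  by rewrite perm_cat2r perm_sym.
rewrite -map_cat; apply: perm_trans (h); apply: perm_trans hs.
by apply: perm_map; rewrite perm_sym.
Qed.

Lemma map_iotaP (T : eqType) (f : nat -> T) a w :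
  reflect (exists2 i, (i < a)%N & w = f i) (w \in map f (iota 0 a)).
Proof.
apply: (iffP mapP) => [[k]|[i ia ->]]; last by exists i; rewrite ?mem_iota.
by rewrite mem_iota => ka; exists k.
Qed.

Section Eigenvalues.
Variables (n : nat) (F : finFieldType) (K : closedFieldType) (j : {rmorphism F -> K}).
Hypothesis n_gt0 : (0 < n)%N.
Hypothesis char2 : (2%:R : F) != 0.
Hypothesis qp : [pchar K].-nat #|F|.
Local Notation q := #|F|.
Local Notation N := (dimV n).
Local Notation J := (symp_mx K n).
Local Notation B := (@symp_form K n).

Definition frob : {rmorphism K -> K} := HB.pack (fun z : K => z ^+ q)
  (GRing.isZmodMorphism.Build K K (fun z : K => z ^+ q)
     (fun a b => etrans (exprDn_pchar a (- b) qp) (congr1 (+%R (a ^+ q)) (exprNn_pchar b qp))))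
  (GRing.isMonoidMorphism.Build K K (fun z : K => z ^+ q)
     (conj (expr1n _ _) (fun a b => exprMn q a b))).

Lemma frobE z : frob z = z ^+ q. Proof. by []. Qed.

Lemma frob_iter i z : iter i frob z = z ^+ (q ^ i).
Proof. by elim: i => [|i IH]; rewrite ?expr1 // iterS IH frobE -exprM expnSr. Qed.

Lemma frob_j a : frob (j a) = j a.
Proof. by rewrite frobE -rmorphXn expf_card. Qed.

(** X^q - X already splits over F, so K has no further roots of it. *)
Lemma frob_fix z : frob z = z -> exists a, z = j a.
Proof.
move=> fz; have : root (map_poly j ('X^q - 'X)) z.
  by rewrite rmorphB /= map_polyXn map_polyX /root !hornerE -frobE fz subrr.
rewrite finField_genPoly rmorph_prod /= (eq_bigr (fun a => 'X - (j a)%:P)); last first.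
  by move=> a _; rewrite rmorphB /= map_polyX map_polyC.
rewrite -(big_map j predT (fun a => 'X - a%:P)) root_prod_XsubC => /mapP[a _ ->].
by exists a.
Qed.

Lemma frob_mx_j a b (M : 'M[F]_(a, b)) : map_mx frob (map_mx j M) = map_mx j M.
Proof. by apply/matrixP=> i k; rewrite !mxE frob_j. Qed.

Lemma frob_mx_fix a b (M : 'M[K]_(a, b)) : map_mx frob M = M -> exists M', M = map_mx j M'.
Proof.
move=> fM; have h (ik : 'I_a * 'I_b) : exists c, M ik.1 ik.2 = j c.
  by apply: frob_fix; rewrite -{2}fM mxE.
have [f hf] := fin_all_exists h; exists (\matrix_(i, k) f (i, k)).
by apply/matrixP=> i k; rewrite !mxE -(hf (i, k)).
Qed.

Lemma q_odd : odd q.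
Proof.
apply: contraT; rewrite -dvdn2 => q2.
have : (2 \in \pi(q))%N by rewrite mem_primes q2 (leq_trans _ (finNzRing_gt1 F)).
move/(pnatPpi qp)/pcharf0/eqP; rewrite -(rmorph_nat j) fmorph_eq0.
by rewrite (negPf char2).
Qed.

(* An orbit of eigenvalues under the Frobenius map and inversion; the sign tells
   whether the Frobenius orbit is closed under inversion. *)
Definition blk (b : nat * bool) (z : K) : seq K :=
  @map nat K (fun i => z ^+ (q ^ i)) (iota 0 b.1) ++
  @map nat K (fun i => z ^- (q ^ i)) (iota 0 b.1).

Definition good (t : (nat * bool) * K) : Prop :=
  [/\ (0 < t.1.1)%N, t.2 ^+ 2 != 1, t.2 != 0, uniq (blk t.1 t.2)
    & t.2 ^+ (q ^ t.1.1) = if t.1.2 then t.2^-1 else t.2].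

Definition spec (bz : seq ((nat * bool) * K)) := flatten [seq blk t.1 t.2 | t <- bz].

Lemma size_spec bz : size (spec bz) = (2 * \sum_(t <- bz) t.1.1)%N.
Proof.
elim: bz => [|t bz IH]; first by rewrite big_nil.
by rewrite /spec /= size_cat -/(spec bz) IH big_cons size_cat !size_map size_iota mulnDr; lia.
Qed.

Lemma good_pow t : good t -> t.2 ^+ (pmn q t.1) = 1.
Proof.
case: t => [[a e] z] [/= a0 z2 z0 _ h]; rewrite /pmn /pm /=; case: e h => h.
  by rewrite exprSr h mulVf.
have q0 : (0 < q ^ a)%N by rewrite expn_gt0 (leq_trans _ (finNzRing_gt1 F)).
by apply: (mulIf z0); rewrite -exprSr prednK // h mul1r.
Qed.

Lemma blkP b z w : w \in blk b z ->
  exists2 i, (i < b.1)%N & w = z ^+ (q ^ i) \/ w = z ^- (q ^ i).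
Proof.
rewrite mem_cat => /orP[] /map_iotaP[i ib ->]; exists i => //.
  by left.
by right.
Qed.

Lemma blk_pow t w : good t -> w \in blk t.1 t.2 -> w ^+ (pmn q t.1) = 1.
Proof.
move=> gt /blkP[i _ [->|->]]; rewrite -?exprVn -!exprM mulnC exprM ?exprVn good_pow //.
  by rewrite expr1n.
by rewrite expr1n invr1.
Qed.

Lemma sqr_Xodd (z : K) k : z ^+ 2 = 1 -> odd k -> z ^+ k = z.
Proof. by move=> z2 ok; rewrite -(odd_double_half k) ok exprD -mul2n exprM z2 expr1n mulr1. Qed.

Lemma qX_odd i : odd (q ^ i). Proof. by rewrite oddX q_odd orbT. Qed.

Lemma frobX_inj i (z w : K) : z ^+ (q ^ i) = w ^+ (q ^ i) -> z = w.
Proof.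
by rewrite -!frob_iter; elim: i => // i IH; rewrite !iterS => /fmorph_inj.
Qed.

Lemma blk_sq t w : good t -> w \in blk t.1 t.2 -> w ^+ 2 != 1.
Proof.
move=> [_ z2 z0 _ _] /blkP[i _ h]; apply: contra_neq z2 => w2.
apply: (@frobX_inj i); rewrite expr1n -exprM mulnC exprM.
case: h w2 => ->; rewrite // exprVn => /(congr1 (@GRing.inv K)).
by rewrite invrK invr1.
Qed.

Definition closed_spec (s : seq K) :=
  [/\ all (fun z => z != 0) s, perm_eq (map frob s) s & perm_eq (map (@GRing.inv K) s) s].

(** The size of the block is the least a > 0 for which z^(q^a) is z or its inverse; minimality makes
    the listed conjugates distinct. *)
Lemma good_exists s z : closed_spec s -> z \in s -> z ^+ 2 != 1 ->
  exists b, good (b, z) /\ {subset blk b z <= s}.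
Proof.
move=> [/allP s0 sf si] zs z2; have z0 := s0 z zs.
have clf w : w \in s -> w ^+ q \in s by move=> ws; rewrite -(perm_mem sf); apply: map_f ws.
have cli w : w \in s -> w^-1 \in s by move=> ws; rewrite -(perm_mem si); apply: map_f ws.
have clX i w : w \in s -> w ^+ (q ^ i) \in s.
  by move=> ws; elim: i => [|i IH]; rewrite ?expr1 // expnSr exprM clf.
have ex : exists a, (0 < a)%N && ((z ^+ (q ^ a) == z) || (z ^+ (q ^ a) == z^-1)).
  pose f (i : 'I_(size s).+1) := z ^+ (q ^ i).
  have /injectivePn[i [k nik e]] : ~~ injectiveb f.
    apply/negP=> /injectiveP inj_f; have u : uniq [seq f i | i <- enum 'I_(size s).+1].
      by rewrite map_inj_uniq ?enum_uniq.
    have := @uniq_leq_size _ _ s u; rewrite size_map size_enum_ord ltnn => h.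
    by have : false by apply: h => _ /mapP[i _ ->]; apply: clX.
  wlog lik : i k nik e / (i < k)%N.
    move=> H; case: (ltngtP i k) => h; [exact: (H i k) | |].
      by apply: (H k i) => //; rewrite eq_sym.
    by case/eqP: nik; apply: val_inj.
  exists (k - i)%N; rewrite subn_gt0 lik /=; apply/orP; left; apply/eqP.
  by apply: (@frobX_inj i); rewrite -exprM -expnD subnK 1?ltnW // -[LHS]/(f k) -e.
have [a /andP[a0 ha] mina] := ex_minnP ex.
exists (a, z ^+ (q ^ a) == z^-1); split; last first.
  move=> w /blkP[i _ [->|->]]; first exact: clX.
  by apply/cli/clX.
have nomin i : (0 < i < a)%N -> z ^+ (q ^ i) <> z /\ z ^+ (q ^ i) <> z^-1.
  move=> /andP[i0 ia]; split=> e; have := mina i; rewrite i0 e eqxx ?orbT leqNgt ia => /(_ isT) //.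
have zz : z <> z^-1 by move=> e; case/eqP: z2; rewrite expr2 {2}e mulfV.
have inj1 (i k : nat) : (i < a)%N -> (k < a)%N -> z ^+ (q ^ i) = z ^+ (q ^ k) -> i = k.
  wlog ik : i k / (i <= k)%N.
    by move=> H ia ka e; case: (leqP i k) => h; [exact: H | apply/esym/H => //; exact: ltnW].
  move=> ia ka; rewrite -{1}(subnK ik) expnD exprM => /esym /frobX_inj e.
  have [|d0] := posnP (k - i)%N; first by lia.
  by have [] := nomin (k - i)%N; [rewrite d0; lia|].
split=> //=; last by case: eqP => //; case/orP: ha => /eqP.
rewrite cat_uniq; apply/and3P; split.
- rewrite map_inj_in_uniq ?iota_uniq // => i k; rewrite !mem_iota => /andP[_ ia] /andP[_ ka].
  exact: inj1.
- apply/negP=> /hasP[w /map_iotaP[i /= ia ->] /map_iotaP[k /= ka e]].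
  case: (ltngtP i k) => ik.
  + move: e; rewrite -(subnK (ltnW ik)) expnD exprM -exprVn => /frobX_inj e.
    have /nomin[_ ne] : (0 < k - i < a)%N by lia.
    by case: ne.
  + move/(congr1 (@GRing.inv K)): e; rewrite invrK -(subnK (ltnW ik)) expnD exprM -exprVn.
    by move=> /frobX_inj e; have /nomin[_ ne] : (0 < i - k < a)%N by lia; case: ne.
  + by move: e; rewrite ik -exprVn => /frobX_inj e; apply: zz.
- rewrite map_inj_in_uniq ?iota_uniq // => i k; rewrite !mem_iota => /andP[_ ia] /andP[_ ka].
  by move/invr_inj; apply: inj1.
Qed.

Lemma blk_closed t : good t -> perm_eq (map frob (blk t.1 t.2)) (blk t.1 t.2) /\
  perm_eq (map (@GRing.inv K) (blk t.1 t.2)) (blk t.1 t.2).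
Proof.
case: t => [[a e] z] [/= a0 z2 z0 ub hz].
have in1 i : (i < a)%N -> z ^+ (q ^ i) \in blk (a, e) z.
  by move=> ia; rewrite mem_cat; apply/orP; left; apply/mapP; exists i; rewrite ?mem_iota.
have in2 i : (i < a)%N -> z ^- (q ^ i) \in blk (a, e) z.
  by move=> ia; rewrite mem_cat; apply/orP; right; apply/mapP; exists i; rewrite ?mem_iota.
split; apply: perm_uniq_size => //.
- by rewrite map_inj_uniq //; apply: (fmorph_inj frob).
- move=> _ /mapP[w /blkP[i /= ia hw] ->].
  have [ia1|] := ltnP i.+1 a.
    by case: hw => ->; rewrite -?exprVn -exprM -expnSr ?exprVn; [apply: in1 | apply: in2].
  move=> ai; have {ai} ai : i.+1 = a by lia.
  have h0 : z \in blk (a, e) z by have := in1 0%N a0; rewrite expr1.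
  have h0' : z^-1 \in blk (a, e) z by have := in2 0%N a0; rewrite expr1.
  by case: hw => ->; rewrite -?exprVn -exprM -expnSr ai ?exprVn hz; case: (e); rewrite ?invrK.
- by rewrite size_map.
- by rewrite map_inj_uniq //; apply: invr_inj.
- by move=> _ /mapP[w /blkP[i /= ia [->|->]] ->]; rewrite ?invrK; [apply: in2 | apply: in1].
- by rewrite size_map.
Qed.

(** Blocks are removed one at a time; the rest stays closed under Frobenius and inversion, and the
    process stops when all remaining values have square 1. *)
Lemma blk_decomp s : closed_spec s -> exists bz r,
  [/\ perm_eq s (spec bz ++ r), (forall t, t \in bz -> good t) & {in r, forall z, z ^+ 2 = 1}].
Proof.
have [m] := ubnP (size s); elim: m s => // m IH s sm cs.
have [/hasP[z zs z2]|] := boolP (has (fun z => z ^+ 2 != 1) s); last first.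
  by move=> /hasPn h; exists [::], s; split=> // z /h /negPn/eqP.
have [b [gb sb]] := good_exists cs zs z2.
have ub : uniq (blk b z) by case: gb.
have [s' hs'] := perm_uniq_sub ub sb.
have [cb1 cb2] := blk_closed gb; case: cs => [s0 c1 c2].
have cs' : closed_spec s'.
  split.
  - by move: s0; rewrite (perm_all _ hs') all_cat => /andP[].
  - exact: perm_map_rest hs' c1 cb1.
  - exact: perm_map_rest hs' c2 cb2.
have [|bz [r [h1 h2 h3]]] := IH s' _ cs'.
  by move: sm; rewrite (perm_size hs') size_cat; have [a0 _ _ _ _] := gb; rewrite size_cat !size_map size_iota; move: a0 => /=; lia.
exists ((b, z) :: bz), r; split=> //.
  by rewrite (perm_trans hs') // /spec /= -catA perm_cat2l.
by move=> t; rewrite inE => /predU1P[->|/h2].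
Qed.

End Eigenvalues.

(** * Spectra of elements of order prime to p *)

Section Diag.
Variables (n : nat) (F : finFieldType) (K : closedFieldType) (j : {rmorphism F -> K}).
Hypothesis n_gt0 : (0 < n)%N.
Hypothesis char2 : (2%:R : F) != 0.
Hypothesis qp : [pchar K].-nat #|F|.
Local Notation q := #|F|.
Local Notation N := (dimV n).
Local Notation frob := (frob qp).
Variable x : {'GL_(2 * n)[F]}.
Hypothesis xS : x \in Sp n F.
Local Notation A := (map_mx j (GLval x)).

Lemma symp_map (y : {'GL_(2 * n)[F]}) : y \in Sp n F -> is_symplectic (map_mx j (GLval y)).
Proof.
by rewrite SpE => /eqP h; apply/eqP; rewrite -(symp_mx_map j) map_trmx -!map_mxM h.
Qed.

Lemma mapGL_inj (y z : {'GL_(2 * n)[F]}) : map_mx j (GLval y) = map_mx j (GLval z) -> y = z.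
Proof.
move=> e; apply: GLval_inj; apply/matrixP=> a b.
by apply: (fmorph_inj j); have /matrixP/(_ a b) := e; rewrite !mxE.
Qed.

Definition diagonalizes (P : 'M[K]_N) (lam : 'rV[K]_N) := P \in unitmx /\ P *m A = diag_mx lam *m P.

Lemma diag_exists k : (x ^+ k = 1)%g -> (k%:R : F) != 0 -> exists P lam, diagonalizes P lam.
Proof.
move=> xk k0; have k0' : (k%:R : K) != 0 by rewrite -(rmorph_nat j) fmorph_eq0.
have [rs rsE] := closed_field_poly_normal ('X^k - 1 : {poly K}).
have kp : (0 < k)%N by case: (k) k0 => //; rewrite eqxx.
rewrite (_ : lead_coef _ = 1) ?scale1r in rsE; last first.
  by apply/eqP; rewrite -[_ == 1]/(_ \is monic) monicXnsubC.
have urs : uniq rs by rewrite -separable_prod_XsubC -rsE separable_Xn_sub_1.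
have [P uP dP] : exists2 P : 'M[K]_N, P \in unitmx & similar_diag P A.
  apply/diagonalizableP; exists rs => //; rewrite -rsE; apply: mxminpoly_min.
  rewrite rmorphB rmorph1 /= rmorphXn /= horner_mx_X.
  have := congr1 GLval xk; rewrite GLvalX GLval1 => /(congr1 (map_mx j)).
  by rewrite rmorphXn /= map_mx1 => ->; rewrite subrr.
have /is_diag_mxP := dP; set D := conjmx P A => hD.
exists P, (\row_i D i i); split=> //.
have -> : diag_mx (\row_i D i i) = D.
  apply/matrixP=> a b; rewrite [LHS]mxE; have [->|ab] := eqVneq a b; first by rewrite mulr1n mxE.
  by rewrite mulr0n hD.
by rewrite /D /conjmx mulmxKpV // submx_full // row_full_unit.
Qed.

Section WithDiag.
Variables (P : 'M[K]_N) (lam : 'rV[K]_N).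
Hypothesis dP : diagonalizes P lam.
Let uP : P \in unitmx. Proof. by case: dP. Qed.
Let PA : P *m A = diag_mx lam *m P. Proof. by case: dP. Qed.

Let uA : A \in unitmx. Proof. by rewrite map_unitmx GLval_unitmx. Qed.

Lemma row_eig i : row i P *m A = lam 0 i *: row i P.
Proof. by rewrite -row_mul PA; apply/rowP=> k; rewrite mul_diag_mx !mxE. Qed.

Lemma row_neq0 i : row i P != 0.
Proof.
apply: contraTneq uP => r0; apply/negP=> u.
have : row i P *m invmx P = delta_mx 0 i by rewrite -row_mul mulmxV // row1.
rewrite r0 mul0mx => /matrixP/(_ 0 i); rewrite !mxE !eqxx => /eqP.
by rewrite eq_sym oner_eq0.
Qed.

Lemma lam_neq0 i : lam 0 i != 0.
Proof.
apply: contra_neq (row_neq0 i) => l0.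
by have := row_eig i; rewrite l0 scale0r => /(congr1 (mulmx^~ (invmx A))); rewrite mulmxK // mul0mx.
Qed.

Lemma char_poly_diag (d : 'rV[K]_N) : char_poly (diag_mx d) = \prod_(i < N) ('X - (d 0 i)%:P).
Proof.
rewrite char_poly_trig ?diag_mx_is_trig //.
by apply: eq_bigr => i _; rewrite mxE eqxx mulr1n.
Qed.

Definition spectrum := [seq lam 0 i | i <- enum 'I_N].

Lemma prod_spectrum (d : 'rV[K]_N) : \prod_(i < N) ('X - (d 0 i)%:P) =
  \prod_(z <- [seq d 0 i | i <- enum 'I_N]) ('X - z%:P).
Proof. by rewrite big_map big_enum. Qed.

Lemma char_poly_A : char_poly A = \prod_(z <- spectrum) ('X - z%:P).
Proof. by rewrite -prod_spectrum -char_poly_diag; apply/esym/(char_poly_intertwine uP). Qed.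

Lemma pow_eig k i : row i P *m A ^+ k = lam 0 i ^+ k *: row i P.
Proof.
elim: k => [|k IH]; first by rewrite !expr0 scale1r mulmx1.
by rewrite exprS -[_ * _]/(A *m A ^+ k) mulmxA row_eig -scalemxAl IH scalerA -exprS.
Qed.

(** The characteristic polynomial has coefficients in F, and the form conjugates A to the transpose
    of its inverse. *)
Lemma spectrum_closed : closed_spec qp spectrum.
Proof.
split.
- by apply/allP=> _ /mapP[i _ ->]; apply: lam_neq0.
- apply: prod_XsubC_eq; rewrite -char_poly_A big_map.
  transitivity (map_poly frob (char_poly A)); last by rewrite map_char_poly (frob_mx_j j).
  by rewrite char_poly_A map_prod_XsubC.
- apply: prod_XsubC_eq; rewrite -char_poly_A.
  pose D' := diag_mx (\row_i (lam 0 i)^-1).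
  have sA := symp_map xS; move/eqP: sA => sA.
  have uJ : symp_mx K n \in unitmx by apply: symp_mx_unit.
  have e1 : A *m symp_mx K n = symp_mx K n *m (invmx A)^T.
    by rewrite trmx_inv -[RHS]/(_ *m _) -{2}sA mulmxK // unitmx_tr.
  have DD' : D' *m diag_mx lam = 1%:M.
    apply/matrixP=> i k; rewrite mul_diag_mx !mxE; case: eqP => [->|_]; rewrite ?mulr0 // mulr1n.
    by rewrite mulVf // lam_neq0.
  have e2 : P *m invmx A = D' *m P.
    by apply: (canLR (mulmxK uA)); rewrite -mulmxA PA mulmxA DD' mul1mx.
  have e3 : (invmx A)^T *m P^T = P^T *m D'.
    by rewrite -trmx_mul e2 trmx_mul tr_diag_mx.
  rewrite (char_poly_intertwine uJ e1) (char_poly_intertwine _ e3) ?unitmx_tr //.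
  rewrite char_poly_diag prod_spectrum -map_comp; congr (\prod_(z <- _) _).
  by apply: eq_map => i; rewrite /= mxE.
Qed.

Lemma order_dvd k e : e ^+ 2 = 1 -> (forall i, lam 0 i ^+ k = e) -> (#[coset 'Z(Sp n F) x]%g %| k)%N.
Proof.
move=> e2 hk; apply: order_coset_dvd; first exact: Sp_normZ.
suff : (x ^+ k)%g = 1%g \/ (x ^+ k)%g = m1 F n by move/(center_SpP n_gt0 char2).
have Ak : A ^+ k = e%:M.
  have : P *m A ^+ k = P *m e%:M.
    by apply/row_matrixP=> i; rewrite !row_mul pow_eig hk mul_mx_scalar.
  by move/(congr1 (mulmx (invmx P))); rewrite !mulKmx.
have Ak' : map_mx j (GLval (x ^+ k)%g) = e%:M by rewrite GLvalX rmorphXn.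
have [e1|e1] : e = 1 \/ e = -1 by move/eqP: e2; rewrite sqrf_eq1 => /orP[] /eqP; [left | right].
  left; apply: mapGL_inj; rewrite Ak' GLval1 e1.
  by rewrite map_mx1.
right; apply: mapGL_inj; rewrite Ak' GLval_m1 // e1.
by rewrite map_mxN map_mx1 raddfN.
Qed.
End WithDiag.
End Diag.

Lemma expr_gcd1 (R : comNzRingType) (w : R) a b : (0 < a)%N -> w ^+ a = 1 -> w ^+ b = 1 -> w ^+ (gcdn a b) = 1.
Proof.
move=> a0 wa wb; case: (egcdnP b a0) => km kn e _.
have : w ^+ (km * a) = 1 by rewrite mulnC exprM wa expr1n.
by rewrite e exprD mulnC exprM wb expr1n mul1r.
Qed.

Lemma invr_eq (R : fieldType) (a b : R) : a * b = 1 -> a^-1 = b.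
Proof.
move=> ab; have a0 : a != 0 by apply: contra_eq_neq ab => ->; rewrite mul0r eq_sym oner_neq0.
by rewrite -[RHS](mulKf a0) ab mulr1.
Qed.

Section Regular.
Variables (n : nat) (F : finFieldType) (K : closedFieldType) (j : {rmorphism F -> K}).
Hypothesis n_gt0 : (0 < n)%N.
Hypothesis char2 : (2%:R : F) != 0.
Hypothesis qp : [pchar K].-nat #|F|.
Local Notation q := #|F|.
Local Notation N := (dimV n).
Local Notation frob := (frob qp).
Local Notation B := (@symp_form K n).
Local Notation Z := 'Z(Sp n F).
Local Notation M_ y := (map_mx j (GLval y)).
Local Notation spec := (@spec F K).
Local Notation good := (@good F K).

Definition spectral (x : {'GL_(2 * n)[F]}) bz :=
  [/\ x \in Sp n F,
      exists P lam, diagonalizes j x P lam /\ perm_eq (spectrum lam) (spec bz),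
      (forall t, t \in bz -> good t) & uniq (spec bz)].

(** The order of the torus of Sp with these blocks. *)
Definition weight (bz : seq ((nat * bool) * K)) := (\prod_(t <- bz) pmn q t.1)%N.

Lemma pmn_gt0 b : (0 < b.1)%N -> (0 < pmn q b)%N.
Proof.
move=> b0; have h : (1 < q ^ b.1)%N by rewrite -(exp1n b.1) ltn_exp2r // finNzRing_gt1.
by rewrite /pmn /pm; case: b.2; move: h; lia.
Qed.

Lemma dvd_blk_lcm b bl : b \in bl -> (pmn q b %| blk_lcm q bl)%N.
Proof.
rewrite /blk_lcm; elim: bl => // c bl IH; rewrite inE big_cons => /predU1P[->|/IH h].
  exact: dvdn_lcml.
exact: dvdn_trans h (dvdn_lcmr _ _).
Qed.

Lemma dvd2_blk_lcm bl : (2 %| blk_lcm q bl)%N.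
Proof.
rewrite /blk_lcm; elim: bl => [|c bl IH]; first by rewrite big_nil.
by rewrite big_cons; apply: dvdn_trans IH (dvdn_lcmr _ _).
Qed.

Lemma in_specP bz w : w \in spec bz -> exists2 t, t \in bz & w \in blk F t.1 t.2.
Proof. by move=> /flattenP[_ /mapP[t tb ->] wt]; exists t. Qed.

Lemma pow_spec bz w : (forall t, t \in bz -> good t) -> w \in spec bz ->
  w ^+ (blk_lcm q (map fst bz)) = 1.
Proof.
move=> gb /in_specP[t tb wt]; have /dvdnP[c ->] := dvd_blk_lcm (map_f fst tb).
by rewrite mulnC exprM (blk_pow (gb t tb) wt) expr1n.
Qed.

Let qo : odd q := q_odd j char2 qp.
Let q3 : (2 < q)%N.
Proof. by move: qo (finNzRing_gt1 F); case: q => [|[|[|]]]. Qed.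

(** [two_blocks] applies with N the order modulo signs. For two blocks, 2 N is the product of the
    weights while N divides their lcm, so their gcd divides 2; a common eigenvalue would then have
    square 1. *)
Lemma regular_exists (x : {'GL_(2 * n)[F]}) k : (1 < n)%N -> (n, q) <> (2%N, 3%N) ->
  x \in Sp n F -> (x ^+ k = 1)%g -> (k%:R : F) != 0 ->
  (q ^ n <= 2 * #[coset Z x]%g + 1)%N ->
  exists bz, [/\ spectral x bz, (2 * #[coset Z x]%g = weight bz)%N,
    (\sum_(t <- bz) t.1.1)%N = n & (size bz = 1 \/ size bz = 2)%N].
Proof.
move=> n1 nq xS xk k0 ord.
have [P [lam dP]] := diag_exists j xk k0.
have [bz [r [h1 h2 h3]]] := blk_decomp n_gt0 char2 (spectrum_closed n_gt0 qp xS dP).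
have inl i : lam 0 i \in spec bz ++ r by rewrite -(perm_mem h1) map_f // mem_enum.
have sz : (2 * n = 2 * (\sum_(t <- bz) t.1.1) + size r)%N.
  by rewrite -(size_spec n_gt0 char2 qp) -size_cat -(perm_size h1) size_map size_enum_ord (dimV_eq n_gt0).
have [r0 hb] : ((size r)./2 = 0 /\ ((exists b, map fst bz = [:: b] /\ 2 * #[coset Z x]%g = pmn q b) \/
   exists b b', map fst bz = [:: b; b'] /\ 2 * #[coset Z x]%g = pmn q b * pmn q b'))%N.
  apply: (@two_blocks n q qo q3 n1 nq) => //.
  - by rewrite all_map; apply/allP=> t /h2[].
  - by rewrite big_map; move: sz; lia.
  - apply: (order_dvd n_gt0 char2 xS dP (e := 1)); first by rewrite expr1n.
    move=> i; have := inl i; rewrite mem_cat => /orP[/(pow_spec h2)//|/h3 e].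
    by have /dvdnP[c ->] := dvd2_blk_lcm (map fst bz); rewrite [(c * _)%N]mulnC exprM e expr1n.
  (* With one block, the power of exponent half the weight is a sign at the base point, and the same
     sign at all its conjugates. *)
  - move=> b bb r0; case: bz bb h1 h2 inl sz => [|t [|]] //= [tb] h1 h2 inl sz.
    have gt : good t by apply: h2; rewrite inE.
    have r00 : r = [::] by apply: size0nil; move: sz r0; lia.
    have e2 : (t.2 ^+ (pmn q b)./2) ^+ 2 = 1.
      by rewrite -exprM mulnC -(pmn_half qo q3 n1) -tb good_pow.
    apply: (order_dvd n_gt0 char2 xS dP e2) => i.
    have := inl i; rewrite r00 cats0 => /in_specP[t']; rewrite inE => /eqP -> /blkP[l _ h].
    have ol : odd (q ^ l) by rewrite oddX qo orbT.
    case: h => ->; rewrite -?exprVn -exprM mulnC exprM ?exprVn.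
      exact: sqr_Xodd.
        have eV : (t.2 ^+ (pmn q b)./2)^-1 = t.2 ^+ (pmn q b)./2.
      by apply: invr_eq; rewrite -expr2.
    by rewrite (sqr_Xodd e2 ol) eV.
have {r0} r0 : r = [::] by apply: size0nil; move: sz r0; lia.
exists bz; rewrite /weight.
have wE : (\prod_(t <- bz) pmn q t.1 = \prod_(b <- map fst bz) pmn q b)%N by rewrite big_map.
have sE : size bz = size (map fst bz) by rewrite size_map.
have bn : (\sum_(t <- bz) t.1.1)%N = n by move: sz; rewrite r0 /=; lia.
move: h1; rewrite r0 cats0 => h1.
have s12 : (size bz = 1 \/ size bz = 2)%N by rewrite sE; case: hb => [[b [-> _]]|[b [b' [-> _]]]]; [left|right].
split=> //; last first.
  by rewrite wE; case: hb => [[b [-> ->]]|[b [b' [-> ->]]]]; rewrite !big_cons big_nil muln1.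
split=> //; first by exists P, lam.
case: bz h2 s12 hb inl {sz h1 wE sE bn} => [|t [|t' [|t'' l]]] h2; try by case.
  by move=> _ _ _; rewrite /spec /= cats0; case: (h2 t); rewrite ?inE.
move=> _ [[b []]//|[b [b' [[tb tb'] oe]]]] inl.
rewrite /spec /= cats0 cat_uniq.
have g1 : good t by apply: h2; rewrite !inE eqxx.
have g2 : good t' by apply: h2; rewrite !inE eqxx orbT.
have [_ _ _ -> _] := g1; have [_ _ _ -> _] := g2; rewrite andbT /=.
apply/negP=> /hasP[w w2 w1]; have := blk_sq qp g1 w1; case/eqP.
have hg : (gcdn (pmn q b) (pmn q b') %| 2)%N.
  have [b0 b0'] : (0 < b.1 /\ 0 < b'.1)%N by rewrite -tb -tb'; case: g1; case: g2.
  have dv : (#[coset Z x]%g %| lcmn (pmn q b) (pmn q b'))%N.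
    apply: (order_dvd n_gt0 char2 xS dP (e := 1)); first by rewrite expr1n.
    move=> i; have := inl i; rewrite r0 cats0 => /in_specP[u].
    rewrite !inE => /orP[] /eqP -> wu.
      by have /dvdnP[c ->] := dvdn_lcml (pmn q b) (pmn q b'); rewrite [(c * _)%N]mulnC exprM -tb (blk_pow g1 wu) expr1n.
    by have /dvdnP[c ->] := dvdn_lcmr (pmn q b) (pmn q b'); rewrite [(c * _)%N]mulnC exprM -tb' (blk_pow g2 wu) expr1n.
  have /dvdnP[c hc] := dv; have := muln_lcm_gcd (pmn q b) (pmn q b').
  rewrite hc -oe => e; apply/dvdnP; exists c.
  have N0 := order_gt0 (coset Z x); apply/eqP; rewrite -(eqn_pmul2r N0) -e; apply/eqP; ring.
have /dvdnP[c ->] := hg; rewrite mulnC exprM expr_gcd1 ?expr1n ?pmn_gt0 //.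
- by rewrite -tb; case: g1.
- by rewrite -tb (blk_pow g1).
- by rewrite -tb' (blk_pow g2).
Qed.

Section Commutant.
Variables (x : {'GL_(2 * n)[F]}) (P : 'M[K]_N) (lam : 'rV[K]_N).
Hypothesis xS : x \in Sp n F.
Hypothesis dP : diagonalizes j x P lam.
Hypothesis lam_inj : forall i k, lam 0 i = lam 0 k -> i = k.
Local Notation A := (M_ x).
Let uP : P \in unitmx. Proof. by case: dP. Qed.
Let PA : P *m A = diag_mx lam *m P. Proof. by case: dP. Qed.
Let sA : is_symplectic A. Proof. exact: symp_map. Qed.

Lemma eig_row (u : 'rV[K]_N) i : u *m A = lam 0 i *: u -> exists c, u = c *: row i P.
Proof.
move=> h; pose c := u *m invmx P; have uE : u = c *m P by rewrite mulmxKV.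
have h2 : c *m diag_mx lam = lam 0 i *: c.
  have : c *m diag_mx lam *m P = lam 0 i *: c *m P by rewrite -mulmxA -PA mulmxA -uE -scalemxAl -uE.
  by move/(congr1 (mulmx^~ (invmx P))); rewrite !mulmxK.
exists (c 0 i); rewrite {1}uE; have -> : c = c 0 i *: delta_mx 0 i.
  apply/rowP=> k; rewrite !mxE eqxx /=; have [->|ki] := eqVneq k i; first by rewrite mulr1.
  have /rowP/(_ k) := h2; rewrite mul_mx_diag !mxE mulr0 => /eqP.
  rewrite mulrC -subr_eq0 -mulrBl mulf_eq0 subr_eq0 => /orP[/eqP/lam_inj e|/eqP //].
  by case/eqP: ki.
by rewrite -scalemxAl -rowE !mxE !eqxx mulr1.
Qed.

Lemma form_rows i k : lam 0 i * lam 0 k != 1 -> B (row i P) (row k P) = 0.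
Proof.
move=> h; have := is_symplectic_form (row i P) (row k P) sA.
rewrite !(row_eig dP) formZl formZr mulrA => /eqP; rewrite -subr_eq0 -{2}[B _ _]mul1r -mulrBl.
by rewrite mulf_eq0 subr_eq0 (negPf h) => /eqP.
Qed.

Lemma form_rows_neq0 i k : lam 0 i * lam 0 k = 1 -> B (row i P) (row k P) != 0.
Proof.
move=> ik; apply: contra_neq (row_neq0 dP i) => Bik.
apply: (form_nondegl n_gt0) => u; rewrite -[u](mulmxKV uP).
move: (u *m invmx P) => c; rewrite mulmx_sum_row.
have -> : B (row i P) (\sum_l c 0 l *: row l P) = \sum_l c 0 l * B (row i P) (row l P).
  elim/big_rec2: _ => [|l b a _ IH]; first by rewrite form0r.
  by rewrite formDr formZr IH.
rewrite big1 // => l _; have [->|lk] := eqVneq l k; first by rewrite Bik mulr0.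
rewrite form_rows ?mulr0 //; apply: contra_neq lk => il; apply: lam_inj.
by apply: (mulfI (lam_neq0 dP i)); rewrite il ik.
Qed.

(** The eigenvalue of X on the i-th eigenline of x, meaningful when X commutes with x. *)
Definition evm (X : 'M[K]_N) (i : 'I_N) : K := (P *m X *m invmx P) i i.

Lemma evmP X : X *m A = A *m X -> forall i, row i P *m X = evm X i *: row i P.
Proof.
move=> XA i; have [c hc] : exists c, row i P *m X = c *: row i P.
  by apply: eig_row; rewrite -mulmxA XA mulmxA (row_eig dP) -scalemxAl.
rewrite hc /evm; congr (_ *: _).
have : row i (P *m X *m invmx P) = c *: row i (1%:M).
  by rewrite row_mul row_mul hc -scalemxAl -row_mul mulmxV.
by move/rowP/(_ i); rewrite !mxE eqxx mulr1 => ->.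
Qed.

Lemma evm_frob X i k : X *m A = A *m X -> lam 0 k = lam 0 i ^+ q ->
  evm (map_mx frob X) k = evm X i ^+ q.
Proof.
move=> XA h; set X' := map_mx frob X.
have fA : map_mx frob A = A by apply: frob_mx_j.
have X'A : X' *m A = A *m X' by rewrite -{1}fA -map_mxM XA map_mxM fA.
set u := map_mx frob (row i P).
have u0 : u != 0 by rewrite map_mx_eq0 (row_neq0 dP).
have uA : u *m A = lam 0 k *: u by rewrite -{1}fA -map_mxM (row_eig dP) map_mxZ /= h.
have uX : u *m X' = evm X i ^+ q *: u by rewrite -map_mxM (evmP XA) map_mxZ.
have [c hc] := eig_row uA.
have : u *m X' = evm X' k *: u by rewrite hc -scalemxAl (evmP X'A) !scalerA mulrC.
rewrite uX => /eqP; rewrite -subr_eq0 -scalerBl scaler_eq0 (negPf u0) orbF subr_eq0.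
by move/eqP.
Qed.

Lemma evm_symp X i k : X *m A = A *m X -> is_symplectic X -> lam 0 i * lam 0 k = 1 ->
  evm X i * evm X k = 1.
Proof.
move=> XA sX ik; have := is_symplectic_form (row i P) (row k P) sX.
rewrite !(evmP XA) formZl formZr mulrA -{2}[B _ _]mul1r.
exact: (mulIf (form_rows_neq0 ik)).
Qed.

Lemma evm_inj X X' : X *m A = A *m X -> X' *m A = A *m X' -> (forall i, evm X i = evm X' i) -> X = X'.
Proof.
move=> XA X'A h; have : P *m X = P *m X' by apply/row_matrixP=> i; rewrite !row_mul !evmP // h.
by move/(congr1 (mulmx (invmx P))); rewrite !mulKmx.
Qed.

Lemma diag_comm (d : 'rV[K]_N) : let X := invmx P *m diag_mx d *m P in
  X *m A = A *m X /\ (forall i, evm X i = d 0 i).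
Proof.
move=> X; split; last by move=> i; rewrite /evm /X !mulmxA mulmxV // mul1mx mulmxK // mxE eqxx mulr1n.
have AE : A = invmx P *m diag_mx lam *m P by rewrite -mulmxA -PA mulKmx.
rewrite /X AE !mulmxA !mulmxK // -!mulmxA; congr (_ *m _); rewrite !mulmxA; congr (_ *m _).
by apply/matrixP=> a b; rewrite !mul_diag_mx !mxE; case: eqP => [->|]; rewrite ?mulr1n ?mulr0n ?mulr0 // mulrC.
Qed.
End Commutant.
End Regular.

(** * Centralizers of regular elements *)

Lemma cyclic_quotient (gT : finGroupType) (Z H : {group gT}) (x : gT) m :
  x \in H -> Z \subset H -> H \subset 'N(Z) -> #|Z| = 2%N -> (#|H| <= 2 * m)%N -> #[coset Z x]%g = m ->
  (H / Z)%g = <[coset Z x]>%g /\ #|H| = (2 * m)%N.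
Proof.
move=> xH ZH HN Z2 Hm ox; have cH : #|H| = (2 * #|H / Z|%g)%N.
  by rewrite card_quotient // -Z2 Lagrange.
have sub : (<[coset Z x]> \subset H / Z)%g by rewrite cycle_subG mem_quotient.
have e : (<[coset Z x]> == H / Z)%g by rewrite eqEcard sub -[#|<[_]>%g|]/(#[_]%g) ox /=; move: Hm; rewrite cH leq_pmul2l.
by split; [rewrite (eqP e) | rewrite cH -(eqP e) -ox].
Qed.

Section Centralizer.
Variables (n : nat) (F : finFieldType) (K : closedFieldType) (j : {rmorphism F -> K}).
Hypothesis n_gt0 : (0 < n)%N.
Hypothesis char2 : (2%:R : F) != 0.
Hypothesis qp : [pchar K].-nat #|F|.
Local Notation q := #|F|.
Local Notation N := (dimV n).
Local Notation frob := (frob qp).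
Local Notation B := (@symp_form K n).
Local Notation Z := 'Z(Sp n F).
Local Notation M_ y := (map_mx j (GLval y)).
Local Notation spec := (@spec F K).
Local Notation good := (@good F K).

Variables (x : {'GL_(2 * n)[F]}) (P : 'M[K]_N) (lam : 'rV[K]_N) (bz : seq ((nat * bool) * K)).
Hypothesis xS : x \in Sp n F.
Hypothesis dP : diagonalizes j x P lam.
Hypothesis lamE : perm_eq (spectrum lam) (spec bz).
Hypothesis gbz : forall t, t \in bz -> good t.
Hypothesis ubz : uniq (spec bz).
Local Notation ev y := (evm P (M_ y)).

Lemma spec_inj i k : lam 0 i = lam 0 k -> i = k.
Proof.
have u : uniq (spectrum lam) by rewrite (perm_uniq lamE).
have /injectiveP inj : injectiveb (lam 0) := u.
exact: inj.
Qed.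

Lemma spec_idx w : w \in spec bz -> exists i, lam 0 i = w.
Proof. by rewrite -(perm_mem lamE) => /mapP[i _ ->]; exists i. Qed.

Lemma idx_spec i : lam 0 i \in spec bz.
Proof. by rewrite -(perm_mem lamE) map_f // mem_enum. Qed.

Lemma blk_spec t w : t \in bz -> w \in blk F t.1 t.2 -> w \in spec bz.
Proof. by move=> tb wt; apply/flattenP; exists (blk F t.1 t.2) => //; apply: (map_f (fun t => blk F t.1 t.2)). Qed.

Lemma frob_idx i : exists k, lam 0 k = lam 0 i ^+ q.
Proof.
have [_ cf _] := spectrum_closed n_gt0 qp xS dP.
have : frob (lam 0 i) \in spectrum lam by rewrite -(perm_mem cf) map_f // map_f // mem_enum.
by case/mapP=> k _ e; exists k.
Qed.

Lemma inv_idx i : exists k, lam 0 i * lam 0 k = 1.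
Proof.
have [_ _ ci] := spectrum_closed n_gt0 qp xS dP.
have : (lam 0 i)^-1 \in spectrum lam by rewrite -(perm_mem ci) map_f // map_f // mem_enum.
by case/mapP=> k _ e; exists k; rewrite -e mulfV // (lam_neq0 dP).
Qed.

(** The default index is reached only outside the spectrum. *)
Definition idx (w : K) : 'I_N := odflt ord0 [pick i | lam 0 i == w].

Lemma idxK w : w \in spec bz -> lam 0 (idx w) = w.
Proof.
move=> /spec_idx[i hi]; rewrite /idx; case: pickP => [k /eqP //|/(_ i)].
by rewrite hi eqxx.
Qed.

Lemma base_blk (t : (nat * bool) * K) : (0 < t.1.1)%N -> t.2 \in blk F t.1 t.2.
Proof.
move=> a0; rewrite mem_cat; apply/orP; left; apply/map_iotaP; exists 0%N => //.
Qed.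

Lemma base_spec t : t \in bz -> t.2 \in spec bz.
Proof. by move=> tb; apply: (blk_spec tb); apply: base_blk; case: (gbz tb). Qed.

Local Notation H := ('C_(Sp n F)[x])%G.

Lemma centralizerP y : y \in H -> y \in Sp n F /\ M_ y *m M_ x = M_ x *m M_ y.
Proof.
move=> /setIP[yS /cent1P c]; split=> //.
by rewrite -!map_mxM; congr (map_mx j _); rewrite -!GLvalM c.
Qed.

Lemma cent_in y : y \in Sp n F -> M_ y *m M_ x = M_ x *m M_ y -> y \in H.
Proof.
move=> yS c; apply/setIP; split=> //; apply/cent1P; apply: (mapGL_inj (j := j)).
by rewrite !GLvalM !map_mxM.
Qed.

(** Elements of the centralizer have entries in F, so their eigenvalues follow the Frobenius orbits
    of the eigenvalues of x. *)
Lemma ev_frobX y i k l : y \in H -> lam 0 k = lam 0 i ^+ (q ^ l) -> ev y k = ev y i ^+ (q ^ l).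
Proof.
move=> /centralizerP[yS yx]; elim: l k => [|l IH] k hk.
  by rewrite expn0 expr1; congr (ev y _); apply: spec_inj; rewrite hk expn0 expr1.
have [k' hk'] : exists k', lam 0 k' = lam 0 i ^+ (q ^ l).
  elim: (l) => [|l' [k' hk']]; first by exists i; rewrite expr1.
  by have [k'' hk''] := frob_idx k'; exists k''; rewrite hk'' hk' -exprM -expnSr.
have := evm_frob qp dP spec_inj yx (_ : lam 0 k = lam 0 k' ^+ q).
rewrite (frob_mx_j j qp) => -> //; last by rewrite hk hk' -exprM -expnSr.
by rewrite (IH k' hk') -exprM -expnSr.
Qed.

Lemma ev_invX y i k : y \in H -> lam 0 i * lam 0 k = 1 -> ev y i * ev y k = 1.
Proof. by move=> /centralizerP[yS yx]; apply: (evm_symp n_gt0 xS dP spec_inj yx (symp_map j yS)). Qed.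

(** The relation z^(q^a) = z or 1/z at the base point passes from the eigenvalues of x to those of y
    on the same eigenlines. *)
Lemma ev_pow y t : y \in H -> t \in bz -> ev y (idx t.2) ^+ (pmn q t.1) = 1.
Proof.
move=> yH tb; have [a0 z2 z0 _ hz] := gbz tb; have lb := idxK (base_spec tb).
have y0 : ev y (idx t.2) != 0.
  have [k hk] := inv_idx (idx t.2); apply/eqP=> e0.
  by have := ev_invX yH hk; rewrite e0 mul0r => /eqP; rewrite eq_sym oner_eq0.
rewrite /pmn /pm; case: t.1.2 hz => hz.
  have [k hk] := inv_idx (idx t.2); have : lam 0 k = lam 0 (idx t.2) ^+ (q ^ t.1.1).
    by rewrite lb hz -lb; apply/esym/invr_eq.
  by move/(ev_frobX yH); rewrite exprSr => <-; rewrite mulrC; apply: ev_invX.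
have : lam 0 (idx t.2) = lam 0 (idx t.2) ^+ (q ^ t.1.1) by rewrite lb hz.
move/(ev_frobX yH) => e; apply: (mulIf y0); have q0 : (0 < q ^ t.1.1)%N by rewrite expn_gt0 (leq_trans _ (finNzRing_gt1 F)).
by rewrite -exprSr (prednK q0) mul1r -e.
Qed.

Lemma ev_base_inj y y' : y \in H -> y' \in H ->
  (forall t, t \in bz -> ev y (idx t.2) = ev y' (idx t.2)) -> y = y'.
Proof.
move=> yH y'H e; have [_ yx] := centralizerP yH; have [_ yx'] := centralizerP y'H.
apply: (mapGL_inj (j := j)); apply: (evm_inj dP spec_inj yx yx') => k.
have [t tb kt] := in_specP (idx_spec k).
have /blkP[l _ h] := kt; have lb := idxK (base_spec tb).
have aux z : z \in H -> ev z k = if lam 0 k == t.2 ^+ (q ^ l) then ev z (idx t.2) ^+ (q ^ l)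
    else ev z (idx t.2) ^- (q ^ l).
  move=> zH; case: eqP => [h'|h']; first by apply: ev_frobX => //; rewrite lb.
  case: h => // h; have [k' hk'] := inv_idx k.
  have : lam 0 k' = lam 0 (idx t.2) ^+ (q ^ l) by rewrite lb -[RHS]invrK -h; apply/esym/invr_eq.
  by move/(ev_frobX zH) <-; apply/esym/invr_eq; rewrite mulrC; apply: ev_invX.
by rewrite !aux // e.
Qed.

Definition roots_of_unity m : seq K := sval (closed_field_poly_normal ('X^m - 1)).

Lemma roots_of_unityP m : (0 < m)%N -> size (roots_of_unity m) = m /\
  (forall w, w ^+ m = 1 -> w \in roots_of_unity m).
Proof.
move=> m0; rewrite /roots_of_unity; case: closed_field_poly_normal => /= rs.
rewrite (_ : lead_coef _ = 1) ?scale1r; last first.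
  by apply/eqP; rewrite -[_ == 1]/(_ \is monic) monicXnsubC.
move=> rsE; split; last by move=> w wm; rewrite -root_prod_XsubC -rsE /root !hornerE wm subrr.
by have := congr1 (size \o @polyseq K) rsE; rewrite /= size_XnsubC // size_prod_XsubC => -[].
Qed.

Fixpoint tuples_of_roots (l : seq nat) : seq (seq K) :=
  if l is m :: l' then [seq w :: s | w <- roots_of_unity m, s <- tuples_of_roots l'] else [:: [::]].

Lemma tuples_of_rootsP (ms : seq nat) : all (fun m => 0 < m)%N ms ->
  size (tuples_of_roots ms) = (\prod_(m <- ms) m)%N /\
  (forall ws : seq K, all2 (fun w m => w ^+ m == 1) ws ms -> ws \in tuples_of_roots ms).
Proof.
elim: ms => [|m ms IH] /=; first by split; [rewrite big_nil | case].
move=> /andP[m0 /IH[h1 h2]]; have [r1 r2] := roots_of_unityP m0.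
split; first by rewrite size_allpairs big_cons h1 r1.
by case=> // w ws /andP[/eqP wm wss]; apply: allpairs_f; [apply: r2 | apply: h2].
Qed.

Let pgt0 t : t \in bz -> (0 < pmn q t.1)%N.
Proof.
by move=> tb; case: (gbz tb) => a0 _ _ _ _; apply: pmn_gt0;
  do ?[exact: n_gt0 | exact: char2 | exact: qp | exact: a0].
Qed.

Definition evs y : seq K := [seq ev y (idx t.2) | t <- bz].

Lemma center_cent : (Z \subset H)%g.
Proof.
by apply/subsetP=> z /centerP[zS c]; apply/setIP; split=> //; apply/cent1P; have := c _ xS; rewrite /commute => ->.
Qed.

Lemma evs_root y : y \in H -> evs y \in tuples_of_roots [seq pmn q t.1 | t <- bz].
Proof.
move=> yH; apply: (tuples_of_rootsP _).2.
  by apply/allP=> _ /mapP[t tb ->]; apply: pgt0.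
rewrite /evs; have : {subset bz <= bz} by [].
elim: {1 3 4}bz => //= t l IH sub; rewrite ev_pow ?eqxx ?sub ?mem_head //=.
by apply: IH => u ul; apply: sub; rewrite inE ul orbT.
Qed.

Lemma evs_inj : {in H &, injective evs}.
Proof.
by move=> y y' yH y'H /eq_in_map e; apply: ev_base_inj.
Qed.

Lemma card_cent_le : (#|H| <= weight F bz)%N.
Proof.
have ms0 : all (fun m => 0 < m)%N [seq pmn q t.1 | t <- bz].
  by apply/allP=> _ /mapP[t tb ->]; apply: pgt0.
have [sz _] := tuples_of_rootsP ms0; rewrite /weight -(big_map _ predT id) -sz cardE -(size_map evs).
apply: uniq_leq_size.
  by rewrite map_inj_in_uniq ?enum_uniq // => a b; rewrite !mem_enum; apply: evs_inj.
by move=> w /mapP[y hy ->]; move: hy; rewrite mem_enum => yH; apply: evs_root.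
Qed.

Hypothesis order_x : (2 * #[coset Z x]%g = weight F bz)%N.

(** The centralizer has at most [weight] elements, and the preimage of the group generated by x
    modulo signs already has that many. *)
Lemma cent_quotient : (H / Z)%g = <[coset Z x]>%g /\ #|H| = weight F bz.
Proof.
have [] := @cyclic_quotient _ Z H x #[coset Z x]%g _ center_cent _ _ _ erefl.
- by apply/setIP; split=> //; apply/cent1P.
- by apply: subset_trans (subsetIl _ _) _; apply: normal_norm; apply: center_normal.
- exact: card_center_Sp.
- by rewrite order_x card_cent_le.
- by rewrite order_x.
Qed.

(** An injection between finite sets of equal size is onto: elements of the torus with prescribed
    eigenvalues exist without being constructed. *)
Lemma evs_surj (zs : seq K) : all2 (fun w m => w ^+ m == 1) zs [seq pmn q t.1 | t <- bz] ->
  exists2 y, y \in H & evs y = zs.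
Proof.
have ms0 : all (fun m => 0 < m)%N [seq pmn q t.1 | t <- bz].
  by apply/allP=> _ /mapP[t tb ->]; apply: pgt0.
have [sz h] := tuples_of_rootsP ms0 => /h zr.
have [_ e] : (size (map evs (enum H)) = size (tuples_of_roots [seq pmn q t.1 | t <- bz])) *
    (map evs (enum H) =i tuples_of_roots [seq pmn q t.1 | t <- bz]).
  apply: uniq_min_size.
  - by rewrite map_inj_in_uniq ?enum_uniq // => a b; rewrite !mem_enum; apply: evs_inj.
  - by move=> w /mapP[y hy ->]; move: hy; rewrite mem_enum => yH; apply: evs_root.
  - by rewrite size_map -cardE (cent_quotient).2 sz big_map.
by move: zr; rewrite -e => /mapP[y]; rewrite mem_enum => yH ->; exists y.
Qed.

(* Replacing x by a suitable element of its centralizer changes the base points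
   of the blocks arbitrarily. *)
Lemma spectral_change bz' : map fst bz' = map fst bz -> (forall t, t \in bz' -> good t) ->
  uniq (spec bz') -> exists2 y, y \in H & spectral j y bz'.
Proof.
move=> e gbz' ubz'.
have [y yH ye] : exists2 y, y \in H & evs y = map snd bz'.
  apply: evs_surj; have -> : [seq pmn q t.1 | t <- bz] = [seq pmn q t.1 | t <- bz'].
    by transitivity (map (pmn q) (map fst bz)); [|rewrite -e]; rewrite -map_comp.
  elim: (bz') gbz' => //= t l IH gl; have gt : good t by apply: gl; rewrite inE eqxx.
  rewrite (good_pow gt) eqxx /=.
  by apply: IH => u ul; apply: gl; rewrite inE ul orbT.
have [yS yx] := centralizerP yH; exists y => //; split=> //.
have uP : P \in unitmx by case: dP.
exists P, (\row_i ev y i); split.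
  split=> //; apply/row_matrixP=> i; rewrite row_mul (evmP dP spec_inj yx).
  by apply/rowP=> k; rewrite mul_diag_mx !mxE.
have sE : spectrum (\row_i ev y i) = [seq ev y i | i <- enum 'I_N].
  by apply: eq_map => i; rewrite mxE.
suff sub : {subset spec bz' <= spectrum (\row_i ev y i)}.
  have s1 : size (spectrum (\row_i ev y i)) = size (spec bz').
    rewrite size_map -(size_map (lam 0)) (perm_size lamE) !(size_spec n_gt0 char2 qp).
    by rewrite -!(big_map fst predT fst) e.
  by rewrite perm_sym; apply: uniq_perm => //; have [] := uniq_min_size ubz' sub (eq_leq s1);
    [rewrite (leq_size_uniq ubz' sub) // s1 | ].
move=> w /in_specP[t' tb' wt']; rewrite sE.
pose k := index t' bz'; have kb' : (k < size bz')%N by rewrite index_mem.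
have kb : (k < size bz)%N by rewrite -(size_map fst) -e size_map.
pose t := nth t' bz k; have tb : t \in bz by apply: mem_nth.
have et1 : t.1 = t'.1.
  by rewrite -[t'](nth_index t' tb') -/k -!(nth_map t' (t'.1)) // e.
have et2 : ev y (idx t.2) = t'.2.
  have := congr1 (fun s => nth 0 s k) ye; rewrite /evs (nth_map t') // (nth_map t') //.
  by rewrite nth_index.
have lb := idxK (base_spec tb).
have /blkP[l ll h] := wt'; rewrite -et1 in ll.
case: h => ->.
  have /spec_idx[i hi] : t.2 ^+ (q ^ l) \in spec bz.
    by apply: (blk_spec tb); rewrite mem_cat; apply/orP; left; apply/map_iotaP; exists l.
  apply/mapP; exists i; rewrite ?mem_enum //.
  by rewrite (ev_frobX (i := idx t.2) (l := l)) ?et2 // hi lb.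
have /spec_idx[i hi] : t.2 ^+ (q ^ l) \in spec bz.
  by apply: (blk_spec tb); rewrite mem_cat; apply/orP; left; apply/map_iotaP; exists l.
have [k' hk'] := inv_idx i; apply/mapP; exists k'; rewrite ?mem_enum //.
rewrite -et2 -(ev_frobX (y := y) (i := idx t.2) (k := i) (l := l)) ?hi ?lb //.
by apply: invr_eq; apply: ev_invX.
Qed.
End Centralizer.

(** * Conjugacy of regular elements *)

Lemma closed_root (K : closedFieldType) (c : K) m : (0 < m)%N -> exists d, d ^+ m = c.
Proof.
move=> m0; have [rs] := closed_field_poly_normal ('X^m - c%:P).
rewrite (_ : lead_coef _ = 1) ?scale1r; last first.
  by apply/eqP; rewrite -[_ == 1]/(_ \is monic) monicXnsubC.
case: rs => [|d rs] e.
  by have := congr1 (size \o @polyseq K) e; rewrite /= size_XnsubC // big_nil size_poly1; lia.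
exists d; have : root ('X^m - c%:P) d by rewrite e root_prod_XsubC mem_head.
by rewrite /root !hornerE subr_eq0 => /eqP.
Qed.

Lemma scaler_swap (R : comNzRingType) (V : lmodType R) (a b : R) (v : V) :
  a *: (b *: v) = b *: (a *: v).
Proof. by rewrite !scalerA mulrC. Qed.

Lemma gram_entry (R : comUnitRingType) n (S S' : 'M[R]_(dimV n)) i k :
  (S *m symp_mx R n *m S'^T) i k = symp_form (row i S) (row k S').
Proof.
by rewrite /symp_form -row_mul tr_row mxE [RHS]mxE; apply: eq_bigr => l _; rewrite !mxE.
Qed.

Section Conjugacy.
Variables (n : nat) (F : finFieldType) (K : closedFieldType) (j : {rmorphism F -> K}).
Hypothesis n_gt0 : (0 < n)%N.
Hypothesis char2 : (2%:R : F) != 0.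
Hypothesis qp : [pchar K].-nat #|F|.
Local Notation q := #|F|.
Local Notation N := (dimV n).
Local Notation frob := (frob qp).
Local Notation B := (@symp_form K n).
Local Notation M_ y := (map_mx j (GLval y)).
Local Notation spec := (@spec F K).
Local Notation good := (@good F K).

Definition fm (i : nat) (v : 'rV[K]_N) := iter i (map_mx frob) v.

Lemma fmZ i c v : fm i (c *: v) = c ^+ (q ^ i) *: fm i v.
Proof.
by elim: i => [|i IH]; rewrite /fm ?expn0 ?expr1 // !iterS -/(fm i _) IH map_mxZ /= -exprM expnSr.
Qed.

Lemma fm_eig (x : {'GL_(2 * n)[F]}) i z v : v *m M_ x = z *: v -> fm i v *m M_ x = z ^+ (q ^ i) *: fm i v.
Proof.
move=> h; elim: i => [|i IH]; first by rewrite expn0 expr1.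
by rewrite /fm iterS -/(fm i v) -{1}(frob_mx_j j qp) -map_mxM IH map_mxZ /= -exprM expnSr.
Qed.

Lemma fm_form i u v : B (fm i u) (fm i v) = B u v ^+ (q ^ i).
Proof.
elim: i => [|i IH]; first by rewrite expn0 expr1.
by rewrite /fm !iterS -/(fm i u) -/(fm i v) symp_form_map IH frobE -exprM expnSr.
Qed.

Lemma fm_eq0 i v : (fm i v == 0) = (v == 0).
Proof. by elim: i => // i IH; rewrite /fm iterS map_mx_eq0. Qed.

Lemma fmD i k v : fm i (fm k v) = fm (i + k) v.
Proof. by rewrite /fm iterD. Qed.

Lemma eig_form0 (x : {'GL_(2 * n)[F]}) a b (u v : 'rV[K]_N) : x \in Sp n F ->
  u *m M_ x = a *: u -> v *m M_ x = b *: v -> a * b != 1 -> B u v = 0.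
Proof.
move=> xS hu hv ab; have := is_symplectic_form u v (symp_map j xS).
rewrite hu hv formZl formZr mulrA => /eqP; rewrite -subr_eq0 -{2}[B _ _]mul1r -mulrBl.
by rewrite mulf_eq0 subr_eq0 (negPf ab) => /eqP.
Qed.

Section OneElement.
Variables (x : {'GL_(2 * n)[F]}) (bz : seq ((nat * bool) * K)).
Hypothesis sx : spectral j x bz.

(** A form of Hilbert 90: an eigenvector is rescaled, by a root of degree q^a - 1, to be fixed by
    the a-th power of Frobenius. *)
Lemma eig_rational z a : z \in spec bz -> (0 < a)%N -> z ^+ (q ^ a) = z ->
  exists v, [/\ v != 0, v *m M_ x = z *: v & fm a v = v].
Proof.
have [xS [P [lam [dP lamE]]] gbz ubz] := sx => zs a0 za.
have inj := spec_inj lamE ubz; have [i hi] := spec_idx lamE zs.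
set v0 := row i P; have v00 : v0 != 0 := row_neq0 dP i.
have hv0 : v0 *m M_ x = z *: v0 by rewrite (row_eig dP) hi.
have [c hc] : exists c, fm a v0 = c *: v0.
  by apply: (eig_row dP inj); rewrite (fm_eig _ hv0) za hi.
have c0 : c != 0 by apply: contraNneq v00 => c0; rewrite -(fm_eq0 a) hc c0 scale0r.
have qa1 : (1 < q ^ a)%N by rewrite -(exp1n a) ltn_exp2r // finNzRing_gt1.
have [t ht] : exists t, t ^+ (q ^ a).-1 = c^-1 by apply: closed_root; lia.
have t0 : t != 0.
  apply: contraTneq c0 => t0; rewrite negbK -invr_eq0 -ht t0 expr0n.
  by rewrite (_ : (_ == 0)%N = false) //; apply/eqP; lia.
exists (t *: v0); split; first by rewrite scaler_eq0 negb_or t0.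
  by rewrite -scalemxAl hv0 scaler_swap.
rewrite fmZ hc scalerA; congr (_ *: _).
by rewrite -(prednK (ltnW qa1)) exprSr ht mulrAC mulVf // mul1r.
Qed.

Lemma eig_form_neq0 z v w : z \in spec bz -> v != 0 -> w != 0 ->
  v *m M_ x = z *: v -> w *m M_ x = z^-1 *: w -> B v w != 0.
Proof.
have [xS [P [lam [dP lamE]]] gbz ubz] := sx => zs v0 w0 hv hw.
have inj := spec_inj lamE ubz; have [i hi] := spec_idx lamE zs.
have [k hk] := inv_idx n_gt0 qp xS dP i.
have hk' : lam 0 k = z^-1 by rewrite -hi; apply/esym/invr_eq.
have [c hc] : exists c, v = c *: row i P by apply: (eig_row dP inj); rewrite hv hi.
have [d hd] : exists d, w = d *: row k P by apply: (eig_row dP inj); rewrite hw hk'.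
rewrite hc hd formZl formZr !mulf_neq0 //.
- by apply: contraNneq v0 => c0; rewrite hc c0 scale0r.
- by apply: contraNneq w0 => c0; rewrite hd c0 scale0r.
- exact: (form_rows_neq0 n_gt0 xS dP inj hk).
Qed.
End OneElement.

Section TwoElements.
Variables (x x' : {'GL_(2 * n)[F]}) (bz : seq ((nat * bool) * K)).
Hypothesis sx : spectral j x bz.
Hypothesis sx' : spectral j x' bz.

Definition eig_pair (z : K) (v v' : 'rV[K]_N) := [/\ v != 0, v' != 0, v *m M_ x = z *: v & v' *m M_ x' = z *: v'].

(** The pairings for x and x' are made equal. If Frobenius inverts the block, w must be the a-th
    Frobenius image of v; the pairings b and b' then satisfy b^(q^a) = - b, so b / b' = c^(q^a + 1)
    for some c with c^(q^(2a)) = c, and c rescales v'. Otherwise both pairings are scaled to 1. *)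
Lemma block_vectors t : t \in bz -> exists v w v' w',
  [/\ eig_pair t.2 v v', eig_pair t.2^-1 w w',
      fm t.1.1 v = (if t.1.2 then w else v) /\ fm t.1.1 v' = (if t.1.2 then w' else v'),
      fm t.1.1 w = (if t.1.2 then v else w) /\ fm t.1.1 w' = (if t.1.2 then v' else w')
    & B v w = B v' w'].
Proof.
move=> tb; have [_ _ gbz _] := sx; have [a0 z2 z0 ub hz] := gbz t tb.
have zs : t.2 \in spec bz by apply: (base_spec gbz).
have zs' : t.2^-1 \in spec bz.
  apply: (blk_spec tb); rewrite mem_cat; apply/orP; right; apply/map_iotaP; exists 0%N => //.
case: t.1.2 hz => hz.
  have zz : t.2 ^+ (q ^ (t.1.1 + t.1.1)) = t.2 by rewrite expnD exprM hz exprVn hz invrK.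
  have [v [v0 hv fv]] := eig_rational sx zs (ltn_addr _ a0) zz.
  have [v' [v0' hv' fv']] := eig_rational sx' zs (ltn_addr _ a0) zz.
  set a := t.1.1 in a0 hz zz fv fv' *.
  have hw : fm a v *m M_ x = t.2^-1 *: fm a v by rewrite (fm_eig _ hv) hz.
  have hw' : fm a v' *m M_ x' = t.2^-1 *: fm a v' by rewrite (fm_eig _ hv') hz.
  have w0 : fm a v != 0 by rewrite fm_eq0.
  have w0' : fm a v' != 0 by rewrite fm_eq0.
  have b0 := eig_form_neq0 sx zs v0 w0 hv hw.
  have b0' := eig_form_neq0 sx' zs v0' w0' hv' hw'.
  have bq : B v (fm a v) ^+ (q ^ a) = - B v (fm a v) by rewrite -fm_form fmD fv formC.
  have bq' : B v' (fm a v') ^+ (q ^ a) = - B v' (fm a v') by rewrite -fm_form fmD fv' formC.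
  set b := B v (fm a v) in b0 bq; set b' := B v' (fm a v') in b0' bq'.
  have [c hc] : exists c, c ^+ (q ^ a).+1 = b / b' by apply: closed_root.
  have r0 : b / b' != 0 by rewrite mulf_neq0 ?invr_eq0.
  have c0 : c != 0 by apply: contraNneq r0 => c0; rewrite -hc c0 expr0n.
  have cq : c ^+ (q ^ a) = b / b' / c by rewrite -hc exprSr mulfK.
  have cqq : c ^+ (q ^ a) ^+ (q ^ a) = c.
    rewrite cq !exprMn !exprVn bq bq' cq invrN mulrNN invfM invrK mulrCA.
    by rewrite mulKf.
  exists v, (fm a v), (c *: v'), (c ^+ (q ^ a) *: fm a v'); split.
  - by split=> //; [rewrite scaler_eq0 negb_or c0 | rewrite -scalemxAl hv' scaler_swap].
  - split=> //; first by rewrite scaler_eq0 negb_or expf_neq0.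
    by rewrite -scalemxAl hw' scaler_swap.
  - by rewrite fmZ.
  - by rewrite fmZ !fmD fv fv' cqq.
  - rewrite formZl formZr -/b -/b' mulrA cq -mulrA mulrCA.
    by rewrite mulrA divfK // divfK.
have zz' : t.2^-1 ^+ (q ^ t.1.1) = t.2^-1 by rewrite exprVn hz.
have [v [v0 hv fv]] := eig_rational sx zs a0 hz.
have [v' [v0' hv' fv']] := eig_rational sx' zs a0 hz.
have [w [w0 hw fw]] := eig_rational sx zs' a0 zz'.
have [w' [w0' hw' fw']] := eig_rational sx' zs' a0 zz'.
have b0 := eig_form_neq0 sx zs v0 w0 hv hw.
have b0' := eig_form_neq0 sx' zs v0' w0' hv' hw'.
have bq : B v w ^+ (q ^ t.1.1) = B v w by rewrite -fm_form fv fw.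
have bq' : B v' w' ^+ (q ^ t.1.1) = B v' w' by rewrite -fm_form fv' fw'.
exists v, ((B v w)^-1 *: w), v', ((B v' w')^-1 *: w'); split.
- by [].
- by split; rewrite ?scaler_eq0 ?negb_or ?invr_eq0 ?b0 ?b0' // -scalemxAl ?hw ?hw' scaler_swap.
- by [].
- by rewrite !fmZ !exprVn bq bq' fw fw'.
- by rewrite !formZr !mulVf.
Qed.

Definition coherent (R R' : K -> 'rV[K]_N) (m : K) :=
  [/\ eig_pair m (R m) (R' m), map_mx frob (R m) = R (m ^+ q), map_mx frob (R' m) = R' (m ^+ q)
    & B (R m) (R m^-1) = B (R' m) (R' m^-1)].

(** Frobenius spreads the vectors at the base points along the block; the relations at the end of
    the orbit are those of [block_vectors]. *)
Lemma block_coherent t : t \in bz -> exists R R', forall m, m \in blk F t.1 t.2 -> coherent R R' m.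
Proof.
move=> tb; have [_ _ gbz _] := sx; have gt := gbz t tb; have [a0 z2 z0 ub hz] := gt.
have [v [w [v' [w' [[v0 v0' hv hv'] [w0 w0' hw hw'] [fv fv'] [fw fw'] hB]]]]] := block_vectors tb.
set a := t.1.1 in a0 fv fv' fw fw'; set z := t.2 in z2 z0 hv hv' hw hw' hz.
pose R0 (v w : 'rV[K]_N) m := if [pick i : 'I_a | m == z ^+ (q ^ i)] is Some i then fm i v
  else if [pick i : 'I_a | m == z ^- (q ^ i)] is Some i then fm i w else 0.
have Rv v1 w1 i : (i < a)%N -> R0 v1 w1 (z ^+ (q ^ i)) = fm i v1.
  move=> ia; rewrite /R0; case: pickP => [k /eqP e|/(_ (Ordinal ia))]; last by rewrite /= eqxx.
  have := ub; rewrite cat_uniq => /andP[u1 _]; congr (fm _ v1).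
  move: u1 => /(uniqP (0 : K)) u1.
  have nk (l : nat) : (l < a)%N -> nth (0 : K) (map (fun i => z ^+ (q ^ i)) (iota 0 a)) l = z ^+ (q ^ l).
    by move=> la; rewrite (nth_map 0%N) ?size_iota // nth_iota.
  apply: u1; rewrite ?inE ?size_map ?size_iota ?ltn_ord //.
  by rewrite !nk ?ltn_ord // -e.
have Rw v1 w1 i : (i < a)%N -> R0 v1 w1 (z ^- (q ^ i)) = fm i w1.
  have := ub; rewrite cat_uniq => /and3P[_ /hasPn disj u2].
  move=> ia; have in2 : z ^- (q ^ i) \in map (fun i => z ^- (q ^ i)) (iota 0 a).
    by apply/map_iotaP; exists i.
  rewrite /R0; case: pickP => [k /eqP e|_].
    have := disj _ in2; rewrite /= => /negP[]; apply/map_iotaP; exists k; by [].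
  case: pickP => [k /eqP e|/(_ (Ordinal ia))]; last by rewrite /= eqxx.
  congr (fm _ w1); move: u2 => /(uniqP (0 : K)) u1.
  have nk (l : nat) : (l < a)%N -> nth (0 : K) (map (fun i => z ^- (q ^ i)) (iota 0 a)) l = z ^- (q ^ l).
    by move=> la; rewrite (nth_map 0%N) ?size_iota // nth_iota.
  apply: u1; rewrite ?inE ?size_map ?size_iota ?ltn_ord //.
  by rewrite !nk ?ltn_ord // -e.
have base v1 w1 : R0 v1 w1 z = v1 by have := Rv v1 w1 0%N a0; rewrite expn0 expr1.
have base' v1 w1 : R0 v1 w1 z^-1 = w1 by have := Rw v1 w1 0%N a0; rewrite expn0 expr1.
have fR v1 w1 m : fm a v1 = (if t.1.2 then w1 else v1) -> fm a w1 = (if t.1.2 then v1 else w1) ->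
    m \in blk F t.1 z -> map_mx frob (R0 v1 w1 m) = R0 v1 w1 (m ^+ q).
  move=> f1 f2 /blkP[i ia h]; have [ia1|ai] := ltnP i.+1 a.
    by case: h => ->; rewrite -?exprVn -exprM -expnSr ?exprVn ?Rv ?Rw.
  have ai1 : i.+1 = a by apply/eqP; rewrite eqn_leq ai ia.
  have fS u : map_mx frob (fm i u) = fm a u by rewrite -ai1.
  case: h => ->.
    rewrite (Rv _ _ _ ia) fS f1 -exprM -expnSr ai1 hz.
    by case: t.1.2; rewrite ?base ?base'.
  rewrite (Rw _ _ _ ia) fS f2 exprVn -exprM -expnSr ai1 hz.
  by case: t.1.2; rewrite ?invrK ?base ?base'.
exists (R0 v w), (R0 v' w') => m mb; split; [|exact: fR|exact: fR|].
  case/blkP: mb => i ia [->|->]; rewrite !(Rv, Rw) //; split; rewrite ?fm_eq0 //.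
  - exact: fm_eig.
  - exact: fm_eig.
  - by rewrite (fm_eig _ hw) exprVn.
  - by rewrite (fm_eig _ hw') exprVn.
case/blkP: mb => i ia [->|->]; rewrite ?invrK !(Rv, Rw) // !fm_form; first by rewrite hB.
by rewrite formC [in RHS]formC hB.
Qed.

Lemma coherent_exists : exists R R', forall m, m \in spec bz -> coherent R R' m.
Proof.
have [_ _ gbz ubz] := sx.
have : {subset bz <= bz} by []. move: ubz; elim: {1 2 4}bz => [|t l IH] ul sub.
  by exists (fun _ => 0), (fun _ => 0).
have [_ u2] : uniq (blk F t.1 t.2) /\ uniq (spec l).
  by move: ul; rewrite /spec /= cat_uniq => /and3P[].
have [R [R' hR]] := block_coherent (sub t (mem_head _ _)).
have [||S [S' hS]] := IH; [exact: u2 | by move=> u ul'; apply: sub; rewrite inE ul' orbT |].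
have gt : good t by apply: gbz; apply: sub; rewrite mem_head.
pose T (f g : K -> 'rV[K]_N) m := if m \in blk F t.1 t.2 then f m else g m.
have [cf ci] := @blk_closed n F K n_gt0 char2 qp t gt.
have inF m : (m ^+ q \in blk F t.1 t.2) = (m \in blk F t.1 t.2).
  by rewrite -(perm_mem cf) -[m ^+ q]/(frob m) mem_map //; apply: fmorph_inj.
have inI m : (m^-1 \in blk F t.1 t.2) = (m \in blk F t.1 t.2).
  by rewrite -(perm_mem ci) mem_map //; apply: invr_inj.
exists (T R S), (T R' S') => m; rewrite /spec /= mem_cat /coherent /T inF inI => /orP[mt|ml].
  by rewrite mt; apply: hR.
have [mt|_] := ifP; first exact: hR.
exact: hS.
Qed.

(** The matrix X sending the eigenbasis of x to that of x' is symplectic since the Gram matrices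
    agree, has entries in F since Frobenius permutes both bases in the same way, and conjugates x
    into x'. *)
Lemma spectral_conj : exists2 h, h \in Sp n F & x' = (x ^ h)%g.
Proof.
have [R [R' hR]] := coherent_exists.
have [xS [P [lam [dP lamE]]] gbz ubz] := sx; have [x'S _ _ _] := sx'.
have inj := spec_inj lamE ubz; have inS := idx_spec lamE.
have uP : P \in unitmx by case: dP.
pose Q := \matrix_(i, k) R (lam 0 i) 0 k; pose Q' := \matrix_(i, k) R' (lam 0 i) 0 k.
have rQ i : row i Q = R (lam 0 i) by apply/rowP=> k; rewrite !mxE.
have rQ' i : row i Q' = R' (lam 0 i) by apply/rowP=> k; rewrite !mxE.
have uQ : Q \in unitmx.
  have h i : exists c, R (lam 0 i) = c *: row i P.
    by have [[_ _ h _] _ _ _] := hR _ (inS i); apply: (eig_row dP inj).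
  have [c hc] := fin_all_exists h.
  have c0 i : c i != 0.
    have [[r0 _ _ _] _ _ _] := hR _ (inS i).
    by apply: contraNneq r0 => c0; rewrite hc c0 scale0r.
  have -> : Q = diag_mx (\row_i c i) *m P.
    by apply/row_matrixP=> i; rewrite rQ hc; apply/rowP=> k; rewrite mul_diag_mx !mxE.
  rewrite unitmx_mul uP andbT unitmxE det_diag unitfE; apply/prodf_neq0 => i _.
  by rewrite mxE.
have gram : Q' *m symp_mx K n *m Q'^T = Q *m symp_mx K n *m Q^T.
  apply/matrixP=> i k; rewrite !gram_entry !rQ !rQ'.
  have [[_ _ e1 e1'] _ _ hB] := hR _ (inS i); have [[_ _ e2 e2'] _ _ _] := hR _ (inS k).
  have [ik|ik] := eqVneq (lam 0 i * lam 0 k) 1; last by rewrite (eig_form0 xS e1 e2) // (eig_form0 x'S e1' e2').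
  by have := invr_eq ik => <-; rewrite hB.
have [X QX] : exists X, Q *m X = Q' by exists (invmx Q *m Q'); rewrite mulKVmx.
have uQT : Q^T \in unitmx by rewrite unitmx_tr.
have sX : is_symplectic X.
  apply/eqP; apply: (can_inj (mulKmx uQ)); apply: (can_inj (mulmxK uQT)).
  by rewrite -gram -QX trmx_mul !mulmxA.
have QA : Q *m M_ x = diag_mx lam *m Q.
  apply/row_matrixP=> i; have [[_ _ e1 _] _ _ _] := hR _ (inS i).
  by rewrite row_mul rQ e1 -rQ; apply/rowP=> k; rewrite mul_diag_mx !mxE.
have QA' : Q' *m M_ x' = diag_mx lam *m Q'.
  apply/row_matrixP=> i; have [[_ _ _ e1] _ _ _] := hR _ (inS i).
  by rewrite row_mul rQ' e1 -rQ'; apply/rowP=> k; rewrite mul_diag_mx !mxE.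
have AX : M_ x *m X = X *m M_ x'.
  by apply: (can_inj (mulKmx uQ)); rewrite !mulmxA QA QX QA' -mulmxA QX.
have fX : map_mx frob X = X.
  have e1 : map_mx frob Q *m X = map_mx frob Q'.
    apply/row_matrixP=> i; rewrite row_mul -!map_row rQ rQ'.
    have [_ -> -> _] := hR _ (inS i); have [k <-] := frob_idx n_gt0 qp xS dP i.
    by rewrite -rQ -rQ' -row_mul QX.
  have uf : map_mx frob Q \in unitmx by rewrite map_unitmx.
  by apply: (can_inj (mulKmx uf)); rewrite e1 -map_mxM QX.
have [X0 hX] := frob_mx_fix j fX.
have uX : X0 \in unitmx by rewrite -(map_unitmx j) -hX; apply: symplectic_unit.
have hS : toGL X0 \in Sp n F.
  rewrite SpE toGLK //; apply/eqP; apply: (map_mx_inj (f := j)).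
  by move/eqP: sX; rewrite hX -(symp_mx_map j) map_trmx -!map_mxM.
exists (toGL X0) => //; apply: (mulgI (toGL X0)); rewrite -conjgC.
apply: (mapGL_inj (j := j)); rewrite !GLvalM !map_mxM toGLK // -hX.
by rewrite AX.
Qed.
End TwoElements.
End Conjugacy.

(** * Cyclic maximal tori *)

Lemma rank_diag_indicator (R : fieldType) N (I : {set 'I_N}) :
  (\rank (diag_mx (\row_i (i \in I)%:R : 'rV[R]_N)) <= #|I|)%N.
Proof.
pose S := \matrix_(i < N, k < #|I|) (i == enum_val k)%:R : 'M[R]_(N, #|I|).
have -> : diag_mx (\row_i (i \in I)%:R : 'rV[R]_N) = S *m S^T; last exact: mulmx_max_rank.
apply/matrixP=> i l; rewrite !mxE.
rewrite (eq_bigr (fun k => (fun m => (i == m)%:R * (l == m)%:R) (enum_val k))); last first.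
  by move=> k _; rewrite !mxE.
rewrite -(big_enum_val (fun m : 'I_N => (i == m)%:R * (l == m)%:R : R)).
have [->|il] := eqVneq i l; last first.
  rewrite mulr0n big1 // => m _; case: eqP => [<-|_]; last by rewrite mul0r.
  by rewrite eq_sym (negPf il) mulr0.
rewrite mulr1n; case: (boolP (l \in I)) => lI.
  rewrite (bigD1 l) //= eqxx mulr1 big1 ?addr0 // => m /andP[_ ml].
  by rewrite eq_sym (negPf ml) mul0r.
by rewrite big1 // => m mI; case: eqP => [e|_]; [move: lI; rewrite e mI | rewrite mul0r].
Qed.

Lemma cycle_conj_quotient (gT : finGroupType) (Z S H : {group gT}) (x y x' h : gT) :
  S \subset 'N(Z) -> x \in S -> y \in S -> h \in S ->
  (H / Z)%g = <[coset Z x]>%g -> y \in H -> x' = (y ^ h)%g ->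
  #[coset Z x']%g = #[coset Z x]%g ->
  (<[coset Z x']> = <[coset Z x]> :^ coset Z h)%g.
Proof.
move=> SN xS yS hS HZ yH -> o; have hN := subsetP SN _ hS; have yN := subsetP SN _ yS.
have e : coset Z (y ^ h)%g = (coset Z y ^ coset Z h)%g by rewrite morphJ.
rewrite e in o *; rewrite cycleJ; congr (_ :^ _)%g.
have yT : coset Z y \in <[coset Z x]>%g by rewrite -HZ; apply: mem_quotient.
apply/eqP; rewrite eqEcard cycle_subG yT /=.
by rewrite -![#|<[_]>%g|]/(#[_]%g) -o orderJ.
Qed.

Section Torus.
Variables (n : nat) (F : finFieldType) (K : closedFieldType) (j : {rmorphism F -> K}).
Hypothesis n_gt0 : (0 < n)%N.
Hypothesis char2 : (2%:R : F) != 0.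
Hypothesis qp : [pchar K].-nat #|F|.
Local Notation q := #|F|.
Local Notation N := (dimV n).
Local Notation frob := (frob qp).
Local Notation B := (@symp_form K n).
Local Notation Z := 'Z(Sp n F).
Local Notation M_ y := (map_mx j (GLval y)).
Local Notation spec := (@spec F K).
Local Notation good := (@good F K).

(** By [spectral_change] the centralizer of x contains an element with the spectrum of x'. That
    element is conjugate to x' and, by its order, generates the same group as x modulo signs. *)
Lemma unique_conj (x x' : {'GL_(2 * n)[F]}) bz bz' : spectral j x bz -> spectral j x' bz' ->
  map fst bz' = map fst bz ->
  (2 * #[coset Z x]%g = weight F bz)%N -> #[coset Z x']%g = #[coset Z x]%g ->
  exists2 h, h \in PSp n F & (<[coset Z x']> = <[coset Z x]> :^ h)%g.
Proof.
move=> sx sx' e ox ox'; have [xS [P [lam [dP lamE]]] gbz ubz] := sx.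
have [_ _ gbz' ubz'] := sx'.
have [y yH sy] := spectral_change n_gt0 char2 qp xS dP lamE gbz ubz ox e gbz' ubz'.
have [h hS hx'] := spectral_conj n_gt0 char2 qp sy sx'.
have [yS _] := centralizerP j yH.
exists (coset Z h); first exact: mem_quotient.
have [HZ _] := cent_quotient n_gt0 char2 qp xS dP lamE gbz ubz ox.
exact: cycle_conj_quotient (normal_norm (center_normal (Sp n F))) xS yS hS HZ yH hx' ox'.
Qed.

Section WithElement.
Variables (x : {'GL_(2 * n)[F]}) (P : 'M[K]_N) (lam : 'rV[K]_N) (bz : seq ((nat * bool) * K)).
Hypothesis xS : x \in Sp n F.
Hypothesis dP : diagonalizes j x P lam.
Hypothesis lamE : perm_eq (spectrum lam) (spec bz).
Hypothesis gbz : forall t, t \in bz -> good t.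
Hypothesis ubz : uniq (spec bz).
Let inj := spec_inj lamE ubz.
Let uP : P \in unitmx. Proof. by case: dP. Qed.
Let PA : P *m M_ x = diag_mx lam *m P. Proof. by case: dP. Qed.
Let sA : is_symplectic (M_ x). Proof. exact: symp_map. Qed.

Definition pr (d : 'rV[K]_N) : 'M[K]_N := locked (invmx P *m diag_mx d *m P).
Lemma prE d : pr d = invmx P *m diag_mx d *m P. Proof. by rewrite /pr -lock. Qed.

Lemma pr_comm d : pr d *m M_ x = M_ x *m pr d.
Proof. by rewrite prE; case: (diag_comm dP d). Qed.

Lemma evm_pr d i : evm P (pr d) i = d 0 i.
Proof. by rewrite prE (diag_comm dP d).2. Qed.

Lemma row_pr d i : row i P *m pr d = d 0 i *: row i P.
Proof. by rewrite (evmP dP inj (pr_comm d)) evm_pr. Qed.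

Lemma pr_ext (X Y : 'M[K]_N) : (forall i, row i P *m X = row i P *m Y) -> X = Y.
Proof.
move=> h; apply: (can_inj (mulKmx uP)); apply/row_matrixP=> i.
by rewrite !row_mul h.
Qed.

Lemma pr_commX (X : 'M[K]_N) d : X *m M_ x = M_ x *m X -> pr d *m X = X *m pr d.
Proof.
move=> c; apply: pr_ext => i.
by rewrite !mulmxA row_pr (evmP dP inj c) -!scalemxAl row_pr (evmP dP inj c) scaler_swap.
Qed.

Lemma lam_neq_inv i : lam 0 i * lam 0 i != 1.
Proof.
have [t tb it] := in_specP (idx_spec lamE i).
by have := blk_sq qp (gbz tb) it; rewrite expr2.
Qed.

Lemma form_ext (X Y : 'M[K]_N) : (forall i k, lam 0 i * lam 0 k = 1 ->
    B (row i P *m X) (row k P) = B (row i P) (row k P *m Y)) ->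
  (forall i, exists c, row i P *m X = c *: row i P) ->
  (forall i, exists c, row i P *m Y = c *: row i P) ->
  X *m symp_mx K n = symp_mx K n *m Y^T.
Proof.
move=> h hX hY; have uT : P^T \in unitmx by rewrite unitmx_tr.
apply: (can_inj (mulKmx uP)); apply: (can_inj (mulmxK uT)).
rewrite !mulmxA -[_ *m Y^T *m P^T]mulmxA -trmx_mul.
apply/matrixP=> i k; rewrite !gram_entry !row_mul.
have [/h //|ik] := eqVneq (lam 0 i * lam 0 k) 1.
have [c ->] := hX i; have [d ->] := hY k.
by rewrite formZl formZr (form_rows xS dP ik) !mulr0.
Qed.

Lemma star_pr (d d' : 'rV[K]_N) : (forall i k, lam 0 i * lam 0 k = 1 -> d 0 i = d' 0 k) ->
  pr d *m symp_mx K n = symp_mx K n *m (pr d')^T.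
Proof.
move=> h; apply: form_ext => [i k /h e|i|i]; rewrite ?row_pr; try by eexists.
by rewrite formZl formZr e.
Qed.

Lemma symp_pr (d : 'rV[K]_N) : (forall i k, lam 0 i * lam 0 k = 1 -> d 0 i * d 0 k = 1) -> is_symplectic (pr d).
Proof.
move=> h; have uT : P^T \in unitmx by rewrite unitmx_tr.
apply/eqP; apply: (can_inj (mulKmx uP)); apply: (can_inj (mulmxK uT)).
rewrite !mulmxA -[_ *m (pr d)^T *m P^T]mulmxA -trmx_mul.
apply/matrixP=> i k; rewrite !gram_entry !row_mul !row_pr formZl formZr mulrA.
have [/h ->|ik] := eqVneq (lam 0 i * lam 0 k) 1; first by rewrite mul1r.
by rewrite (form_rows xS dP ik) mulr0.
Qed.

Lemma frob_pr (d d' : 'rV[K]_N) : (forall i k, lam 0 k = lam 0 i ^+ q -> d' 0 k = d 0 i ^+ q) ->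
  map_mx frob (pr d) = pr d'.
Proof.
have fA : map_mx frob (M_ x) = M_ x by apply: frob_mx_j.
have fc : map_mx frob (pr d) *m M_ x = M_ x *m map_mx frob (pr d).
  by rewrite -{1}fA -map_mxM pr_comm map_mxM fA.
move=> h; apply: (evm_inj dP inj fc (pr_comm d')) => k; rewrite evm_pr.
have [i hi] : exists i, lam 0 k = lam 0 i ^+ q.
  have [_ cf _] := spectrum_closed n_gt0 qp xS dP.
  have : lam 0 k \in spectrum lam by rewrite map_f // mem_enum.
  by rewrite -(perm_mem cf) => /mapP[_ /mapP[i _ ->] ->]; exists i.
by rewrite (evm_frob qp dP inj (pr_comm d) hi) evm_pr (h i k hi).
Qed.

Local Notation H := ('C_(Sp n F)[x])%G.
(** The centralizer of x in Sp over K, a torus because the eigenvalues of x are distinct. *)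
Definition Talg (A : 'M[K]_N) := is_symplectic A /\ A *m M_ x = M_ x *m A.

Lemma torus_Talg : torus Talg.
Proof.
have [io hio] : exists io : 'I_N -> 'I_N, forall i, lam 0 i * lam 0 (io i) = 1.
  exact: fin_all_exists (inv_idx n_gt0 qp xS dP).
have ioK i : io (io i) = i.
  apply: inj; apply: (mulfI (lam_neq0 dP (io i))); rewrite hio mulrC.
  by apply/esym; apply: hio.
have ion i : io i != i.
  by apply: contra_neq (lam_neq_inv i) => e; rewrite -{2}e hio.
(* The weight at index l is t_l / t_(io l), where [io] pairs each eigenvalue with its inverse, so
   the image is symplectic by construction. *)
pose chi l i : int := (i == l)%:R - (i == io l)%:R.
have prod_chi (t : 'I_N -> K) l : (forall i, t i != 0) -> \prod_i t i ^ chi l i = t l / t (io l).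
  move=> t0; rewrite (bigD1 l) //= (bigD1 (io l)) ?ion //= big1; last first.
    by move=> i /andP[/negPf il /negPf iol]; rewrite /chi il iol subrr expr0z.
  rewrite mulr1 /chi !eqxx (eq_sym l) (negPf (ion l)) subr0 sub0r expr1z.
  by rewrite -exprnN expr1.
exists N, P, chi; split=> // A; split=> [[sAA cA]|[t [t0 ->]]].
  have eA i := evmP dP inj cA i; set e := evm P A in eA.
  have ee i k : lam 0 i * lam 0 k = 1 -> e i * e k = 1.
    exact: (evm_symp n_gt0 xS dP inj cA sAA).
  have e0 i : e i != 0.
    by apply/eqP=> z; have := ee i (io i) (hio i); rewrite z mul0r => /eqP; rewrite eq_sym oner_eq0.
  (* In each pair of inverse eigenvalues the smaller index carries the parameter and the other one
     is set to 1. *)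
  exists (fun i : 'I_N => if (i < io i)%N then e i else 1); split=> [i|]; first by case: ifP => // _; apply: oner_neq0.
  rewrite -prE; apply: pr_ext => i; rewrite row_pr eA mxE prod_chi; last first.
    by move=> k; case: ifP => // _; apply: oner_neq0.
  congr (_ *: _); rewrite ioK; have := ion i; rewrite -val_eqE /= => ne.
  case: (ltngtP i (io i)) => h; first by rewrite divr1.
    by rewrite div1r; apply/esym/invr_eq; rewrite mulrC; apply: ee.
  by rewrite h eqxx in ne.
rewrite -prE; split; last exact: pr_comm.
apply: symp_pr => i k ik; rewrite !mxE !prod_chi //.
have -> : k = io i by apply: inj; apply: (mulfI (lam_neq0 dP i)); rewrite hio.
by rewrite ioK mulrA divfK // mulfV.
Qed.

(** A torus containing x is commutative, so it centralizes x. *)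
Lemma maximal_torus_Talg : maximal_torus Talg.
Proof.
split; first by split; [exact: torus_Talg | move=> A []].
move=> T' [[k [Q [chi [uQ hT]]]] symT'] sub A TA; split; first exact: symT'.
have Tx : T' (M_ x) by apply: sub.
have [t [_ ->]] := (hT A).1 TA; have [u [_ ->]] := (hT _).1 Tx.
rewrite !mulmxA !mulmxK // -!mulmxA; congr (_ *m _); rewrite !mulmxA; congr (_ *m _).
by apply/matrixP=> a b; rewrite !mul_diag_mx !mxE; case: eqP => [->|]; rewrite ?mulr1n ?mulr0n ?mulr0 // mulrC.
Qed.

Lemma frobenius_stable_Talg : frobenius_stable F Talg.
Proof.
move=> A; rewrite -[map_mx _ A]/(map_mx frob A).
have fA : map_mx frob (M_ x) = M_ x by apply: frob_mx_j.
have finj : injective (map_mx frob : 'M[K]_N -> 'M[K]_N).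
  by move=> U V /matrixP e; apply/matrixP=> a b; apply: (fmorph_inj frob); have := e a b; rewrite !mxE.
have e1 : is_symplectic (map_mx frob A) = is_symplectic A.
  rewrite /is_symplectic -{1 2}(symp_mx_map frob) map_trmx -!map_mxM.
  by apply/eqP/eqP => [/finj|->].
rewrite /Talg e1; split=> -[h1 h2]; split=> //.
  by apply: finj; rewrite !map_mxM fA.
by rewrite -{1}fA -map_mxM h2 map_mxM fA.
Qed.

Lemma maximal_torus_cent : maximal_torus_Sp j H.
Proof.
exists Talg; split; [exact: maximal_torus_Talg | exact: frobenius_stable_Talg |].
move=> y; split=> [yH|[yS [_ c]]]; last exact: (@cent_in n F K j).
by have [yS c] := centralizerP j yH; split=> //; split=> //; apply: symp_map.
Qed.

Lemma cyclic_maximal_torus : (2 * #[coset Z x]%g = weight F bz)%N ->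
  [/\ (H / Z)%g = <[coset Z x]>%g, cyclic (H / Z)%g, maximal_torus_PSp j (H / Z)%G
    & #|(H / Z)%g| = (weight F bz)./2].
Proof.
move=> ox; have [HZ _] := cent_quotient n_gt0 char2 qp xS dP lamE gbz ubz ox.
split=> //.
- by rewrite HZ cycle_cyclic.
- by exists H => //; apply: maximal_torus_cent.
- rewrite HZ -[#|_|]/(#[_]%g).
  by move: (#[_]%g) (weight F bz) ox => a b; lia.
Qed.
End WithElement.
End Torus.

(** * Overgroups of the tori *)

Section TwoBlocks.
Variables (n : nat) (F : finFieldType) (K : closedFieldType) (j : {rmorphism F -> K}).
Hypothesis n_gt0 : (0 < n)%N.
Hypothesis char2 : (2%:R : F) != 0.
Hypothesis qp : [pchar K].-nat #|F|.
Local Notation q := #|F|.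
Local Notation N := (dimV n).
Local Notation frob := (frob qp).
Local Notation J := (symp_mx F n).
Local Notation Z := 'Z(Sp n F).
Local Notation M_ y := (map_mx j (GLval y)).
Local Notation spec := (@spec F K).
Local Notation good := (@good F K).

Section Stabilizer.
Variables U W : 'M[F]_N.
Definition stab_set : {set {'GL_(2 * n)[F]}} :=
  [set y in Sp n F | stablemx U (GLval y) && stablemx W (GLval y)].
Lemma stab_group_set : group_set stab_set.
Proof.
apply/group_setP; split=> [|y z]; rewrite ![_ \in stab_set]inE.
  by rewrite group1 GLval1 !mulmx1 !submx_refl.
move=> /and3P[yS yU yW] /and3P[zS zU zW]; rewrite groupM // GLvalM !mulmxA.
by rewrite (submx_trans (submxMr _ yU) zU) (submx_trans (submxMr _ yW) zW).
Qed.
Definition stab_group := Group stab_group_set.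
End Stabilizer.

Variables (x : {'GL_(2 * n)[F]}) (P : 'M[K]_N) (lam : 'rV[K]_N).
Variables (t t' : (nat * bool) * K).
Local Notation bz := [:: t; t'].
Hypothesis xS : x \in Sp n F.
Hypothesis dP : diagonalizes j x P lam.
Hypothesis lamE : perm_eq (spectrum lam) (spec bz).
Hypothesis gbz : forall t, t \in bz -> good t.
Hypothesis ubz : uniq (spec bz).
Local Notation H := ('C_(Sp n F)[x])%G.
Let inj := spec_inj lamE ubz.
Let uP : P \in unitmx. Proof. by case: dP. Qed.
Local Notation pr := (pr P).
Let gt : good t. Proof. by apply: gbz; rewrite inE eqxx. Qed.
Let gt' : good t'. Proof. by apply: gbz; rewrite !inE eqxx orbT. Qed.

Lemma eig_in_spec (u : 'rV[K]_N) m : u != 0 -> u *m M_ x = m *: u -> exists i, lam 0 i = m.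
Proof.
move=> u0 h; pose c := u *m invmx P; have uE : u = c *m P by rewrite mulmxKV.
have [_ PA] := dP.
have h2 : c *m diag_mx lam = m *: c.
  have : c *m diag_mx lam *m P = m *: c *m P by rewrite -mulmxA -PA mulmxA -uE h -scalemxAl -uE.
  by move/(congr1 (mulmx^~ (invmx P))); rewrite !mulmxK.
have [i ci] : exists i, c 0 i != 0.
  apply/existsP; apply: contraR u0; rewrite negb_exists => /forallP c0.
  have -> : u = 0 *m P; last by rewrite mul0mx.
  by rewrite uE; congr (_ *m P); apply/rowP=> i; rewrite [RHS]mxE; apply/eqP; have := c0 i; rewrite negbK.
exists i; have /rowP/(_ i) := h2; rewrite mul_mx_diag [LHS]mxE [RHS]mxE mulrC.
exact: (mulIf ci).
Qed.

Let I : {set 'I_N} := [set i | lam 0 i \in blk F t.1 t.2].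
Let d : 'rV[K]_N := \row_i (i \in I)%:R.

Let blk_frob w : (w ^+ q \in blk F t.1 t.2) = (w \in blk F t.1 t.2).
Proof.
have [cf _] := @blk_closed n F K n_gt0 char2 qp t gt.
by rewrite -(perm_mem cf) -[w ^+ q]/(frob w) mem_map //; apply: fmorph_inj.
Qed.
Let blk_inv w : (w^-1 \in blk F t.1 t.2) = (w \in blk F t.1 t.2).
Proof.
have [_ ci] := @blk_closed n F K n_gt0 char2 qp t gt.
by rewrite -(perm_mem ci) mem_map //; apply: invr_inj.
Qed.

Lemma card_block : #|I| = (2 * t.1.1)%N.
Proof.
have -> : #|I| = count (mem (blk F t.1 t.2)) (spectrum lam).
  rewrite -sum1_card -sum1_count big_map big_enum_cond /=.
  by apply: eq_bigl => i; rewrite inE.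
have -> : count (mem (blk F t.1 t.2)) (spectrum lam) = count (mem (blk F t.1 t.2)) (spec bz).
  exact/seq.permP.
rewrite /spec /= cats0 count_cat.
have -> : count (mem (blk F t.1 t.2)) (blk F t.1 t.2) = size (blk F t.1 t.2).
  by apply/eqP; rewrite -all_count; apply/allP.
have -> : count (mem (blk F t.1 t.2)) (blk F t'.1 t'.2) = 0%N.
  apply/eqP; rewrite -leqn0 leqNgt -has_count.
  by move: ubz; rewrite /spec /= cats0 cat_uniq => /and3P[].
by rewrite addn0 size_cat !size_map size_iota; lia.
Qed.

Lemma block_idempotent : exists E : 'M[F]_N, map_mx j E = pr d.
Proof.
suff [E hE] : exists E : 'M[F]_N, pr d = map_mx j E by exists E.
apply: (@frob_mx_fix F K j qp); apply: (frob_pr n_gt0 qp xS dP lamE ubz) => i k ik.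
by rewrite !mxE !inE ik blk_frob; case: (_ \in _); rewrite ?expr1n // expr0n gtn_eqF // (leq_trans _ (finNzRing_gt1 F)).
Qed.

(** The projection E onto the first block is fixed by Frobenius, self-adjoint, and commutes with the
    centralizer. For properness: a transvection along v in the image of E stabilizes both spaces; if
    it commuted with x, v would be an eigenvector with eigenvalue in F, hence of square 1, because
    Frobenius inverts the block. *)
Lemma SpxSp_proper : t.1.2 -> exists2 M, SpxSp_subgroup t.1.1 t'.1.1 M & (H / Z)%G \proper M.
Proof.
move=> minus; have [E hE] := block_idempotent.
have jinj (a b : nat) (X Y : 'M[F]_(a, b)) : map_mx j X = map_mx j Y -> X = Y by apply: map_mx_inj.
have EE : E *m E = E.
  apply: jinj; rewrite map_mxM hE; apply: (pr_ext dP) => i.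
  by rewrite mulmxA !(row_pr dP lamE ubz) -scalemxAl (row_pr dP lamE ubz) scalerA !mxE -natrM mulnb andbb.
have EJ : E *m J = J *m E^T.
  apply: jinj; rewrite !map_mxM -map_trmx hE symp_mx_map.
  apply: (star_pr xS dP lamE ubz) => i k ik; rewrite !mxE !inE.
  by rewrite -blk_inv (_ : (lam 0 i)^-1 = lam 0 k) //; apply: invr_eq.
have EC y : y \in H -> E *m GLval y = GLval y *m E.
  move=> /(centralizerP j)[_ c]; apply: jinj; rewrite !map_mxM hE.
  exact: (pr_commX dP lamE ubz).
set W : 'M[F]_N := 1%:M - E.
have nE : n = (t.1.1 + t'.1.1)%N.
  have := perm_size lamE; rewrite size_map size_enum_ord (size_spec n_gt0 char2 qp).
  by rewrite !big_cons big_nil (dimV_eq n_gt0); lia.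
have rank_pr (I' : {set 'I_N}) : (\rank (pr (\row_i (i \in I')%:R)) <= #|I'|)%N.
  rewrite prE; apply: leq_trans (mxrankM_maxl _ _) _; apply: leq_trans (mxrankM_maxr _ _) _.
  exact: rank_diag_indicator.
have rE : (\rank E <= 2 * t.1.1)%N by rewrite -(mxrank_map j) hE -card_block; apply: rank_pr.
have rW : (\rank W <= 2 * t'.1.1)%N.
  rewrite -(mxrank_map j); have -> : map_mx j W = pr (\row_i (i \in ~: I)%:R).
    rewrite map_mxB map_mx1 hE; apply: (pr_ext dP) => i.
    rewrite mulmxBr mulmx1 !(row_pr dP lamE ubz) !mxE in_setC.
    by case: (i \in I); rewrite ?scale1r ?scale0r ?subrr ?subr0.
  apply: leq_trans (rank_pr _) _; rewrite cardsCs setCK card_ord card_block.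
  by rewrite (dimV_eq n_gt0); lia.
have rEW : (N <= \rank E + \rank W)%N.
  apply: leq_trans (mxrank_add _ _); rewrite (_ : E + W = 1%:M) ?mxrank1 //.
  by rewrite addrC subrK.
have N2 := dimV_eq n_gt0.
pose HM := stab_group E W.
have ZH : (Z \subset H)%g by apply: (center_cent xS).
have HHM : H \subset HM.
  apply/subsetP=> y yH; have [yS _] := centralizerP j yH; have c := EC y yH.
  rewrite [y \in HM]inE yS /=; apply/andP; split; first by rewrite c submxMl.
  by rewrite (_ : W *m GLval y = GLval y *m W) ?submxMl // mulmxBl mulmxBr mul1mx mulmx1 c.
exists (HM / Z)%G.
  exists E, W, HM; split=> //; first by split; lia.
  - apply/eqmxP; rewrite submx1 /= -{1}(subrK E 1%:M) addrC.
    exact: addmx_sub_adds.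
  - rewrite /W linearB /= trmx1 mulmxBr mulmx1 -[E *m J *m E^T]mulmxA -EJ mulmxA EE subrr //.
  - move=> y; rewrite [y \in HM]inE; split=> [/and3P[]|[-> -> ->]] //.
rewrite properE; apply/andP; split; first exact: quotientS.
apply/negP; rewrite quotientSGK //; last first.
  apply: subset_trans (normal_norm (center_normal _)); apply/subsetP=> y.
  by rewrite [y \in HM]inE => /andP[].
move=> /subsetP sub; set v := nz_row E.
have vE : (v <= E)%MS by apply: nz_row_sub.
have v0 : v != 0.
  rewrite nz_row_eq0 -mxrank_eq0; have [a0 _ _ _ _] := gt; move: a0 rEW rW; lia.
have tH : tg v 1 \in H.
  apply: sub; rewrite [_ \in HM]inE tg_Sp //= GLval_tg //; apply/andP; split.
    apply/rV_subP=> _ /submxP[D ->]; rewrite mulmxA mul_tv; apply: addmx_sub; first exact: submxMl.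
    by apply: scalemx_sub.
  apply/rV_subP=> _ /submxP[D ->]; rewrite mulmxA mul_tv.
  have -> : symp_form (D *m W) v = 0.
    have /submxP[D' ->] := vE; rewrite /symp_form trmx_mul.
    have -> : D *m W *m J *m (E^T *m D'^T) = D *m (W *m (J *m E^T)) *m D'^T by rewrite !mulmxA.
    by rewrite -EJ mulmxA mulmxBl mul1mx EE subrr mul0mx mulmx0 mul0mx mxE.
  by rewrite mulr0 scale0r addr0 submxMl.
have [_ /cent1P cx] := setIP tH.
have : (tg v 1 ^ x)%g = tg v 1 by rewrite /conjg cx mulKg.
rewrite tg_conj // => /(congr1 (fun g => GLval g)); rewrite !GLval_tg // => e.
have vx0 : v *m GLval x != 0.
  by apply: contra_neq v0 => h; rewrite -[v](mulmxK (GLval_unitmx x)) h mul0mx.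
have [k hk] := tv_line n_gt0 v0 vx0 (oner_neq0 F) (esym e).
have mv0 : map_mx j v != 0 by rewrite map_mx_eq0.
have [|i hi] := @eig_in_spec (map_mx j v) (j k) mv0; first by rewrite -map_mxM hk map_mxZ.
have fi : lam 0 i ^+ q = lam 0 i by rewrite hi; exact: frob_j.
have iI : (i : 'I_N) \in I.
  have eE : E *m E = E := EE; have /submxP[D vD] := vE.
  have vEv : v *m E = v by rewrite vD -mulmxA EE.
  have := congr1 (map_mx j) vEv; rewrite map_mxM hE => h.
  have [c hc] : exists c, map_mx j v = c *: row i P.
    by apply: (eig_row dP inj); rewrite -map_mxM hk map_mxZ hi.
  rewrite hc -scalemxAl (row_pr dP lamE ubz) in h; apply: contraT => nI.
  move: h; rewrite !mxE (negPf nI) scale0r scaler0 => h.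
  by move: mv0; rewrite hc -h eqxx.
move: iI; rewrite inE => /blkP[l _ hl].
have [a0 z2 z0 _ hz] := gt; rewrite minus in hz.
have fz : t.2 ^+ q = t.2.
  case: hl => hl; move: fi; rewrite hl; last rewrite -exprVn.
    by rewrite -exprM mulnC exprM => /(frobX_inj qp).
  rewrite -exprM mulnC exprM => /(frobX_inj qp); rewrite exprVn.
  by apply: invr_inj.
have fz' m : t.2 ^+ (q ^ m) = t.2.
  by elim: m => [|m IH]; rewrite ?expr1 // expnSr exprM IH.
by move: z2; rewrite expr2 -{2}(fz' t.1.1) hz mulfV ?eqxx.
Qed.
End TwoBlocks.

(** * The field with Q elements inside a closed field *)

Section FixField.
Variables (K : closedFieldType) (Q : nat).

Definition frob_pnat := ([pchar K].-nat Q && (1 < Q)%N).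
(** Indexing the predicate by the proof lets its closure properties be registered as an instance. *)
Definition fixp (_ : frob_pnat) : {pred K} := fun z => z ^+ Q == z.

Variable hQ : frob_pnat.
Let hq : [pchar K].-nat Q. Proof. by case/andP: hQ. Qed.
Let Q1 : (1 < Q)%N. Proof. by case/andP: hQ. Qed.

Lemma fixp_divring : divring_closed (fixp hQ).
Proof.
split=> [|x y|x y]; rewrite !unfold_in ?expr1n //.
  by move=> /eqP hx /eqP hy; rewrite exprDn_pchar // exprNn_pchar // hx hy.
by move=> /eqP hx /eqP hy; rewrite exprMn exprVn hx hy.
Qed.
HB.instance Definition _ := GRing.isDivringClosed.Build K (fixp hQ) fixp_divring.

Record fix_field := FixField { fix_val : K; _ : fix_val \in fixp hQ }.
HB.instance Definition _ := [isSub for fix_val].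
HB.instance Definition _ := [Choice of fix_field by <:].
HB.instance Definition _ := [SubChoice_isSubIntegralDomain of fix_field by <:].
HB.instance Definition _ := [SubIntegralDomain_isSubField of fix_field by <:].

Definition fix_roots : seq K := sval (closed_field_poly_normal ('X^Q - 'X)).

Lemma fix_rootsE : 'X^Q - 'X = \prod_(z <- fix_roots) ('X - z%:P).
Proof.
rewrite /fix_roots; case: closed_field_poly_normal => /= rs {1}->.
rewrite (_ : lead_coef _ = 1) ?scale1r // lead_coefDl ?lead_coefXn //.
by rewrite size_polyXn size_polyN size_polyX.
Qed.

Lemma fix_rootsP z : (z \in fix_roots) = (z \in fixp hQ).
Proof. by rewrite -root_prod_XsubC -fix_rootsE /root !hornerE subr_eq0. Qed.

Lemma fix_roots_uniq : uniq fix_roots /\ size fix_roots = Q.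
Proof.
split.
  rewrite -separable_prod_XsubC -fix_rootsE separable_poly.unlock !derivE.
  have Q0 : (Q%:R : K) = 0.
    have [p pQ] : exists p, p \in \pi(Q) by exists (pdiv Q); rewrite pi_pdiv.
    have pK := pnatPpi hq pQ; have /dvdnP[c ->] : (p %| Q)%N by move: pQ; rewrite mem_primes => /and3P[].
    by rewrite natrM (pcharf0 pK) mulr0.
  by rewrite -scaler_nat Q0 scale0r sub0r -[X in coprimep _ X]scaleN1r coprimepZr ?oppr_eq0 ?oner_eq0 // coprimep1.
have := congr1 (size \o @polyseq K) fix_rootsE; rewrite /= size_prod_XsubC size_polyDl ?size_polyXn.
  by case.
by rewrite size_polyN size_polyX.
Qed.

(** The successor makes the ordinal type nonempty, as [inord] requires. *)
Definition fix_pickle (l : fix_field) : 'I_(size fix_roots).+1 := inord (index (fix_val l) fix_roots).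
Definition fix_unpickle (i : 'I_(size fix_roots).+1) : option fix_field := insub (nth 0 fix_roots i).
Lemma fix_pickleK : pcancel fix_pickle fix_unpickle.
Proof.
move=> l; have lr : fix_val l \in fix_roots by rewrite fix_rootsP; apply: (valP l).
rewrite /fix_unpickle /fix_pickle inordK ?nth_index //; first by rewrite valK.
by rewrite ltnS index_size.
Qed.
HB.instance Definition _ := PCanIsCountable fix_pickleK.
HB.instance Definition _ := isFinite.Build fix_field (pcan_enumP fix_pickleK).
End FixField.

Lemma fix_field_exists (K : closedFieldType) (Q : nat) : [pchar K].-nat Q -> (1 < Q)%N ->
  exists (L : finFieldType) (k : {rmorphism L -> K}),
    #|L| = Q /\ forall z : K, z ^+ Q = z -> exists l, z = k l.
Proof.
move=> hq Q1; have hQ : frob_pnat K Q by rewrite /frob_pnat hq.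
exists (fix_field hQ : finFieldType), (val : {rmorphism fix_field hQ -> K}); split.
  have [u sz] := fix_roots_uniq hQ; rewrite -[RHS]sz cardE -(size_map val).
  apply/perm_size/uniq_perm => //.
    by rewrite map_inj_uniq ?enum_uniq //; apply: val_inj.
  move=> z; rewrite fix_rootsP; apply/mapP/idP => [[l _ ->]|hz]; first exact: (valP l).
  by exists (FixField hz); rewrite ?mem_enum.
move=> z hz; have zf : z \in fixp hQ by rewrite unfold_in hz.
by exists (FixField zf).
Qed.

Section TwoByTwo.
Variable R : comNzRingType.
Implicit Types A C : 'M[R]_2.

Lemma det2 A : \det A = A 0 0 * A 1 1 - A 0 1 * A 1 0.
Proof.
rewrite (expand_det_row A 0) !big_ord_recl big_ord0 addr0 /cofactor !det_mx11 !mxE /=.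
rewrite expr0 expr1 mul1r mulN1r mulrN.
by congr (A _ _ * A _ _ - A _ _ * A _ _); apply: val_inj.
Qed.

Lemma mul2 A C i k : (A *m C) i k = A i 0 * C 0 k + A i 1 * C 1 k.
Proof.
rewrite mxE !big_ord_recl big_ord0 addr0.
by congr (_ + A _ _ * C _ _); apply: val_inj.
Qed.

Lemma alt2_conj A C : C 0 0 = 0 -> C 1 1 = 0 -> C 1 0 = - C 0 1 ->
  (A *m C *m A^T) 0 1 = \det A * C 0 1.
Proof. by move=> c0 c1 c2; rewrite !mul2 [A^T 0 1]mxE [A^T 1 1]mxE c0 c1 c2 det2; ring. Qed.
End TwoByTwo.

Lemma symp_form2 (R : comUnitRingType) (u v : 'rV[R]_2) : @symp_form R 1 u v = u 0 0 * v 0 1 - u 0 1 * v 0 0.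
Proof.
have sum2 (f : 'I_2 -> R) : \sum_(k < 2) f k = f 0 + f 1.
  by rewrite !big_ord_recl big_ord0 addr0; congr (_ + f _); apply: val_inj.
transitivity (\sum_(k < 2) (u *m symp_mx R 1) 0 k * v 0 k).
  by rewrite /symp_form mxE; apply: eq_bigr => k _; rewrite [v^T _ _]mxE.
have JE (k : 'I_2) : (u *m symp_mx R 1) 0 k = \sum_(l < 2) u 0 l * symp_mx R 1 l k by rewrite mxE.
by rewrite sum2 !JE !sum2 !mxE /=; ring.
Qed.

(** * The overgroup for a single block *)

Section OneBlock.
Variables (n : nat) (F : finFieldType) (K : closedFieldType) (j : {rmorphism F -> K}).
Hypothesis n_gt0 : (0 < n)%N.
Hypothesis char2 : (2%:R : F) != 0.
Hypothesis qp : [pchar K].-nat #|F|.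
Local Notation q := #|F|.
Local Notation N := (dimV n).
Local Notation frob := (frob qp).
Local Notation J := (symp_mx F n).
Local Notation Z := 'Z(Sp n F).
Local Notation M_ y := (map_mx j (GLval y)).
Local Notation spec := (@spec F K).
Local Notation good := (@good F K).

Variables (x : {'GL_(2 * n)[F]}) (P : 'M[K]_N) (lam : 'rV[K]_N) (t : (nat * bool) * K).
Local Notation bz := [:: t].
Hypothesis xS : x \in Sp n F.
Hypothesis dP : diagonalizes j x P lam.
Hypothesis lamE : perm_eq (spectrum lam) (spec bz).
Hypothesis gbz : forall t, t \in bz -> good t.
Hypothesis ubz : uniq (spec bz).
Local Notation H := ('C_(Sp n F)[x])%G.
Let inj := spec_inj lamE ubz.
Let uP : P \in unitmx. Proof. by case: dP. Qed.
Local Notation pr := (pr P).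
Let gt : good t. Proof. by apply: gbz; rewrite inE eqxx. Qed.

Let tn : t.1.1 = n.
Proof.
have := perm_size lamE; rewrite size_map size_enum_ord (size_spec n_gt0 char2 qp).
by rewrite !big_cons big_nil (dimV_eq n_gt0); lia.
Qed.

(** The spectrum is cut into n pairs {z^(q^l), z^(- q^l)}. The projection [e] onto the pair l = 0
    has rank at most 2 and entries in the extension L of degree n; its n Frobenius conjugates sum to
    1, which yields the structure of an L-plane. *)
Let pairp (l : nat) (w : K) := (w == t.2 ^+ (q ^ l)) || (w == t.2 ^- (q ^ l)).
Let d (l : nat) : 'rV[K]_N := \row_i (pairp l (lam 0 i))%:R.
Let e := pr (d 0).

Let q0 : (0 < q)%N. Proof. by rewrite (leq_trans _ (finNzRing_gt1 F)). Qed.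

Lemma frob_pair l : map_mx frob (pr (d l)) = pr (d l.+1).
Proof.
apply: (frob_pr n_gt0 qp xS dP lamE ubz) => i k ik; rewrite !mxE.
have -> : pairp l.+1 (lam 0 k) = pairp l (lam 0 i).
  have eqf a b : (a ^+ q == b ^+ q) = (a == b) := inj_eq (fmorph_inj frob) a b.
  by rewrite /pairp ik !expnSr !exprM -exprVn !eqf.
by case: (pairp _ _); rewrite ?expr1n // expr0n gtn_eqF.
Qed.

Lemma pair_period : d n = d 0.
Proof.
apply/rowP=> i; rewrite !mxE /pairp expn0 expr1.
have [_ _ _ _] := gt; rewrite tn => ->.
by case: t.1.2; rewrite ?invrK // orbC.
Qed.

Lemma pair_entry l a b : (pr (d l)) a b = e a b ^+ (q ^ l).
Proof.
elim: l => [|l IH]; first by rewrite expn0 expr1.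
by rewrite -frob_pair mxE IH frobE -exprM expnSr.
Qed.

Lemma sum_pairs : \sum_(l < n) pr (d l) = 1%:M.
Proof.
apply: (pr_ext dP) => i; rewrite mulmx1 mulmx_sumr.
have [t' tb hi] := in_specP (idx_spec lamE i); rewrite inE in tb; rewrite (eqP tb) {tb} in hi.
have /blkP[l0 l0n h] := hi; rewrite tn in l0n.
rewrite (bigD1 (Ordinal l0n)) //= (row_pr dP lamE ubz) mxE.
have -> : pairp l0 (lam 0 i) by rewrite /pairp; case: h => ->; rewrite eqxx ?orbT.
rewrite scale1r big1 ?addr0 // => l ll0; rewrite (row_pr dP lamE ubz) mxE.
have -> : pairp l (lam 0 i) = false; last by rewrite scale0r.
apply/negP=> hl; case/negP: ll0; rewrite -val_eqE /=.
have ub : uniq (blk F t.1 t.2) by case: gt.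
move: ub; rewrite /blk cat_uniq tn => /and3P[u1 /hasPn disj u2].
have in1 m : (m < n)%N -> t.2 ^+ (q ^ m) \in map (fun i => t.2 ^+ (q ^ i)) (iota 0 n).
  by move=> mn; apply/map_iotaP; exists m.
have in2 m : (m < n)%N -> t.2 ^- (q ^ m) \in map (fun i => t.2 ^- (q ^ i)) (iota 0 n).
  by move=> mn; apply/map_iotaP; exists m.
have dj a b : (a < n)%N -> (b < n)%N -> t.2 ^+ (q ^ a) <> t.2 ^- (q ^ b).
  by move=> an bn ab; have := disj _ (in2 b bn); rewrite /= -ab in1.
have i1 a b : (a < n)%N -> (b < n)%N -> t.2 ^+ (q ^ a) = t.2 ^+ (q ^ b) -> a = b.
  move=> an bn ab; have := uniqP (0 : K) u1 a b; rewrite !inE size_map size_iota => /(_ an bn).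
  by apply; rewrite !(nth_map 0%N) ?size_iota // !nth_iota.
have ln := ltn_ord l; apply/eqP.
by case: h hl => ->; rewrite /pairp => /orP[] /eqP; [move/(i1 _ _ l0n ln) | move/(dj _ _ l0n ln) |
  move/esym/(dj _ _ ln l0n) | move/invr_inj/(i1 _ _ l0n ln)].
Qed.

Lemma pair_idem l : pr (d l) *m pr (d l) = pr (d l).
Proof.
apply: (pr_ext dP) => i.
by rewrite mulmxA !(row_pr dP lamE ubz) -scalemxAl (row_pr dP lamE ubz) scalerA !mxE -natrM mulnb andbb.
Qed.

Lemma pair_star l : pr (d l) *m symp_mx K n = symp_mx K n *m (pr (d l))^T.
Proof.
apply: (star_pr xS dP lamE ubz) => i k ik; rewrite !mxE; congr (_%:R); congr nat_of_bool.
have -> : lam 0 k = (lam 0 i)^-1 by apply/esym/invr_eq.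
rewrite /pairp orbC; congr (_ || _); first by rewrite -(inj_eq (@invr_inj K)) invrK.
by rewrite -[in RHS](inj_eq (@invr_inj K)) !invrK.
Qed.

Lemma rank_pair : (\rank e <= 2)%N.
Proof.
pose I := [set i | pairp 0 (lam 0 i)]; have dE : d 0 = \row_i (i \in I)%:R.
  by apply/rowP=> i; rewrite !mxE inE.
rewrite /e prE dE; apply: leq_trans (mxrankM_maxl _ _) _; apply: leq_trans (mxrankM_maxr _ _) _.
apply: leq_trans (rank_diag_indicator _ _) _.
apply: (@leq_trans #|[set idx lam t.2; idx lam t.2^-1]|); last by rewrite cards2; case: (_ != _).
have [a0 _ _ _ _] := gt.
have s1 : t.2 \in spec bz by apply: (base_spec gbz); rewrite inE.
have s2 : t.2^-1 \in spec bz.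
  apply: (@blk_spec F K bz t); rewrite ?inE //= mem_cat; apply/orP; right; apply/map_iotaP.
  by exists 0%N; rewrite ?expn0 ?expr1.
apply/subset_leq_card/subsetP=> i; rewrite !inE /pairp expn0 !expr1 => /orP[] /eqP h; apply/orP.
  by left; apply/eqP/inj; rewrite (idxK lamE).
by right; apply/eqP/inj; rewrite (idxK lamE).
Qed.

Section WithField.
Variables (L : finFieldType) (k : {rmorphism L -> K}) (i : {rmorphism F -> L}).
Hypothesis cardL : #|L| = (q ^ n)%N.
Hypothesis kL : forall z : K, z ^+ (q ^ n) = z -> exists l, z = k l.
Hypothesis ki : forall a, k (i a) = j a.

Local Notation iM y := (map_mx i (GLval y)).
Let kiM a b (Y : 'M[F]_(a, b)) : map_mx k (map_mx i Y) = map_mx j Y.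
Proof. by apply/matrixP=> c c'; rewrite !mxE ki. Qed.
Let kinj a b (X Y : 'M[L]_(a, b)) : map_mx k X = map_mx k Y -> X = Y.
Proof. exact: map_mx_inj. Qed.

Lemma pair_descent : exists e0 : 'M[L]_N, map_mx k e0 = e.
Proof.
have h (ab : 'I_N * 'I_N) : exists l, e ab.1 ab.2 = k l.
  by apply: kL; rewrite -pair_entry pair_period.
have [f hf] := fin_all_exists h; exists (\matrix_(a, b) f (a, b)).
by apply/matrixP=> a b; rewrite !mxE -(hf (a, b)).
Qed.

(** The conjugate projections are self-adjoint and sum to 1, so the form is the sum of the
    conjugates of its restriction to the image of [e0], that is, a trace. *)
Lemma form_trace (e0 : 'M[L]_N) (u v : 'rV[F]_N) : map_mx k e0 = e ->
  i (symp_form u v) = \sum_(l < n) @symp_form L n (map_mx i u *m e0) (map_mx i v *m e0) ^+ (q ^ l).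
Proof.
move=> he; apply: (fmorph_inj k); rewrite ki rmorph_sum /=.
rewrite -(symp_form_map j) -[map_mx j u]mulmx1 -{1}sum_pairs mulmx_sumr /symp_form.
rewrite !mulmx_suml summxE; apply: eq_bigr => l _; rewrite rmorphXn /=.
rewrite -[((map_mx i u *m e0) *m _ *m _) 0 0]/(symp_form _ _) -symp_form_map !map_mxM he !kiM.
have fl (w : 'rV[F]_N) : fm qp l (map_mx j w *m e) = map_mx j w *m pr (d l).
  elim: (l : nat) => // m IH; rewrite /fm iterS -/(fm qp m _) IH map_mxM frob_pair.
  by rewrite (frob_mx_j j qp).
rewrite -(fm_form qp) !fl /symp_form trmx_mul.
have -> : map_mx j u *m pr (d l) *m symp_mx K n *m ((pr (d l))^T *m (map_mx j v)^T) =
    map_mx j u *m (pr (d l) *m (symp_mx K n *m (pr (d l))^T)) *m (map_mx j v)^T by rewrite !mulmxA.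
have -> : pr (d l) *m (symp_mx K n *m (pr (d l))^T) = pr (d l) *m symp_mx K n.
  by rewrite -pair_star mulmxA pair_idem.
by rewrite !mulmxA.
Qed.

(** A factorization E R of the projection identifies F^(2n) with L^2 by u |-> u E. This map is
    injective because the conjugates of [e] sum to 1, so the rank is at least 2 by cardinality. *)
Lemma PSL2_factor : exists (E : 'M[L]_(N, 2)) (R : 'M[L]_(2, N)),
  [/\ map_mx k (E *m R) = e, R *m E = 1%:M, (R *m symp_mx L n *m R^T) 0 1 = 1 &
      injective (fun u : 'rV[F]_N => map_mx i u *m E)].
Proof.
have [e0 he] := pair_descent.
have e0e0 : e0 *m e0 = e0 by apply: kinj; rewrite map_mxM he pair_idem.
have inj_row m (E : 'M[L]_(N, m)) (R : 'M[L]_(m, N)) : E *m R = e0 ->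
    injective (fun u : 'rV[F]_N => map_mx i u *m E).
  move=> ER u v /= uv; apply/eqP; rewrite -subr_eq0 -(map_mx_eq0 j) map_mxB.
  set w := map_mx j u - map_mx j v.
  have we : w *m e = 0.
    rewrite /w mulmxBl -he -!kiM -!map_mxM -map_mxB -ER !mulmxA uv subrr.
    exact: map_mx0.
  have wl (l : nat) : w *m pr (d l) = 0.
    have -> : w *m pr (d l) = fm qp l (w *m e); last first.
      by rewrite we; elim: l => // l IH; rewrite /fm iterS -/(fm _ _ _) IH map_mx0.
    elim: l => // l IH; rewrite /fm iterS -/(fm _ _ _) -IH map_mxM frob_pair.
    by rewrite /w map_mxB !(frob_mx_j j qp).
  rewrite -[w]mulmx1 -sum_pairs mulmx_sumr big1 // => l _; exact: wl.
have rk : \rank e0 = 2.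
  apply/eqP; rewrite eqn_leq -{1}(mxrank_map k) he rank_pair /=.
  have := leq_card _ (inj_row _ _ _ (mulmx_base e0)); rewrite !card_mx cardL -expnM.
  rewrite leq_exp2l ?finNzRing_gt1 //; move: (\rank e0) (dimV_eq n_gt0) => r hN.
  by rewrite !mul1n hN mulnC leq_pmul2l.
have [E [R [ER RE]]] : exists (E : 'M[L]_(N, 2)) (R : 'M[L]_(2, N)), E *m R = e0 /\ R *m E = 1%:M.
  have fC : row_full (col_base e0) := col_base_full e0; have fR := row_base_free e0.
  have h : row_base e0 *m col_base e0 = 1%:M.
    have gen r (Cb : 'M[L]_(N, r)) (Rb : 'M[L]_(r, N)) : Cb *m Rb = e0 -> row_full Cb -> row_free Rb ->
        Rb *m Cb = 1%:M.
      move=> CR fCb fRb; have h1 : Cb *m (Rb *m Cb) *m Rb = Cb *m 1%:M *m Rb.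
        by rewrite mulmx1 CR -[in RHS]e0e0 -CR !mulmxA.
      by move/(row_free_inj fRb)/(row_full_inj fCb): h1.
    exact: gen (mulmx_base e0) fC fR.
  move: (col_base e0) (row_base e0) (mulmx_base e0) h; rewrite rk => Cb Rb h1 h2.
  by exists Cb, Rb.
have e0J : e0 *m symp_mx L n = symp_mx L n *m e0^T.
  by apply: kinj; rewrite !map_mxM -map_trmx he symp_mx_map pair_star.
pose C := R *m symp_mx L n *m R^T.
have Calt : C^T = - C by rewrite /C !trmx_mul trmxK symp_mx_tr mulNmx mulmxN mulmxA.
have char2L : (2%:R : L) != 0 by rewrite -(rmorph_nat i) fmorph_eq0.
have Cdiag a : C a a = 0.
  have /matrixP/(_ a a) := Calt; rewrite !mxE => /eqP; rewrite -addr_eq0 -mulr2n -[_ *+ 2]mulr_natl.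
  by rewrite mulf_eq0 (negPf char2L) => /eqP.
have C10 : C 1 0 = - C 0 1 by have /matrixP/(_ 0 1) := Calt; rewrite mxE => ->; rewrite mxE.
have Cform (u v : 'rV[L]_2) : (u *m C *m v^T) 0 0 = C 0 1 * @symp_form L 1 u v.
  have sum2 (f : 'I_2 -> L) : \sum_(m < 2) f m = f 0 + f 1.
    by rewrite !big_ord_recl big_ord0 addr0; congr (_ + f _); apply: val_inj.
  rewrite symp_form2 mxE sum2 [(u *m C) 0 0]mxE [(u *m C) 0 1]mxE !sum2 !Cdiag C10.
  rewrite [v^T 0 0]mxE [v^T 1 0]mxE; ring.
have eform (u v : 'rV[L]_N) : symp_form (u *m e0) (v *m e0) = C 0 1 * @symp_form L 1 (u *m E) (v *m E).
  rewrite -Cform /C /symp_form -ER !trmx_mul !mulmxA //.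
have c0 : C 0 1 != 0.
  apply/eqP=> c0; have [w w0] : exists w : 'rV[F]_N, w != 0.
    by exists (delta_mx 0 ord0); apply/eqP=> /matrixP/(_ 0 ord0); rewrite !mxE !eqxx => /eqP; rewrite oner_eq0.
  have [u hu] := form_exists n_gt0 w0; have := form_trace u w he.
  rewrite hu rmorph1 big1 => [/eqP|l _]; first by rewrite oner_eq0.
  by rewrite eform c0 mul0r expr0n expn_eq0 eqn0Ngt q0.
have [c C01] : exists c, C 0 1 = c by exists (C 0 1).
rewrite C01 in c0.
(* Rescaling one basis vector turns the Gram entry c into 1. *)
pose D : 'M[L]_2 := diag_mx (\row_a if a == 0 then c else 1).
pose D' : 'M[L]_2 := diag_mx (\row_a if a == 0 then c^-1 else 1).
have DD' : D *m D' = 1%:M.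
  apply/matrixP=> a b; rewrite mul_diag_mx !mxE; have [->|_] := eqVneq a b.
    by rewrite !mulr1n; case: ifP; rewrite ?mulr1 // mulfV.
  by rewrite !mulr0n mulr0.
have D'D : D' *m D = 1%:M by apply: mulmx1C.
exists (E *m D), (D' *m R); split.
- by rewrite !mulmxA -(mulmxA E) DD' mulmx1 ER he.
- by rewrite !mulmxA -(mulmxA D') RE mulmx1 D'D.
- have -> : D' *m R *m symp_mx L n *m (D' *m R)^T = D' *m C *m D'^T.
    by rewrite [(D' *m R)^T]trmx_mul /C !mulmxA.
  rewrite tr_diag_mx mul_mx_diag mxE mul_diag_mx mxE [(\row__ _) 0 0]mxE [(\row__ _) 0 1]mxE /=.
  by rewrite C01 mulr1 mulVf.
- by apply: (inj_row _ _ (D' *m R)); rewrite !mulmxA -(mulmxA E) DD' mulmx1.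
Qed.

(** The centralizer acts L-linearly and preserves the alternating L-form, so with determinant 1. If
    the inclusion were an equality, x would commute with all of SL_2 and act as a scalar of square
    1, against z^2 != 1. *)
Lemma PSL2_proper : exists2 M, PSL2_subgroup M & (H / Z)%G \proper M.
Proof.
have [E [R [he RE C01 Einj]]] := PSL2_factor.
have [e0 e0def] : exists e0, e0 = E *m R by exists (E *m R).
rewrite -e0def in he; pose phi (u : 'rV[F]_N) := map_mx i u *m E.
have char2L : (2%:R : L) != 0 by rewrite -(rmorph_nat i) fmorph_eq0.
have e0E : e0 *m E = E by rewrite e0def -mulmxA RE mulmx1.
have Re0 : R *m e0 = R by rewrite e0def mulmxA RE mul1mx.
have phi_form u v : i (symp_form u v) = \sum_(l < n) (@symp_form L 1 (phi u) (phi v)) ^+ (q ^ l).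
  rewrite (form_trace u v he); apply: eq_bigr => l _; congr (_ ^+ _).
  pose C := R *m symp_mx L n *m R^T.
  have -> : symp_form (map_mx i u *m e0) (map_mx i v *m e0) = (phi u *m C *m (phi v)^T) 0 0.
    by rewrite /symp_form /phi /C e0def !trmx_mul !mulmxA.
  have Calt : C^T = - C by rewrite /C !trmx_mul trmxK symp_mx_tr mulNmx mulmxN mulmxA.
  have Cdiag a : C a a = 0.
    have /matrixP/(_ a a) := Calt; rewrite !mxE => /eqP; rewrite -addr_eq0 -mulr2n -[_ *+ 2]mulr_natl.
    by rewrite mulf_eq0 (negPf char2L) => /eqP.
  have C10 : C 1 0 = - 1 by have /matrixP/(_ 0 1) := Calt; rewrite mxE => ->; rewrite mxE C01.
  move: (phi u) (phi v) => a b.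
  have sum2 (f : 'I_2 -> L) : \sum_(m < 2) f m = f 0 + f 1.
    by rewrite !big_ord_recl big_ord0 addr0; congr (_ + f _); apply: val_inj.
  rewrite symp_form2 mxE sum2 [(a *m C) 0 0]mxE [(a *m C) 0 1]mxE !sum2 !Cdiag C10 [C 0 1]C01.
  rewrite [b^T 0 0]mxE [b^T 1 0]mxE; ring.
have phiD a u v : phi (a *: u + v) = i a *: phi u + phi v.
  by rewrite /phi map_mxD map_mxZ mulmxDl scalemxAl.
have phi_bij : bijective phi.
  apply: inj_card_bij; first exact: Einj.
  by rewrite !card_mx cardL -expnM leq_exp2l ?finNzRing_gt1 // !mul1n (dimV_eq n_gt0) mulnC.
pose HMs := [set y : {'GL_(2 * n)[F]} | [exists A : 'M[L]_2, (\det A == 1) &&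
  [forall u, phi (u *m GLval y) == phi u *m A]]].
have HMP y : reflect (exists A : 'M[L]_2, \det A = 1 /\ forall u, phi (u *m GLval y) = phi u *m A) (y \in HMs).
  rewrite [y \in HMs]inE; apply: (iffP existsP) => [[A /andP[/eqP dA /forallP h]]|[A [dA h]]]; exists A.
    by split=> // u; apply/eqP.
  by rewrite dA eqxx; apply/forallP=> u; rewrite h.
have HMg : group_set HMs.
  apply/group_setP; split=> [|y z].
    by apply/HMP; exists 1%:M; split=> [|u]; rewrite ?det1 // GLval1 !mulmx1.
  move=> /HMP[A [dA hA]] /HMP[A' [dA' hA']]; apply/HMP; exists (A *m A').
  by split=> [|u]; rewrite ?det_mulmx ?dA ?dA' ?mulr1 // GLvalM mulmxA hA' hA mulmxA.
pose HM := Group HMg.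
have HMSp y : y \in HM -> y \in Sp n F.
  move=> /HMP[A [dA hA]]; rewrite SpE; apply/symplecticP=> u v; apply: (fmorph_inj i).
  rewrite !phi_form; apply: eq_bigr => l _; congr (_ ^+ _); rewrite !hA !symp_form2.
  move: (phi u) (phi v) => a b.
  have rE (c : 'rV[L]_2) m : (c *m A) 0 m = c 0 0 * A 0 m + c 0 1 * A 1 m.
    by rewrite mxE !big_ord_recl big_ord0 addr0; congr (_ + c _ _ * A _ _); apply: val_inj.
  by rewrite !rE -[RHS]mul1r -dA det2; ring.
have cE y : y \in H -> iM y *m E = E *m (R *m iM y *m E).
  move=> yH; have [_ c] := centralizerP j yH.
  have ce : e0 *m iM y = iM y *m e0.
    by apply: kinj; rewrite !map_mxM he kiM (pr_commX dP lamE ubz).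
  by rewrite !mulmxA -e0def ce -mulmxA e0E.
have HHM : H \subset HM.
  apply/subsetP=> y yH; have [yS c] := centralizerP j yH; have cy := cE y yH.
  apply/HMP; exists (R *m iM y *m E); split; last first.
    by move=> u; rewrite /phi map_mxM -[in LHS]mulmxA cy mulmxA.
  have ce : e0 *m iM y = iM y *m e0.
    by apply: kinj; rewrite !map_mxM he kiM (pr_commX dP lamE ubz).
  have e0J : e0 *m symp_mx L n = symp_mx L n *m e0^T.
    by apply: kinj; rewrite !map_mxM -map_trmx he symp_mx_map pair_star.
  have yJ : iM y *m symp_mx L n *m (iM y)^T = symp_mx L n.
    by move: yS; rewrite SpE => /eqP h; rewrite -(symp_mx_map i) map_trmx -!map_mxM h.
  have [A Adef] : exists A, A = R *m iM y *m E by exists (R *m iM y *m E).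
  rewrite -Adef; pose C := R *m symp_mx L n *m R^T.
  have Calt : C^T = - C by rewrite /C !trmx_mul trmxK symp_mx_tr mulNmx mulmxN mulmxA.
  have Cdiag a : C a a = 0.
    have /matrixP/(_ a a) := Calt; rewrite !mxE => /eqP; rewrite -addr_eq0 -mulr2n -[_ *+ 2]mulr_natl.
    by rewrite mulf_eq0 (negPf char2L) => /eqP.
  have C10 : C 1 0 = - C 0 1 by have /matrixP/(_ 0 1) := Calt; rewrite mxE => ->; rewrite mxE.
  have ACA : A *m C *m A^T = C.
    have AR : A *m R = R *m iM y.
      by rewrite Adef -mulmxA -e0def -mulmxA -ce mulmxA Re0.
    have -> : A *m C *m A^T = A *m R *m symp_mx L n *m (A *m R)^T.
      by rewrite [(A *m R)^T]trmx_mul /C !mulmxA.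
    rewrite AR trmx_mul; have -> : R *m iM y *m symp_mx L n *m ((iM y)^T *m R^T) =
       R *m (iM y *m symp_mx L n *m (iM y)^T) *m R^T by rewrite !mulmxA.
    by rewrite yJ.
  have := alt2_conj A (Cdiag 0) (Cdiag 1) C10; rewrite ACA [C 0 1]C01 mulr1 => <-.
  by [].
have ZH : (Z \subset H)%g by apply: (center_cent xS).
have xH : x \in H by apply/setIP; split=> //; apply/cent1P.
exists (HM / Z)%G.
  exists L, i, phi, HM; split=> // y.
  by split=> [/HMP|h]; last apply/HMP.
rewrite properE; apply/andP; split; first exact: quotientS.
apply/negP; rewrite quotientSGK //; last first.
  by apply: subset_trans (normal_norm (center_normal _)); apply/subsetP=> y; apply: HMSp.
move=> /subsetP sub; set X := R *m iM x *m E.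
have commX (A : 'M[L]_2) : \det A = 1 -> A *m X = X *m A.
  move=> dA; have uA : A \in unitmx by rewrite unitmxE dA unitr1.
  have h a : exists u, phi u = row a (E *m A).
    by have [psi _ psiK] := phi_bij; exists (psi (row a (E *m A))).
  have [f hf] := fin_all_exists h; pose Y := \matrix_(a, b) f a 0 b.
  have YE : map_mx i Y *m E = E *m A.
    apply/row_matrixP=> a; rewrite -hf row_mul -map_row; congr (map_mx i _ *m E).
    by apply/rowP=> b; rewrite !mxE.
  have phiY u : phi (u *m Y) = phi u *m A by rewrite /phi map_mxM -mulmxA YE mulmxA.
  have uY : Y \in unitmx.
    rewrite -row_free_unit -kermx_eq0; apply/rowV0P=> u /sub_kermxP uY0; apply: Einj.
    apply: (can_inj (mulmxK uA)); rewrite -[LHS]phiY uY0 map_mx0 !mul0mx.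
    by rewrite /phi map_mx0 mul0mx.
  have yH : toGL Y \in H.
    by apply: sub; apply/HMP; exists A; rewrite toGLK.
  have [_ /cent1P c] := setIP yH; have XY : GLval x *m Y = Y *m GLval x.
    by have := congr1 (fun g => GLval g) c; rewrite !GLvalM toGLK.
  have := congr1 (fun M => R *m (map_mx i M *m E)) XY; rewrite !map_mxM.
  rewrite -[map_mx i (GLval x) *m _ *m E]mulmxA YE -[map_mx i Y *m _ *m E]mulmxA (cE x xH) -/X.
  rewrite [map_mx i Y *m (E *m X)]mulmxA YE !mulmxA RE mul1mx -/X => ->.
  by [].
(* Commuting with one upper and one lower unipotent matrix is enough to be scalar. *)
pose A1 : 'M[L]_2 := \matrix_(a, b) ((a <= b)%N)%:R; pose A2 : 'M[L]_2 := \matrix_(a, b) ((b <= a)%N)%:R.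
have c1 := commX A1 _; have c2 := commX A2 _.
have {c1}c1 : A1 *m X = X *m A1 by apply: c1; rewrite det2 !mxE /=; ring.
have {c2}c2 : A2 *m X = X *m A2 by apply: c2; rewrite det2 !mxE /=; ring.
have X10 : X 1 0 = 0.
  have /matrixP/(_ 0 0) := c1; rewrite !mul2 ![A1 _ _]mxE /= !mul1r !mulr1 mulr0 addr0 => h.
  by apply: (addrI (X 0 0)); rewrite h addr0.
have X01 : X 0 1 = 0.
  have /matrixP/(_ 1 1) := c2; rewrite !mul2 ![A2 _ _]mxE /= !mul1r !mulr1 mulr0 add0r => h.
  by apply: (addIr (X 1 1)); rewrite h add0r.
have X00 : X 0 0 = X 1 1.
  have /matrixP/(_ 0 1) := c1; rewrite !mul2 ![A1 _ _]mxE /= !mul1r !mulr1 X01 add0r => ->.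
  by rewrite addr0.
have /HMP[A [dA hA]] := subsetP HHM _ xH.
have AX : A = X.
  apply/row_matrixP=> a; have [psi _ psiK] := phi_bij.
  have := hA (psi (delta_mx 0 a)); rewrite /phi map_mxM -mulmxA (cE x xH) -/X mulmxA.
  by rewrite -/(phi _) psiK -!rowE.
have X2 : X 0 0 ^+ 2 = 1 by rewrite -dA AX det2 X01 mul0r subr0 -X00 expr2.
have Xs : X = (X 0 0)%:M.
  apply/matrixP=> a b; rewrite [RHS]mxE.
  have two (c : 'I_2) : c = 0 \/ c = 1 by case: c => [[|[|[]]] hc] //; [left|right]; apply: val_inj.
  by case: (two a) => ->; case: (two b) => ->; rewrite ?mulr1n ?mulr0n.
have xe : iM x *m e0 = X 0 0 *: e0.
  by rewrite e0def mulmxA (cE x xH) -/X {1}Xs mul_mx_scalar -scalemxAl.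
have := congr1 (map_mx k) xe; rewrite map_mxM kiM map_mxZ he => h.
pose i0 := idx lam t.2; have li0 : lam 0 i0 = t.2 by apply: (idxK lamE); apply: (base_spec gbz); rewrite inE.
have := congr1 (mulmx (row i0 P)) h; rewrite mulmxA (row_eig dP) -scalemxAl -scalemxAr !(row_pr dP lamE ubz).
have -> : d 0%N 0 i0 = 1 by rewrite mxE /pairp expn0 expr1 li0 eqxx.
rewrite !scale1r => /eqP; rewrite -subr_eq0 -scalerBl scaler_eq0.
rewrite (negPf (row_neq0 dP i0)) orbF subr_eq0 => /eqP tk.
by have [_ z2 _ _ _] := gt; rewrite -li0 tk -rmorphXn X2 rmorph1 eqxx in z2.
Qed.

End WithField.

Lemma PSL2_proper_block : exists2 M, PSL2_subgroup M & (H / Z)%G \proper M.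
Proof.
have qn1 : (1 < q ^ n)%N by rewrite -(exp1n n) ltn_exp2r // finNzRing_gt1.
have qnp : [pchar K].-nat (q ^ n)%N by rewrite pnatX qp.
have [L [k [cL kL]]] := fix_field_exists qnp qn1.
have h a : exists l, k l = j a.
  have [|l ->] := kL (j a); last by exists l.
  rewrite -rmorphXn /=; congr (j _); elim: (n) => [|m IH]; first by rewrite expn0 expr1.
  by rewrite expnSr exprM IH expf_card.
have [i hi] := fin_all_exists h.
have iB : {morph i : a b / a - b} by move=> a b; apply: (fmorph_inj k); rewrite rmorphB !hi rmorphB.
have iM : {morph i : a b / a * b} by move=> a b; apply: (fmorph_inj k); rewrite rmorphM !hi rmorphM.
have i1 : i 1 = 1 by apply: (fmorph_inj k); rewrite hi !rmorph1.
pose im : {rmorphism F -> L} := HB.pack i (GRing.isZmodMorphism.Build F L i iB) (GRing.isMonoidMorphism.Build F L i (conj i1 iM)).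
exact: (@PSL2_proper L k im cL kL hi).
Qed.
End OneBlock.

(** * Tori generated by an element of large order *)

Lemma order_conj_aut (gT : finGroupType) (S : {group gT}) (c : gT) :
  'Z(S)%g = 1%g -> c \in S -> #[conj_aut S c]%g = #[c]%g.
Proof.
move=> Z1 cS; have cN := subsetP (normG S) _ cS.
apply/eqP; rewrite eqn_dvd; apply/andP; split; rewrite order_dvdn.
  by rewrite -morphX //= expg_order morph1.
have : (c ^+ #[conj_aut S c])%g \in 'Z(S)%g.
  rewrite inE groupX //= -ker_conj_aut; apply/kerP; first exact: groupX.
  by rewrite morphX // expg_order.
by rewrite Z1 => /set1P ->.
Qed.

(** * Arithmetic of the torus orders *)

Section Arithmetic.
Local Open Scope nat_scope.
Variable q : nat.
Hypothesis q3 : 2 < q.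

(** If a and b both had odd quotients by g = gcd (a, b), then q^g + 1 > 2 would divide both
    numbers. *)
Lemma gcd_blocks a b : 0 < a -> 0 < b -> gcdn (q ^ a).+1 (q ^ b).+1 %| 2 ->
  (2 * gcdn a b %| a) || (2 * gcdn a b %| b).
Proof.
move=> a0 b0 h; set g := gcdn a b.
have [a' ha] := dvdnP (dvdn_gcdl a b); have [b' hb] := dvdnP (dvdn_gcdr a b).
rewrite -/g in ha hb; have g0 : 0 < g by rewrite gcdn_gt0 a0.
have odd_dvd y d : odd d -> y.+1 %| (y ^ d).+1.
  move=> od; have e1 : y = y.+1.-1 by []. 
  have /eqP : (y ^ d).+1 = 0 %[mod y.+1]; last by rewrite mod0n.
  have e2 : (y ^ 2) = 1 %[mod y.+1].
    case: (y) => [|z]; first by rewrite !modn1.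
    have -> : z.+1 ^ 2 = z * z.+2 + 1 by rewrite -mulnn; lia.
    by rewrite modnMDl.
  rewrite -(odd_double_half d) od /= add1n expnS -mul2n expnM -addn1 -modnDml -modnMmr.
  by rewrite -modnXm e2 modnXm exp1n modnMmr muln1 modnDml addn1 modnn mod0n.
have [oa|ea] := boolP (odd a'); last first.
  apply/orP; left; rewrite {1}ha; apply: dvdn_mul => //; by rewrite dvdn2.
have [ob|eb] := boolP (odd b'); last first.
  apply/orP; right; rewrite {1}hb; apply: dvdn_mul => //; by rewrite dvdn2.
have d1 : (q ^ g).+1 %| (q ^ a).+1 by rewrite ha mulnC expnM odd_dvd.
have d2 : (q ^ g).+1 %| (q ^ b).+1 by rewrite hb mulnC expnM odd_dvd.
have /dvdn_leq : (q ^ g).+1 %| 2 by apply: dvdn_trans h; rewrite dvdn_gcd d1.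
have : q ^ 1 <= q ^ g by rewrite leq_exp2l; lia.
rewrite expn1 => h1 /(_ isT) h2.
by have := leq_trans (leq_trans q3 h1) (ltnW h2).
Qed.

Lemma sum_prod_eq x y u v : x + y = u + v -> x * y = u * v -> (x = u /\ y = v) \/ (x = v /\ y = u).
Proof.
move=> s p; have [lt|gt|e] := ltngtP x u; last by left; split=> //; move: s e; clear; lia.
  have [d hd] : exists d, u = x + d by exists (u - x); lia.
  have hy : y = v + d by lia.
  have d0 : 0 < d by lia.
  have e : d * x = d * v by move: p; rewrite hd hy; clear; lia.
  by move/eqP: e; rewrite eqn_pmul2l // => /eqP e; right; split=> //; lia.
have [d hd] : exists d, x = u + d by exists (x - u); lia.
have hv : v = y + d by lia.
have d0 : 0 < d by lia.
have e : d * y = d * u by move: p; rewrite hd hv; clear; lia.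
by move/eqP: e; rewrite eqn_pmul2l // => /eqP e; right; split=> //; lia.
Qed.

(** Expanding and cancelling x y = u v leaves y = x + u + v + 2, so q would divide 2. *)
Lemma mixed_sign_neq x y u v : q %| x -> q %| y -> q %| u -> q %| v -> 0 < y -> x * y = u * v ->
  x.+1 * y.-1 <> u.+1 * v.+1.
Proof.
move=> qx qy qu qv; case: y qy => // y qy _ p e.
have h : y.+1 = x + u + v + 2 by move: p e; clear; lia.
have hs : q %| x + u + v by rewrite !dvdn_add.
by move: qy; rewrite h dvdn_addr // => /dvdn_leq; lia.
Qed.

(** Mixed signs fail modulo q, and two factors of type q^a - 1 give too small a product. Otherwise
    the powers of q have known sum and product, hence are known up to order. *)
Lemma weight_arith (a b : nat) (c c' : nat * bool) : 0 < a -> 0 < b -> 0 < c.1 -> 0 < c'.1 ->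
  c.1 + c'.1 = a + b -> pmn q c * pmn q c' = (q ^ a).+1 * (q ^ b).+1 ->
  c.2 /\ c'.2 /\ ((c.1 = a /\ c'.1 = b) \/ (c.1 = b /\ c'.1 = a)).
Proof.
case: c c' => [a1 e] [b1 e'] /= a0 b0 a10 b10 s; rewrite /pmn /=.
have XY : q ^ a1 * q ^ b1 = q ^ a * q ^ b by rewrite -!expnD s.
have qd m : 0 < m -> q %| q ^ m by move=> m0; rewrite -{1}(expn1 q) dvdn_exp2l.
have q0 m : 0 < q ^ m by rewrite expn_gt0; lia.
have qi m m' : q ^ m = q ^ m' -> m = m' by move=> h; apply/eqP; rewrite -(@eqn_exp2l q) ?h //; lia.
case: e; case: e'; rewrite /pm /= => h.
- split=> //; split=> //.
  have sXY : q ^ a1 + q ^ b1 = q ^ a + q ^ b by move: h XY; clear; lia.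
  by have [[/qi -> /qi ->]|[/qi -> /qi ->]] := sum_prod_eq sXY XY; [left | right].
- by case: (@mixed_sign_neq _ _ _ _ (qd _ a10) (qd _ b10) (qd _ a0) (qd _ b0) (q0 b1) XY).
- rewrite mulnC in XY; rewrite mulnC in h.
  by case: (@mixed_sign_neq _ _ _ _ (qd _ b10) (qd _ a10) (qd _ a0) (qd _ b0) (q0 a1) XY).
- exfalso; move: h XY (q0 a1) (q0 b1); move: (q ^ a1) (q ^ b1) (q ^ a) (q ^ b).
  by clear; move=> [|x] [|y] u v //=; lia.
Qed.
End Arithmetic.

Lemma horner_mx_row (R : fieldType) m (S' : 'M[R]_m.+1) (v : 'rV_m.+1) (a : R) (p : {poly R}) :
  v *m S' = a *: v -> v *m horner_mx S' p = p.[a] *: v.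
Proof.
move=> h; elim/poly_ind: p => [|p c IH]; first by rewrite rmorph0 mulmx0 horner0 scale0r.
rewrite rmorphD rmorphM /= horner_mx_X horner_mx_C mulmxDr -[_ * S']/(_ *m S') mulmxA IH.
by rewrite -scalemxAl h mul_mx_scalar hornerMXaddC scalerDl scalerA.
Qed.

Section Conclusion.
Variables (n : nat) (F : finFieldType) (K : closedFieldType) (j : {rmorphism F -> K}).
Hypothesis n_gt1 : (1 < n)%N.
Hypothesis char2 : (2%:R : F) != 0.
Hypothesis qp : [pchar K].-nat #|F|.
Local Notation q := #|F|.
Hypothesis nq : (n, q) <> (2%N, 3%N).
Local Notation N := (dimV n).
Local Notation frob := (frob qp).
Local Notation J := (symp_mx F n).
Local Notation Z := 'Z(Sp n F).
Local Notation M_ y := (map_mx j (GLval y)).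
Local Notation spec := (@spec F K).
Local Notation good := (@good F K).
Local Notation S := (PSp n F).
Hypothesis center_S : 'Z(S)%g = 1%g.
Let n_gt0 : (0 < n)%N. Proof. exact: ltnW. Qed.
Let qo : odd q := q_odd j char2 qp.
Let q3 : (2 < q)%N.
Proof. by move: qo (finNzRing_gt1 F); case: q => [|[|[|]]]. Qed.

Lemma weight_neq0 bz : (forall t, t \in bz -> good t) -> ((weight F bz)%:R : F) != 0.
Proof.
rewrite /weight; elim: bz => [|t bz IH] gb; first by rewrite big_nil oner_eq0.
rewrite big_cons natrM mulf_neq0 ?IH //; last by move=> u ub; apply: gb; rewrite inE ub orbT.
have qF : (q%:R : F) = 0.
  apply: (fmorph_inj j); rewrite rmorph0 rmorph_nat.
  have pQ : pdiv q \in \pi(q) by rewrite pi_pdiv finNzRing_gt1.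
  have /dvdnP[c ->] := pdiv_dvd q; by rewrite natrM (pcharf0 (pnatPpi qp pQ)) mulr0.
have [a0 _ _ _ _] : good t by apply: gb; rewrite inE eqxx.
have q0 : (0 < q ^ t.1.1)%N by rewrite expn_gt0; lia.
have qX : ((q ^ t.1.1)%:R : F) = 0 by rewrite natrX qF expr0n gtn_eqF.
rewrite /pmn /pm; case: t.1.2; first by rewrite -addn1 natrD qX add0r oner_eq0.
by rewrite -subn1 natrB // qX sub0r oppr_eq0 oner_eq0.
Qed.

Lemma center_expr2 (z : {'GL_(2 * n)[F]}) : z \in Z -> (z ^+ 2 = 1)%g.
Proof.
move=> /(center_SpP n_gt0 char2)[->|->]; first by rewrite expg1n.
by apply: GLval_inj; rewrite GLvalX GLval_m1 // GLval1 sqrrN expr1n.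
Qed.

Lemma pow_order (x : {'GL_(2 * n)[F]}) : x \in Sp n F -> (x ^+ (2 * #[coset Z x]%g) = 1)%g.
Proof.
move=> xS; have xN : x \in 'N(Z) by apply: Sp_normZ.
have : (x ^+ #[coset Z x] \in Z)%g by rewrite coset_idr ?groupX // morphX // expg_order.
move/center_expr2; rewrite -expgM; move: (#[_]%g) => l; have -> : (l * 2 = 2 * l)%N by lia.
by [].
Qed.

(** A generator of T' lifts to an element of Sp of the same large order modulo signs. This order is
    prime to p because the weight is 1 or - 1 modulo p, so [regular_exists] applies. *)
Lemma torus_generator (T' : {group coset_of Z}) bz : (forall t, t \in bz -> good t) ->
  (q ^ n <= weight F bz + 1)%N -> cyclic T' -> maximal_torus_PSp j T' ->
  #|T'| = (weight F bz)./2 -> ~~ odd (weight F bz) ->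
  exists x' bz', [/\ T' = <[coset Z x']>%G, spectral j x' bz', weight F bz' = weight F bz,
    (\sum_(t <- bz') t.1.1)%N = n & (size bz' = 1 \/ size bz' = 2)%N].
Proof.
move=> gb qw /cyclicP[c Tc] [H' [Ta [_ _ hH']] TH'] cT ev.
have [x' x'N x'H] : exists2 x', x' \in 'N(Z) & x' \in H' /\ c = coset Z x'.
  have : c \in (H' / Z)%g by rewrite -TH' Tc cycle_id.
  by case/morphimP=> x' h1 h2 h3; exists x'.
have x'S : x' \in Sp n F by have [] := (hH' x').1 x'H.1.
have oc : (2 * #[coset Z x']%g)%N = weight F bz.
  by rewrite -x'H.2 /order -Tc cT; lia.
have k0 : ((2 * #[coset Z x']%g)%N%:R : F) != 0 by rewrite oc weight_neq0.
have [|bz' [s1 s2 s3 s4]] := regular_exists j n_gt0 char2 qp n_gt1 nq x'S (pow_order x'S) k0.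
  by rewrite oc.
exists x', bz'; split=> //; first by apply/group_inj; rewrite Tc x'H.2.
by rewrite -s2 oc.
Qed.

(* Inside PSL_2, x' + x'^-1 acts as a scalar of the big field, so F[x' + x'^-1]
   has no zero divisors and the eigenvalues form a single block. *)
Lemma PSL2_one_block (M' : {group coset_of Z}) x' u u' : PSL2_subgroup M' ->
  spectral j x' [:: u; u'] -> coset Z x' \in M' -> False.
Proof.
move=> [L [i [phi [H' [cL [[psi phiK psiK] phiD] _ hH' ->]]]]] sx'.
have [x'S [P [lam [dP lamE]]] gbz ubz] := sx' => /morphimP[h hN hH eh].
have zh : exists2 z, z \in Z & x' = (z * h)%g.
  have := eh => /(rcoset_kercosetP (Sp_normZ x'S) hN)/rcosetP[z zZ ->]; by exists z.
have phi0 : phi 0 = 0.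
  by have := phiD (-1) 0 0; rewrite scaler0 addr0 rmorphN1 scaleN1r addNr.
have phiZ a v : phi (a *: v) = i a *: phi v by have := phiD a v 0; rewrite addr0 phi0 addr0.
have phiA v w : phi (v + w) = phi v + phi w by have := phiD 1 v w; rewrite !scale1r rmorph1 scale1r.
(* The sign lost in passing to PSp is absorbed into A, whose determinant is unchanged in dimension
   2. *)
have [A [dA hA]] : exists A : 'M[L]_2, \det A = 1 /\ forall v, phi (v *m GLval x') = phi v *m A.
  have [A [dA hA]] := (hH' h).1 hH; have [z /(center_SpP n_gt0 char2)[->|->] ->] := zh.
    by exists A; split=> // v; rewrite mul1g.
  exists (- A); split; first by rewrite -scaleN1r detZ sqrrN expr1n mul1r.
  move=> v; rewrite GLvalM GLval_m1 // mulmxA mulmxN mulmx1 hA.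
  by rewrite mulmxN -mulNmx; congr (_ *m A); rewrite -scaleN1r phiZ rmorphN1 scaleN1r.
pose tau := A 0 0 + A 1 1; pose S' : 'M[F]_N := GLval x' + invmx (GLval x').
have uA : A \in unitmx by rewrite unitmxE dA unitr1.
have AA : A + invmx A = tau%:M.
  have CH : A *m A + 1%:M = tau *: A.
    apply/matrixP=> a b; have two (c : 'I_2) : c = 0 \/ c = 1 by case: c => [[|[|[]]] hc] //; [left|right]; apply: val_inj.
    have dd := det2 A; rewrite dA in dd.
    rewrite mxE mul2 [(tau *: A) a b]mxE [1%:M a b]mxE /tau.
    by case: (two a) => ->; case: (two b) => -> /=; rewrite ?mulr1n ?mulr0n ?dd; ring.
  have := congr1 (mulmx (invmx A)) CH; rewrite mulmxDr mulmxA mulVmx // mul1mx mulmx1 => ->.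
  by rewrite -scalemxAr mulVmx // scalemx1.
have ux := GLval_unitmx x'.
have hA' v : phi (v *m invmx (GLval x')) = phi v *m invmx A.
  by rewrite -{2}[v](mulmxKV ux) hA mulmxK.
have hS v : phi (v *m S') = tau *: phi v.
  by rewrite /S' mulmxDr phiA hA hA' -mulmxDr AA mul_mx_scalar.
have hp (p : {poly F}) v : phi (v *m horner_mx S' p) = (map_poly i p).[tau] *: phi v.
  elim/poly_ind: p v => [|p c IH] v; first by rewrite rmorph0 mulmx0 map_poly0 horner0 scale0r.
  rewrite rmorphD rmorphM /= horner_mx_X horner_mx_C mulmxDr -[_ * S']/(_ *m S') mulmxA phiA hS IH.
  rewrite mul_mx_scalar phiZ rmorphD rmorphM /= map_polyX map_polyC hornerMXaddC.
  by rewrite scalerDl scalerA mulrC.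
have gu : good u by apply: gbz; rewrite !inE eqxx.
have gu' : good u' by apply: gbz; rewrite !inE eqxx orbT.
have [a0 z2 z0 ub hz] := gu; set a := u.1.1 in a0 hz; set z := u.2 in z2 z0 hz.
(* [f] has the conjugates of z + 1/z as roots; it descends to F, and vanishes at the base point of
   the first block but not at that of the second. *)
pose sg := z + z^-1; pose f := \prod_(c <- map (fun l => sg ^+ (q ^ l)) (iota 0 a)) ('X - c%:P).
have sga : sg ^+ (q ^ a) = sg.
  rewrite /sg -frob_iter; have it m w w' : iter m frob (w + w') = iter m frob w + iter m frob w'.
    by elim: m => // m IH; rewrite !iterS IH rmorphD.
  by rewrite it !frob_iter exprVn hz; case: u.1.2; rewrite ?invrK // addrC.
have ff : map_poly frob f = f.
  rewrite map_prod_XsubC /f -(big_map frob predT (fun c => 'X - c%:P)); apply: perm_big.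
  case: a a0 hz sga @f => // a _ hz sga f.
  have -> : iota 0 a.+1 = rcons (iota 0 a) a by rewrite -cats1 -addn1 iotaD.
  rewrite !map_rcons -map_comp frobE -exprM -expnSr sga perm_rcons.
  have -> : sg :: map (frob \o (fun l => sg ^+ (q ^ l))) (iota 0 a) = map (fun l => sg ^+ (q ^ l)) (iota 0 a.+1).
    rewrite /= expn0 expr1; congr cons; rewrite -[1%N]addn0 iotaDl -map_comp; apply: eq_map => l /=.
    by rewrite -exprM -expnSr.
  by rewrite -map_rcons; apply: perm_map; rewrite -cats1 -addn1 iotaD.
have [g gE] : exists g : {poly F}, map_poly j g = f.
  have hc l : exists c, f`_l = j c by apply: frob_fix; rewrite -coef_map ff.
  have [cf hcf] : exists cf : 'I_(size f) -> F, forall l : 'I_(size f), f`_l = j (cf l).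
    exact: (fin_all_exists (fun l : 'I_(size f) => hc l)).
  exists (\poly_(l < size f) (if insub l is Some m then cf m else 0)).
  apply/polyP=> l; rewrite coef_map coef_poly; case: ltnP => h' /=; last by rewrite (rmorph0 j) nth_default.
  by rewrite insubT /= -hcf.
have rowS m : row m P *m map_mx j S' = (lam 0 m + (lam 0 m)^-1) *: row m P.
  rewrite /S' map_mxD map_invmx mulmxDr (row_eig dP) scalerDl; congr (_ + _).
  have uM : M_ x' \in unitmx by rewrite map_unitmx.
  apply: (can_inj (mulmxK uM)); rewrite mulmxKV // -scalemxAl (row_eig dP) scalerA mulVf ?scale1r //.
  exact: (lam_neq0 dP).
have rowg m : row m P *m map_mx j (horner_mx S' g) = f.[lam 0 m + (lam 0 m)^-1] *: row m P.
  by rewrite map_horner_mx gE; apply: horner_mx_row.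
have zs : z \in spec [:: u; u'] by apply: (base_spec gbz); rewrite inE eqxx.
have zs' : u'.2 \in spec [:: u; u'] by apply: (base_spec gbz); rewrite !inE eqxx orbT.
have f1 : f.[z + z^-1] = 0.
  apply/eqP; rewrite -/(root f _) root_prod_XsubC; apply/map_iotaP; exists 0%N => //.
have z0' : u'.2 != 0 by case: gu'.
have f2 : f.[u'.2 + u'.2^-1] != 0.
  rewrite -/(root f _) root_prod_XsubC; apply/negP=> /map_iotaP[l la].
  have -> : sg ^+ (q ^ l) = z ^+ (q ^ l) + z ^- (q ^ l).
    rewrite /sg -frob_iter; have it m w w' : iter m frob (w + w') = iter m frob w + iter m frob w'.
      by elim: m => // m IH; rewrite !iterS IH rmorphD.
    by rewrite it !frob_iter exprVn.
  set w := z ^+ (q ^ l); have w0 : w != 0 by rewrite expf_neq0.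
  move=> e; have : (u'.2 - w) * (u'.2 - w^-1) = 0.
    have -> : (u'.2 - w) * (u'.2 - w^-1) = u'.2 * ((u'.2 + u'.2^-1) - (w + w^-1)).
      by rewrite mulrBl !mulrBr !mulrDr !mulfV // ; ring.
    by rewrite e subrr mulr0.
  have nin : u'.2 \notin blk F u.1 u.2.
    move: ubz; rewrite /spec /= cats0 cat_uniq => /and3P[_ /hasPn disj _]; apply: disj.
    by apply: base_blk; case: gu'.
  move/eqP; rewrite mulf_eq0 !subr_eq0 => /orP[] /eqP e2; case/negP: nin; rewrite e2 mem_cat.
    by apply/orP; left; apply/map_iotaP; exists l.
  by apply/orP; right; apply/map_iotaP; exists l.
have phi_inj : injective phi := can_inj phiK.
(* g(S') acts as the scalar g(tau) of L: if it is 0 the second block is contradicted; otherwise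
   g(S') is invertible and the first block is. *)
have [t0|t0] := eqVneq (map_poly i g).[tau] 0.
  have g0 : horner_mx S' g = 0.
    apply/row_matrixP=> m; rewrite rowE row0; apply: phi_inj.
    by rewrite hp t0 scale0r phi0.
  have := rowg (idx lam u'.2); rewrite g0 map_mx0 mulmx0 (idxK lamE zs') => /esym/eqP.
  by rewrite scaler_eq0 (negPf f2) (negPf (row_neq0 dP _)).
have ug : horner_mx S' g \in unitmx.
  rewrite -row_free_unit -kermx_eq0; apply/rowV0P=> v /sub_kermxP h0; apply: phi_inj.
  have := hp g v; rewrite h0 phi0 => /esym/eqP; rewrite scaler_eq0 (negPf t0) /= => /eqP ->.
  by [].
have := rowg (idx lam z); rewrite (idxK lamE zs) f1 scale0r => h0.
have := row_neq0 dP (idx lam z); have ug' : map_mx j (horner_mx S' g) \in unitmx by rewrite map_unitmx.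
by rewrite -[row _ P](mulmxK ug') h0 mul0mx eqxx.
Qed.

Section Element.
Variables (x : {'GL_(2 * n)[F]}) (k : nat).
Hypothesis xS : x \in Sp n F.
Hypothesis xk : (x ^+ k = 1)%g.
Hypothesis k0 : (k%:R : F) != 0.
Hypothesis ord : (q ^ n <= 2 * #[coset Z x]%g + 1)%N.
Hypothesis no_isotropic : forall U U' : 'M[F]_N, isotropic U -> isotropic U' -> U' != 0 ->
  (forall v : 'rV[F]_N, (v <= U')%MS -> v != 0 -> exists2 u : 'rV[F]_N, (u <= U)%MS & symp_form u v != 0) ->
  (U *m GLval x <= U)%MS -> (U' *m GLval x <= U')%MS -> #|[set v : 'rV[F]_N | (v <= U)%MS]| = (q ^ n)%N.

Let q_gt0 : (0 < q)%N. Proof. exact: (@ltn_trans 2 0 _ isT q3). Qed.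
Let q_gt1 : (1 < q)%N. Proof. exact: ltnW q3. Qed.
Local Notation y := (conj_aut S (coset Z x)).
Let xbS : coset Z x \in S. Proof. exact: mem_quotient. Qed.

(** The eigenspaces for the conjugates of z and for those of 1/z are defined over F, stable,
    isotropic and in duality. [no_isotropic] gives the first one q^n elements, while its dimension
    is at most the size of the block. *)
Lemma plus_block bz t : spectral j x bz -> t \in bz -> t.1.2 = false -> (n <= t.1.1)%N.
Proof.
move=> [_ [P [lam [dP lamE]]] gbz ubz] tb plus; have inj := spec_inj lamE ubz.
have gt := gbz t tb; have [a0 z2 z0 ub hz] := gt; rewrite plus in hz.
set a := t.1.1 in a0 hz *; set z := t.2 in z2 z0 hz.
pose S1 := map (fun i => z ^+ (q ^ i)) (iota 0 a); pose S2 := map (fun i => z ^- (q ^ i)) (iota 0 a).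
have [u1 disj u2] : [/\ uniq S1, (forall w, w \in S2 -> w \notin S1) & uniq S2].
  by move: ub; rewrite /blk cat_uniq => /and3P[? /hasPn ? ?].
have zS1 : {subset S1 <= spec bz}.
  by move=> w ws; apply: (blk_spec tb); rewrite /blk mem_cat -/S1 ws.
have zS2 : {subset S2 <= spec bz}.
  by move=> w ws; apply: (blk_spec tb); rewrite /blk mem_cat -/S2 ws orbT.
have invS w : (w^-1 \in S1) = (w \in S2).
  by apply/map_iotaP/map_iotaP => -[i ia e]; exists i => //; [rewrite -e invrK | rewrite e invrK].
have frS1 w : (w ^+ q \in S1) = (w \in S1).
  apply/map_iotaP/map_iotaP => -[i ia e].
    case: i ia e => [|i] ia e.
      exists a.-1; rewrite ?prednK //; apply: (fmorph_inj frob).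
      by rewrite !frobE e -exprM -expnSr prednK // hz expn0 expr1.
    exists i; first exact: ltnW.
    by apply: (fmorph_inj frob); rewrite !frobE e -exprM -expnSr.
  have [ia1|ai] := ltnP i.+1 a; first by exists i.+1; rewrite // e -exprM -expnSr.
  exists 0%N; first exact: a0.
  have ei : i.+1 = a by apply/eqP; rewrite eqn_leq ia ai.
  by rewrite e -exprM -expnSr ei hz expn0 expr1.
have frS2 w : (w ^+ q \in S2) = (w \in S2) by rewrite -!invS -exprVn frS1.
have invS' w : (w^-1 \in S2) = (w \in S1) by rewrite -invS invrK.
pose dd (s : seq K) : 'rV[K]_N := \row_i (lam 0 i \in s)%:R.
have descend s : (forall w, (w ^+ q \in s) = (w \in s)) -> exists E : 'M[F]_N, pr P (dd s) = map_mx j E.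
  move=> fs; apply: (@frob_mx_fix F K j qp); apply: (frob_pr n_gt0 qp xS dP lamE ubz) => i l il.
  by rewrite !mxE il fs; case: (_ \in _); rewrite ?expr1n // expr0n gtn_eqF // q_gt0.
have [E hE] := descend S1 frS1; have [E' hE'] := descend S2 frS2.
have jinj (a' b' : nat) (X Y : 'M[F]_(a', b')) : map_mx j X = map_mx j Y -> X = Y by apply: map_mx_inj.
have idem s (X : 'M[F]_N) : pr P (dd s) = map_mx j X -> X *m X = X.
  move=> hX; apply: jinj; rewrite map_mxM -hX; apply: (pr_ext dP) => i.
  by rewrite mulmxA !(row_pr dP lamE ubz) -scalemxAl (row_pr dP lamE ubz) scalerA !mxE -natrM mulnb andbb.
have EE := idem _ _ hE; have EE' := idem _ _ hE'.
have star12 : E *m J = J *m E'^T.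
  apply: jinj; rewrite !map_mxM -map_trmx -hE -hE' symp_mx_map.
  apply: (star_pr xS dP lamE ubz) => i l il; rewrite !mxE -invS.
  by have /invr_eq il' : lam 0 l * lam 0 i = 1 by [rewrite mulrC]; rewrite il'.
have star21 : E' *m J = J *m E^T.
  apply: jinj; rewrite !map_mxM -map_trmx -hE -hE' symp_mx_map.
  apply: (star_pr xS dP lamE ubz) => i l il; rewrite !mxE -invS'.
  by have /invr_eq il' : lam 0 l * lam 0 i = 1 by [rewrite mulrC]; rewrite il'.
have disjoint : E *m E' = 0 /\ E' *m E = 0.
  by split; apply: jinj; rewrite map_mxM -hE -hE' map_mx0; apply: (pr_ext dP) => i;
    rewrite mulmxA !(row_pr dP lamE ubz) -scalemxAl (row_pr dP lamE ubz) scalerA !mxE -natrM mulnb mulmx0;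
    have := disj (lam 0 i); case: (_ \in S2) => [/(_ isT)/negPf ->|_]; rewrite ?andbF ?scale0r.
have commx s (X : 'M[F]_N) : pr P (dd s) = map_mx j X -> (X *m GLval x <= X)%MS.
  move=> hX; have -> : X *m GLval x = GLval x *m X; last exact: submxMl.
  by apply: jinj; rewrite !map_mxM -hX (pr_comm dP).
have iso (X X' : 'M[F]_N) : X *m X = X -> X' *m J = J *m X^T -> X *m X' = 0 -> isotropic X.
  move=> XX h h0 u v /submxP[D ->] /submxP[D' ->]; rewrite /symp_form trmx_mul.
  have -> : D *m X *m J *m (X^T *m D'^T) = D *m (X *m (J *m X^T)) *m D'^T by rewrite !mulmxA.
  by rewrite -h mulmxA h0 mul0mx mulmx0 mul0mx mxE.
have i0S : z \in S1 by apply/map_iotaP; exists 0%N; rewrite ?expn0 ?expr1.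
have E'0 : E' != 0.
  have zi : z^-1 \in S2 by rewrite invS'.
  apply/eqP=> e0; have := row_pr dP lamE ubz (dd S2) (idx lam z^-1).
  rewrite hE' e0 map_mx0 mulmx0 mxE (idxK lamE) ?zS2 // zi scale1r => /esym/eqP.
  by rewrite (negPf (row_neq0 dP _)).
have := no_isotropic (iso _ _ EE star21 disjoint.1) (iso _ _ EE' star12 disjoint.2) E'0 _ (commx _ _ hE) (commx _ _ hE').
have nondeg v : (v <= E')%MS -> v != 0 -> exists2 u : 'rV[F]_N, (u <= E)%MS & symp_form u v != 0.
  move=> /submxP[D vD] v0; have [u hu] := form_exists n_gt0 v0; exists (u *m E); first exact: submxMl.
  have vE : v = v *m E' by rewrite vD -mulmxA EE'.
  have -> : symp_form (u *m E) v = symp_form u v; last by rewrite hu oner_eq0.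
  rewrite [in RHS]vE /symp_form trmx_mul.
  by rewrite -!mulmxA (mulmxA E) star12 !mulmxA.
move=> /(_ nondeg) card.
have rE : (\rank E <= a)%N.
  pose I : {set 'I_N} := [set i | lam 0 i \in S1].
  have dE : dd S1 = \row_i (i \in I)%:R by apply/rowP=> i; rewrite !mxE inE.
  rewrite -(mxrank_map j) -hE prE dE; apply: leq_trans (mxrankM_maxl _ _) _.
  apply: leq_trans (mxrankM_maxr _ _) _; apply: leq_trans (rank_diag_indicator _ _) _.
  apply: (@leq_trans #|[set idx lam (z ^+ (q ^ (l : 'I_a))) | l in 'I_a]|); last first.
    by apply: leq_trans (leq_imset_card _ _) _; rewrite card_ord.
  apply/subset_leq_card/subsetP=> i; rewrite inE => iS; have /map_iotaP[l la hl] := iS.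
  apply/imsetP; exists (Ordinal la) => //; apply: inj; rewrite (idxK lamE) //=.
  by rewrite -hl; apply: zS1.
have : (#|[set v : 'rV[F]_N | (v <= E)%MS]| <= q ^ \rank E)%N.
  apply: (@leq_trans #|[set (D : 'rV[F]_(\rank E)) *m row_base E | D in {: 'rV[F]_(\rank E)}]|).
    apply/subset_leq_card/subsetP=> v; rewrite inE -(eq_row_base E) => /submxP[D ->].
    by apply/imsetP; exists D.
  by apply: leq_trans (leq_imset_card _ _) _; rewrite card_mx mul1n.
rewrite card leq_exp2l; last exact: q_gt1.
by move=> h; apply: leq_trans h rE.
Qed.

Lemma weight_even bz : spectral j x bz -> (2 * #[coset Z x]%g)%N = weight F bz -> ~~ odd (weight F bz).
Proof. by move=> _ <-; rewrite oddM. Qed.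

Lemma generates_unique_intro bz tor : spectral j x bz -> (2 * #[coset Z x]%g)%N = weight F bz ->
  tor ('C_(Sp n F)[x] / Z)%G ->
  (forall T', tor T' -> exists x' bz', [/\ T' = <[coset Z x']>%G, spectral j x' bz',
     weight F bz' = weight F bz & map fst bz' = map fst bz /\ #|T'| = (weight F bz)./2]) ->
  generates_unique tor y.
Proof.
move=> sx ox torT uniqT; have [_ [P [lam [dP lamE]]] gbz ubz] := sx.
have [HZ cyc mt card] := cyclic_maximal_torus n_gt0 char2 qp xS dP lamE gbz ubz ox.
exists ('C_(Sp n F)[x] / Z)%G; split=> //.
  transitivity (conj_aut S @* <[coset Z x]>)%g; first by congr (_ @* _)%g; exact: HZ.
  by rewrite morphim_cycle // (subsetP (normG _) _ xbS).
move=> T' /uniqT[x' [bz' [TE sx' w' [fE cT]]]].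
have o' : #[coset Z x']%g = #[coset Z x]%g.
  have -> : #[coset Z x']%g = #|T'| by rewrite TE.
  by rewrite cT -ox; move: (#[_]%g) => m; clear; lia.
have [h hS e] := unique_conj n_gt0 char2 qp sx sx' fE ox o'.
by exists h => //; rewrite TE /= e HZ.
Qed.

Lemma case_beta_intro t t' : spectral j x [:: t; t'] -> (2 * #[coset Z x]%g)%N = weight F [:: t; t'] ->
  (t.1.1 + t'.1.1)%N = n -> t.1.2 -> t'.1.2 -> (2 * gcdn t.1.1 t'.1.1 %| t.1.1)%N -> case_beta j y.
Proof.
move=> sx ox tn m1 m2 g; have [_ [P [lam [dP lamE]]] gbz ubz] := sx.
have gt : good t by apply: gbz; rewrite !inE eqxx.
have gt' : good t' by apply: gbz; rewrite !inE eqxx orbT.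
have [a0 _ _ _ _] := gt; have [b0 _ _ _ _] := gt'.
have wE : weight F [:: t; t'] = ((q ^ t.1.1 + 1) * (q ^ t'.1.1 + 1))%N.
  by rewrite /weight !big_cons big_nil muln1 /pmn m1 m2 /= !addn1.
have [HZ cyc mt card] := cyclic_maximal_torus n_gt0 char2 qp xS dP lamE gbz ubz ox.
have we := weight_even sx ox.
exists t.1.1, t'.1.1; split=> //; first by rewrite order_conj_aut // -wE -ox -divn2 mulKn.
apply: (generates_unique_intro sx ox).
  by split=> //; [apply: (SpxSp_proper n_gt0 char2 qp xS dP lamE gbz ubz) | rewrite card wE].
move=> T' [cT' mT' _ cardT'].
have cT'' : #|T'| = (weight F [:: t; t'])./2 by rewrite cardT' wE.
have [|x' [bz' [h1 h2 h3 h4 h5]]] := torus_generator gbz _ cT' mT' cT'' we; first by rewrite -ox.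
have [_ [P' [lam' [dP' lamE']]] gbz' ubz'] := h2.
case: h5 => sz.
  (* A single block has weight q^n + 1 or q^n - 1, which is never (q^a + 1) (q^b + 1) with a + b =
     n. *)
  exfalso; case: bz' sz h2 h3 h4 {h1 dP' lamE' ubz'} gbz' => [|u []] // _ _; rewrite /weight !big_cons !big_nil !muln1 !addn0.
  move=> e un gbz'; move: e; rewrite /pmn un m1 m2 /= -tn expnD.
  have := expn_gt0 q t.1.1; have := expn_gt0 q t'.1.1; rewrite (ltn_trans _ q3) //=.
  by case: u.1.2 => /=; move: (q ^ t.1.1)%N (q ^ t'.1.1)%N => [|u1] [|u2] //=; clear; lia.
case: bz' sz h1 h2 h3 h4 {dP' lamE' ubz'} gbz' => [|u [|u' []]] // _ TE sx' w' sn gbz'.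
have gu : good u by apply: gbz'; rewrite !inE eqxx.
have gu' : good u' by apply: gbz'; rewrite !inE eqxx orbT.
have [c0 _ _ _ _] := gu; have [c0' _ _ _ _] := gu'.
have [] := @weight_arith q q3 t.1.1 t'.1.1 u.1 u'.1 a0 b0 c0 c0'.
- by move: sn; rewrite !big_cons big_nil addn0 => ->.
- by move: w'; rewrite wE /weight !big_cons big_nil !muln1 !addn1.
move=> e1 [e2 e3].
have ut (a b : (nat * bool) * K) : a.1.2 -> b.1.2 -> a.1.1 = b.1.1 -> a.1 = b.1.
  by case: a b => [[? []] ?] [[? []] ?] //= _ _ ->.
case: e3 => [[f1 f2]|[f1 f2]].
  exists x', [:: u; u']; split=> //; split=> //=.
  by rewrite (ut u t) // (ut u' t').
exists x', [:: u'; u]; split=> //.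
- have [x'S [P2 [lam2 [dP2 lamE2]]] _ ubz2] := sx'.
  have pe : perm_eq (spec [:: u; u']) (spec [:: u'; u]) by rewrite /spec /= !cats0 perm_catC.
  split=> //; first by exists P2, lam2; split=> //; apply: perm_trans lamE2 pe.
    by move=> w; rewrite !inE orbC => hw; apply: gbz'; rewrite !inE.
  by rewrite -(perm_uniq pe).
- by rewrite -w' /weight !big_cons big_nil !muln1 mulnC.
- by split=> //=; rewrite (ut u t') // (ut u' t).
Qed.

Lemma torus_conclusion_intro : torus_conclusion j y.
Proof.
have [bz [sx ox sn sz]] := regular_exists j n_gt0 char2 qp n_gt1 nq xS xk k0 ord.
split; first by apply: mem_morphim => //; apply: (subsetP (normG _)).
have [_ [P [lam [dP lamE]]] gbz ubz] := sx.
have we := weight_even sx ox.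
have [HZ cyc mt card] := cyclic_maximal_torus n_gt0 char2 qp xS dP lamE gbz ubz ox.
case: sz => sz.
  left; case: bz sz sx ox sn gbz ubz lamE we HZ cyc mt card => [|t []] // _ sx ox sn gbz ubz lamE we HZ cyc mt card.
  rewrite big_cons big_nil addn0 in sn.
  have wE : weight F [:: t] = pm t.1.2 (q ^ n) by rewrite /weight big_cons big_nil muln1 /pmn sn.
  exists t.1.2; split; first by rewrite order_conj_aut // -wE -ox -divn2 mulKn.
  apply: (generates_unique_intro sx ox).
    split=> //; last by rewrite card wE.
    exact: (PSL2_proper_block n_gt0 char2 qp xS dP lamE gbz ubz).
  move=> T' [cT' mT' [M' psl prM'] cardT'].
  have cT'' : #|T'| = (weight F [:: t])./2 by rewrite cardT' wE.
  have [|x' [bz' [h1 h2 h3 h4 h5]]] := torus_generator gbz _ cT' mT' cT'' we; first by rewrite -ox.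
  case: h5 => sz'; last first.
    exfalso; case: bz' sz' h2 h3 h4 => [|u [|u' []]] // _ sx' _ _.
    apply: (PSL2_one_block psl sx'); have := proper_sub prM'.
    by rewrite h1 /= cycle_subG.
  exists x', bz'; split=> //; split=> //.
  case: bz' sz' h2 h3 h4 {h1} => [|u []] // _ sx' w' un; congr cons.
  rewrite big_cons big_nil addn0 in un; move: w'; rewrite wE /weight big_cons big_nil muln1 /pmn un.
  case: u un {sx'} => [[a e] z] /= ->; case: t sn {sx ox we HZ cyc mt card cT'' cardT' wE lamE gbz ubz} => [[b e'] z'] /= ->.
  have : (0 < q ^ n)%N by rewrite expn_gt0 q_gt0.
  by case: e; case: e' => //=; clear; lia.
right; case: bz sz sx ox sn gbz ubz lamE we HZ cyc mt card => [|t [|t' []]] // _ sx ox sn gbz ubz lamE we HZ cyc mt card.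
rewrite !big_cons big_nil addn0 in sn.
have gt : good t by apply: gbz; rewrite !inE eqxx.
have gt' : good t' by apply: gbz; rewrite !inE eqxx orbT.
have [a0 _ _ _ _] := gt; have [b0 _ _ _ _] := gt'.
(* By [plus_block], a block that Frobenius does not invert fills the whole space and leaves no room
   for the other one. *)
have m1 : t.1.2.
  apply: contraT => /negPf p1; have := plus_block sx (_ : t \in [:: t; t']) p1.
  by rewrite inE eqxx => /(_ isT); rewrite -sn -{2}[t.1.1]addn0 leq_add2l leqNgt b0.
have m2 : t'.1.2.
  apply: contraT => /negPf p1; have := plus_block sx (_ : t' \in [:: t; t']) p1.
  by rewrite !inE eqxx orbT => /(_ isT); rewrite -sn -{2}[t'.1.1]add0n leq_add2r leqNgt a0.
have hg : (gcdn (pmn q t.1) (pmn q t'.1) %| 2)%N.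
  have dv : (#[coset Z x]%g %| lcmn (pmn q t.1) (pmn q t'.1))%N.
    apply: (order_dvd n_gt0 char2 xS dP (e := 1)); first by rewrite expr1n.
    move=> i; have := idx_spec lamE i => /in_specP[u].
    rewrite !inE => /orP[] /eqP -> wu.
      by have /dvdnP[c ->] := dvdn_lcml (pmn q t.1) (pmn q t'.1); rewrite [(c * _)%N]mulnC exprM (blk_pow gt wu) expr1n.
    by have /dvdnP[c ->] := dvdn_lcmr (pmn q t.1) (pmn q t'.1); rewrite [(c * _)%N]mulnC exprM (blk_pow gt' wu) expr1n.
  have /dvdnP[c hc] := dv; have := muln_lcm_gcd (pmn q t.1) (pmn q t'.1).
  have ow : (pmn q t.1 * pmn q t'.1 = 2 * #[coset Z x]%g)%N by rewrite ox /weight !big_cons big_nil muln1.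
  rewrite hc ow => e; apply/dvdnP; exists c.
  have N0 := order_gt0 (coset Z x); apply/eqP; rewrite -(eqn_pmul2r N0) -e; apply/eqP; ring.
have := @gcd_blocks q q3 t.1.1 t'.1.1 a0 b0; move: hg; rewrite /pmn m1 m2 /= => hg /(_ hg) /orP[] dv.
  exact: (case_beta_intro sx ox sn m1 m2 dv).
have pe : perm_eq (spec [:: t; t']) (spec [:: t'; t]) by rewrite /spec /= !cats0 perm_catC.
apply: (@case_beta_intro t' t) => //.
- split=> //; first by exists P, lam; split=> //; apply: perm_trans lamE pe.
    by move=> w; rewrite !inE orbC => hw; apply: gbz; rewrite !inE.
  by rewrite -(perm_uniq pe).
- by rewrite ox /weight !big_cons big_nil !muln1 mulnC.
- by rewrite addnC.
- by rewrite gcdnC.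
Qed.
End Element.
End Conclusion.

(** * Simple spectra and finite fields *)

Section SimpleSpectrum.
Variables (C : closedFieldType) (gT : finGroupType) (G : {group gT}) (m : nat).
Variables (rG : mx_representation C G m.+1) (x : gT).
Hypothesis xG : x \in G.
Hypothesis x0 : (#[x]%g%:R : C) != 0.
Hypothesis simp : simple_spectrum (rG x).

Lemma simple_spectrum_diag : exists (P : 'M[C]_m.+1) (lam : 'rV[C]_m.+1),
  [/\ P \in unitmx, P *m rG x = diag_mx lam *m P & injective (lam 0)].
Proof.
have [rs urs dec] := repr_eigenspaces rG xG x0.
have [P uP dP] : exists2 P : 'M[C]_m.+1, P \in unitmx & similar_diag P (rG x).
  by apply/diagonalizablePeigen; exists rs.
have /is_diag_mxP := dP; set D := conjmx P (rG x) => hD.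
have [lam hlam] : exists lam : 'rV_m.+1, diag_mx lam = D.
  exists (\row_i D i i); apply/matrixP=> a b; rewrite [LHS]mxE; have [->|ab] := eqVneq a b.
    by rewrite mulr1n mxE.
  by rewrite mulr0n hD.
have PA : P *m rG x = diag_mx lam *m P.
  by rewrite hlam /D /conjmx mulmxKpV // submx_full // row_full_unit.
exists P, lam; split=> // i k lik.
have cp : char_poly (rG x) = \prod_(a <- [seq lam 0 l | l <- enum 'I_m.+1]) ('X - a%:P).
  rewrite big_map big_enum /= -(char_poly_intertwine uP (esym PA)) char_poly_trig ?diag_mx_is_trig //.
  by apply: eq_bigr => l _; rewrite !mxE eqxx mulr1n.
have cnt : count_mem (lam 0 i) [seq lam 0 l | l <- enum 'I_m.+1] = 1%N.
  rewrite -mu_prod_XsubC -cp; apply: simp; rewrite eigenvalue_root_char cp root_prod_XsubC.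
  by apply: map_f; rewrite mem_enum.
apply/eqP; apply: contra_eqT cnt => ik; rewrite neq_ltn; apply/orP; right.
rewrite count_map -size_filter.
have /card_uniqP <- := filter_uniq (preim (lam 0) (pred1 (lam 0 i))) (enum_uniq 'I_m.+1).
apply/card_gt1P; exists i, k; split=> //; rewrite mem_filter mem_enum /= ?eqxx //.
by rewrite lik eqxx.
Qed.

Lemma simple_eigenline (a : C) (u v : 'rV[C]_m.+1) :
  u *m rG x = a *: u -> v *m rG x = a *: v -> u != 0 -> (v <= u)%MS.
Proof.
have [P [lam [uP PA inj]]] := simple_spectrum_diag => hu hv u0.
have supp (t : 'rV[C]_m.+1) i : t *m rG x = a *: t -> (t *m invmx P) 0 i != 0 -> lam 0 i = a.
  move=> ht ti; have : t *m invmx P *m diag_mx lam = a *: (t *m invmx P).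
    apply: (can_inj (mulmxK uP)); rewrite -[LHS](mulmxA _ (diag_mx lam)) -PA mulmxA mulmxKV // ht.
    by rewrite -scalemxAl mulmxKV.
  move/rowP/(_ i); rewrite mul_mx_diag [LHS]mxE [RHS]mxE mulrC => h.
  exact: (mulIf ti).
have [i ui] : exists i, (u *m invmx P) 0 i != 0.
  apply/existsP; apply: contraR u0; rewrite negb_exists => /forallP h.
  rewrite -[u](mulmxKV uP); suff -> : u *m invmx P = 0 by rewrite mul0mx.
  by apply/rowP=> i; rewrite [RHS]mxE; apply/eqP; rewrite -[_ == _]negbK h.
apply/sub_rVP; exists ((v *m invmx P) 0 i / (u *m invmx P) 0 i).
apply: (can_inj (mulmxK (_ : invmx P \in unitmx))); first by rewrite unitmx_inv.
apply/rowP=> k; rewrite -scalemxAl [RHS]mxE; have [->|ki] := eqVneq k i; first by rewrite divfK.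
have z (t : 'rV[C]_m.+1) : t *m rG x = a *: t -> (t *m invmx P) 0 k = 0.
  move=> ht; apply/eqP; apply: contraR ki => tk; apply/eqP/inj.
  by rewrite (supp t) // (supp u).
by rewrite !z ?mulr0.
Qed.

(** The m + 1 distinct eigenvalues are all roots of X^N - c. *)
Lemma simple_spectrum_order N (c : C) : (0 < N)%N -> rG (x ^+ N)%g = c%:M -> (m < N)%N.
Proof.
have [P [lam [uP PA inj]]] := simple_spectrum_diag => N0 hN.
have cN i : lam 0 i ^+ N = c.
  have h k : row i P *m rG (x ^+ k)%g = lam 0 i ^+ k *: row i P.
    elim: k => [|k IH]; first by rewrite expg0 repr_mx1 mulmx1 scale1r.
    rewrite expgSr repr_mxM ?groupX // mulmxA IH -scalemxAl -row_mul PA.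
    have -> : row i (diag_mx lam *m P) = lam 0 i *: row i P.
      by apply/rowP=> l; rewrite [LHS]mxE mul_diag_mx !mxE.
    by rewrite scalerA exprSr.
  have r0 : row i P != 0.
    apply/eqP=> z; have := row_free_unit P; rewrite uP => /row_freeP[Q hQ].
    have := congr1 (row i) hQ; rewrite row_mul z mul0mx => /rowP/(_ i).
    by rewrite !mxE eqxx => /eqP; rewrite eq_sym oner_eq0.
  have := h N; rewrite hN mul_mx_scalar => /eqP.
  by rewrite -subr_eq0 -scalerBl scaler_eq0 (negPf r0) orbF subr_eq0 => /eqP.
have Q0 : ('X^N - c%:P : {poly C}) != 0 by rewrite -size_poly_gt0 size_XnsubC.
have := max_poly_roots Q0 (rs := [seq lam 0 i | i <- enum 'I_m.+1]).
rewrite size_XnsubC // size_map size_enum_ord ltnS; apply.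
  by apply/allP=> a /mapP[i _ ->]; rewrite /root hornerD hornerN hornerXn hornerC cN subrr.
by rewrite map_inj_uniq ?enum_uniq.
Qed.

End SimpleSpectrum.

Section FiniteField.
Variable F : finFieldType.

Lemma finField_generator : exists u : F, u != 0 /\ forall a, a != 0 -> exists k, a = u ^+ k.
Proof.
have /cyclicP[u hu] := field_unit_group_cyclic [set: {unit F}]%G.
exists (val u); split; first by rewrite -unitfE; apply: valP.
move=> a a0; have ua : a \is a GRing.unit by rewrite unitfE.
have : FinRing.unit F ua \in <[u]>%g by rewrite -hu inE.
by case/cycleP=> k hk; exists k; rewrite -FinRing.val_unitX -hk.
Qed.

(** Nonsquares are odd powers of a generator of the multiplicative group. *)
Lemma nonsquare_ratio (c a : F) : (forall k, c != k * k) -> (forall k, a != k * k) ->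
  exists k, a = c * (k * k).
Proof.
move=> hc ha; have [u [u0 hu]] := finField_generator.
have nz (b : F) : (forall k, b != k * k) -> b != 0 by move=> h; have := h 0; rewrite mulr0.
have odd_exp b : (forall k, b != k * k) -> exists k, b = u * (u ^+ k * u ^+ k).
  move=> h; have [k hk] := hu b (nz b h); exists k./2.
  have ok : odd k.
    apply: contraT => ek; have := h (u ^+ k./2); rewrite -exprD addnn.
    by rewrite -{1}[k]odd_double_half (negPf ek) in hk; rewrite hk eqxx.
  by rewrite -exprD addnn -exprS hk -{1}[k]odd_double_half ok.
have [i ->] := odd_exp c hc; have [k ->] := odd_exp a ha.
exists (u ^+ k / u ^+ i); have ui : u ^+ i != 0 by rewrite expf_neq0.
by field.
Qed.

Variable s : {rmorphism F -> F}.

(* Dedekind: a polynomial with fixed coefficients vanishing at a generator a of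
   the field has all the conjugates of a as roots. *)
Lemma fixed_field_card e : (0 < e)%N -> (forall a, iter e s a = a) ->
  (forall i, (0 < i < e)%N -> exists a, iter i s a != a) ->
  (#|[set a : F | s a == a]| ^ e <= #|F|)%N.
Proof.
move=> e0 se mine; have [u [u0 hu]] := finField_generator.
have sX i k : iter i s (u ^+ k) = iter i s u ^+ k.
  by elim: i => //= i ->; rewrite rmorphXn.
have s0 i : iter i s 0 = 0 by elim: i => //= i ->; rewrite rmorph0.
have moved i : (0 < i < e)%N -> iter i s u != u.
  move=> hi; have [a ha] := mine i hi; apply: contra ha => /eqP h.
  have [->|a0] := eqVneq a 0; first by rewrite s0.
  by have [k ->] := hu a a0; rewrite sX h.
have sinj i : injective (iter i s) by elim: i => //= i IH a b /fmorph_inj/IH.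
have uconj : uniq [seq iter i s u | i <- iota 0 e].
  rewrite map_inj_in_uniq ?iota_uniq // => i k; rewrite !mem_iota /= add0n.
  wlog ik : i k / (i <= k)%N => [W|].
    by case: (leqP i k) => [/W|/ltnW/W h hi hk e1] //; apply/esym/h.
  move=> ie ke; rewrite -{1}(subnKC ik) iterD => /sinj h.
  apply/eqP; rewrite eqn_leq ik leqNgt; apply/negP=> ik'.
  have : iter (k - i) s u != u by apply: moved; rewrite subn_gt0 ik' (leq_ltn_trans (leq_subr _ _)).
  by rewrite -h eqxx.
pose A := [set a : F | s a == a].
rewrite -[X in (_ ^ X)%N](card_ord e) -card_ffun_on.
pose ev (f : {ffun 'I_e -> F}) : F := \sum_(i < e) f i * u ^+ i.
rewrite -(card_in_imset (f := ev)) ?max_card // => f g /ffun_onP fA /ffun_onP gA efg.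
pose P : {poly F} := \poly_(i < e) (if insub i is Some l then f l - g l else 0).
have cP (i : 'I_e) : P`_i = f i - g i.
  by rewrite coef_poly ltn_ord; case: insubP => [l _ hl|]; [congr (f _ - g _); apply: val_inj | rewrite ltn_ord].
have fixP i (l : 'I_e) : iter i s P`_l = P`_l.
  elim: i => //= i ->; rewrite cP rmorphB.
  by have := fA l; have := gA l; rewrite !inE => /eqP -> /eqP ->.
have Pev a : P.[a] = \sum_(i < e) P`_i * a ^+ i.
  by rewrite horner_poly; apply: eq_bigr => i _; rewrite coef_poly ltn_ord.
have sP i : P.[iter i s u] = iter i s P.[u].
  rewrite !Pev.
  have sD I (r : seq I) (h : I -> F) : iter i s (\sum_(l <- r) h l) = \sum_(l <- r) iter i s (h l).
    by elim: (i) => //= k ->; rewrite rmorph_sum.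
  rewrite sD; apply: eq_bigr => l _; have -> : iter i s (P`_l * u ^+ l) = iter i s P`_l * iter i s (u ^+ l).
    by elim: (i) => //= k ->; rewrite rmorphM.
  by rewrite sX fixP.
have P0 : P = 0.
  apply: (roots_geq_poly_eq0 _ uconj); last by rewrite size_map size_iota size_poly.
  apply/allP=> a /mapP[i _ ->]; rewrite /root sP Pev.
  rewrite (eq_bigr (fun l => f l * u ^+ l - g l * u ^+ l)) => [|l _]; last by rewrite cP mulrBl.
  by rewrite sumrB -/(ev f) -/(ev g) efg subrr s0.
by apply/ffunP=> i; apply/eqP; rewrite -subr_eq0 -cP P0 coef0.
Qed.

Lemma rmorph_order : exists e, [/\ (0 < e)%N, forall a, iter e s a = a &
  forall i, (0 < i < e)%N -> exists a, iter i s a != a].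
Proof.
pose pred i := (0 < i)%N && [forall a, iter i s a == a].
have [i hi] : exists i, pred i.
  pose t : {perm F} := perm (fmorph_inj s).
  exists #[t]%g; rewrite /pred order_gt0; apply/forallP=> a.
  have it k b : (t ^+ k)%g b = iter k s b.
    by elim: k b => [|k IH] b; rewrite ?perm1 // expgSr permM IH permE.
  by rewrite -it expg_order perm1.
have [e /andP[e0 /forallP se] mine] := ex_minnP (ex_intro pred i hi).
exists e; split=> // [a|l /andP[l0 le]]; first exact/eqP.
apply/existsP; rewrite -negb_forall; apply/negP => h; move: le; rewrite ltnNge.
by rewrite mine // /pred l0.
Qed.
End FiniteField.

Section Bound.
Local Open Scope nat_scope.
(** With x = y^n it suffices that e 2^n + 1 <= x^(e-1), by induction on e from 2 2^n + 1 <= 3^n,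
    which is sharp at n = 2. *)
Lemma semilinear_arith n y e : 1 < n -> 3 <= y -> 1 < e -> e * 2 ^ n * y ^ n + 2 <= (y ^ n) ^ e.
Proof.
move=> n1 y3 e1; have [x hx] : exists x, x = y ^ n by exists (y ^ n).
rewrite -hx.
have {hx} x3 : 3 ^ n <= x by rewrite hx leq_exp2r // ltnW.
have h2 : 2 * 2 ^ n + 1 <= 3 ^ n.
  case: n n1 {x x3} => [|[|n]] // _; elim: n => // n IH.
  rewrite expnS [3 ^ _]expnS; move: IH; move: (2 ^ n.+2) (3 ^ n.+2) => a b; lia.
have p2 : 0 < 2 ^ n by rewrite expn_gt0.
have h : e * 2 ^ n + 1 <= x ^ e.-1.
  case: e e1 => [|[|e]] // _; elim: e => [|e IH]; first by rewrite /= expn1; lia.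
  rewrite /= expnS; move: IH h2 x3 p2 => /=; move: (x ^ e.+1) (2 ^ n) (3 ^ n) => a b t.
  by clear; nia.
have {x3} x0 : 3 <= x by lia.
rewrite -[in (x ^ e)](prednK (ltnW e1)) expnS; move: (x ^ e.-1) h => z; move: (2 ^ n) p2 => t.
by clear -x0; nia.
Qed.
End Bound.

(** * Inner automorphisms and the layer *)

Section LayerInner.
Local Open Scope group_scope.

Section InnerAut.
Variables (sT : finGroupType) (S : {group sT}).
Hypothesis simS : simple S.
Hypothesis nabS : ~~ abelian S.

Lemma nonabelian_simple_center : 'Z(S) = 1.
Proof.
have [_ /(_ 'Z(S)%G (center_normal S))[-> //|e]] := simpleP _ simS.
by case/negP: nabS; rewrite -e; apply: center_abelian.
Qed.

Lemma conj_aut_inj c d : c \in S -> d \in S -> conj_aut S c = conj_aut S d -> c = d.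
Proof.
move=> cS dS e; have cN := subsetP (normG S) _ cS; have dN := subsetP (normG S) _ dS.
have : c * d^-1 \in 'Z(S).
  rewrite inE groupM ?groupV //= -ker_conj_aut; apply/kerP; first by rewrite groupM ?groupV.
  by rewrite morphM ?groupV // morphV // [X in X * _]e mulgV.
by rewrite nonabelian_simple_center => /set1P e1; rewrite -[c](mulgKV d) e1 mul1g.
Qed.

Lemma inn_isog : S \isog conj_aut S @* S.
Proof.
have := first_isog_loc [morphism of conj_aut S] (normG S).
rewrite ker_conj_aut -[_ :&: _]/('Z(S)) => h.
apply: isog_trans h; rewrite nonabelian_simple_center; exact: quotient1_isog.
Qed.

Lemma conj_aut_conj a c : a \in Aut S -> c \in S -> (conj_aut S c) ^ a = conj_aut S (a c).
Proof.
move=> aA cS; have acS : a c \in S by apply: Aut_closed.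
apply/permP=> t; have aVA : a^-1 \in Aut S by rewrite groupV.
have [tS|tS] := boolP (t \in S).
  have a1S : a^-1 t \in S by apply: Aut_closed.
  rewrite conjgE !permM conj_autE // conj_autE // -(autmE aA) morphJ // /= !autmE.
  by rewrite permKV.
have out b : b \in Aut S -> b t = t by move=> bA; apply: out_Aut bA tS.
by rewrite !out ?groupJ // (subsetP (Aut_conj_aut S S)) // mem_morphim // (subsetP (normG S)).
Qed.

Lemma inn_centraliser (B : {group {perm sT}}) :
  B \subset Aut S -> B \subset 'C(conj_aut S @* S) -> B :=: 1.
Proof.
move=> BA BC; apply/trivgP/subsetP=> a aB; apply/set1P; have aA := subsetP BA _ aB.
apply: (eq_Aut aA (group1 _)) => c cS; rewrite perm1.
apply: (conj_aut_inj (Aut_closed aA cS) cS); rewrite -conj_aut_conj //; apply/conjg_fixP/commgP/commute_sym.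
by apply: (centP (subsetP BC _ aB)); rewrite mem_morphim // (subsetP (normG S)).
Qed.

(** Inn(S) is simple with trivial centralizer in Aut(S), so a nontrivial normal subgroup meets it
    nontrivially and hence contains it. *)
Lemma normal_contains_inn (A B : {group {perm sT}}) : A \subset Aut S ->
  conj_aut S @* S <| A -> B <| A -> B :!=: 1 -> conj_aut S @* S \subset B.
Proof.
move=> sA nI nB B1; have sI : simple (conj_aut S @* S) by rewrite -(isog_simple inn_isog).
have nBI : B :&: conj_aut S @* S <| conj_aut S @* S.
  rewrite /normal subsetIr; apply: normsI; last exact: normG.
  exact: subset_trans (normal_sub nI) (normal_norm nB).
have [_ /(_ _ nBI)[e|e]] := simpleP _ sI; last by rewrite -e subsetIl.
case/eqP: B1; apply: inn_centraliser.
  exact: subset_trans (normal_sub nB) sA.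
apply/commG1P/eqP; rewrite -subG1 -e subsetI commg_subl commg_subr.
rewrite (subset_trans (normal_sub nB) (normal_norm nI)).
by rewrite (subset_trans (normal_sub nI) (normal_norm nB)).
Qed.
End InnerAut.

(** The image of E is nontrivial, so it contains Inn(S). The image of Z(E) is abelian, so it does
    not and must be trivial; whence Z(E) is the intersection of E with Z(G), and the orders
    agree. *)
Lemma layer_inner (gT sT : finGroupType) (G E : {group gT}) (S : {group sT})
    (iota : {morphism (G / 'Z(G)) >-> {perm sT}}) :
  almost_quasisimple S iota -> is_layer G S E -> E \subset G ->
  iota @* (E / 'Z(G)) = conj_aut S @* S.
Proof.
move=> [simS nabS inj nI sA] [nE /andP[/eqP pE simE] iE] sEG.
have nZ : G \subset 'N('Z(G)) := normal_norm (center_normal G).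
have normal (H : {group gT}) : H <| G -> iota @* (H / 'Z(G)) <| iota @* (G / 'Z(G)).
  by move=> nH; rewrite morphim_normal // quotient_normal.
have triv (H : {group gT}) : H <| G -> iota @* (H / 'Z(G)) = 1 -> H \subset 'Z(G).
  move=> nH e; have sH := subset_trans (normal_sub nH) nZ.
  rewrite -quotient_sub1 // -(injmSK inj) ?quotientS ?(normal_sub nH) // ?sub1G ?e ?sub1G //.
have absE : ~~ (E \subset 'Z(G)).
  apply/negP=> sEZ; have abE : abelian E by apply: abelianS sEZ (center_abelian G).
  have [/eqP h _] := simpleP _ simE; apply: h; apply: quotientS1.
  by rewrite subsetI subxx.
have IB : conj_aut S @* S \subset iota @* (E / 'Z(G)).
  apply: (normal_contains_inn simS nabS sA nI (normal _ nE)).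
  by apply/eqP=> e; case/negP: absE; apply: triv.
have nZE : 'Z(E) <| G by apply: char_normal_trans (center_char E) nE.
have ZEG : 'Z(E) \subset 'Z(G).
  apply: (triv _ nZE); apply/eqP; apply: contraT => h; case/negP: (nabS).
  rewrite (isog_abelian (inn_isog simS nabS)).
  have := normal_contains_inn simS nabS sA nI (normal _ nZE) h.
  by move/abelianS; apply; rewrite morphim_abelian // quotient_abelian // center_abelian.
have ZE : 'Z(G) :&: E = 'Z(E).
  apply/eqP; rewrite eqEsubset; apply/andP; split; last by rewrite subsetI ZEG center_sub.
  rewrite subsetI subsetIr (subset_trans (subsetIl _ _)) //.
  by rewrite (subset_trans (subsetIr _ _)) // centS.
apply/esym/eqP; rewrite eqEcard IB /= card_injm ?quotientS //.
rewrite -(card_isog (inn_isog simS nabS)) -(card_isog iE).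
have := card_isog (second_isog (subset_trans sEG nZ)).
by rewrite ZE => ->.
Qed.

End LayerInner.

(** * Twisted Weil representations *)

Section Twist.
Variables (C : closedFieldType) (F : finFieldType) (n : nat).
Local Notation N := (dimV n).
Local Notation J := (symp_mx F n).
Local Notation B := (@symp_form F n).
Local Notation Sp := (Sp n F).
Local Notation H := (heisenberg n F).
Variables (s : {rmorphism F -> F}) (M : 'M[F]_N) (c : F).
Hypothesis n_gt0 : (0 < n)%N.
Hypothesis uM : M \in unitmx.
Hypothesis c0 : c != 0.
Hypothesis MJ : M *m J *m M^T = c *: J.

Definition semi (x : {'GL_(2 * n)[F]}) : {'GL_(2 * n)[F]} :=
  toGL (invmx M *m map_mx s (GLval x) *m M).

Lemma semi_unit x : invmx M *m map_mx s (GLval x) *m M \in unitmx.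
Proof. by rewrite !unitmx_mul unitmx_inv uM map_unitmx GLval_unitmx. Qed.

Lemma GLval_semi x : GLval (semi x) = invmx M *m map_mx s (GLval x) *m M.
Proof. by rewrite /semi toGLK // semi_unit. Qed.

Lemma semi_map x : map_mx s (GLval x) *m M = M *m GLval (semi x).
Proof. by rewrite GLval_semi !mulmxA mulmxV // mul1mx. Qed.

Lemma semiM x y : semi (x * y)%g = (semi x * semi y)%g.
Proof.
apply: GLval_inj; rewrite GLvalM !GLval_semi GLvalM map_mxM !mulmxA.
by rewrite -(mulmxA _ M (invmx M)) mulmxV // mulmx1.
Qed.

Lemma semi1 : semi 1%g = 1%g.
Proof. by apply: GLval_inj; rewrite GLval_semi GLval1 map_mx1 mulmx1 mulVmx. Qed.

Lemma semi_inj : injective semi.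
Proof.
move=> x y /(congr1 GLval); rewrite !GLval_semi => h; apply: GLval_inj.
have : invmx M *m map_mx s (GLval x) = invmx M *m map_mx s (GLval y) by apply: (can_inj (mulmxK uM)).
move/(congr1 (mulmx M)); rewrite !mulmxA mulmxV // !mul1mx; exact: map_mx_inj.
Qed.

Lemma form_semi u v : B (map_mx s u *m M) (map_mx s v *m M) = c * s (B u v).
Proof.
rewrite -form_map /symp_form trmx_mul !mulmxA -(mulmxA _ M J) -(mulmxA _ (M *m J)) MJ.
by rewrite -scalemxAr -scalemxAl [LHS]mxE.
Qed.

Lemma semi_Sp x : x \in Sp -> semi x \in Sp.
Proof.
rewrite !SpE => /symplecticP hx; apply/symplecticP=> u v.
have [u' eu] := map_row_surj s (u *m invmx M); have [v' ev] := map_row_surj s (v *m invmx M).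
have -> : u = map_mx s u' *m M by rewrite -eu mulmxKV.
have -> : v = map_mx s v' *m M by rewrite -ev mulmxKV.
rewrite -!mulmxA -!semi_map !mulmxA -!map_mxM !form_semi.
by rewrite hx.
Qed.

Lemma semi_onto y : y \in Sp -> exists2 x, x \in Sp & y = semi x.
Proof.
move=> yS; have sub : semi @: Sp \subset Sp by apply/subsetP=> z /imsetP[x xS ->]; apply: semi_Sp.
have /eqP e : semi @: Sp == Sp by rewrite eqEcard sub card_imset //=; exact: semi_inj.
by move: yS; rewrite -{1}e => /imsetP[x xS ->]; exists x.
Qed.

Lemma semi_tg (char2 : (2%:R : F) != 0) v a :
  semi (tg v a) = tg (map_mx s v *m M) (s a / c).
Proof.
apply: GLval_inj; rewrite GLval_tg //; apply: (can_inj (mulKmx uM)).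
rewrite -semi_map GLval_tg //; apply: eq_mulrows => u; rewrite !mulmxA.
have [u' ->] := map_row_surj s u.
rewrite -map_mxM !mul_tv form_semi map_mxD map_mxZ rmorphM mulmxDl -scalemxAl.
by rewrite mulrA -(mulrA _ c^-1) mulVf // mulr1.
Qed.

(** The semilinear similitude multiplies the form by c, so it extends to the Heisenberg group with
    the same factor on the center. *)
Definition hsemi (h : H) : H := Heis (map_mx s (heis_vec h) *m M) (c * s (heis_ctr h)).

Lemma hsemiM h k : hsemi (h * k)%g = (hsemi h * hsemi k)%g.
Proof.
congr Heis => /=; first by rewrite map_mxD mulmxDl.
rewrite form_semi !rmorphD rmorphM fmorphV rmorph_nat !mulrDr.
by rewrite mulrA.
Qed.

Lemma hsemi1 : hsemi 1%g = 1%g.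
Proof. by congr Heis => /=; rewrite ?map_mx0 ?mul0mx // rmorph0 mulr0. Qed.

Lemma hsemi_inj : injective hsemi.
Proof.
move=> [u t] [v r] [] /(can_inj (mulmxK uM))/map_mx_inj -> /(mulfI c0)/fmorph_inj ->.
by [].
Qed.

Lemma hsemi_act h x : hsemi (heis_act h x) = heis_act (hsemi h) (semi x).
Proof. by congr Heis => /=; rewrite map_mxM -!mulmxA semi_map. Qed.

Variables (w : mx_representation C Sp (#|F| ^ n)).

Lemma twist_repr_proof : mx_repr Sp (fun x => w (semi x)).
Proof.
split=> [|x y xS yS]; first by rewrite semi1 repr_mx1.
by rewrite semiM repr_mxM ?semi_Sp.
Qed.
Definition twist_repr := MxRepresentation twist_repr_proof.

(** Composing the Heisenberg representation with [hsemi] restores the intertwining relation for the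
    twist of [w] by [semi]. *)
Lemma twist_weil : weil_representation w -> weil_representation twist_repr.
Proof.
case=> rho [irr [t ht] rel].
have hr : mx_repr [set: H] (fun h => rho (hsemi h)).
  split=> [|h k _ _]; first by rewrite hsemi1 repr_mx1.
  by rewrite hsemiM repr_mxM ?inE.
have onto h : exists k, h = hsemi k.
  have [g hg gh] := injF_bij hsemi_inj; by exists (g h).
exists (MxRepresentation hr); split.
- case: irr => _ n0 simp; split=> //; first exact: mxmodule1.
  move=> U modU sU U0; apply: simp => //; apply/mxmoduleP=> h _.
  have [k ->] := onto h; exact: (mxmoduleP modU k (in_setT _)).
- have [[v r] [_ e]] := onto (Heis 0 t); exists r.
  by rewrite /= /hsemi /= map_mx0 mul0mx -e.
- by move=> x h xS /=; rewrite rel ?semi_Sp // hsemi_act.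
Qed.

Lemma twist_simple U : mxsimple w U -> mxsimple twist_repr U.
Proof.
have modE (X : 'M_(#|F| ^ n)) : mxmodule twist_repr X -> mxmodule w X.
  move=> mX; apply/mxmoduleP=> y /semi_onto[x xS ->]; exact: (mxmoduleP mX).
case=> mU U0 simp; split=> // [|X mX sX X0]; last by apply: simp => //; apply: modE.
by apply/mxmoduleP=> x xS; apply: (mxmoduleP mU); apply: semi_Sp.
Qed.
End Twist.

(** * The group G and its action on PSp *)

Section Cover.
Variables (n : nat) (F : finFieldType) (p : nat).
Hypothesis n_gt1 : (1 < n)%N.
Hypothesis char2 : (2%:R : F) != 0.
Hypothesis pF : p \in [pchar F].
Let n_gt0 : (0 < n)%N := ltnW n_gt1.
Local Notation S := (PSp n F).
Local Notation Z := 'Z(Sp n F).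
Local Notation Sp := (Sp n F).
Variables (gT : finGroupType) (G : {group gT}).
Variable iota : {morphism (G / 'Z(G))%g >-> {perm coset_of 'Z(Sp)}}.
Hypothesis hG : almost_quasisimple S iota.
Variable E : {group gT}.
Hypothesis hE : is_layer G S E.
Hypothesis sEG : E \subset G.
Variable pi : {morphism Sp >-> gT}.
Hypothesis hpi : (pi @* Sp)%g = E.

Let simS : simple S. Proof. by case: hG. Qed.
Let nabS : ~~ abelian S. Proof. by case: hG. Qed.
Let nZ : G \subset 'N('Z(G))%g := normal_norm (center_normal G).
Local Notation bar g := (iota (coset 'Z(G)%g g)).

Lemma mem_barG g : g \in G -> coset 'Z(G)%g g \in (G / 'Z(G))%g.
Proof. exact: mem_quotient. Qed.

Lemma barM g h : g \in G -> h \in G -> bar (g * h)%g = (bar g * bar h)%g.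
Proof.
move=> gG hG'; rewrite (morphM (coset_morphism _)) ?(subsetP nZ) //.
by rewrite morphM ?mem_barG.
Qed.

Lemma barX g k : g \in G -> bar (g ^+ k)%g = (bar g ^+ k)%g.
Proof. by move=> gG; rewrite (morphX (coset_morphism _)) ?(subsetP nZ) // morphX ?mem_barG. Qed.

Lemma barJ g h : g \in G -> h \in G -> bar (g ^ h)%g = (bar g ^ bar h)%g.
Proof.
by move=> gG hG'; rewrite (morphJ (coset_morphism _)) ?(subsetP nZ) // morphJ ?mem_barG.
Qed.

Lemma bar_Aut g : g \in G -> bar g \in Aut S.
Proof.
by move=> gG; case: hG => _ _ _ _ sA; apply: (subsetP sA); rewrite mem_morphim ?mem_barG.
Qed.

Lemma bar_inj g h : g \in G -> h \in G -> bar g = bar h -> exists2 z, z \in 'Z(G)%g & g = (z * h)%g.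
Proof.
case: hG => _ _ inj _ _ gG hG' /(injmP inj) e.
have := e (mem_barG gG) (mem_barG hG').
by move/(rcoset_kercosetP (subsetP nZ _ gG) (subsetP nZ _ hG'))/rcosetP.
Qed.

Lemma pi_E x : x \in Sp -> pi x \in E.
Proof. by move=> xS; rewrite -hpi mem_morphim. Qed.

Lemma pi_G x : x \in Sp -> pi x \in G.
Proof. by move=> xS; apply: (subsetP sEG); apply: pi_E. Qed.

Lemma bar_inner x : x \in Sp -> exists2 c, c \in S & bar (pi x) = conj_aut S c.
Proof.
move=> xS; have : bar (pi x) \in (conj_aut S @* S)%g.
  by rewrite -(layer_inner hG hE sEG) mem_morphim ?mem_quotient ?pi_G ?pi_E.
by case/morphimP=> c _ cS e; exists c.
Qed.

Lemma inner_bar c : c \in S -> exists2 x, x \in Sp & bar (pi x) = conj_aut S c.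
Proof.
move=> cS; have : conj_aut S c \in (conj_aut S @* S)%g.
  by rewrite mem_morphim // (subsetP (normG S)).
rewrite -(layer_inner hG hE sEG) => /morphimP[t _ /morphimP[g _ gE ->] e].
by move: gE; rewrite -hpi => /morphimP[x _ xS ex]; exists x; rewrite // -ex -e.
Qed.

(** The image of a central z is conjugation by some d in S; it commutes with all inner
    automorphisms, so d is central in the simple group S. *)
Lemma bar_center z : z \in Z -> bar (pi z) = 1%g.
Proof.
move=> zZ; have [zS cz] := centerP _ _ zZ.
have [d dS e] := bar_inner zS; rewrite e.
have : d \in 'Z(S)%g.
  apply/centerP; split=> // c cS; have [x xS ex] := inner_bar cS.
  have dN : conj_aut S d \in Aut S by rewrite -e bar_Aut ?pi_G.
  have : (c ^ d)%g = c.
    apply: (conj_aut_inj simS nabS) => //; first exact: groupJ.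
    rewrite -(conj_autE dS cS) -(conj_aut_conj dN cS) -e -ex -barJ ?pi_G // -morphJ //.
    by rewrite conjgE -cz // mulKg.
  by move/conjg_fixP/commgP/commute_sym.
by rewrite (nonabelian_simple_center simS nabS) => /set1P ->; rewrite morph1.
Qed.

Lemma bar_coset x y : x \in Sp -> y \in Sp -> coset Z x = coset Z y -> bar (pi x) = bar (pi y).
Proof.
move=> xS yS /(coset_eqP n_gt1 char2 xS yS)[-> //|->].
have mZ : m1 F n \in Z by apply/(center_SpP n_gt0 char2); right.
have mS := m1_Sp F n_gt0.
by rewrite morphM // barM ?pi_G // (bar_center mZ) mulg1.
Qed.

(** pi induces a morphism of S onto Inn(S), identified with S; it is bijective by cardinality. *)
Lemma cover_automorphism : exists2 a, a \in Aut S &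
  forall x, x \in Sp -> bar (pi x) = conj_aut S (a (coset Z x)).
Proof.
have [f hf] : exists f : coset_of Z -> coset_of Z, forall c, c \in S ->
    f c \in S /\ forall x, x \in Sp -> coset Z x = c -> bar (pi x) = conj_aut S (f c).
  apply: (fin_all_exists (P := fun c d => c \in S -> d \in S /\
    forall x, x \in Sp -> coset Z x = c -> bar (pi x) = conj_aut S d)) => c.
  have [cS|_] := boolP (c \in S); last by exists 1%g.
  have [x xS e] := PSpP cS; have [d dS ed] := bar_inner xS.
  by exists d => _; split=> // y yS ey; rewrite -ed; apply: bar_coset => //; rewrite ey.
have fE x : x \in Sp -> bar (pi x) = conj_aut S (f (coset Z x)).
  by move=> xS; apply: (hf _ (mem_PSp xS)).2.
have fM : {in S &, {morph f : c d / (c * d)%g}}.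
  move=> c d cS dS; have [cf _] := hf c cS; have [df _] := hf d dS.
  have [x xS ec] := PSpP cS; have [y yS ed] := PSpP dS.
  apply: (conj_aut_inj simS nabS); rewrite ?groupM ?(hf _ _).1 ?groupM //.
  rewrite morphM ?(subsetP (normG S)) // ec ed -cosetM // -!fE ?groupM //=.
  by rewrite morphM // barM ?pi_G // !fE.
pose fm := Morphism fM.
have fS : (fm @* S)%g = S.
  apply/eqP; rewrite eqEsubset; apply/andP; split.
    by apply/subsetP=> _ /morphimP[c _ cS ->]; have [] := hf c cS.
  apply/subsetP=> c cS; have [x xS ex] := inner_bar cS.
  have -> : c = fm (coset Z x).
    by apply: (conj_aut_inj simS nabS cS); [have [] := hf _ (mem_PSp xS) | rewrite -ex -fE].
  by rewrite mem_morphim ?mem_PSp.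
have inj : ('injm fm)%g by rewrite -card_im_injm fS.
exists (aut inj fS) => [|x xS]; first exact: Aut_aut.
by rewrite autE ?mem_PSp // fE.
Qed.

(** The twist implements the inverse of the automorphism induced by pi, so the two cancel. *)
Lemma normalized_cover : exists (s : {rmorphism F -> F}) (M : 'M[F]_(dimV n)) (c : F),
  [/\ M \in unitmx, c != 0, M *m symp_mx F n *m M^T = c *: symp_mx F n &
    forall x, x \in Sp -> bar (pi (semi s M x)) = conj_aut S (coset Z x)].
Proof.
have [a aA ha] := cover_automorphism; have aVA : (a^-1)%g \in Aut S by rewrite groupV.
have [s [M [c [uM c0 MJ hM]]]] := aut_PSp n_gt1 char2 pF aVA.
exists s, M, c; split=> // x xS; have [sS e] := hM x xS.
by rewrite ha ?semi_Sp // -e permKV.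
Qed.

Variables (s : {rmorphism F -> F}) (M : 'M[F]_(dimV n)) (c : F).
Hypothesis uM : M \in unitmx.
Hypothesis c0 : c != 0.
Hypothesis MJ : M *m symp_mx F n *m M^T = c *: symp_mx F n.
Hypothesis cover : forall x, x \in Sp -> bar (pi (semi s M x)) = conj_aut S (coset Z x).
Local Notation pi' x := (pi (semi s M x)).
Let sS x : x \in Sp -> semi s M x \in Sp := @semi_Sp F n s M c uM MJ x.

Lemma pi'_E x : x \in Sp -> pi' x \in E.
Proof. by move=> xS; rewrite pi_E ?sS. Qed.

Lemma pi'_G x : x \in Sp -> pi' x \in G.
Proof. by move=> xS; rewrite pi_G ?sS. Qed.

Lemma pi'_onto g : g \in E -> exists2 x, x \in Sp & g = pi' x.
Proof.
rewrite -hpi => /morphimP[y _ yS ->]; have [x xS ->] := semi_onto s uM MJ yS.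
by exists x.
Qed.

Lemma pi'M x y : x \in Sp -> y \in Sp -> pi' (x * y)%g = (pi' x * pi' y)%g.
Proof. by move=> xS yS; rewrite semiM // morphM ?sS. Qed.

Lemma pi'1 : pi' 1%g = 1%g.
Proof. by rewrite semi1 // morph1. Qed.

Lemma pi'X x k : x \in Sp -> pi' (x ^+ k)%g = (pi' x ^+ k)%g.
Proof. by move=> xS; elim: k => [|k IH]; rewrite ?pi'1 // !expgS pi'M ?groupX // IH. Qed.

(** Both sides have the same image in Aut(S), so they differ by a z in the center of G, which also
    lies in E. It comes from 1 or - 1, so z^2 = 1, and z^p = 1 since both sides have order dividing
    p; as p is odd, z = 1. *)
Lemma cover_conj g (s1 : {rmorphism F -> F}) M1 (c1 : F) : g \in G ->
  M1 \in unitmx -> c1 != 0 -> M1 *m symp_mx F n *m M1^T = c1 *: symp_mx F n ->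
  (forall x, x \in Sp -> bar g (coset Z x) = coset Z (semi s1 M1 x)) ->
  forall x, x \in Sp -> (x ^+ p = 1)%g -> (pi' x ^ g)%g = pi' (semi s1 M1 x).
Proof.
move=> gG uM1 c10 MJ1 hg x xS xp; have x1S := semi_Sp s1 uM1 MJ1 xS.
have x1p : (semi s1 M1 x ^+ p = 1)%g.
  have sX k : semi s1 M1 (x ^+ k)%g = (semi s1 M1 x ^+ k)%g.
    by elim: k => [|k IH]; rewrite ?semi1 // !expgS semiM // IH.
  by rewrite -sX xp semi1.
have e : bar (pi' x ^ g)%g = bar (pi' (semi s1 M1 x)).
  by rewrite barJ ?pi'_G // !cover // (conj_aut_conj) ?mem_PSp ?bar_Aut // hg.
have [z zZ ez] := bar_inj (groupJ (pi'_G xS) gG) (pi'_G x1S) e.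
have [zG cz] := centerP _ _ zZ.
have nE : G \subset 'N(E) by case: hE => /normal_norm.
have zE : z \in E.
  rewrite -[z](mulgK (pi' (semi s1 M1 x))) -ez groupM ?groupV ?pi'_E //.
  by rewrite memJ_norm ?pi'_E // (subsetP nE).
have z2 : (z ^+ 2 = 1)%g.
  have [y yS ey] := pi'_onto zE.
  have : conj_aut S (coset Z y) = conj_aut S 1%g.
    rewrite -cover // -ey morph1 coset_id // ?morph1 //.
  move/(conj_aut_inj simS nabS (mem_PSp yS) (group1 _))/coset_idr => yZ.
  have := yZ (Sp_normZ yS); move/(center_SpP n_gt0 char2) => y1.
  have y2 : (y ^+ 2 = 1)%g.
    case: y1 => ->; first by rewrite expg1n.
    by apply: GLval_inj; rewrite GLvalX GLval_m1 // GLval1 sqrrN expr1n.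
  by rewrite ey -pi'X // y2 pi'1.
have zp : (z ^+ p = 1)%g.
  have {}cz : commute z (pi' (semi s1 M1 x)) by apply: cz; rewrite pi'_G.
  have := congr1 (fun t => t ^+ p)%g ez; rewrite /= -conjXg -pi'X // xp pi'1 conj1g.
  by rewrite expgMn // -pi'X // x1p pi'1 mulg1 => <-.
have z1 : z = 1%g.
  have := zp; rewrite -{1}(odd_double_half p) (odd_p char2 pF) add1n expgS.
  by rewrite -mul2n expgM z2 expg1n mulg1.
by rewrite ez z1 mul1g.
Qed.

End Cover.

(* T and T' are mutually inverse isomorphisms between the row space of U, on
   which x in Sp acts by V x, and the row space of (1 + e P0) / 2. *)
Record weil_model (C : closedFieldType) (n : nat) (F : finFieldType) m
    (V : {'GL_(2 * n)[F]} -> 'M[C]_m) (U : 'M[C]_m) : Type := WeilModel {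
  wm_rho : mx_representation C [set: heisenberg n F] (#|F| ^ n);
  wm_rep : mx_representation C (Sp n F) (#|F| ^ n);
  wm_sign : C;
  wm_to : 'M[C]_(m, #|F| ^ n);
  wm_from : 'M[C]_(#|F| ^ n, m);
  wm_irr : mx_irreducible wm_rho;
  wm_nontriv : exists t : F, wm_rho (Heis 0 t) != 1%:M;
  wm_rel : forall x h, x \in Sp n F ->
    wm_rho h *m wm_rep x = wm_rep x *m wm_rho (heis_act h x);
  wm_sq : wm_sign * wm_sign = 1;
  wm_toP : forall u : 'rV_m, (u <= U)%MS ->
    (u *m wm_to <= Pe wm_rho wm_sign)%MS /\ u *m wm_to *m wm_from = u;
  wm_fromP : forall v : 'rV_(#|F| ^ n), (v <= Pe wm_rho wm_sign)%MS ->
    (v *m wm_from <= U)%MS /\ v *m wm_from *m wm_to = v;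
  wm_int : forall x (u : 'rV_m), x \in Sp n F -> (u <= U)%MS ->
    u *m V x *m wm_to = u *m wm_to *m wm_rep x }.

Section Model.
Variables (C : closedFieldType) (n : nat) (F : finFieldType).
Hypothesis charC : [pchar C] =i pred0.
Hypothesis n_gt1 : (1 < n)%N.
Hypothesis char2 : (2%:R : F) != 0.
Let n_gt0 : (0 < n)%N := ltnW n_gt1.
Local Notation Sp := (Sp n F).
Local Notation D := (#|F| ^ n)%N.

Section Exists.
Variables (gT : finGroupType) (E : {group gT}) (pi : {morphism Sp >-> gT}).
Hypothesis hpi : (pi @* Sp)%g = E.
Variables (s : {rmorphism F -> F}) (M : 'M[F]_(dimV n)) (c : F).
Hypothesis uM : M \in unitmx.
Hypothesis c0 : c != 0.
Hypothesis MJ : M *m symp_mx F n *m M^T = c *: symp_mx F n.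
Variables (m : nat) (rE : mx_representation C E m).

Lemma weil_model_exists (U : 'M[C]_m) (simU : mxsimple rE U) :
  weil_module_via pi (submod_repr (mxsimple_module simU)) ->
  exists W : weil_model (fun x => rE (pi (semi s M x))) U, True.
Proof.
case=> w0 [[w [ww [U' [simU' [B dB fB hB]]]]] w0E].
have ww' := twist_weil s uM c0 MJ ww; have simU2 := twist_simple s uM MJ simU'.
set w' := twist_repr s uM MJ w in ww' simU2 *.
have [rho [irr nt rel]] := ww'.
have [e [ee eU]] := w_simple charC n_gt0 char2 irr nt rel simU2.
have mU := mxsimple_module simU; have mU' := mxsimple_module simU'.
have [Bi BBi BiB] : exists2 Bi : 'M_(\rank U', \rank U), B *m Bi = 1%:M & Bi *m B = 1%:M.
  have inv a b (X : 'M[C]_(a, b)) : a = b -> row_free X -> exists2 Y, X *m Y = 1%:M & Y *m X = 1%:M.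
    move=> eab; case: b / eab X => X fX; have uX : X \in unitmx by rewrite -row_free_unit.
    by exists (invmx X); rewrite ?mulmxV ?mulVmx.
  exact: inv.
(* Coordinates on U, then the isomorphism B of submodules, then the inclusion of U' into the space
   of w; T' goes backwards. *)
pose T : 'M_(m, D) := in_submod U 1%:M *m B *m val_submod (U := U') 1%:M.
pose T' : 'M_(D, m) := in_submod U' 1%:M *m Bi *m val_submod (U := U) 1%:M.
have TE (u : 'rV_m) : u *m T = val_submod (in_submod U u *m B).
  by rewrite [RHS]val_submodE (in_submodE U u) /T !mulmxA.
have T'E (v : 'rV_D) : v *m T' = val_submod (in_submod U' v *m Bi).
  by rewrite [RHS]val_submodE (in_submodE U' v) /T' !mulmxA.
unshelve eexists; last by []; apply: (@WeilModel _ _ _ _ _ _ rho w' e T T' irr nt rel ee).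
- move=> u uU; rewrite -eU TE T'E val_submodP; split=> //.
  by rewrite val_submodK -mulmxA BBi mulmx1 in_submodK.
- move=> v; rewrite -eU => vU; rewrite T'E TE val_submodP; split=> //.
  by rewrite val_submodK -mulmxA BiB mulmx1 in_submodK.
move=> x u xS uU; have sx := semi_Sp s uM MJ xS.
rewrite !TE (in_submodJ mU) // -mulmxA.
have -> : submod_mx mU (pi (semi s M x)) = w0 (semi s M x).
  by rewrite w0E.
rewrite hB // mulmxA.
by rewrite [RHS]/= -(val_submodJ mU').
Qed.
End Exists.

Variables (m : nat) (V : {'GL_(2 * n)[F]} -> 'M[C]_m) (U : 'M[C]_m).
Variable W : weil_model V U.
Local Notation rho := (wm_rho W).
Local Notation w := (wm_rep W).
Local Notation e := (wm_sign W).
Local Notation T := (wm_to W).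
Local Notation T' := (wm_from W).
Let ee := wm_sq W.
Let irr := wm_irr W.
Let nt := wm_nontriv W.
Let rel := @wm_rel _ _ _ _ _ _ W.
Let toP := @wm_toP _ _ _ _ _ _ W.
Let fromP := @wm_fromP _ _ _ _ _ _ W.
Let wint := @wm_int _ _ _ _ _ _ W.

Lemma model_sspec y : y \in Sp ->
  (forall (a : C) (u v : 'rV[C]_m), (u <= U)%MS -> (v <= U)%MS ->
    u *m V y = a *: u -> v *m V y = a *: v -> u != 0 -> (v <= u)%MS) ->
  (forall u : 'rV[C]_m, (u <= U)%MS -> (u *m V y <= U)%MS) ->
  sspec rho w e y.
Proof.
move=> yS simp stab a u v ua va ue ve u0.
have [uU uK] := fromP ue; have [vU vK] := fromP ve.
have eig (t : 'rV_D) : t *m w y = a *: t -> (t <= Pe rho e)%MS ->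
    t *m T' *m V y = a *: (t *m T').
  move=> ta te; have [tU tK] := fromP te.
  have [_ <-] := toP (stab _ tU); rewrite wint // tK ta.
  by rewrite scalemxAl.
have n0 : u *m T' != 0 by apply: contra u0 => /eqP z; rewrite -uK z mul0mx.
have /sub_rVP[k hk] := simp a _ _ uU vU (eig u ua ue) (eig v va ve) n0.
by apply/sub_rVP; exists k; rewrite -vK hk -scalemxAl uK.
Qed.

Lemma model_isotropic y : y \in Sp ->
  (forall (a : C) (u v : 'rV[C]_m), (u <= U)%MS -> (v <= U)%MS ->
    u *m V y = a *: u -> v *m V y = a *: v -> u != 0 -> (v <= u)%MS) ->
  (forall u : 'rV[C]_m, (u <= U)%MS -> (u *m V y <= U)%MS) ->
  forall X X' : 'M[F]_(dimV n), isotropic X -> isotropic X' -> X' != 0 ->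
  (forall v : 'rV[F]_(dimV n), (v <= X')%MS -> v != 0 ->
    exists2 u : 'rV[F]_(dimV n), (u <= X)%MS & symp_form u v != 0) ->
  (X *m GLval y <= X)%MS -> (X' *m GLval y <= X')%MS ->
  #|[set v : 'rV[F]_(dimV n) | (v <= X)%MS]| = D.
Proof.
move=> yS simp stab X X' iX iX' X0 dual sX sX'.
have ss := model_sspec yS simp stab.
exact: (stable_isotropic charC n_gt0 char2 irr nt rel ee yS ss iX iX' X0 dual sX sX').
Qed.

Definition model_proj : 'M[C]_m := locked (T *m Pe rho e *m T').

Lemma model_projE : model_proj = T *m Pe rho e *m T'.
Proof. by rewrite /model_proj -lock. Qed.

Lemma model_proj_sub (u : 'rV[C]_m) : (u *m model_proj <= U)%MS.
Proof. by rewrite model_projE !mulmxA; have [] := fromP (submxMl (u *m T) (Pe rho e)). Qed.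

Lemma model_proj_id (u : 'rV[C]_m) : (u <= U)%MS -> u *m model_proj = u.
Proof.
move=> uU; have [/submxP[k hk] h] := toP uU.
by rewrite model_projE !mulmxA hk -(mulmxA k) (PePe charC n_gt0 char2 irr nt) // -hk h.
Qed.

Lemma model_trace x : x \in Sp -> (forall u : 'rV[C]_m, (u <= U)%MS -> (u *m V x <= U)%MS) ->
  \tr (Pe rho e *m w x) = \tr (model_proj *m V x).
Proof.
move=> xS stab; have -> : Pe rho e *m w x = Pe rho e *m T' *m V x *m T.
  apply: eq_mulrows => v; rewrite !mulmxA.
  have [vU vK] := fromP (submxMl v (Pe rho e)).
  by rewrite wint // vK.
by rewrite mxtrace_mulC model_projE !mulmxA.
Qed.

(** Sp is transitive on nonzero vectors, and the trace on the image of [Pe e] is invariant under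
    conjugation by Sp. *)
Lemma model_trace_root (v v' : 'rV[F]_(dimV n)) a : v != 0 -> v' != 0 ->
  \tr (Pe rho e *m w (tg v a)) = \tr (Pe rho e *m w (tg v' a)).
Proof.
move=> v0 v0'; have [x xS <-] := Sp_trans n_gt0 char2 v0 v0'.
rewrite -tg_conj // conjgE !repr_mxM ?groupM ?groupV ?tg_Sp // !mulmxA.
rewrite [RHS]mxtrace_mulC !mulmxA (Pe_comm e (w_P0 rel xS)) -(mulmxA (Pe rho e)).
by rewrite -repr_mxM ?groupV // mulgV repr_mx1 mulmx1.
Qed.

(* Conjugation by A permutes the root elements and multiplies the parameter by
   a nonsquare, hence the trace would be constant on them. *)
Lemma model_unstable (A : 'M[C]_m) (s : {rmorphism F -> F}) (M : 'M[F]_(dimV n)) (c : F) :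
  A \in unitmx -> M \in unitmx -> c != 0 -> (forall k, c != k * k) ->
  (forall x (u : 'rV[C]_m), x \in Sp -> (u <= U)%MS -> (u *m V x <= U)%MS) ->
  (forall v a, A *m V (tg (map_mx s v *m M) (s a / c)) = V (tg v a) *m A) ->
  (forall u : 'rV[C]_m, (u <= U)%MS -> (u *m A <= U)%MS) ->
  (forall u : 'rV[C]_m, (u <= U)%MS -> (u *m invmx A <= U)%MS) -> False.
Proof.
move=> uA uM c0 nsq stab conj sA sAV.
have [v v0] : exists v : 'rV[F]_(dimV n), v != 0.
  by exists (delta_mx 0 0); apply/eqP => /rowP/(_ 0); rewrite !mxE eqxx; apply/eqP/oner_neq0.
pose f a := \tr (Pe rho e *m w (tg v a)).
have fE v' a : v' != 0 -> f a = \tr (model_proj *m V (tg v' a)).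
  by move=> v0'; rewrite /f (model_trace_root a v0 v0') model_trace ?tg_Sp // => u; apply: stab; rewrite tg_Sp.
have fsq a k : k != 0 -> f (k ^+ 2 * a) = f a.
  move=> k0; have kv : k *: v != 0 by rewrite scaler_eq0 negb_or k0.
  rewrite (fE v) // (fE (k *: v)) //; congr (\tr (_ *m V _)).
  by apply: GLval_inj; rewrite !GLval_tg // tvZ.
have fs a : f (s a / c) = f a.
  have v0' : map_mx s v *m M != 0.
    apply: contra v0 => /eqP z; rewrite -(map_mx_eq0 s) -[map_mx s v](mulmxK uM) z mul0mx //.
  rewrite (fE _ _ v0') (fE _ a v0); set X := V (tg v a).
  set Q := model_proj; have hX : V (tg (map_mx s v *m M) (s a / c)) = invmx A *m X *m A.
    by rewrite -mulmxA -conj mulmxA mulVmx // mul1mx.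
  (* Q' is another projection with image U, and the trace on U of an operator stabilizing U can be
     computed with either. *)
  pose Q' := A *m Q *m invmx A.
  have idQ (Y : 'M_m) : (forall u : 'rV_m, (u *m Y <= U)%MS) -> Y *m Q = Y.
    by move=> hY; apply: eq_mulrows => u; rewrite mulmxA model_proj_id.
  have idQ' (Y : 'M_m) : (forall u : 'rV_m, (u *m Y <= U)%MS) -> Y *m Q' = Y.
    move=> hY; apply: eq_mulrows => u; rewrite /Q' !mulmxA.
    by rewrite model_proj_id ?sA // mulmxK.
  have subQ' (u : 'rV_m) : (u *m Q' <= U)%MS by rewrite /Q' !mulmxA sAV // model_proj_sub.
  rewrite hX !mulmxA mxtrace_mulC !mulmxA -/Q'.
  transitivity (\tr (Q' *m (Q *m X))); first by rewrite mulmxA (idQ _ subQ').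
  rewrite mxtrace_mulC idQ' // => u.
  by rewrite mulmxA stab ?tg_Sp // model_proj_sub.
(* c = c^2 (1 / c), so invariance under squares reduces this to [fs] at 1. *)
have fc : f c = f 1.
  have := fs 1; rewrite rmorph1 mul1r => <-; rewrite -[RHS](fsq _ c c0) expr2 mulfK //.
apply: (root_trace_nonconst charC n_gt1 char2 irr nt rel v0 ee nsq (tau := f 1)) => a a0.
have [/existsP[k /eqP hk]|h] := boolP [exists k, a == k * k].
  have k0 : k != 0 by apply: contraNneq a0 => z; rewrite hk z mulr0.
  by rewrite -/(f a) hk -expr2 -[_ ^+ 2]mulr1 fsq.
have [k hk] : exists k, a = c * (k * k).
  apply: nonsquare_ratio nsq _ => k; apply: contra h => /eqP ->; by apply/existsP; exists k.
have k0 : k != 0 by apply: contraNneq a0 => z; rewrite hk z !mulr0.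
by rewrite -/(f a) hk mulrC -expr2 fsq.
Qed.
End Model.

(** * Field automorphisms *)

Section Iterates.
Variables (n : nat) (F : finFieldType).
Hypothesis n_gt1 : (1 < n)%N.
Hypothesis char2 : (2%:R : F) != 0.
Let n_gt0 : (0 < n)%N := ltnW n_gt1.
Local Notation N := (dimV n).
Local Notation J := (symp_mx F n).
Local Notation S := (PSp n F).
Local Notation Sp := (Sp n F).
Local Notation Z := 'Z(Sp).

Lemma semi_scale (s : {rmorphism F -> F}) (M : 'M[F]_N) (k : F) x :
  M \in unitmx -> k != 0 -> semi s (k *: M) x = semi s M x.
Proof.
move=> uM k0; apply: GLval_inj; rewrite !GLval_semi ?unitmxZ ?unitfE //.
by rewrite invmxZ ?unitmxZ ?unitfE // -!scalemxAl -scalemxAr scalerA mulVf // scale1r.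
Qed.

Variables (s : {rmorphism F -> F}) (M : 'M[F]_N) (c : F).
Hypothesis uM : M \in unitmx.
Hypothesis c0 : c != 0.
Hypothesis MJ : M *m J *m M^T = c *: J.

Lemma map_form (A : 'M[F]_N) k : A *m J *m A^T = k *: J ->
  map_mx s A *m J *m (map_mx s A)^T = s k *: J.
Proof. by move/(congr1 (map_mx s)); rewrite !map_mxM map_trmx map_mxZ !map_symp_mx. Qed.

(** The matrix part of the i-th iterate of u |-> s(u) M. *)
Fixpoint iter_mx i : 'M[F]_N := if i is l.+1 then map_mx s (iter_mx l) *m M else 1%:M.

Lemma iter_mx_form i : exists2 k, k != 0 & iter_mx i *m J *m (iter_mx i)^T = k *: J.
Proof.
elim: i => [|i [k k0 IH]] /=; first by exists 1; rewrite ?oner_neq0 // trmx1 mulmx1 mul1mx scale1r.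
exists (c * s k); first by rewrite mulf_neq0 // fmorph_eq0.
rewrite trmx_mul !mulmxA -(mulmxA _ M J) -(mulmxA _ (M *m J)) MJ -scalemxAr -scalemxAl.
by rewrite (map_form IH) scalerA.
Qed.

Lemma iter_semi i x : map_mx (iter i s) (GLval x) *m iter_mx i = iter_mx i *m GLval (iter i (semi s M) x).
Proof.
elim: i => [|i IH] /=; first by rewrite mulmx1 mul1mx map_mx_id.
rewrite -[RHS]mulmxA -semi_map // [RHS]mulmxA.
have -> (y : 'M[F]_N) : map_mx s (iter_mx i) *m map_mx s y = map_mx s (iter_mx i *m y) by rewrite map_mxM.
rewrite -IH map_mxM mulmxA; congr (_ *m _ *m _).
by apply/matrixP=> a b; rewrite !mxE.
Qed.

Lemma iter_mxS i : iter_mx i.+1 = map_mx (iter i s) M *m iter_mx i.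
Proof.
elim: i => [|i IH]; first by rewrite /= map_mx1 mul1mx mulmx1 map_mx_id.
rewrite -[LHS]/(map_mx s (iter_mx i.+1) *m M) {1}IH map_mxM -mulmxA; congr (_ *m _).
by apply/matrixP=> a b; rewrite !mxE.
Qed.

Variable b : {perm coset_of Z}.
Hypothesis bA : b \in Aut S.
Hypothesis hb : forall x, x \in Sp -> b (coset Z x) = coset Z (semi s M x).
Hypothesis center_S : 'Z(S)%g = 1%g.

Lemma iter_Sp i x : x \in Sp -> iter i (semi s M) x \in Sp.
Proof. by move=> xS; elim: i => //= i IH; apply: semi_Sp MJ _ IH. Qed.

Lemma perm_iter_semi i x : x \in Sp -> (b ^+ i)%g (coset Z x) = coset Z (iter i (semi s M) x).
Proof.
move=> xS; elim: i => [|i IH]; first by rewrite perm1.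
by rewrite expgSr permM IH hb ?iter_Sp.
Qed.

Lemma inner_eq (a : {perm coset_of Z}) y : a \in Aut S -> y \in Sp ->
  (forall x, x \in Sp -> a (coset Z x) = coset Z (x ^ y)%g) -> a = conj_aut S (coset Z y).
Proof.
move=> aA yS h; have yS' := mem_PSp yS.
apply: (eq_Aut aA) => [|t /PSpP[x xS ->]].
  by rewrite (subsetP (Aut_conj_aut S S)) // mem_morphim // (subsetP (normG S)).
by rewrite h // conj_autE ?mem_PSp // cosetJ.
Qed.

Lemma fixed_gt2 : (3 <= #|[set a : F | s a == a]|)%N.
Proof.
have n11 : (1 : F) != -1 by rewrite -subr_eq0 opprK -mulr2n -[_ *+ 2]mulr_natr mul1r.
rewrite cardE; apply: (@uniq_leq_size _ [:: 0; 1; -1 : F]).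
  by rewrite /= !inE negb_or !(eq_sym 0) oner_eq0 oppr_eq0 oner_eq0 n11.
by move=> a; rewrite mem_enum !inE => /or3P[] /eqP ->; rewrite ?rmorph0 ?rmorph1 ?rmorphN1.
Qed.

(* The e-th power of the semilinear map u |-> s(u) M, e the order of s, is a
   linear map commuting with it, to which the order bound applies. *)
Lemma field_aut_order : (exists a, s a != a) ->
  (exists k, [/\ (0 < k)%N, (b ^+ k = 1)%g & (k + 2 <= #|F| ^ n)%N]) /\
  (c = 1 -> exists k, [/\ (0 < k)%N, (b ^+ k = 1)%g & (2 * k + 2 <= #|F| ^ n)%N]).
Proof.
case=> a0 ha0; have [e [e0 se mine]] := rmorph_order s.
have e1 : (1 < e)%N.
  by case: e e0 se {mine} => [|[|e]] // _ se; move: ha0; rewrite -{2}(se a0) eqxx.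
have comm : map_mx s (iter_mx e) *m M = M *m iter_mx e.
  rewrite -[LHS]/(iter_mx e.+1) iter_mxS; congr (_ *m _).
  by apply/matrixP=> i k; rewrite mxE se.
have conj x : x \in Sp -> GLval x *m iter_mx e = iter_mx e *m GLval (iter e (semi s M) x).
  by move=> xS; rewrite -iter_semi; congr (_ *m _); apply/matrixP=> i k; rewrite mxE se.
set q0 := #|[set a : F | s a == a]|.
have card : (e * 2 ^ n * q0 ^ n + 2 <= #|F| ^ n)%N.
  apply: leq_trans (semilinear_arith n_gt1 fixed_gt2 e1) _.
  by rewrite -expnM mulnC expnM leq_exp2r // fixed_field_card.
have inner k y (A : 'M[F]_N) : y \in Sp -> A \in unitmx -> GLval y = A ->
    (forall x, x \in Sp -> GLval x *m A = A *m GLval (iter k (semi s M) x)) ->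
    (b ^+ k)%g = conj_aut S (coset Z y).
  move=> yS uA yA h; apply: inner_eq => //; first exact: groupX.
  move=> x xS; rewrite perm_iter_semi //; congr (coset Z _); apply: GLval_inj.
  by rewrite GLvalJ yA -mulmxA h // mulKmx.
have trivial k y : y \in Sp -> (b ^+ k)%g = conj_aut S (coset Z y) ->
    (b ^+ (k * #[coset Z y]) = 1)%g.
  move=> yS h; rewrite expgM h -(order_conj_aut center_S) ?mem_PSp // expg_order //.
have [k k0 kJ] := iter_mx_form e.
(* The iterate commutes with the semilinear map; comparing the multipliers of the two products shows
   that s fixes k. *)
have sk : s k = k.
  have : (c * s k) *: J = (c * k) *: J.
    have <- : iter_mx e.+1 *m J *m (iter_mx e.+1)^T = (c * s k) *: J.
      rewrite /= trmx_mul !mulmxA -(mulmxA _ M J) -(mulmxA _ (M *m J)) MJ -scalemxAr -scalemxAl.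
      by rewrite (map_form kJ) scalerA.
    rewrite /= comm trmx_mul !mulmxA -(mulmxA M) -(mulmxA M) kJ -scalemxAr -scalemxAl MJ scalerA.
    by rewrite mulrC.
  have J0 : J != 0 by apply/eqP=> z; have := symp_mx_unit F n_gt0; rewrite z unitr0.
  move/eqP; rewrite -subr_eq0 -scalerBl scaler_eq0 (negPf J0) orbF -mulrBr mulf_eq0 (negPf c0).
  by rewrite subr_eq0 => /eqP.
split.
  (* The multiplier k of the e-th iterate need not be a square, but the square of the iterate
     divided by k is symplectic, at the cost of the exponent 2 e. *)
  pose A : 'M[F]_N := k^-1 *: (iter_mx e *m iter_mx e).
  have sA : is_symplectic A.
    apply/eqP; rewrite /A linearZ /= trmx_mul -!scalemxAl -scalemxAr !mulmxA.
    rewrite -(mulmxA _ (iter_mx e) J) -(mulmxA _ (iter_mx e *m J)) kJ -scalemxAr -scalemxAl kJ !scalerA.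
    by rewrite mulVf // mulr1 mulVf // scale1r.
  have uA := symplectic_unit n_gt0 sA; have yS := toGL_Sp n_gt0 sA; have yA := toGLK uA.
  have h := inner (e + e)%N _ A yS uA yA.
  have hb2 : (b ^+ (e + e))%g = conj_aut S (coset Z (toGL A)).
    apply: h => x xS; rewrite /A -scalemxAr -scalemxAl; congr (_ *: _).
    by rewrite iterD mulmxA conj // -[LHS]mulmxA (conj (iter e _ x)) ?iter_Sp // mulmxA.
  exists ((e + e) * #[coset Z (toGL A)]%g)%N; split; first by rewrite muln_gt0 order_gt0 addn_gt0 e0.
    exact: trivial.
  have := @order_bound F n n_gt0 char2 _ yS s M uM.
  rewrite yA /A map_mxZ map_mxM -scalemxAl -mulmxA comm mulmxA comm -scalemxAr !mulmxA.
  rewrite fmorphV sk => /(_ erefl); move: (#[_]%g) card => o; rewrite -/q0.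
  move: (2 ^ n)%N (q0 ^ n)%N (#|F| ^ n)%N => t x u; clear; nia.
(* For c = 1 the e-th iterate is itself symplectic, which gains a factor 2. *)
move=> c1; have ek : k = 1.
  have form1 i : iter_mx i *m J *m (iter_mx i)^T = J.
    elim: i => [|i IH] /=; first by rewrite trmx1 mulmx1 mul1mx.
    rewrite trmx_mul !mulmxA -(mulmxA _ M J) -(mulmxA _ (M *m J)) MJ -scalemxAr -scalemxAl.
    by rewrite c1 scale1r -{2}[J]scale1r -(rmorph1 s); apply: map_form; rewrite scale1r.
  have : (k - 1) *: J = 0 by rewrite scalerBl -kJ form1 scale1r subrr.
  have J0 : J != 0 by apply/eqP=> z; have := symp_mx_unit F n_gt0; rewrite z unitr0.
  by move/eqP; rewrite scaler_eq0 (negPf J0) orbF subr_eq0 => /eqP.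
have sA : is_symplectic (iter_mx e) by apply/eqP; rewrite kJ ek scale1r.
have uA := symplectic_unit n_gt0 sA; have yS := toGL_Sp n_gt0 sA; have yA := toGLK uA.
have hb2 := inner e _ _ yS uA yA conj.
exists (e * #[coset Z (toGL (iter_mx e))]%g)%N; split; first by rewrite muln_gt0 order_gt0 e0.
  exact: trivial.
have := @order_bound F n n_gt0 char2 _ yS s M uM; rewrite yA => /(_ comm).
move: (#[_]%g) card => o; rewrite -/q0.
move: (2 ^ n)%N (q0 ^ n)%N (#|F| ^ n)%N => t x u; clear; nia.
Qed.
End Iterates.

(** * The two cases *)

Section Main.
Variables (n : nat) (F : finFieldType) (K : closedFieldType) (j : {rmorphism F -> K}) (p : nat).
Hypothesis n_gt1 : (1 < n)%N.
Hypothesis char2 : (2%:R : F) != 0.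
Hypothesis qp : [pchar K].-nat #|F|.
Hypothesis pF : p \in [pchar F].
Hypothesis nq : (n, #|F|) <> (2%N, 3%N).
Let n_gt0 : (0 < n)%N := ltnW n_gt1.
Local Notation q := #|F|.
Local Notation S := (PSp n F).
Local Notation Sp := (Sp n F).
Local Notation Z := 'Z(Sp).
Variables (gT : finGroupType) (G : {group gT}).
Variable iota : {morphism (G / 'Z(G))%g >-> {perm coset_of 'Z(Sp)}}.
Hypothesis hG : almost_quasisimple S iota.
Variable E : {group gT}.
Hypothesis hE : is_layer G S E.
Hypothesis sEG : E \subset G.
Variable pi : {morphism Sp >-> gT}.
Hypothesis hpi : (pi @* Sp)%g = E.
Variable C : closedFieldType.
Hypothesis charC : [pchar C] =i pred0.
Variables (m' : nat) (V : mx_representation C G m'.+1).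
Hypothesis hirr : mx_irreducible V.
Variable g : gT.
Hypothesis hg : g \in G.
Hypothesis hspec : simple_spectrum (V g).
Variables (s : bool) (d : nat).
Hypothesis hd : d = (pm s (q ^ n))./2.
Local Notation rE := (subg_repr V sEG).
Hypothesis hweil : forall (U : 'M_m'.+1) (simU : mxsimple rE U),
  weil_module_via pi (submod_repr (mxsimple_module simU)) /\ \rank U = d.
Hypothesis hm : m'.+1 = d \/ m'.+1 = (2 * d)%N.
Local Notation bar h := (iota (coset 'Z(G)%g h)).
Local Notation gbar := (bar g).

Let center_S : 'Z(S)%g = 1%g.
Proof. by case: hG => simS nabS _ _ _; apply: nonabelian_simple_center. Qed.

Lemma q_gt2 : (2 < q)%N.
Proof. by have := q_odd j char2 qp; have := finNzRing_gt1 F; case: q => [|[|[|]]]. Qed.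

Lemma qn_ge9 : (9 <= q ^ n)%N.
Proof.
apply: leq_trans (_ : 3 ^ n <= _)%N; last by rewrite leq_exp2r // q_gt2.
by rewrite -[9%N]/(3 ^ 2)%N leq_exp2l.
Qed.

Lemma degree_double : (2 * d)%N = pm s (q ^ n).
Proof.
have oq : odd (q ^ n) by rewrite oddX (q_odd j char2 qp) orbT.
rewrite hd mul2n -[RHS]odd_double_half; suff -> : odd (pm s (q ^ n)) = false by [].
by case: (q ^ n)%N oq => [|k] //=; case: s => /= /negPf ->.
Qed.

Lemma degree_ge : (q ^ n <= 2 * d + 1)%N.
Proof. by rewrite degree_double; have := qn_ge9; case: s => /=; lia. Qed.

Lemma dim_ge : (d <= m'.+1)%N.
Proof. by case: hm => ->; rewrite ?mul2n -?addnn ?leq_addr. Qed.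

Lemma center_scalar z : z \in 'Z(G)%g -> exists a, V z = a%:M.
Proof.
case/(centerP _ _) => zG cz; have ai := @group_closure_closed_field C gT _ _ _ hirr.
apply/is_scalar_mxP/(mx_abs_irr_cent_scalar ai)/centgmxP => x xG.
by rewrite -!repr_mxM // cz.
Qed.

Let g0 : (#[g]%g%:R : C) != 0. Proof. by rewrite natC_eq0 // -lt0n order_gt0. Qed.

(** A power of g acting trivially on S is central in G, hence a scalar on V, and
    [simple_spectrum_order] applies. *)
Lemma dim_le_order k : (0 < k)%N -> (gbar ^+ k = 1)%g -> (m'.+1 <= k)%N.
Proof.
move=> k0 gk; have e : bar (g ^+ k)%g = bar 1%g by rewrite (barX iota) // gk !morph1.
have [z zZ ez] := bar_inj hG (groupX k hg) (group1 G) e.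
have [a ha] := center_scalar zZ.
by apply: (simple_spectrum_order hg g0 hspec k0 (c := a)); rewrite ez mulg1.
Qed.

Lemma simple_exists : exists U, mxsimple rE U.
Proof.
have nz1 : (1%:M : 'M[C]_m'.+1) != 0 by exact: oner_neq0.
have [U simU _] := dec_mxsimple_exists (mxmodule1 rE) nz1.
by exists U.
Qed.

Variables (s0 : {rmorphism F -> F}) (M0 : 'M[F]_(dimV n)) (c0 : F).
Hypothesis uM0 : M0 \in unitmx.
Hypothesis c00 : c0 != 0.
Hypothesis MJ0 : M0 *m symp_mx F n *m M0^T = c0 *: symp_mx F n.
Hypothesis cover : forall x, x \in Sp -> bar (pi (semi s0 M0 x)) = conj_aut S (coset Z x).
Local Notation pi' x := (pi (semi s0 M0 x)).
Let piE x : x \in Sp -> pi' x \in E.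
Proof. by move=> xS; apply: (pi'_E hpi s0 uM0 MJ0). Qed.
Let piG x : x \in Sp -> pi' x \in G.
Proof. by move=> xS; apply: (subsetP sEG); apply: piE. Qed.

Lemma simple_stable U x (u : 'rV[C]_m'.+1) : mxsimple rE U -> x \in Sp -> (u <= U)%MS -> (u *m V (pi' x) <= U)%MS.
Proof.
move=> simU xS uU; apply: submx_trans (submxMr _ uU) _.
exact: (mxmoduleP (mxsimple_module simU) _ (piE xS)).
Qed.

Lemma inner_scalar h y : h \in G -> y \in Sp -> bar h = conj_aut S (coset Z y) ->
  exists2 a, a != 0 & V h = a *: V (pi' y).
Proof.
move=> hG' yS; rewrite -cover // => e; have [z zZ ez] := bar_inj hG hG' (piG yS) e.
have [zG _] := centerP _ _ zZ; have [a ha] := center_scalar zZ; exists a.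
  apply/eqP=> z0; have := repr_mx_unit V zG; rewrite ha z0 raddf0 unitmxE det0 unitr0 //.
by rewrite ez repr_mxM ?piG // ha mul_scalar_mx.
Qed.

Lemma inner_stable h y U : h \in G -> y \in Sp -> bar h = conj_aut S (coset Z y) ->
  mxsimple rE U -> (U *m V h <= U)%MS.
Proof.
move=> hG' yS e simU; have [a _ ->] := inner_scalar hG' yS e.
by rewrite -scalemxAr scalemx_sub // (mxmoduleP (mxsimple_module simU) _ (piE yS)).
Qed.

(** The spectral hypothesis is restricted to a simple submodule so that the lemma serves both g and
    g^2. *)
Lemma inner_conclusion h y U : h \in G -> y \in Sp -> bar h = conj_aut S (coset Z y) ->
  mxsimple rE U ->
  (forall (a : C) (u v : 'rV[C]_m'.+1), (u <= U)%MS -> (v <= U)%MS ->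
    u *m V h = a *: u -> v *m V h = a *: v -> u != 0 -> (v <= u)%MS) ->
  (d <= #[bar h]%g)%N -> ~~ (p %| #[bar h]%g)%N -> torus_conclusion j (bar h).
Proof.
move=> hG' yS e simU lines dle pn; have [a a0 Va] := inner_scalar hG' yS e.
have [W _] := weil_model_exists charC n_gt1 char2 s0 uM0 c00 MJ0 (hweil simU).1.
have oe : #[bar h]%g = #[coset Z y]%g by rewrite e order_conj_aut ?mem_PSp.
rewrite oe in dle pn; rewrite e.
apply: (torus_conclusion_intro j n_gt1 char2 qp nq center_S yS (pow_order j n_gt1 char2 qp yS)).
- rewrite -(dvdn_pcharf pF) Gauss_dvdr // coprime_sym prime_coprime ?(pcharf_prime pF) //.
  by rewrite dvdn2 (odd_p char2 pF).
- by apply: leq_trans degree_ge _; rewrite leq_add2r leq_mul2l.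
apply: (model_isotropic charC n_gt1 char2 W yS) => [b u v uU vU hu hv|u uU].
  by apply: (lines (a * b)) => //; rewrite Va -scalemxAr ?hu ?hv scalerA.
exact: simple_stable.
Qed.

Section Outer.
Variables (s1 : {rmorphism F -> F}) (M1 : 'M[F]_(dimV n)) (c1 : F).
Hypothesis uM1 : M1 \in unitmx.
Hypothesis c10 : c1 != 0.
Hypothesis MJ1 : M1 *m symp_mx F n *m M1^T = c1 *: symp_mx F n.
Hypothesis hb : forall x, x \in Sp -> gbar (coset Z x) = coset Z (semi s1 M1 x).
Let uV : V g \in unitmx := repr_mx_unit V hg.

Lemma stable_inv (U : 'M[C]_m'.+1) : (U *m V g <= U)%MS -> (U *m invmx (V g) <= U)%MS.
Proof.
move=> h; have : (U <= U *m V g)%MS.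
  by have [_ <-] := mxrank_leqif_sup h; rewrite mxrankMfree // row_free_unit.
by move/(submxMr (invmx (V g))); rewrite mulmxK.
Qed.

Lemma nonsquare_unstable U : (forall k, c1 != k * k) -> mxsimple rE U -> ~ (U *m V g <= U)%MS.
Proof.
move=> nsq simU sU; have [W _] := weil_model_exists charC n_gt1 char2 s0 uM0 c00 MJ0 (hweil simU).1.
apply: (model_unstable charC n_gt1 char2 W (s := s1) uV uM1 c10 nsq).
- by move=> x u xS uU; apply: simple_stable.
- move=> v a /=; rewrite -(semi_tg s1 n_gt0 uM1 c10 MJ1 char2).
  have tS : tg v a \in Sp := tg_Sp n_gt0 char2 v a.
  rewrite -(cover_conj n_gt1 char2 pF hG hE sEG hpi uM0 MJ0 cover hg uM1 c10 MJ1 hb tS).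
    rewrite -!repr_mxM ?groupJ ?piG //; congr (V _).
    by rewrite conjgE !mulgA mulgV mul1g.
  exact: (tg_exp n_gt1 char2 pF).
- by move=> u uU; apply: submx_trans (submxMr _ uU) sU.
by move=> u uU; apply: submx_trans (submxMr _ uU) (stable_inv sU).
Qed.

Lemma nonsquare_dim : (forall k, c1 != k * k) -> m'.+1 = (2 * d)%N.
Proof.
move=> nsq; case: hm => // e; have [U simU] := simple_exists.
case: (nonsquare_unstable nsq simU); apply: submx_full.
by rewrite /row_full (hweil simU).2 e.
Qed.

Lemma nonsquare_reducible : (forall k, c1 != k * k) -> ~ mx_irreducible rE.
Proof. by move=> nsq /(nonsquare_unstable nsq); apply; apply: submx1. Qed.

Lemma square_normalize k : c1 = k * k -> exists M, [/\ M \in unitmx,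
  M *m symp_mx F n *m M^T = 1 *: symp_mx F n &
  forall x, x \in Sp -> gbar (coset Z x) = coset Z (semi s1 M x)].
Proof.
move=> e; have k0 : k != 0 by apply: contraNneq c10 => z; rewrite e z mulr0.
have kV0 : k^-1 != 0 by rewrite invr_eq0.
exists (k^-1 *: M1); split.
- by rewrite unitmxZ // unitfE.
- rewrite linearZ /= -!scalemxAl -scalemxAr MJ1 !scalerA e; congr (_ *: _).
  by rewrite mulrA -[k^-1 * k^-1 * k]mulrA mulVf // mulr1 mulVf.
by move=> x xS; rewrite semi_scale // hb.
Qed.

Lemma is_square c : (exists k : F, c = k * k) \/ (forall k : F, c != k * k).
Proof.
have [/existsP[k /eqP ->]|h] := boolP [exists k, c == k * k]; first by left; exists k.
by right=> k; apply: contra h => h; apply/existsP; exists k.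
Qed.

(** A nontrivial s1 bounds the order of gbar by (q^n - 2) / 2 if c1 is a square and by q^n - 2
    otherwise. These lie below d and 2 d, the least possible dimensions in the two cases. *)
Lemma field_aut_trivial a : s1 a = a.
Proof.
apply/eqP; apply/negPn/negP => sa; have gA := bar_Aut hG hg.
have [[k e]|nsq] := is_square c1.
  have [M [uM MJ hM]] := square_normalize e.
  have [_ /(_ erefl)[l [l0 gl h]]] :=
    field_aut_order n_gt1 char2 uM (oner_neq0 F) MJ gA hM center_S (ex_intro _ a sa).
  by move: (dim_le_order l0 gl) degree_ge dim_ge h; move: (q ^ n)%N => X; clear; lia.
have [[l [l0 gl h]] _] :=
  field_aut_order n_gt1 char2 uM1 c10 MJ1 gA hb center_S (ex_intro _ a sa).
have := dim_le_order l0 gl; rewrite (nonsquare_dim nsq).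
by move: degree_ge h; move: (q ^ n)%N => X; clear; lia.
Qed.

Lemma semi_linear (M : 'M[F]_(dimV n)) x : M \in unitmx -> semi s1 M x = (x ^ toGL M)%g.
Proof.
move=> uM; apply: GLval_inj; rewrite GLval_semi // GLvalJ toGLK //; congr (_ *m _ *m _).
by apply/matrixP=> a b; rewrite mxE field_aut_trivial.
Qed.

Lemma gbar_PCSp : gbar \in PCSp_aut n F.
Proof.
rewrite inE bar_Aut //=; apply/exists_inP; exists (toGL M1).
  by rewrite inE; apply/existsP; exists c1; rewrite c10 toGLK // MJ1 eqxx.
by apply/forall_inP=> x xS; rewrite hb // semi_linear.
Qed.

Hypothesis gp : p^'.-elt gbar.

Lemma p_ndvd (b : {perm coset_of Z}) : (#[b]%g %| #[gbar]%g)%N -> ~~ (p %| #[b]%g)%N.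
Proof.
move=> bg; apply/negP=> pb; have := gp; rewrite /p_elt.
move/pnatP => /(_ (order_gt0 _) p (pcharf_prime pF) (dvdn_trans pb bg)).
by rewrite !inE eqxx.
Qed.

(** The torus orders are close to q^n / 2 while 2 d >= q^n - 1. In the second case 2 gcd (a, b) | a
    excludes a = b = 1, so one factor is at least 9 + 1, enough for a contradiction. *)
Lemma torus_conclusion_order (b : {perm coset_of Z}) : torus_conclusion j b -> ~ (2 * d <= #[b]%g)%N.
Proof.
case=> _ h le; have q9 := qn_ge9; have dg := degree_ge; have q2 := q_gt2.
case: h => [[s' [o _]]|[a [b' [[a0 b0] nab dv o _]]]].
  move: le q9 dg; rewrite o -divn2; move: (q ^ n)%N => X.
  by case: s' {o} => /=; clear; lia.
have le2 : (2 * (2 * d) <= (q ^ a + 1) * (q ^ b' + 1))%N.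
  rewrite -(odd_double_half ((q ^ a + 1) * (q ^ b' + 1))) -mul2n.
  by apply: leq_trans (leq_addl _ _); rewrite leq_mul2l -o.
have ge x : (0 < x)%N -> (3 <= q ^ x)%N.
  move=> x0; apply: (leq_trans q2); rewrite -[X in (X <= _)%N]expn1.
  by rewrite leq_exp2l // (ltnW q2).
have ge2 x : (1 < x)%N -> (9 <= q ^ x)%N.
  move=> x1; apply: leq_trans (_ : 3 ^ x <= _)%N; last by rewrite leq_exp2r // ltnW.
  by rewrite -[9%N]/(3 ^ 2)%N leq_exp2l.
have big : (9 <= q ^ a)%N \/ (9 <= q ^ b')%N.
  have [a1|a1] := ltnP 1 a; first by left; apply: ge2.
  have [b1|b1] := ltnP 1 b'; first by right; apply: ge2.
  have ea : a = 1%N by apply/eqP; rewrite eqn_leq a1.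
  have eb : b' = 1%N by apply/eqP; rewrite eqn_leq b1.
  by move: dv; rewrite ea eb.
have := ge a a0; have := ge b' b0; move: le2 dg big; rewrite nab expnD.
move: (q ^ a)%N (q ^ b')%N => x y; clear; nia.
Qed.

(** The order of gbar is at least dim V, so dim V = 2 d contradicts [torus_conclusion_order]. In
    dimension d, a simple submodule of the restriction fills V. *)
Lemma square_conclusion k : c1 = k * k ->
  [/\ mx_irreducible rE, weil_module_via pi rE & torus_conclusion j gbar].
Proof.
move=> e; have [M [uM MJ hM]] := square_normalize e; rewrite scale1r in MJ.
have yS : toGL M \in Sp by apply: (toGL_Sp n_gt0); apply/eqP.
have ge : gbar = conj_aut S (coset Z (toGL M)).
  apply: inner_eq => //; first exact: bar_Aut.
  by move=> x xS; rewrite hM // semi_linear.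
have dl := dim_le_order (order_gt0 gbar) (expg_order gbar).
have [U simU] := simple_exists.
have tc : torus_conclusion j gbar.
  apply: (inner_conclusion hg yS ge simU).
  - by move=> a u v _ _; apply: (simple_eigenline hg g0 hspec).
  - exact: leq_trans dim_ge dl.
  - exact: p_ndvd.
have md : m'.+1 = d.
  by case: hm => // e2; case: (torus_conclusion_order tc); rewrite -e2.
have irrE : mx_irreducible rE.
  apply/mx_irrP; split=> // W modW W0; have [U' simU' sU'] := dec_mxsimple_exists modW W0.
  rewrite /row_full eqn_leq rank_leq_col /= {1}md -(hweil simU').2.
  exact: mxrankS.
split=> //; have [[w0 [[w [ww [X [simX r0]]]] w0E]] _] := hweil irrE.
have rp : mx_repr Sp (fun x => rE (pi x)).
  split=> [|x y xS yS']; first by rewrite morph1 repr_mx1.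
  by rewrite morphM // repr_mxM // -hpi mem_morphim.
exists (MxRepresentation rp); split=> //; exists w; split=> //; exists X, simX.
apply: mx_rsim_trans r0; apply: mx_rsim_sym.
have [B dB fB hB] := rsim_submod1 (mxsimple_module irrE) (eqmx_refl _).
exists B => // x xS; rewrite w0E // hB // -hpi; exact: mem_morphim.
Qed.

Lemma nonsquare_conclusion : (forall k, c1 != k * k) ->
  [/\ ~ mx_irreducible rE, m'.+1 = pm s (q ^ n), gbar \notin PSp_aut n F
    & torus_conclusion j (gbar ^+ 2)%g].
Proof.
move=> nsq; have [U simU] := simple_exists; have md := nonsquare_dim nsq.
split; first exact: nonsquare_reducible.
- by rewrite md degree_double.
- apply/negP => /morphimP[c _ /PSpP[y yS ->] e].
  by case: (nonsquare_unstable nsq simU); apply: inner_stable e simU.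
(* gbar is induced by M1, of multiplier c1, so its square is induced by the symplectic matrix M1^2 /
   c1. *)
pose A : 'M[F]_(dimV n) := c1^-1 *: (M1 *m M1).
have sA : is_symplectic A.
  apply/eqP; rewrite /A linearZ /= trmx_mul -!scalemxAl -scalemxAr !mulmxA.
  rewrite -(mulmxA _ M1 (symp_mx F n)) -(mulmxA _ (M1 *m _)) MJ1 -scalemxAr -scalemxAl MJ1 !scalerA.
  by rewrite mulVf // mulr1 mulVf // scale1r.
have yS := toGL_Sp n_gt0 sA; have uA := symplectic_unit n_gt0 sA.
have gA := bar_Aut hG hg.
have ge : bar (g ^+ 2)%g = conj_aut S (coset Z (toGL A)).
  rewrite (barX iota) //; apply: inner_eq => //; first exact: groupX.
  move=> x xS; rewrite expgS expg1 permM hb // hb ?(semi_Sp s1 uM1 MJ1) //; congr (coset Z _).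
  rewrite -semi_linear // /A semi_scale ?unitmx_mul ?uM1 ?invr_eq0 //.
  rewrite !semi_linear ?unitmx_mul ?uM1 //.
  by rewrite toGLM // conjgM.
have e2 : bar (g ^+ 2)%g = (gbar ^+ 2)%g by rewrite (barX iota).
rewrite -e2; apply: (inner_conclusion (groupX 2 hg) yS ge simU).
(* If u g^2 = a u and mu^2 = a, then u g + mu u is an eigenvector of g for mu. Those of u and v are
   proportional, so some v - l u in U is multiplied by - mu under g, and [cap] makes it 0. *)
- move=> a u v uU vU hu hv u0; have [mu hmu] : exists mu : C, mu * mu = a.
    have [mu /eqP] := solve_monicpoly (fun i => if i == 0%N then a else 0) (isT : (0 < 2)%N).
    by rewrite big_ord_recl big_ord1 /= expr0 mulr1 mul0r addr0 expr2 => /eqP; exists mu.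
  have VV : V (g ^+ 2)%g = V g *m V g by rewrite expgS expg1 repr_mxM.
  (* U is simple and differs from U g, so the two meet trivially. *)
  have cap (t : 'rV[C]_m'.+1) : (t <= U)%MS -> (t *m V g <= U)%MS -> t = 0.
    move=> tU tgU; apply/eqP; apply: contraT => t0.
    have modUg : mxmodule rE (U *m V g).
      apply/mxmoduleP=> h hE' /=; have hG' := subsetP sEG _ hE'.
      have hgE : (h ^ g^-1)%g \in E.
        have nE : G \subset 'N(E) by case: hE => /normal_norm.
        by rewrite memJ_norm // (subsetP nE) ?groupV.
      have -> : U *m V g *m V h = U *m V (h ^ g^-1)%g *m V g.
        rewrite -!mulmxA -!repr_mxM ?groupJ ?groupV //; congr (_ *m V _).
        by rewrite conjgE invgK !mulgA mulgKV.
      by rewrite submxMr // (mxmoduleP (mxsimple_module simU) _ hgE).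
    have [_ _ min] := simU; have := min _ (capmx_module (mxsimple_module simU) modUg) (capmxSl _ _).
    have n0 : (U :&: U *m V g)%MS != 0.
      apply/rowV0Pn; exists (t *m V g); first by rewrite sub_capmx tgU submxMr.
      by apply: contra t0 => /eqP z; rewrite -[t](mulmxK uV) z mul0mx.
    move=> /(_ n0) h; have hU : (U <= U *m V g)%MS := submx_trans h (capmxSr _ _).
    case: (nonsquare_unstable nsq simU).
    by have [_ <-] := mxrank_leqif_sup hU; rewrite mxrankMfree // row_free_unit.
  have eig (t : 'rV[C]_m'.+1) : t *m V (g ^+ 2)%g = a *: t ->
      (t *m V g + mu *: t) *m V g = mu *: (t *m V g + mu *: t).
    rewrite VV mulmxA => ht; rewrite mulmxDl ht -scalemxAl scalerDr scalerA hmu addrC //.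
  have n0 : u *m V g + mu *: u != 0.
    apply: contra u0; rewrite addr_eq0 => /eqP z; apply/eqP; apply: cap => //.
    by rewrite z -scaleNr scalemx_sub.
  have /sub_rVP[l hl] := simple_eigenline hg g0 hspec (eig u hu) (eig v hv) n0.
  apply/sub_rVP; exists l; apply/eqP; rewrite -subr_eq0; apply/eqP; apply: cap.
    by rewrite addmx_sub // -scaleNr scalemx_sub.
  have -> : (v - l *: u) *m V g = - mu *: (v - l *: u).
    rewrite mulmxBl -scalemxAl -[v *m _](addrK (mu *: v)) hl scalerDr !scalerA.
    rewrite scalerBr !scaleNr opprK scalerA [l * mu]mulrC.
    by rewrite addrAC [_ + _ *: u - _]addrC addKr addrC.
  by rewrite scalemx_sub // addmx_sub // -scaleNr scalemx_sub.
- rewrite e2 -(leq_pmul2l (isT : (0 < 2)%N)) -md; apply: dim_le_order.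
    by rewrite muln_gt0 order_gt0.
  by rewrite expgM expg_order.
by rewrite e2 p_ndvd // orderXdvd.
Qed.
End Outer.
End Main.

Theorem theorem8p2
  (* q = p^f odd, F the field with q elements, K its algebraic closure *)
  (n q p f : nat) (F : finFieldType) (K : closedFieldType)
  (j : {rmorphism F -> K}) (hK : integralRange j)
  (hn : (2 <= n)%N) (hp : prime p) (hq : q = (p ^ f)%N) (hodd : odd q)
  (hF : #|F| = q) (hnq : (n, q) <> (2%N, 3%N))
  (* G almost quasisimple, G / Z(G) <= Aut(PSp), E = E(G) a quotient of Sp *)
  (gT : finGroupType) (G : {group gT})
  (iota : {morphism (G / 'Z(G))%g >-> {perm coset_of 'Z(Sp n F)}})
  (hG : almost_quasisimple (PSp n F) iota)
  (E : {group gT}) (hE : is_layer G (PSp n F) E) (sEG : E \subset G)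
  (pi : {morphism Sp n F >-> gT}) (hpi : pi @* Sp n F = E)
  (* V a faithful irreducible module over the complex numbers R[i] *)
  (R : realType) (m : nat) (V : mx_representation (complex R) G m)
  (hirr : mx_irreducible V) (hfaith : mx_faithful V)
  (g : gT) (hg : g \in G) (hspec : simple_spectrum (V g))
  (s : bool) (d : nat) (hd : d = (pm s (q ^ n))./2)
  (hweil : forall (U : 'M_m) (simU : mxsimple (subg_repr V sEG) U),
     weil_module_via pi (submod_repr (mxsimple_module simU)) /\ \rank U = d)
  (hm : m = d \/ m = (2 * d)%N) :
  let gbar := iota (coset 'Z(G) g) in
  gbar \in PCSp_aut n F /\
  (p^'.-elt gbar ->
     [/\ mx_irreducible (subg_repr V sEG),
         weil_module_via pi (subg_repr V sEG)
       & torus_conclusion j gbar]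
     \/
     [/\ ~ mx_irreducible (subg_repr V sEG),
         m = pm s (q ^ n),
         gbar \notin PSp_aut n F
       & torus_conclusion j (gbar ^+ 2)%g]).
Proof.
have pF : p \in [pchar F] by apply: (card_finPcharP _ hp); rewrite hF hq.
have q1 := finNzRing_gt1 F.
have char2 : (2%:R : F) != 0.
  rewrite -(dvdn_pcharf pF) dvdn_prime2 //; apply/eqP=> p2.
  by move: hodd q1; rewrite hF hq p2; case: f {hq} => // f; rewrite oddX.
have qp : [pchar K].-nat #|F|.
  by rewrite hF hq pnatX pnatE // (rmorph_pchar j).
have charC : [pchar complex R] =i pred0 by exact: Num.Theory.pchar_num.
have nq : (n, #|F|) <> (2%N, 3%N) by rewrite hF.
have m0 : (0 < m)%N by case/mx_irrP: hirr.
case: m m0 V hirr hfaith hspec hweil hm => // m' _ V hirr _ hspec hweil hm gbar.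
move: hd hweil; rewrite -{1}hF => hd hweil.
(* From here on pi is replaced by its twist, which induces the identity on PSp. *)
have [s0 [M0 [c0 [uM0 c00 MJ0 cover]]]] := normalized_cover hn char2 pF hG hE sEG hpi.
have gA := bar_Aut hG hg.
have [s1 [M1 [c1 [uM1 c10 MJ1 hM]]]] := aut_PSp hn char2 pF gA.
have hb x : x \in Sp n F -> gbar (coset 'Z(Sp n F)%g x) = coset 'Z(Sp n F)%g (semi s1 M1 x).
  by move=> xS; rewrite (hM x xS).2.
split.
  exact: (gbar_PCSp j hn char2 qp pF hG hE hpi charC hirr hg hspec hd hweil hm uM0 c00 MJ0 cover uM1 c10 MJ1 hb).
move=> gp; have [[k e]|nsq] := is_square c1.
  left; exact: (square_conclusion j hn char2 qp pF nq hG hE hpi charC hirr hg hspec hd hweil hm uM0 c00 MJ0 cover uM1 c10 MJ1 hb gp e).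
right; rewrite -hF.
exact: (nonsquare_conclusion j hn char2 qp pF nq hG hE hpi charC hirr hg hspec hd hweil hm uM0 c00 MJ0 cover uM1 c10 MJ1 hb gp nsq).
Qed.
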